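(* Let $n\ge 3$ and let $\alpha\in L^\infty(\partial\Omega;\mathbb{C})$ be such that $\operatorname{Re}\alpha\ge|\operatorname{Im}\alpha|$ (almost everywhere on $\partial\Omega$). Suppose there exist non-negative numbers $b_1,b_2$ satisfying $2C^*[b_1+S^*b_2]<1$ such that $$\|x\,\alpha\|_{L^\infty(\partial\Omega)}\le b_1\qquad\text{and}\qquad \|(-\Delta)^{1/4}(x\,\alpha)\|_{L^{2(n-1)}(\partial\Omega)}\le b_2 .$$ Then there exists a positive constant $c$ such that, given any $\lambda\in\mathbb{C}$ and $f\in L^2(\Omega,|x|\,dx)$, any solution $u\in\mathcal{D}(-\Delta_\alpha^\Omega)$ of the equation $(-\Delta_\alpha^\Omega-\lambda)u=f$ satisfies $$\|\nabla u^-\|_{L^2(\Omega)}\le c\,\|rf\|_{L^2(\Omega)}\qquad\text{if } |\operatorname{Im}\lambda|\le\operatorname{Re}\lambda,$$ and $$\|\nabla u\|_{L^2(\Omega)}\le c\,\|rf\|_{L^2(\Omega)}\qquad\text{if } |\operatorname{Im}\lambda|>\operatorname{Re}\lambda,$$ where $r(x):=|x|$ and $u^-(x):=e^{-i(\operatorname{Re}\lambda)^{1/2}\operatorname{sgn}(\operatorname{Im}\lambda)|x|}\,u(x)$.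
   Context: $\Omega:=\mathbb{R}^{n-1}\times(0,\infty)$ is the upper half-space, with $\partial\Omega$ identified with $\mathbb{R}^{n-1}$; points are $x=(x',x_n)$, and on $\partial\Omega$ one has $x=(x',0)$, $x'=(x_1,\dots,x_{n-1})$. $\operatorname{sgn}$ is the usual sign function, with $\operatorname{sgn}(0)=0$. For $\alpha\in L^\infty(\partial\Omega;\mathbb{C})$, the Robin Laplacian $-\Delta_\alpha^\Omega$ is the m-sectorial operator in $L^2(\Omega)$ associated, via the first representation theorem, with the closed form $h_\alpha[u]:=\int_\Omega|\nabla u|^2\,dx+\int_{\partial\Omega}\alpha|u|^2\,d\sigma$, $\mathcal{D}(h_\alpha):=H^1(\Omega)$ (boundary values in the sense of traces). That is, $u\in\mathcal{D}(-\Delta_\alpha^\Omega)$ iff $u\in H^1(\Omega)$ and there is $w_u\in L^2(\Omega)$ such that $\int_\Omega\nabla u\cdot\overline{\nabla v}\,dx+\int_{\partial\Omega}\alpha u\bar v\,d\sigma=\int_\Omega w_u\bar v\,dx$ for all $v\in H^1(\Omega)$, and then $-\Delta_\alpha^\Omega u:=w_u$. $(-\Delta)^{1/4}$ is the fractional Laplacian on $\mathbb{R}^{n-1}$, defined via the Fourier transform as the multiplier $|\xi|^{1/2}$. Set $2^*:=2(n-1)/(n-2)$. $C^*$ is the smallest constant $C$ (depending on $n$) such that the fractional Leibniz rule $$\|(-\Delta)^{1/4}(fg)\|_{L^2(\mathbb{R}^{n-1})}\le C\big[\|f\|_{L^\infty(\mathbb{R}^{n-1})}\|(-\Delta)^{1/4}g\|_{L^2(\mathbb{R}^{n-1})}+\|(-\Delta)^{1/4}f\|_{L^{2(n-1)}(\mathbb{R}^{n-1})}\|g\|_{L^{2^*}(\mathbb{R}^{n-1})}\big]$$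 holds for all complex-valued functions $f,g$ on $\mathbb{R}^{n-1}$ (for which the right-hand side is finite); such a finite constant exists (homogeneous Kato–Ponce inequality). $S^*$ is the smallest constant $S$ such that $\|f\|_{L^{2^*}(\mathbb{R}^{n-1})}\le S\,\|(-\Delta)^{1/4}f\|_{L^2(\mathbb{R}^{n-1})}$ holds for all $f\in\dot H^{1/2}(\mathbb{R}^{n-1})$. Norms of the vector-valued function $x\alpha=(x_1\alpha,\dots,x_{n-1}\alpha)$ are sums over components: $\|x\alpha\|_{L^\infty(\partial\Omega)}=\sum_{j=1}^{n-1}\|x_j\alpha\|_{L^\infty(\mathbb{R}^{n-1})}$ and $\|(-\Delta)^{1/4}(x\alpha)\|_{L^{2(n-1)}(\partial\Omega)}=\sum_{j=1}^{n-1}\|(-\Delta)^{1/4}(x_j\alpha)\|_{L^{2(n-1)}(\mathbb{R}^{n-1})}$. If $rf\notin L^2(\Omega)$, the right-hand sides are understood as $+\infty$. *)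

(* Defs.v *)
From HB Require Import structures.
From mathcomp Require Import all_boot all_order all_algebra.
From mathcomp Require Import all_classical all_reals all_analysis.
From mathcomp Require Import complex.

Set Implicit Arguments.
Unset Strict Implicit.
Unset Printing Implicit Defensive.
Import Order.TTheory GRing.Theory Num.Theory.
Import numFieldNormedType.Exports.

Local Open Scope classical_set_scope.
Local Open Scope complex_scope.
Local Open Scope ring_scope.

(* The space R^d is 'rV[R]_d.  The library equips it with its topology and
   its normed-module structure (for the sup norm); the measurable structure is
   added here: the product sigma-algebra of the Borel sigma-algebra of R, as
   the library does for tuples. *)
Section rV_measurable.
Context (R : realType) (d : nat).

Definition rV_coord (i : 'I_d) (x : 'rV[R]_d) : R := x ord0 i.

Let rV_set0 : g_sigma_preimage rV_coord set0.
Proof. exact: sigma_algebra0. Qed.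

Let rV_setC A : g_sigma_preimage rV_coord A -> g_sigma_preimage rV_coord (~` A).
Proof. exact: sigma_algebraC. Qed.

Let rV_bigcup (F : (set 'rV[R]_d)^nat) :
  (forall i, g_sigma_preimage rV_coord (F i)) ->
  g_sigma_preimage rV_coord (\bigcup_i (F i)).
Proof. exact: sigma_algebra_bigcup. Qed.

HB.instance Definition _ := @isMeasurable.Build default_measure_display
  'rV[R]_d (g_sigma_preimage rV_coord) rV_set0 rV_setC rV_bigcup.

Lemma measurable_fun_rVP d' (T : measurableType d') (f : T -> 'rV[R]_d) :
  (forall i, measurable_fun setT (fun t => f t ord0 i)) -> measurable_fun setT f.
Proof.
move=> mf.
have sub : g_sigma_preimage (fun i => rV_coord i \o f) `<=` measurable.
  apply: smallest_sub; first exact: sigma_algebra_measurable.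
  elim/big_ind: _ => // [A B sA sB C [/sA|/sB]//|i _ _ [B mB <-]].
  exact: mf.
move=> _ A mA; rewrite g_sigma_preimage_comp in sub.
by apply: sub; exists A.
Qed.

Lemma measurable_rV_coord (i : 'I_d) : measurable_fun setT (rV_coord i).
Proof.
move=> _ Y mY; rewrite setTI; apply: sub_sigma_algebra => /=.
rewrite -bigcup_seq/=; exists i => /=; first by rewrite mem_index_enum.
by exists Y => //; rewrite setTI.
Qed.

End rV_measurable.

Section lebesgue_rV.
Context (R : realType).

(* (x', t) |-> (x'_1, ..., x'_d, t) *)
Definition rV_rcons d (x : 'rV[R]_d) (t : R) : 'rV[R]_d.+1 :=
  \row_(i < d.+1) if unlift ord_max i is Some j then x ord0 j else t.

Definition rV_of_pair d (p : 'rV[R]_d * R) : 'rV[R]_d.+1 := rV_rcons p.1 p.2.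

Lemma measurable_rV_of_pair d : measurable_fun setT (@rV_of_pair d).
Proof.
apply: measurable_fun_rVP => i.
rewrite /rV_of_pair /rV_rcons; under eq_fun do rewrite mxE.
case: (unlift ord_max i) => [j|]; last exact: measurable_snd.
exact: (measurableT_comp (@measurable_rV_coord R d j)).
Qed.

Section extension.
Context d (m : {measure set 'rV[R]_d -> \bar R}).

Definition lebesgue_rV_extend : set 'rV[R]_d.+1 -> \bar R :=
  pushforward (m \x (@lebesgue_measure R))%E (@rV_of_pair d).

Let extend0 : lebesgue_rV_extend set0 = 0%E.
Proof. by rewrite /lebesgue_rV_extend /pushforward preimage_set0 measure0. Qed.

Let extend_ge0 A : (0 <= lebesgue_rV_extend A)%E.
Proof. by rewrite /lebesgue_rV_extend /pushforward; apply: measure_ge0. Qed.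

Let extend_sigma_additive : semi_sigma_additive lebesgue_rV_extend.
Proof.
move=> F mF tF mUF; rewrite /lebesgue_rV_extend /pushforward preimage_bigcup.
have mpre A : measurable A -> measurable (@rV_of_pair d @^-1` A).
  by move=> mA; rewrite -[X in measurable X]setTI; exact: measurable_rV_of_pair.
apply: measure_semi_sigma_additive => [n||]; first exact: mpre.
- apply/trivIsetP => /= i j _ _ ij; rewrite -preimage_setI.
  by move/trivIsetP : tF => /(_ _ _ _ _ ij) ->//; rewrite preimage_set0.
- by rewrite -preimage_bigcup; exact: mpre.
Qed.

HB.instance Definition _ := isMeasure.Build _ _ _ lebesgue_rV_extend
  extend0 extend_ge0 extend_sigma_additive.

End extension.

Fixpoint lebesgue_rV (d : nat) : {measure set 'rV[R]_d -> \bar R} :=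
  match d with
  | 0 => \d_(0 : 'rV[R]_0)
  | d'.+1 => lebesgue_rV_extend (lebesgue_rV d')
  end.

End lebesgue_rV.

Section complex_functions.
Context (R : realType).

Definition expi (t : R) : R[i] := cos t +i* sin t.

Section measure_space.
Context d (T : measurableType d) (mu : {measure set T -> \bar R}).
Implicit Types (D : set T) (f : T -> R[i]).

Definition cmeasurable D f : Prop :=
  measurable_fun D (fun x => complex.Re (f x)) /\
  measurable_fun D (fun x => complex.Im (f x)).

Definition cintegrable D f : Prop :=
  mu.-integrable D (fun x => (complex.Re (f x))%:E) /\
  mu.-integrable D (fun x => (complex.Im (f x))%:E).

Definition cintegral D f : R[i] :=
  Rintegral mu D (fun x => complex.Re (f x))
  +i* Rintegral mu D (fun x => complex.Im (f x)).

Definition cLnorm D (p : \bar R) f : \bar R :=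
  Lnorm mu p (fun x => (\1_D x * Normc.normc (f x))%:E).

Definition cLp D (p : \bar R) f : Prop :=
  cmeasurable D f /\ (cLnorm D p f < +oo)%E.

End measure_space.

(* C^k: all iterated directional derivatives up to order k exist everywhere
   and are continuous. *)
Fixpoint Ck (V : normedModType R) (k : nat) (f : V -> R) : Prop :=
  continuous f /\
  match k with
  | 0 => True
  | k'.+1 => forall v : V, (forall x, derivable f x v) /\
                           Ck k' (fun x => 'D_v f x)
  end.

Section euclidean.
Context (n : nat).
Implicit Types (x y : 'rV[R]_n) (D : set 'rV[R]_n) (u phi : 'rV[R]_n -> R[i])
  (G : 'I_n -> 'rV[R]_n -> R[i]).

Definition dot x y : R := \sum_(j < n) x ord0 j * y ord0 j.

(* Euclidean norm; the library's norm on row vectors is the sup norm. *)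
Definition enorm x : R := Num.sqrt (dot x x).

(* C_c^oo(D; C) *)
Definition test_fun D phi : Prop :=
  [/\ forall k, Ck k (fun x => complex.Re (phi x)),
      forall k, Ck k (fun x => complex.Im (phi x)) &
      exists K : set 'rV[R]_n,
        [/\ compact K, K `<=` D & forall x, ~ K x -> phi x = 0]].

Definition partial (j : 'I_n) phi : 'rV[R]_n -> R[i] := fun x =>
  ('D_(delta_mx ord0 j) (fun y => complex.Re (phi y)) x)
  +i* ('D_(delta_mx ord0 j) (fun y => complex.Im (phi y)) x).

Definition locally_integrable D u : Prop :=
  cmeasurable D u /\
  forall K : set 'rV[R]_n, compact K -> K `<=` D ->
    cintegrable (lebesgue_rV R n) K u.

(* G is the weak gradient of u in the open set D. *)
Definition weak_gradient D u G : Prop :=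
  [/\ locally_integrable D u,
      forall j, locally_integrable D (G j) &
      forall phi, test_fun D phi -> forall j,
        cintegral (lebesgue_rV R n) D (fun x => u x * partial j phi x) =
        - cintegral (lebesgue_rV R n) D (fun x => G j x * phi x)].

Definition vL2norm D G : \bar R :=
  cLnorm (lebesgue_rV R n) D 2%:E
    (fun x => (Num.sqrt (\sum_(j < n) Normc.normc (G j x) ^+ 2))%:C).

(* u belongs to H^1(D), with weak gradient G. *)
Definition H1 D u G : Prop :=
  [/\ cLp (lebesgue_rV R n) D 2%:E u,
      forall j, cLp (lebesgue_rV R n) D 2%:E (G j) &
      weak_gradient D u G].

(* Unitary Fourier transform and its inverse, as absolutely convergent
   integrals. *)
Definition fourier phi : 'rV[R]_n -> R[i] := fun xi =>
  (Num.sqrt (2 * pi) ^- n)%:C *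
  cintegral (lebesgue_rV R n) setT (fun x => expi (- dot x xi) * phi x).

Definition inv_fourier phi : 'rV[R]_n -> R[i] := fun x =>
  (Num.sqrt (2 * pi) ^- n)%:C *
  cintegral (lebesgue_rV R n) setT (fun xi => expi (dot x xi) * phi xi).

(* (-Delta)^{1/4} on test functions: the Fourier multiplier |xi|^{1/2}. *)
Definition frac_lap_test phi : 'rV[R]_n -> R[i] :=
  inv_fourier (fun xi => (Num.sqrt (enorm xi))%:C * fourier phi xi).

(* (-Delta)^{1/4} f = g.  The multiplier |xi|^{1/2} is not smooth at 0, so it
   does not act on all tempered distributions, and the Fourier transform of
   a function f in L^p, p > 2, need not be a function.  The multiplier is
   therefore transposed onto test functions phi: as it is even, it is
   symmetric for the bilinear pairing, and (-Delta)^{1/4} phi is O(|x|^{-n-1/2})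
   at infinity, so that the left-hand integral converges for f in any L^p. *)
Definition is_frac_lap (f g : 'rV[R]_n -> R[i]) : Prop :=
  [/\ cmeasurable setT f, cmeasurable setT g &
  forall phi, test_fun setT phi ->
    [/\ cintegrable (lebesgue_rV R n) setT (fun x => f x * frac_lap_test phi x),
        cintegrable (lebesgue_rV R n) setT (fun x => g x * phi x) &
        cintegral (lebesgue_rV R n) setT (fun x => f x * frac_lap_test phi x) =
        cintegral (lebesgue_rV R n) setT (fun x => g x * phi x)]].

(* The homogeneous space \dot H^{1/2}: tempered f whose Fourier transform is
   a locally integrable function F with |xi|^{1/2} F in L^2; the identity
   "F is the Fourier transform of f" is that of tempered distributions. *)
Definition homogeneous_H12 (f : 'rV[R]_n -> R[i]) : Prop :=
  [/\ cmeasurable setT f,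
      exists N : nat, cintegrable (lebesgue_rV R n) setT
        (fun x => ((1 + enorm x) ^- N)%:C * f x) &
      exists F : 'rV[R]_n -> R[i],
      [/\ locally_integrable setT F,
          cLp (lebesgue_rV R n) setT 2%:E
            (fun xi => (Num.sqrt (enorm xi))%:C * F xi) &
          forall phi, test_fun setT phi ->
            cintegral (lebesgue_rV R n) setT (fun xi => F xi * phi xi) =
            cintegral (lebesgue_rV R n) setT (fun x => f x * fourier phi x)]].

End euclidean.

Definition is_smallest (P : R -> Prop) (c : R) : Prop :=
  P c /\ forall c', P c' -> c <= c'.

(* From here on, the half-space lies in R^n with n = d.+1, and its boundary is
   R^d, d = n - 1. *)
Section half_space.
Context (d : nat).

(* 2^* = 2(n-1)/(n-2) *)
Definition two_star : R := 2 * d%:R / (d%:R - 1).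

(* The inequality is required for those f, g whose right-hand side is finite;
   it then asserts that (-Delta)^{1/4} (f g) is a function h in L^2. *)
Definition leibniz_constant (C : R) : Prop :=
  forall f g Lf Lg : 'rV[R]_d -> R[i],
    cLp (lebesgue_rV R d) setT +oo%E f ->
    is_frac_lap f Lf -> cLp (lebesgue_rV R d) setT (2 * d%:R)%:E Lf ->
    cLp (lebesgue_rV R d) setT two_star%:E g ->
    is_frac_lap g Lg -> cLp (lebesgue_rV R d) setT 2%:E Lg ->
    exists h : 'rV[R]_d -> R[i],
      is_frac_lap (fun x => (f x * g x)%R) h /\
      (cLnorm (lebesgue_rV R d) setT 2%:E h <=
       C%:E * (cLnorm (lebesgue_rV R d) setT +oo f *
                 cLnorm (lebesgue_rV R d) setT 2%:E Lg +
               cLnorm (lebesgue_rV R d) setT (2 * d%:R)%:E Lf *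
                 cLnorm (lebesgue_rV R d) setT two_star%:E g))%E.

Definition sobolev_constant (S : R) : Prop :=
  forall f Lf : 'rV[R]_d -> R[i],
    homogeneous_H12 f -> is_frac_lap f Lf ->
    (cLnorm (lebesgue_rV R d) setT two_star%:E f <=
     S%:E * cLnorm (lebesgue_rV R d) setT 2%:E Lf)%E.

Definition half_space : set 'rV[R]_d.+1 := [set x | 0 < x ord0 ord_max].

Implicit Types (u v w f : 'rV[R]_d.+1 -> R[i])
  (G : 'I_d.+1 -> 'rV[R]_d.+1 -> R[i]) (g alpha : 'rV[R]_d -> R[i]).

(* For u in H^1(half_space) with weak gradient G, g is the trace of u: the
   trace operator is the continuous extension to H^1 of the restriction
   phi |-> phi(., 0), phi in C_c^oo(R^n). *)
Definition is_trace u G g : Prop :=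
  cLp (lebesgue_rV R d) setT 2%:E g /\
  exists phi : nat -> 'rV[R]_d.+1 -> R[i],
  [/\ forall k, test_fun setT (phi k),
      (fun k => cLnorm (lebesgue_rV R d.+1) half_space 2%:E
                  (fun x => u x - phi k x)) @ \oo --> 0%E,
      (fun k => vL2norm half_space
                  (fun j x => G j x - partial j (phi k) x)) @ \oo --> 0%E &
      (fun k => cLnorm (lebesgue_rV R d) setT 2%:E
                  (fun x => g x - phi k (rV_rcons x 0))) @ \oo --> 0%E].

(* u is in the domain of the Robin Laplacian, which maps it to w. *)
Definition robin_laplacian alpha u w : Prop :=
  cLp (lebesgue_rV R d.+1) half_space 2%:E w /\
  exists G g,
  [/\ H1 half_space u G, is_trace u G g &
  forall v Gv gv, H1 half_space v Gv -> is_trace v Gv gv ->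
    cintegral (lebesgue_rV R d.+1) half_space
      (fun x => \sum_(j < d.+1) G j x * (Gv j x)^*) +
    cintegral (lebesgue_rV R d) setT (fun x => alpha x * g x * (gv x)^*) =
    cintegral (lebesgue_rV R d.+1) half_space (fun x => w x * (v x)^*)].

(* (-Delta_alpha - lambda) u = f in L^2(half_space) *)
Definition robin_equation alpha (lambda : R[i]) u f : Prop :=
  exists w, robin_laplacian alpha u w /\
    {ae lebesgue_rV R d.+1,
      forall x, half_space x -> w x - lambda * u x = f x}.

Definition weighted_L2 f : Prop :=
  cmeasurable half_space f /\
  (\int[lebesgue_rV R d.+1]_(x in half_space)
     (enorm x * Normc.normc (f x) ^+ 2)%:E < +oo)%E.

Definition r_norm f : \bar R :=
  cLnorm (lebesgue_rV R d.+1) half_space 2%:E (fun x => (enorm x)%:C * f x).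

(* Used for Re lambda >= 0 only, where Num.sqrt is the real square root. *)
Definition u_minus (lambda : R[i]) u : 'rV[R]_d.+1 -> R[i] := fun x =>
  expi (- (Num.sqrt (complex.Re lambda) * Num.sg (complex.Im lambda) * enorm x))
  * u x.

Definition x_alpha alpha (j : 'I_d) : 'rV[R]_d -> R[i] := fun x =>
  (x ord0 j)%:C * alpha x.

End half_space.
End complex_functions.

(* Main.v *)
Require Import Defs.
From HB Require Import structures.
From mathcomp Require Import all_boot all_order all_algebra.
From mathcomp Require Import all_classical all_reals all_analysis.
From mathcomp Require Import measurable_realfun ess_sup_inf complex ring lra.

Set Implicit Arguments.
Unset Strict Implicit.
Unset Printing Implicit Defensive.
Import Order.TTheory GRing.Theory Num.Theory.
Import numFieldNormedType.Exports.

Local Open Scope classical_set_scope.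
Local Open Scope complex_scope.
Local Open Scope ring_scope.

(* The proof is a multiplier method in which dilations replace second
   derivatives.  If |Im lambda| <= Re lambda, put
   kap = sqrt(Re lambda) sgn(Im lambda) and v = e^{-i kap |x|} u.  The equation
   of v is tested against
   - v,
   - (U_t v - U_{-t} v) / 2t as t -> 0, where U_t v = e^{(n-2)t/2} v(e^t x): the
     gradient terms cancel exactly because U_t preserves the Dirichlet integral,
   - |x| e^{-eta |x|} v as eta -> 0.
   In the combination with weights 1/2, 1, |Im lambda| / (2 sqrt(Re lambda)) all
   terms carrying kap or Im lambda cancel, up to one controlled by the
   imaginary part of the first identity; the weighted Dirichlet integral of the
   third identity is nonnegative by a Hardy inequality; right-hand sides are
   bounded by Hardy's inequality
   |int f conj(v)| <= 2 / (n-2) ||r f|| ||grad v||.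
   The boundary term of the second identity is
   Re sum_j int x_j alpha g conj(d_j g), g the trace of v.  The symbol
   xi_j |xi|^{-1/2} is a pointwise limit of trigonometric polynomials, i.e. of
   combinations of translations, whence
   |int q d_j phi| <= ||(-Delta)^{1/4} q|| ||(-Delta)^{1/4} phi||; for
   q = x_j alpha g the fractional Leibniz rule and the Sobolev inequality apply,
   and ||(-Delta)^{1/4} g|| <= ||grad v|| on the half-space.  The resulting
   constant C* (b1 + S* b2) < 1/2 is absorbed by the Dirichlet integral.
   If |Im lambda| > Re lambda, testing against u is enough. *)

(** The solution lies only in the form domain, so neither second derivatives nor [x . grad v] are
    available for testing. The dilates [U_t v] are admissible, because dilations preserve the
    half-space and its boundary. Placing [U_t] and [U_{-t}] symmetrically makes the quotient
    antisymmetric up to factors [e^{a t}], so the real part of the gradient term vanishes for each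
    [t], at any regularity. Derivatives fall on approximating test functions through the mean value
    theorem; as the quotient costs a factor [1/t], the approximants are chosen with error [t^2]. The
    weight 1/2 of the first identity fixes the threshold: the second identity brings in no Dirichlet
    integral and loses [K ||grad v||^2] on the boundary, [K] being the positive part of
    [C* (b1 + S* b2)], so that [1/2 - K > 0] remains. The third identity presupposes that
    [|x|^{1/2} v] and [|x|^{1/2} grad v] are square integrable. For [Im lambda <> 0] this comes from
    its own imaginary part, in which [Im lambda] multiplies the weighted norm of [v]; for
    [Im lambda = 0], [kap] is 0 and the third identity drops out. The Fourier side rests on Bessel's
    inequality and inversion for test functions. *)

Local Notation Re := complex.Re.
Local Notation Im := complex.Im.
Local Notation mT := measurableT.
Local Notation ncM := Normc.normcM.
Local Notation nc := Normc.normc.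

(** * Modulus, real part and imaginary part of complex numbers *)

Section normc_facts.
Context (R : realType).
Implicit Types (z w : R[i]) (x y r : R).

Lemma nc_sqr z : nc z ^+ 2 = Re z ^+ 2 + Im z ^+ 2.
Proof. by case: z => a b /=; rewrite sqr_sqrtr// addr_ge0// sqr_ge0. Qed.

Lemma nc_ge0 z : 0 <= nc z.
Proof. by case: z => a b /=; exact: sqrtr_ge0. Qed.

Lemma nc_Re z : `|Re z| <= nc z.
Proof.
rewrite -(@ler_pXn2r _ 2) ?nnegrE ?nc_ge0// nc_sqr.
by rewrite -normrX ger0_norm ?sqr_ge0// lerDl sqr_ge0.
Qed.

Lemma nc_Im z : `|Im z| <= nc z.
Proof.
rewrite -(@ler_pXn2r _ 2) ?nnegrE ?nc_ge0// nc_sqr.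
by rewrite -normrX ger0_norm ?sqr_ge0// lerDr sqr_ge0.
Qed.

Lemma nc_conj z : nc z^* = nc z.
Proof. by case: z => a b /=; rewrite sqrrN. Qed.

Lemma nc_real x : nc x%:C = `|x|.
Proof. by rewrite /= expr0n/= addr0 sqrtr_sqr. Qed.

Lemma nc_sum (I : Type) (r : seq I) (P : pred I) (F : I -> R[i]) :
  nc (\sum_(i <- r | P i) F i) <= \sum_(i <- r | P i) nc (F i).
Proof.
elim/big_ind2 : _ => [|z x w y zx wy|//]; first by rewrite Normc.normc0.
by rewrite (le_trans (le_normcD _ _))// lerD.
Qed.

Lemma nc_sqrD z w : nc (z + w) ^+ 2 <= 2 * (nc z ^+ 2 + nc w ^+ 2).
Proof.
rewrite !nc_sqr !raddfD/=.
set a := Re z; set b := Re w.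
set c := Im z; set d := Im w.
by have := sqr_ge0 (a - b); have := sqr_ge0 (c - d); nra.
Qed.

Lemma nc_le_ReIm z : nc z <= `|Re z| + `|Im z|.
Proof.
rewrite {1}[z]complexE (le_trans (le_normcD _ _))// lerD ?nc_real//.
by rewrite ncM nc_real /= !expr0n/= add0r expr1n sqrtr1 mul1r.
Qed.

Lemma nc_expi x : nc (expi x) = 1.
Proof. by rewrite /= cos2Dsin2 sqrtr1. Qed.

Lemma expiD x y : expi (x + y) = expi x * expi y.
Proof.
by apply/eqP; rewrite eq_complex /= cosD sinD eqxx/= [X in _ == X]addrC [sin x * _]mulrC eqxx.
Qed.

Lemma expi0 : expi (0 : R) = 1.
Proof. by rewrite /expi cos0 sin0. Qed.

Lemma conj_expi x : (expi x)^* = expi (- x).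
Proof. by rewrite /expi /= cosN sinN. Qed.

Lemma Re_mulconj z : Re (z * z^*) = nc z ^+ 2.
Proof. by rewrite nc_sqr; case: z => a b /=; rewrite mulrN opprK -!expr2. Qed.

Lemma mulconj z : z * z^* = (nc z ^+ 2)%:C.
Proof.
apply/eqP; rewrite eq_complex Re_mulconj /= eqxx/=.
by case: z => a b /=; rewrite mulrN mulrC addrC subrr.
Qed.

Lemma ReD z w : Re (z + w) = Re z + Re w.
Proof. by case: z w => ? ? []. Qed.

Lemma ImD z w : Im (z + w) = Im z + Im w.
Proof. by case: z w => ? ? []. Qed.

Lemma ReB z w : Re (z - w) = Re z - Re w.
Proof. by case: z w => ? ? []. Qed.

Lemma ImB z w : Im (z - w) = Im z - Im w.
Proof. by case: z w => ? ? []. Qed.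

Lemma ReM z w : Re (z * w) = Re z * Re w - Im z * Im w.
Proof. by case: z w => ? ? []. Qed.

Lemma ImM z w : Im (z * w) = Re z * Im w + Im z * Re w.
Proof. by case: z w => ? ? []. Qed.

Lemma Re_conj z : Re z^* = Re z. Proof. by case: z. Qed.

Lemma Im_conj z : Im z^* = - Im z. Proof. by case: z. Qed.

Lemma ReRM r z : Re (r%:C * z) = r * Re z.
Proof. by rewrite ReM /= mul0r subr0. Qed.

Lemma ImRM r z : Im (r%:C * z) = r * Im z.
Proof. by rewrite ImM /= mul0r addr0. Qed.

Lemma ReIM r z : Re ((0 +i* r) * z) = - r * Im z.
Proof. by rewrite ReM /=; ring. Qed.

Lemma ImIM r z : Im ((0 +i* r) * z) = r * Re z.
Proof. by rewrite ImM /=; ring. Qed.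

End normc_facts.

(** * Integrals of complex-valued functions *)

Section complex_integral.
Context d (T : measurableType d) (R : realType).
Variables (mu : {measure set T -> \bar R}) (D : set T) (mD : measurable D).
Implicit Types (f g h : T -> R[i]) (a b : T -> R).

Lemma cmeas_Re f : cmeasurable D f -> measurable_fun D (fun x => Re (f x)).
Proof. by case. Qed.

Lemma cmeas_Im f : cmeasurable D f -> measurable_fun D (fun x => Im (f x)).
Proof. by case. Qed.

Lemma cmeas_cst (z : R[i]) : cmeasurable D (fun=> z).
Proof. by split; exact: measurable_cst. Qed.

Lemma cmeas_real a : measurable_fun D a -> cmeasurable D (fun x => (a x)%:C).
Proof. by split => //=; exact: measurable_cst. Qed.

Lemma cmeasD f g : cmeasurable D f -> cmeasurable D g ->
  cmeasurable D (fun x => f x + g x).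
Proof.
move=> [f1 f2] [g1 g2]; split.
- rewrite (_ : (fun x => _) = (fun x => Re (f x) + Re (g x))).
    exact: measurable_funD.
  by apply/funext => x; rewrite raddfD.
- rewrite (_ : (fun x => _) = (fun x => Im (f x) + Im (g x))).
    exact: measurable_funD.
  by apply/funext => x; rewrite raddfD.
Qed.

Lemma cmeasM f g : cmeasurable D f -> cmeasurable D g ->
  cmeasurable D (fun x => f x * g x).
Proof.
move=> [f1 f2] [g1 g2]; split.
- rewrite (_ : (fun x => _) = (fun x => Re (f x) * Re (g x) -
      Im (f x) * Im (g x))).
    by apply: measurable_funB; exact: measurable_funM.
  by apply/funext => x; case: (f x) (g x) => ? ? [].
- rewrite (_ : (fun x => _) = (fun x => Re (f x) * Im (g x) +
      Im (f x) * Re (g x))).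
    by apply: measurable_funD; exact: measurable_funM.
  by apply/funext => x; case: (f x) (g x) => ? ? [].
Qed.

Lemma cmeasN f : cmeasurable D f -> cmeasurable D (fun x => - f x).
Proof.
move=> mf; rewrite (_ : (fun x => _) = (fun x => (-1) * f x)).
  by apply: cmeasM => //; exact: cmeas_cst.
by apply/funext => x; rewrite mulN1r.
Qed.

Lemma cmeasB f g : cmeasurable D f -> cmeasurable D g ->
  cmeasurable D (fun x => f x - g x).
Proof. by move=> mf mg; apply: cmeasD => //; exact: cmeasN. Qed.

Lemma cmeas_conj f : cmeasurable D f -> cmeasurable D (fun x => (f x)^*).
Proof.
move=> [f1 f2]; split.
- rewrite (_ : (fun x => _) = (fun x => Re (f x)))//.
  by apply/funext => x; case: (f x).
- rewrite (_ : (fun x => _) = (fun x => - Im (f x))).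
    exact: measurableT_comp.
  by apply/funext => x; case: (f x).
Qed.

Lemma meas_nc f : cmeasurable D f -> measurable_fun D (fun x => nc (f x)).
Proof.
move=> [f1 f2]; rewrite (_ : (fun x => _) =
    (fun x => Num.sqrt (Re (f x) ^+ 2 + Im (f x) ^+ 2))).
  apply: (measurableT_comp (continuous_measurable_fun (@sqrt_continuous R))) => //.
  by apply: measurable_funD; exact: measurable_funX.
by apply/funext => x; case: (f x).
Qed.

Lemma cint_meas f : cintegrable mu D f -> cmeasurable D f.
Proof.
by move=> [f1 f2]; split; apply/measurable_EFinP; apply: measurable_int; eassumption.
Qed.

Lemma int_le a b : measurable_fun D a -> (forall x, D x -> `|a x| <= b x) ->
  mu.-integrable D (EFin \o b) -> mu.-integrable D (EFin \o a).
Proof.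
move=> ma ab ib; apply: (le_integrable mD _ _ ib); first exact/measurable_EFinP.
by move=> x Dx /=; rewrite lee_fin (le_trans (ab x Dx))// ler_norm.
Qed.

Lemma cint_le f b : cmeasurable D f -> (forall x, D x -> nc (f x) <= b x) ->
  mu.-integrable D (EFin \o b) -> cintegrable mu D f.
Proof.
move=> [f1 f2] fb ib; split; apply: (@int_le _ b) => // x Dx.
- by rewrite (le_trans (nc_Re _))// fb.
- by rewrite (le_trans (nc_Im _))// fb.
Qed.

Lemma cint_nc f : cintegrable mu D f -> mu.-integrable D (fun x => (nc (f x))%:E).
Proof.
move=> fi; have [f1 f2] := fi.
apply: (@int_le _ (fun x => `|Re (f x)| + `|Im (f x)|)).
- exact/meas_nc/cint_meas.
- by move=> x _; rewrite ger0_norm ?nc_ge0// nc_le_ReIm.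
- rewrite (_ : _ \o _ = (fun x => (`|Re (f x)|%:E + `|Im (f x)|%:E)%E)).
    by apply: integrableD => //; apply: integrable_norm.
  by apply/funext => x; rewrite /= EFinD.
Qed.

(** Integrability is defined componentwise; since the modulus dominates both components and is
    dominated by the sum of their absolute values, every domination argument can be run on the
    modulus alone. *)
Lemma cintP f : cintegrable mu D f <->
  cmeasurable D f /\ mu.-integrable D (fun x => (nc (f x))%:E).
Proof.
split=> [fi|[mf fi]]; first by split; [exact: cint_meas|exact: cint_nc].
exact: (@cint_le _ (fun x => nc (f x))).
Qed.

Lemma cintD f g : cintegrable mu D f -> cintegrable mu D g ->
  cintegrable mu D (fun x => f x + g x).
Proof.
move=> /cintP[mf fi] /cintP[mg gi].
apply: (@cint_le _ (fun x => nc (f x) + nc (g x))); first exact: cmeasD.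
- by move=> x _; exact: le_normcD.
- rewrite (_ : _ \o _ = (fun x => (nc (f x))%:E + (nc (g x))%:E)%E).
    exact: integrableD.
  by apply/funext => x; rewrite /= EFinD.
Qed.

Lemma cintZ z f : cintegrable mu D f -> cintegrable mu D (fun x => z * f x).
Proof.
move=> /cintP[mf fi]; apply: (@cint_le _ (fun x => nc z * nc (f x))).
- by apply: cmeasM => //; exact: cmeas_cst.
- by move=> x _; rewrite ncM.
- rewrite (_ : _ \o _ = (fun x => ((nc z)%:E * (nc (f x))%:E)%E)).
    exact: integrableZl.
  by apply/funext => x; rewrite /= EFinM.
Qed.

Lemma cintM_bnd (C : R) f g : cmeasurable D g -> (forall x, D x -> nc (g x) <= C) ->
  cintegrable mu D f -> cintegrable mu D (fun x => g x * f x).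
Proof.
move=> mg gC /cintP[mf fi]; apply: (@cint_le _ (fun x => C * nc (f x))).
- exact: cmeasM.
- by move=> x Dx; rewrite ncM ler_wpM2r ?nc_ge0// gC.
- rewrite (_ : _ \o _ = (fun x => (C%:E * (nc (f x))%:E)%E)).
    exact: integrableZl.
  by apply/funext => x; rewrite /= EFinM.
Qed.

Lemma cintN f : cintegrable mu D f -> cintegrable mu D (fun x => - f x).
Proof.
move=> /(cintZ (-1)); rewrite (_ : (fun x => - f x) = (fun x => -1 * f x))//.
by apply/funext => x; rewrite mulN1r.
Qed.

Lemma cintB f g : cintegrable mu D f -> cintegrable mu D g ->
  cintegrable mu D (fun x => f x - g x).
Proof. by move=> fi gi; apply: cintD => //; exact: cintN. Qed.

Lemma cint0 : cintegrable mu D (fun=> 0).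
Proof. by split; exact: integrable0. Qed.

Lemma cint_conj f : cintegrable mu D f -> cintegrable mu D (fun x => (f x)^*).
Proof.
move=> /cintP[mf fi]; apply: (@cint_le _ (fun x => nc (f x))) => //.
- exact: cmeas_conj.
- by move=> x _; rewrite nc_conj.
Qed.

Lemma cint_sum (I : Type) (s : seq I) (F : I -> T -> R[i]) :
  (forall i, cintegrable mu D (F i)) -> cintegrable mu D (fun x => \sum_(i <- s) F i x).
Proof.
move=> mF; elim: s => [|i s ih].
  by under eq_fun do rewrite big_nil; exact: cint0.
by under eq_fun do rewrite big_cons; exact: cintD.
Qed.

Lemma eq_cintegral f g : (forall x, D x -> f x = g x) ->
  cintegral mu D f = cintegral mu D g.
Proof.
by move=> fg; rewrite /cintegral; congr (_ +i* _); apply: eq_Rintegral => x;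
  rewrite inE => /fg ->.
Qed.

Lemma eq_cint f g : (forall x, D x -> f x = g x) ->
  cintegrable mu D f -> cintegrable mu D g.
Proof.
move=> fg [f1 f2]; split.
- by apply: eq_integrable f1 => // x; rewrite inE => /fg ->.
- by apply: eq_integrable f2 => // x; rewrite inE => /fg ->.
Qed.

Lemma cintegralD f g : cintegrable mu D f -> cintegrable mu D g ->
  cintegral mu D (fun x => f x + g x) = cintegral mu D f + cintegral mu D g.
Proof.
move=> [f1 f2] [g1 g2]; rewrite /cintegral; apply/eqP; rewrite eq_complex /=.
by apply/andP; split; apply/eqP; rewrite -RintegralD//; apply: eq_Rintegral => x _;
  rewrite raddfD.
Qed.

Lemma cintegralZ z f : cintegrable mu D f ->
  cintegral mu D (fun x => z * f x) = z * cintegral mu D f.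
Proof.
case: z => a b [f1 f2]; rewrite /cintegral; apply/eqP; rewrite eq_complex /=.
have H (c : R) (h : T -> R) : mu.-integrable D (fun x => (h x)%:E) ->
    mu.-integrable D (fun x => (c * h x)%:E).
  move=> ih; rewrite (_ : (fun x => _) = (fun x => c%:E * (h x)%:E)%E); last by [].
  exact: integrableZl.
apply/andP; split; apply/eqP.
- rewrite -!RintegralZl//= -RintegralB//; [|exact: H|exact: H].
  by apply: eq_Rintegral => x _; case: (f x).
- rewrite -!RintegralZl//= -RintegralD//; [|exact: H|exact: H].
  by apply: eq_Rintegral => x _; case: (f x).
Qed.

Lemma cintegral0 : cintegral mu D (fun=> 0) = 0.
Proof. by rewrite /cintegral !Rintegral_cst// !mul0r. Qed.

Lemma cintegralN f : cintegrable mu D f ->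
  cintegral mu D (fun x => - f x) = - cintegral mu D f.
Proof.
move=> fi; rewrite -mulN1r -cintegralZ//.
by apply: eq_cintegral => x _; rewrite mulN1r.
Qed.

Lemma cintegralB f g : cintegrable mu D f -> cintegrable mu D g ->
  cintegral mu D (fun x => f x - g x) = cintegral mu D f - cintegral mu D g.
Proof. by move=> fi gi; rewrite cintegralD ?cintegralN//; exact: cintN. Qed.

Lemma cintegral_conj f : cintegrable mu D f ->
  cintegral mu D (fun x => (f x)^*) = (cintegral mu D f)^*.
Proof.
move=> [f1 f2]; rewrite /cintegral /=; congr (_ +i* _).
- by apply: eq_Rintegral => x _; case: (f x).
- rewrite -mulN1r -RintegralZl//.
  by apply: eq_Rintegral => x _; rewrite mulN1r; case: (f x).
Qed.

Lemma cintegral_sum (I : Type) (s : seq I) (F : I -> T -> R[i]) :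
  (forall i, cintegrable mu D (F i)) ->
  cintegral mu D (fun x => \sum_(i <- s) F i x) = \sum_(i <- s) cintegral mu D (F i).
Proof.
move=> mF; elim: s => [|i s ih].
  by under eq_fun do rewrite big_nil; rewrite big_nil cintegral0.
under eq_fun do rewrite big_cons.
by rewrite big_cons cintegralD// ?ih//; exact: cint_sum.
Qed.

Lemma cintegral_real a :
  cintegral mu D (fun x => (a x)%:C) = (Rintegral mu D a)%:C.
Proof. by rewrite /cintegral /= Rintegral_cst// mul0r. Qed.

Lemma cint_real a : mu.-integrable D (EFin \o a) -> cintegrable mu D (fun x => (a x)%:C).
Proof. by move=> ia; split => //=; exact: integrable0. Qed.

(* rotating the value of the integral onto the positive real axis *)
Lemma le_nc_cintegral f b : cintegrable mu D f ->
  (forall x, D x -> nc (f x) <= b x) -> mu.-integrable D (EFin \o b) ->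
  nc (cintegral mu D f) <= Rintegral mu D b.
Proof.
move=> fi fb ib; set I := cintegral mu D f.
have [I0|I0] := eqVneq (nc I) 0.
  rewrite I0; apply: Rintegral_ge0 => x Dx.
  by rewrite (le_trans (nc_ge0 _) (fb x Dx)).
have IP : 0 < nc I by rewrite lt_neqAle eq_sym I0 nc_ge0.
pose w := ((nc I)^-1)%:C * I^*.
have wI : w * I = (nc I)%:C.
  rewrite /w -mulrA [_ * I]mulrC mulconj -rmorphM/=; congr (_%:C).
  by rewrite expr2 mulKf.
have nw : nc w = 1.
  by rewrite /w ncM nc_real nc_conj ger0_norm ?mulVf// invr_ge0 nc_ge0.
have -> : nc I = Re (w * I) by rewrite wI.
rewrite /I -cintegralZ//= ; apply: le_Rintegral => //.
- by case: (cintZ w fi).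
- move=> x Dx; rewrite (le_trans (ler_norm _))// (le_trans (nc_Re _))//.
  by rewrite ncM nw mul1r fb.
Qed.

End complex_integral.

Arguments cintegral : simpl never.

(** * Limits of complex sequences *)

Section complex_limits.
Context (R : realType).

(** Encoded by the real sequence of distances to the limit, so that only limits in [R] are handled;
    [ccvgP] gives back the two components. *)
Definition ccvg (u : nat -> R[i]) (l : R[i]) :=
  (fun n => nc (u n - l)) @ \oo --> (0 : R).

Lemma cvg0_le (u v : R^nat) : (forall n, 0 <= u n <= v n) ->
  v @ \oo --> (0 : R) -> u @ \oo --> (0 : R).
Proof.
move=> uv v0; apply: (@squeeze_cvgr _ _ _ _ (fun=> 0) v) => //.
- by near=> n; exact: uv.
- exact: cvg_cst.
Unshelve. all: end_near. Qed.

Lemma cvg0_abs (u : R^nat) : (fun n => `|u n|) @ \oo --> (0 : R) -> u @ \oo --> (0 : R).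
Proof. exact: (@norm_cvg0 R R^o). Qed.

Lemma ccvgP (u : nat -> R[i]) l : ccvg u l <->
  (fun n => Re (u n)) @ \oo --> Re l /\
  (fun n => Im (u n)) @ \oo --> Im l.
Proof.
split=> [ul|[u1 u2]].
- split; apply/subr_cvg0/cvg0_abs.
  + by apply: cvg0_le ul => n; rewrite normr_ge0/= -raddfB nc_Re.
  + by apply: cvg0_le ul => n; rewrite normr_ge0/= -raddfB nc_Im.
- apply: (@cvg0_le _ (fun n => `|Re (u n) - Re l| +
    `|Im (u n) - Im l|)).
    by move=> n; rewrite nc_ge0/= (le_trans (nc_le_ReIm _))// !raddfB.
  rewrite -[X in _ --> X](addr0 0) -[X in _ --> X + X](@normr0 _ R).
  by apply: cvgD; apply: cvg_norm; apply/subr_cvg0.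
Qed.

Lemma ccvg_squeeze (u : nat -> R[i]) l (v : R^nat) :
  (forall n, nc (u n - l) <= v n) -> v @ \oo --> (0 : R) -> ccvg u l.
Proof. by move=> uv; apply: cvg0_le => n; rewrite nc_ge0 uv. Qed.

Lemma ccvg_cst (l : R[i]) : ccvg (fun=> l) l.
Proof. by rewrite /ccvg subrr; under eq_fun do rewrite Normc.normc0; exact: cvg_cst. Qed.

Lemma ccvgD u v a b : ccvg u a -> ccvg v b -> ccvg (fun n => u n + v n) (a + b).
Proof.
move=> /ccvgP[u1 u2] /ccvgP[v1 v2]; apply/ccvgP; split; rewrite raddfD.
- by under eq_fun do rewrite raddfD; exact: cvgD.
- by under eq_fun do rewrite raddfD; exact: cvgD.
Qed.

Lemma ccvgM u v a b : ccvg u a -> ccvg v b -> ccvg (fun n => u n * v n) (a * b).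
Proof.
move=> /ccvgP[u1 u2] /ccvgP[v1 v2]; apply/ccvgP.
have E1 (z w : R[i]) : Re (z * w) =
  Re z * Re w - Im z * Im w by case: z w => ? ? [].
have E2 (z w : R[i]) : Im (z * w) =
  Re z * Im w + Im z * Re w by case: z w => ? ? [].
split; rewrite ?E1 ?E2; under eq_fun do rewrite ?E1 ?E2.
- by apply: cvgB; exact: cvgM.
- by apply: cvgD; exact: cvgM.
Qed.

Lemma ccvg_conj u a : ccvg u a -> ccvg (fun n => (u n)^*) a^*.
Proof. by move=> ua; rewrite /ccvg; under eq_fun do rewrite -rmorphB nc_conj. Qed.

Lemma ccvg_real (u : R^nat) (a : R) : u @ \oo --> a -> ccvg (fun n => (u n)%:C) a%:C.
Proof. by move=> ua; apply/ccvgP; split => //=; exact: cvg_cst. Qed.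

Lemma ccvg_sum (I : Type) (s : seq I) (u : I -> nat -> R[i]) (l : I -> R[i]) :
  (forall i, ccvg (u i) (l i)) ->
  ccvg (fun n => \sum_(i <- s) u i n) (\sum_(i <- s) l i).
Proof.
move=> ul; elim: s => [|i s ih].
  by under eq_fun do rewrite big_nil; rewrite big_nil; exact: ccvg_cst.
by under eq_fun do rewrite big_cons; rewrite big_cons; exact: ccvgD.
Qed.

Lemma ccvg_unique u a b : ccvg u a -> ccvg u b -> a = b.
Proof.
move=> /ccvgP[a1 a2] /ccvgP[b1 b2]; apply/eqP; rewrite eq_complex.
by rewrite (cvg_unique _ a1 b1) ?(cvg_unique _ a2 b2) ?eqxx//; exact: norm_hausdorff.
Qed.

Lemma ccvg_nc u a : ccvg u a -> (fun n => nc (u n)) @ \oo --> nc a.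
Proof.
move=> ua; apply/subr_cvg0/cvg0_abs; apply: cvg0_le ua => n.
rewrite normr_ge0/= ler_norml; apply/andP; split.
- rewrite lerNl opprB lerBlDr; have := le_normcD (a - u n) (u n).
  by rewrite subrK -[a - u n]opprB normcN.
- by rewrite lerBlDr; have := le_normcD (u n - a) a; rewrite subrK.
Qed.

Lemma ccvg_expi (u : R^nat) (a : R) : u @ \oo --> a -> ccvg (fun n => expi (u n)) (expi a).
Proof.
move=> ua; apply/ccvgP; split => /=.
- by apply: continuous_cvg => //; exact: continuous_cos.
- by apply: continuous_cvg => //; exact: continuous_sin.
Qed.

Lemma ccvg_le u a (M : R) : ccvg u a -> (forall n, nc (u n) <= M) -> nc a <= M.
Proof.
move=> /ccvg_nc ua uM; rewrite -(cvg_lim (@norm_hausdorff _ R^o) ua).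
apply: limr_le; first by apply/cvg_ex; exists (nc a).
by near=> n; exact: uM.
Unshelve. all: end_near. Qed.

Lemma cvg_le_cst (u : R^nat) (a M : R) : u @ \oo --> a -> (forall n, u n <= M) -> a <= M.
Proof.
move=> ua uM; rewrite -(cvg_lim (@norm_hausdorff _ R^o) ua).
apply: limr_le; first by apply/cvg_ex; exists a.
by near=> n; exact: uM.
Unshelve. all: end_near. Qed.

End complex_limits.

(** * Dominated convergence, [L^2] norm, inner product and [L^2] convergence *)

Section L2.
Context d (T : measurableType d) (R : realType).
Variables (mu : {measure set T -> \bar R}) (D : set T) (mD : measurable D).
Implicit Types (f g h : T -> R[i]) (a b : T -> R).

(** The real theorem is applied to the real and the imaginary part, with one common majorant of the
    modulus. *)
Lemma cdominated (f_ : nat -> T -> R[i]) f b :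
  (forall n, cmeasurable D (f_ n)) -> cmeasurable D f ->
  (forall x, D x -> ccvg (f_ ^~ x) (f x)) ->
  mu.-integrable D (EFin \o b) -> (forall n x, D x -> nc (f_ n x) <= b x) ->
  cintegrable mu D f /\
  ccvg (fun n => cintegral mu D (f_ n)) (cintegral mu D f).
Proof.
move=> mf_ mf ff ib fb.
have H (P : R[i] -> R) : (forall z, `|P z| <= nc z) ->
    (forall n, measurable_fun D (fun x => P (f_ n x))) ->
    measurable_fun D (fun x => P (f x)) ->
    (forall x, D x -> (fun n => P (f_ n x)) @ \oo --> P (f x)) ->
    mu.-integrable D (fun x => (P (f x))%:E) /\
    (fun n => Rintegral mu D (fun x => P (f_ n x))) @ \oo -->
      Rintegral mu D (fun x => P (f x)).
  move=> Pnc mPf_ mPf Pff.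
  have [] := @dominated_convergence _ _ _ mu _ mD (fun n x => (P (f_ n x))%:E)
    (fun x => (P (f x))%:E) (EFin \o b).
  - by move=> n; exact/measurable_EFinP.
  - exact/measurable_EFinP.
  - by apply/aeW => x Dx; apply: cvg_EFin; [exact: nearW|exact: Pff].
  - by [].
  - by apply/aeW => x n Dx /=; rewrite lee_fin (le_trans (Pnc _))// fb.
  - move=> iPf _ cPf; split => //.
    apply: fine_cvg; rewrite fineK//.
    exact: integrable_fin_num.
have [i1 c1] := H _ (@nc_Re R) (fun n => cmeas_Re (mf_ n)) (cmeas_Re mf)
  (fun x Dx => ((ccvgP _ _).1 (ff x Dx)).1).
have [i2 c2] := H _ (@nc_Im R) (fun n => cmeas_Im (mf_ n)) (cmeas_Im mf)
  (fun x Dx => ((ccvgP _ _).1 (ff x Dx)).2).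
by split; [split|apply/ccvgP].
Qed.

Lemma rdominated (f_ : nat -> T -> R) (f b : T -> R) :
  (forall n, measurable_fun D (f_ n)) -> measurable_fun D f ->
  (forall x, D x -> f_ ^~ x @ \oo --> f x) ->
  mu.-integrable D (EFin \o b) -> (forall n x, D x -> `|f_ n x| <= b x) ->
  (fun n => Rintegral mu D (f_ n)) @ \oo --> Rintegral mu D f.
Proof.
move=> mf_ mf ff ib fb.
have [] := @cdominated (fun n x => (f_ n x)%:C) (fun x => (f x)%:C) b.
- by move=> n; exact: cmeas_real.
- exact: cmeas_real.
- by move=> x Dx; apply: ccvg_real; exact: ff.
- by [].
- by move=> n x Dx; rewrite nc_real fb.
- by move=> _; rewrite (cintegral_real _ mD) => /ccvgP[+ _] /=; under eq_fun do rewrite (cintegral_real _ mD).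
Qed.

Definition L2 f := cmeasurable D f /\ mu.-integrable D (fun x => (nc (f x) ^+ 2)%:E).

Definition n2 f : R := Num.sqrt (Rintegral mu D (fun x => nc (f x) ^+ 2)).

Definition ip f g : R[i] := cintegral mu D (fun x => f x * (g x)^*).

Arguments ip : simpl never.

Lemma n2_ge0 f : 0 <= n2 f. Proof. exact: sqrtr_ge0. Qed.

Lemma sqr_n2 f : n2 f ^+ 2 = Rintegral mu D (fun x => nc (f x) ^+ 2).
Proof. by rewrite sqr_sqrtr; [|apply: Rintegral_ge0 => x _; exact: sqr_ge0]. Qed.

Lemma L2_meas f : L2 f -> cmeasurable D f. Proof. by case. Qed.

Lemma meas_nc2 f : cmeasurable D f -> measurable_fun D (fun x => nc (f x) ^+ 2).
Proof. by move=> mf; apply: measurable_funX; exact: meas_nc. Qed.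

Lemma L2_le f b : cmeasurable D f -> (forall x, D x -> nc (f x) ^+ 2 <= b x) ->
  mu.-integrable D (EFin \o b) -> L2 f.
Proof.
move=> mf fb ib; split => //; apply: (@int_le _ _ _ mu D mD _ b) => //.
  exact: meas_nc2.
by move=> x Dx; rewrite ger0_norm ?sqr_ge0// fb.
Qed.

Lemma eq_n2 f g : (forall x, D x -> f x = g x) -> n2 f = n2 g.
Proof. by move=> fg; congr Num.sqrt; apply: eq_Rintegral => x; rewrite inE => /fg ->. Qed.

Lemma eq_ip f g f' g' : (forall x, D x -> f x = f' x) -> (forall x, D x -> g x = g' x) ->
  ip f g = ip f' g'.
Proof. by move=> ff gg; apply: eq_cintegral => x Dx; rewrite ff// gg. Qed.

Lemma L2_0 : L2 (fun=> 0).
Proof.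
split; first exact: cmeas_cst.
under eq_fun do rewrite Normc.normc0 expr0n/=; exact: integrable0.
Qed.

Lemma L2D f g : L2 f -> L2 g -> L2 (fun x => f x + g x).
Proof.
move=> [mf fi] [mg gi].
apply: (@L2_le _ (fun x => 2 * (nc (f x) ^+ 2 + nc (g x) ^+ 2))).
- exact: cmeasD.
- by move=> x _; exact: nc_sqrD.
- rewrite (_ : _ \o _ = (fun x => (2%:E * ((nc (f x) ^+ 2)%:E + (nc (g x) ^+ 2)%:E))%E)).
    by apply: integrableZl => //; exact: integrableD.
  by apply/funext => x; rewrite /= EFinM EFinD.
Qed.

Lemma L2_bnd (C : R) f g : cmeasurable D g -> (forall x, D x -> nc (g x) <= C) ->
  L2 f -> L2 (fun x => g x * f x).
Proof.
move=> mg gC [mf fi]; apply: (@L2_le _ (fun x => C ^+ 2 * nc (f x) ^+ 2)).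
- exact: cmeasM.
- move=> x Dx; rewrite ncM exprMn ler_wpM2r ?sqr_ge0//.
  by rewrite lerXn2r ?nnegrE ?nc_ge0 ?gC// (le_trans (nc_ge0 (g x)))// gC.
- rewrite (_ : _ \o _ = (fun x => ((C ^+ 2)%:E * (nc (f x) ^+ 2)%:E)%E)).
    exact: integrableZl.
  by apply/funext => x; rewrite /= EFinM.
Qed.

Lemma L2Z z f : L2 f -> L2 (fun x => z * f x).
Proof. by apply: (@L2_bnd (nc z)); [exact: cmeas_cst|]. Qed.

Lemma L2N f : L2 f -> L2 (fun x => - f x).
Proof.
move=> /(L2Z (-1)); rewrite (_ : (fun x => - f x) = (fun x => -1 * f x))//.
by apply/funext => x; rewrite mulN1r.
Qed.

Lemma L2B f g : L2 f -> L2 g -> L2 (fun x => f x - g x).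
Proof. by move=> lf lg; apply: L2D => //; exact: L2N. Qed.

Lemma L2_sum (I : Type) (s : seq I) (F : I -> T -> R[i]) :
  (forall i, L2 (F i)) -> L2 (fun x => \sum_(i <- s) F i x).
Proof.
move=> mF; elim: s => [|i s ih].
  by under eq_fun do rewrite big_nil; exact: L2_0.
by under eq_fun do rewrite big_cons; exact: L2D.
Qed.

Lemma eq_L2 f g : (forall x, D x -> f x = g x) -> L2 f -> L2 g.
Proof.
move=> fg [[m1 m2] fi]; split; [split|].
- by apply: eq_measurable_fun m1 => x; rewrite inE => /fg ->.
- by apply: eq_measurable_fun m2 => x; rewrite inE => /fg ->.
- by apply: eq_integrable fi => // x; rewrite inE => /fg ->.
Qed.

Lemma L2_ncM f g : L2 f -> L2 g -> mu.-integrable D (fun x => (nc (f x) * nc (g x))%:E).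
Proof.
move=> [mf fi] [mg gi].
apply: (@int_le _ _ _ mu D mD _ (fun x => nc (f x) ^+ 2 + nc (g x) ^+ 2)).
- by apply: measurable_funM; exact: meas_nc.
- move=> x _; rewrite ger0_norm ?mulr_ge0 ?nc_ge0//.
  have := sqr_ge0 (nc (f x) - nc (g x)); have := nc_ge0 (f x); have := nc_ge0 (g x).
  by nra.
- rewrite (_ : _ \o _ = (fun x => ((nc (f x) ^+ 2)%:E + (nc (g x) ^+ 2)%:E)%E)).
    exact: integrableD.
  by apply/funext => x; rewrite /= EFinD.
Qed.

Lemma L2_cintM f g : L2 f -> L2 g -> cintegrable mu D (fun x => f x * g x).
Proof.
move=> lf lg; apply: (@cint_le _ _ _ mu D mD _ (fun x => nc (f x) * nc (g x))).
- by apply: cmeasM; exact: L2_meas.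
- by move=> x _; rewrite ncM.
- exact: L2_ncM.
Qed.

Lemma L2_conj f : L2 f -> L2 (fun x => (f x)^*).
Proof.
move=> [mf fi]; split; first exact: cmeas_conj.
by under eq_fun do rewrite nc_conj.
Qed.

Lemma ip_cint f g : L2 f -> L2 g -> cintegrable mu D (fun x => f x * (g x)^*).
Proof. by move=> lf lg; apply: L2_cintM => //; exact: L2_conj. Qed.

Lemma ler_addeps (x y c : R) : (forall e, 0 < e -> x <= y + e * c) -> x <= y.
Proof.
move=> h; rewrite leNgt; apply/negP => yx.
have c0 : 0 < c by have := h 1 ltr01; rewrite mul1r; lra.
have := h ((x - y) / (2 * c)); rewrite divr_gt0 ?subr_gt0 ?mulr_gt0// => /(_ isT).
by rewrite invfM mulrA mulfVK ?gt_eqF//; lra.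
Qed.

(* optimising [2 a b <= s a^2 + b^2 / s] over [s], with [e] avoiding division by 0 *)
Lemma holder22 f g : L2 f -> L2 g ->
  Rintegral mu D (fun x => nc (f x) * nc (g x)) <= n2 f * n2 g.
Proof.
move=> lf lg; have [mf fi] := lf; have [mg gi] := lg.
apply: (@ler_addeps _ _ ((n2 f + n2 g) / 2)) => e e0.
pose s := (n2 g + e) / (n2 f + e).
have f0 := n2_ge0 f; have g0 := n2_ge0 g.
have fe : 0 < n2 f + e by lra.
have ge : 0 < n2 g + e by lra.
have s0 : 0 < s by rewrite divr_gt0.
have H : 2 * Rintegral mu D (fun x => nc (f x) * nc (g x)) <=
    s * n2 f ^+ 2 + s^-1 * n2 g ^+ 2.
  rewrite !sqr_n2 -!RintegralZl//; last exact: L2_ncM.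
  have Zi (c : R) (h : T -> R) : mu.-integrable D (fun x => (h x)%:E) ->
      mu.-integrable D (fun x => (c * h x)%:E).
    move=> ih; rewrite (_ : (fun x => _) = (fun x => c%:E * (h x)%:E)%E); last by [].
    exact: integrableZl.
  rewrite -RintegralD//; [|exact: Zi|exact: Zi].
  apply: le_Rintegral => //; first exact/Zi/L2_ncM.
    rewrite (_ : _ \o _ = (fun x => ((s * nc (f x) ^+ 2)%:E + (s^-1 * nc (g x) ^+ 2)%:E)%E)).
      by apply: integrableD => //; exact: Zi.
    by apply/funext => x; rewrite /= EFinD.
  move=> x _; rewrite -subr_ge0.
  rewrite (_ : _ - _ = s * (nc (f x) - s^-1 * nc (g x)) ^+ 2).
    by rewrite mulr_ge0 ?sqr_ge0// ltW.
  by field; rewrite gt_eqF.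
have E1 : s * n2 f ^+ 2 <= (n2 g + e) * n2 f.
  rewrite /s mulrAC ler_pdivrMr// -mulrA; apply: ler_wpM2l; first exact: ltW.
  by rewrite expr2; apply: ler_wpM2l => //; lra.
have E2 : s^-1 * n2 g ^+ 2 <= (n2 f + e) * n2 g.
  rewrite /s invf_div mulrAC ler_pdivrMr// -mulrA; apply: ler_wpM2l; first exact: ltW.
  by rewrite expr2; apply: ler_wpM2l => //; lra.
nra.
Qed.

Lemma CS f g : L2 f -> L2 g -> nc (ip f g) <= n2 f * n2 g.
Proof.
move=> lf lg; apply: le_trans (holder22 lf lg); apply: le_nc_cintegral => //.
- exact: ip_cint.
- by move=> x _; rewrite ncM nc_conj.
- exact: L2_ncM.
Qed.

Lemma CS' f g : L2 f -> L2 g -> nc (cintegral mu D (fun x => f x * g x)) <= n2 f * n2 g.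
Proof.
move=> lf lg; apply: le_trans (holder22 lf lg); apply: le_nc_cintegral => //.
- exact: L2_cintM.
- by move=> x _; rewrite ncM.
- exact: L2_ncM.
Qed.

Lemma n2_le f g : L2 g -> cmeasurable D f -> (forall x, D x -> nc (f x) <= nc (g x)) ->
  n2 f <= n2 g.
Proof.
move=> [mg gi] mf fg; rewrite ler_wsqrtr// le_Rintegral//.
- have [] // : L2 f.
  apply: (@L2_le _ (fun x => nc (g x) ^+ 2)) => // x Dx.
  by rewrite lerXn2r ?nnegrE ?nc_ge0 ?fg.
- by move=> x Dx; rewrite lerXn2r ?nnegrE ?nc_ge0 ?fg.
Qed.

Lemma n2Z z f : L2 f -> n2 (fun x => z * f x) = nc z * n2 f.
Proof.
move=> [mf fi]; rewrite /n2.
under eq_Rintegral do rewrite ncM exprMn.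
by rewrite RintegralZl// sqrtrM ?sqr_ge0// sqrtr_sqr ger0_norm ?nc_ge0.
Qed.

Lemma n2N f : n2 (fun x => - f x) = n2 f.
Proof. by rewrite /n2; under eq_Rintegral do rewrite normcN. Qed.

Lemma n2BC f g : n2 (fun x => f x - g x) = n2 (fun x => g x - f x).
Proof. by rewrite /n2; under eq_Rintegral do rewrite -opprB normcN. Qed.

Lemma n2_0 : n2 (fun=> 0) = 0.
Proof.
by rewrite /n2; under eq_Rintegral do rewrite Normc.normc0 expr0n; rewrite Rintegral_cst// mul0r sqrtr0.
Qed.

Lemma n2D f g : L2 f -> L2 g -> n2 (fun x => f x + g x) <= n2 f + n2 g.
Proof.
move=> lf lg; have [mf fi] := lf; have [mg gi] := lg.
rewrite -(@ler_pXn2r _ 2) ?nnegrE ?addr_ge0 ?n2_ge0//.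
have H := holder22 lf lg.
have -> : (n2 f + n2 g) ^+ 2 = n2 f ^+ 2 + 2 * (n2 f * n2 g) + n2 g ^+ 2 by ring.
apply: (@le_trans _ _ (n2 f ^+ 2 + 2 * Rintegral mu D (fun x => nc (f x) * nc (g x))
   + n2 g ^+ 2)); last lra.
have Zi (c : R) (h : T -> R) : mu.-integrable D (fun x => (h x)%:E) ->
    mu.-integrable D (fun x => (c * h x)%:E).
  move=> ih; rewrite (_ : (fun x => _) = (fun x => c%:E * (h x)%:E)%E); last by [].
  exact: integrableZl.
have Di (h k : T -> R) : mu.-integrable D (fun x => (h x)%:E) ->
    mu.-integrable D (fun x => (k x)%:E) -> mu.-integrable D (fun x => (h x + k x)%:E).
  move=> ih ik; rewrite (_ : (fun x => _) = (fun x => (h x)%:E + (k x)%:E)%E); last by [].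
  exact: integrableD.
have ifg := L2_ncM lf lg.
rewrite !sqr_n2 -!RintegralZl// -!RintegralD//; try by [exact: Zi|apply: Di => //; exact: Zi].
apply: le_Rintegral => //.
- by have [] := L2D lf lg.
- by apply: (Di _ _) => //; apply: Di => //; exact: Zi.
- move=> x _; rewrite (_ : _ + _ = (nc (f x) + nc (g x)) ^+ 2).
    by rewrite lerXn2r ?nnegrE ?addr_ge0 ?nc_ge0// le_normcD.
  by ring.
Qed.

Lemma n2B f g : L2 f -> L2 g -> n2 (fun x => f x - g x) <= n2 f + n2 g.
Proof. by move=> lf lg; rewrite -[n2 g]n2N; apply: n2D => //; exact: L2N. Qed.

Lemma n2_tri f g h : L2 f -> L2 g -> L2 h ->
  n2 (fun x => f x - h x) <= n2 (fun x => f x - g x) + n2 (fun x => g x - h x).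
Proof.
move=> lf lg lh; rewrite -(@eq_n2 (fun x => (f x - g x) + (g x - h x))).
  by apply: n2D; exact: L2B.
by move=> x _; rewrite addrA subrK.
Qed.

Lemma n2_lip f g : L2 f -> L2 g -> `|n2 f - n2 g| <= n2 (fun x => f x - g x).
Proof.
move=> lf lg; rewrite ler_norml; apply/andP; split.
- rewrite lerNl opprB lerBlDr n2BC -(@eq_n2 (fun x => (g x - f x) + f x)).
    by apply: n2D => //; exact: L2B.
  by move=> x _; rewrite subrK.
- rewrite lerBlDr -(@eq_n2 (fun x => (f x - g x) + g x)).
    by apply: n2D => //; exact: L2B.
  by move=> x _; rewrite subrK.
Qed.

Lemma n2_bnd (C : R) f g : 0 <= C -> cmeasurable D g -> (forall x, D x -> nc (g x) <= C) ->
  L2 f -> n2 (fun x => g x * f x) <= C * n2 f.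
Proof.
move=> C0 mg gC lf; rewrite -[in leRHS](ger0_norm C0) -nc_real -n2Z//.
apply: n2_le; [exact: L2Z|apply: cmeasM => //; exact: L2_meas|].
by move=> x Dx; rewrite !ncM nc_real ger0_norm// ler_wpM2r ?nc_ge0 ?gC.
Qed.

Lemma ipDl f g h : L2 f -> L2 g -> L2 h -> ip (fun x => f x + g x) h = ip f h + ip g h.
Proof.
move=> lf lg lh; rewrite /ip -cintegralD//; [|exact: ip_cint|exact: ip_cint].
by apply: eq_cintegral => x _; rewrite mulrDl.
Qed.

Lemma ipZl z f g : L2 f -> L2 g -> ip (fun x => z * f x) g = z * ip f g.
Proof.
move=> lf lg; rewrite /ip -cintegralZ//; last exact: ip_cint.
by apply: eq_cintegral => x _; rewrite mulrA.
Qed.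

Lemma ipC f g : L2 f -> L2 g -> ip f g = (ip g f)^*.
Proof.
move=> lf lg; rewrite /ip -cintegral_conj//; last exact: ip_cint.
by apply: eq_cintegral => x _; rewrite rmorphM /= conjCK mulrC.
Qed.

Lemma ipNl f g : L2 f -> L2 g -> ip (fun x => - f x) g = - ip f g.
Proof.
move=> lf lg; rewrite -mulN1r -ipZl//.
by apply: eq_ip => // x _; rewrite mulN1r.
Qed.

Lemma ipBl f g h : L2 f -> L2 g -> L2 h -> ip (fun x => f x - g x) h = ip f h - ip g h.
Proof. by move=> lf lg lh; rewrite ipDl ?ipNl//; exact: L2N. Qed.

Lemma ipDr f g h : L2 f -> L2 g -> L2 h -> ip h (fun x => f x + g x) = ip h f + ip h g.
Proof.
move=> lf lg lh; rewrite ipC//; last exact: L2D.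
by rewrite ipDl// rmorphD /= -!ipC.
Qed.

Lemma ipZr z f g : L2 f -> L2 g -> ip f (fun x => z * g x) = z^* * ip f g.
Proof.
move=> lf lg; rewrite ipC//; last exact: L2Z.
by rewrite ipZl// rmorphM /= -ipC.
Qed.

Lemma ipBr f g h : L2 f -> L2 g -> L2 h -> ip h (fun x => f x - g x) = ip h f - ip h g.
Proof.
move=> lf lg lh; rewrite ipC//; last exact: L2B.
by rewrite ipBl// rmorphB /= -!ipC.
Qed.

Lemma ip_self f : ip f f = (n2 f ^+ 2)%:C.
Proof.
by rewrite sqr_n2 -(cintegral_real _ mD); apply: eq_cintegral => x _; rewrite mulconj.
Qed.

Lemma ip_suml (I : Type) (s : seq I) (F : I -> T -> R[i]) g :
  (forall i, L2 (F i)) -> L2 g ->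
  ip (fun x => \sum_(i <- s) F i x) g = \sum_(i <- s) ip (F i) g.
Proof.
move=> mF lg; rewrite /ip -cintegral_sum//; last by move=> i; exact: ip_cint.
by apply: eq_cintegral => x _; rewrite mulr_suml.
Qed.

Definition cvg2 (f_ : nat -> T -> R[i]) f :=
  (fun n => n2 (fun x => f_ n x - f x)) @ \oo --> (0 : R).

Lemma cvg2_dominated (f_ : nat -> T -> R[i]) f b :
  (forall n, cmeasurable D (f_ n)) -> cmeasurable D f ->
  (forall x, D x -> ccvg (f_ ^~ x) (f x)) ->
  mu.-integrable D (fun x => (b x ^+ 2)%:E) -> (forall n x, D x -> nc (f_ n x) <= b x) ->
  cvg2 f_ f.
Proof.
move=> mf_ mf ff ib fb.
have fb' x : D x -> nc (f x) <= b x.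
  by move=> Dx; apply: (ccvg_le (ff x Dx)) => n; exact: fb.
suff H : (fun n => Rintegral mu D (fun x => nc (f_ n x - f x) ^+ 2)) @ \oo -->
    Rintegral mu D (fun=> 0).
  rewrite /cvg2 -(@sqrtr0 R); apply: continuous_cvg; first exact: sqrt_continuous.
  by move: H; rewrite Rintegral_cst// mul0r.
(* [|f_n - f|^2 <= 2 (|f_n|^2 + |f|^2) <= 4 b^2]. *)
apply: (@rdominated _ _ (fun x => 4 * b x ^+ 2)).
- by move=> n; apply: meas_nc2; exact: cmeasB.
- exact: measurable_cst.
- move=> x Dx; rewrite -[X in _ --> X](expr0n R 2).
  by apply: (@cvg_comp _ _ _ _ (fun y : R => y ^+ 2)); [exact: ff|exact: exprn_continuous].
- rewrite (_ : _ \o _ = (fun x => (4%:E * (b x ^+ 2)%:E)%E)).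
    exact: integrableZl.
  by apply/funext => x; rewrite /= EFinM.
- move=> n x Dx; rewrite ger0_norm ?sqr_ge0//.
  have := nc_sqrD (f_ n x) (- f x); rewrite normcN.
  have := fb n x Dx; have := fb' x Dx; have := nc_ge0 (f x); have := nc_ge0 (f_ n x).
  by move=> *; nra.
Qed.

Lemma cvg2_ipl (f_ : nat -> T -> R[i]) f g : (forall n, L2 (f_ n)) -> L2 f -> L2 g -> cvg2 f_ f ->
  ccvg (fun n => ip (f_ n) g) (ip f g).
Proof.
move=> lf_ lf lg ff; apply: (@ccvg_squeeze _ _ _ (fun n => n2 (fun x => f_ n x - f x) * n2 g)).
  by move=> n; rewrite -ipBl// CS//; exact: L2B.
by rewrite -[X in _ --> X](mul0r (n2 g)); apply: cvgM => //; exact: cvg_cst.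
Qed.

Lemma cvg2_ipr (f_ : nat -> T -> R[i]) f g : (forall n, L2 (f_ n)) -> L2 f -> L2 g -> cvg2 f_ f ->
  ccvg (fun n => ip g (f_ n)) (ip g f).
Proof.
move=> lf_ lf lg ff; rewrite ipC// (_ : (fun _ => _) = fun n => (ip (f_ n) g)^*).
  by apply: ccvg_conj; exact: cvg2_ipl.
by apply/funext => n; rewrite ipC.
Qed.

Lemma cvg2_n2 (f_ : nat -> T -> R[i]) f : (forall n, L2 (f_ n)) -> L2 f -> cvg2 f_ f ->
  (fun n => n2 (f_ n)) @ \oo --> n2 f.
Proof.
move=> lf_ lf ff; apply/subr_cvg0/cvg0_abs; apply: cvg0_le ff => n.
by rewrite normr_ge0/= n2_lip.
Qed.

Lemma cvg2_bounded (f_ : nat -> T -> R[i]) f : (forall n, L2 (f_ n)) -> L2 f -> cvg2 f_ f ->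
  exists M : R, forall n, n2 (f_ n) <= M.
Proof.
move=> lf_ lf /(cvg2_n2 lf_ lf) ff.
have /cvg_seq_bounded [M [_ MP]] : cvgn (fun n => n2 (f_ n)) by apply/cvg_ex; exists (n2 f).
exists (M + 1) => n; rewrite (le_trans (ler_norm _))//.
by apply: (MP (M + 1)) => //; rewrite ltrDl.
Qed.

(** The difference splits into [<f_n - f, g_n> + <f, g_n - g>], and the norms of the convergent
    [g_n] are bounded. *)
Lemma cvg2_ip (f_ : nat -> T -> R[i]) f (g_ : nat -> T -> R[i]) g : (forall n, L2 (f_ n)) -> L2 f -> (forall n, L2 (g_ n)) -> L2 g ->
  cvg2 f_ f -> cvg2 g_ g -> ccvg (fun n => ip (f_ n) (g_ n)) (ip f g).
Proof.
move=> lf_ lf lg_ lg ff gg; have [M MP] := cvg2_bounded lg_ lg gg.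
apply: (@ccvg_squeeze _ _ _ (fun n => n2 (fun x => f_ n x - f x) * M +
    n2 f * n2 (fun x => g_ n x - g x))).
  move=> n.
  rewrite (_ : _ - _ = ip (fun x => f_ n x - f x) (g_ n) + ip f (fun x => g_ n x - g x)).
    rewrite (le_trans (le_normcD _ _))// lerD//; last by apply: CS => //; exact: L2B.
    rewrite (le_trans (CS _ _))//; first exact: L2B.
    by rewrite ler_wpM2l ?n2_ge0.
  by rewrite ipBl// ipBr// addrA subrK.
rewrite [X in _ --> X](_ : _ = 0 * M + n2 f * 0); last by rewrite mul0r mulr0 addr0.
by apply: cvgD; apply: cvgM => //; exact: cvg_cst.
Qed.

Lemma cvg2_bnd (C : R) (f_ : nat -> T -> R[i]) f g : cmeasurable D g -> (forall x, D x -> nc (g x) <= C) ->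
  (forall n, L2 (f_ n)) -> L2 f -> cvg2 f_ f ->
  cvg2 (fun n x => g x * f_ n x) (fun x => g x * f x).
Proof.
move=> mg gC lf_ lf ff; apply: (@cvg0_le _ _ (fun n => `|C| * n2 (fun x => f_ n x - f x))).
  move=> n; rewrite n2_ge0/=.
  rewrite (@eq_n2 _ (fun x => g x * (f_ n x - f x))); last by move=> x _; rewrite mulrBr.
  apply: n2_bnd => //; last exact: L2B.
  by move=> x Dx; rewrite (le_trans (gC x Dx))// ler_norm.
by rewrite -[X in _ --> X](mulr0 `|C|); apply: cvgM => //; exact: cvg_cst.
Qed.

Lemma cvg2D (f_ : nat -> T -> R[i]) f (g_ : nat -> T -> R[i]) g : (forall n, L2 (f_ n)) -> L2 f -> (forall n, L2 (g_ n)) -> L2 g ->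
  cvg2 f_ f -> cvg2 g_ g -> cvg2 (fun n x => f_ n x + g_ n x) (fun x => f x + g x).
Proof.
move=> lf_ lf lg_ lg ff gg.
apply: (@cvg0_le _ _ (fun n => n2 (fun x => f_ n x - f x) + n2 (fun x => g_ n x - g x))).
  move=> n; rewrite n2_ge0/= -(@eq_n2 (fun x => (f_ n x - f x) + (g_ n x - g x))).
    by apply: n2D; exact: L2B.
  by move=> x _; ring.
by rewrite -[X in _ --> X](addr0 0); exact: cvgD.
Qed.

Lemma cvg2_cst f : cvg2 (fun=> f) f.
Proof.
rewrite /cvg2 (_ : (fun _ => _) = fun=> 0); first exact: cvg_cst.
by apply/funext => _; rewrite -[RHS]n2_0; apply: eq_n2 => x _; rewrite subrr.
Qed.

(** Bridge to the norms of the statement: there the restriction to [D] is an indicator factor inside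
    [Lnorm], here it is the domain of integration. *)
Lemma cLnorm2E f : cmeasurable D f ->
  cLnorm mu D 2%:E f = sqrte (\int[mu]_(x in D) (nc (f x) ^+ 2)%:E).
Proof.
move=> mf; rewrite /cLnorm unlock poweR12_sqrt; last first.
  by apply: integral_ge0 => x _; exact: poweR_ge0.
congr sqrte; rewrite [RHS]integral_mkcond.
apply: eq_integral => x _; rewrite patchE indicE.
case: ifPn => xD; rewrite /= ?xD ?mul1r ?(negbTE xD) ?mul0r ?normr0.
- by rewrite ger0_norm ?nc_ge0// powR_mulrn// nc_ge0.
- by rewrite powR0.
Qed.

Lemma L2_cLnorm f : L2 f -> cLnorm mu D 2%:E f = (n2 f)%:E.
Proof.
move=> [mf fi]; rewrite cLnorm2E// /n2 /Rintegral.
rewrite -[in LHS](@fineK _ (\int[mu]_(x in D) _)%E)//.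
exact: integrable_fin_num.
Qed.

Lemma L2P f : cLp mu D 2%:E f <-> L2 f.
Proof.
split=> [[mf fi]|lf]; last by split; [exact: L2_meas|rewrite L2_cLnorm// ltry].
split => //; apply/integrableP; split; first exact/measurable_EFinP/meas_nc2.
under eq_integral do rewrite gee0_abs ?lee_fin ?sqr_ge0//.
move: fi; rewrite cLnorm2E//.
have : (0 <= \int[mu]_(x in D) (nc (f x) ^+ 2)%:E)%E.
  by apply: integral_ge0 => x _; rewrite lee_fin sqr_ge0.
by case: (\int[mu]_(x in D) _)%E => // r _ _; rewrite ltry.
Qed.

End L2.

Notation pushm := measure_function_pushforward__canonical__measure_function_Measure.

(** * Lebesgue measure on row vectors *)

Section rV_borel.
Context (R : realType) (d : nat).

Lemma rV_ballE (x y : 'rV[R]_d) (e : R) : 0 < e ->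
  ball x e y <-> forall i, `|x ord0 i - y ord0 i| < e.
Proof.
move=> e0; split=> [[_ xy] i|xy]; first exact: (xy ord0 i).
by split => // i j; rewrite ord1; exact: xy.
Qed.

(** The sigma-algebra is generated by the coordinates. An open set is a countable union of sup-norm
    balls with rational centre and radius [1/(k+1)], and each such ball is a finite intersection of
    coordinate preimages of intervals. *)
Lemma open_rV_measurable (U : set 'rV[R]_d) : open U -> measurable U.
Proof.
move=> oU.
pose q (p : 'rV[rat]_d * nat) : 'rV[R]_d := \row_i ratr (p.1 ord0 i).
pose e (p : 'rV[rat]_d * nat) : R := p.2.+1%:R^-1.
have e0 p : 0 < e p by rewrite invr_gt0 ltr0n.
pose I := [set p | ball (q p) (e p) `<=` U].
have -> : U = \bigcup_(p in I) [set y | forall i, `|q p ord0 i - y ord0 i| < e p].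
  apply/seteqP; split => [x Ux|x [p Ip] /= xp]; last by apply: Ip; exact/rV_ballE.
  have [eps /= eps0 beps] : exists2 eps : R, 0 < eps & ball x eps `<=` U.
    by move: oU => /(_ x Ux)/nbhs_ballP[eps /= ? ?]; exists eps.
  (* A rational centre within [1/(n+1) < eps/2] of [x] has a ball of that radius which contains [x]
     and stays within [eps] of it. *)
  pose n := `|Num.ceil (2 / eps)|%N.
  have neps : n.+1%:R^-1 < eps / 2.
    rewrite -[ltRHS]invrK invf_div ltf_pV2 ?posrE ?ltr0n ?divr_gt0//.
    have h : 2 / eps <= n%:R.
      by rewrite natr_absz (le_trans (Num.Theory.ceil_ge _))// ler_int ler_norm.
    by rewrite (le_lt_trans h)// ltr_nat.
  have [k k0 kE] : exists2 k : R, 0 < k & k = n.+1%:R^-1.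
    by exists n.+1%:R^-1 => //; rewrite invr_gt0 ltr0n.
  rewrite -kE in neps.
  have /choice[r rP] : forall i, exists r : rat, `|ratr r - x ord0 i| < k.
    move=> i; have : x ord0 i - k < x ord0 i + k by rewrite ltrD2l gtrN.
    move=> /rat_in_itvoo[r]; rewrite in_itv/= => /andP[r1 r2]; exists r.
    by rewrite ltr_distlC; apply/andP; split; lra.
  exists (\row_i r i, n) => /=.
  - move=> y /rV_ballE; rewrite /q /e/= -kE => /(_ k0) qy; apply: beps.
    apply/rV_ballE => // i; have := qy i; rewrite !mxE => qyi.
    have := rP i; move: qyi; rewrite !ltr_distlC => /andP[? ?] /andP[? ?].
    by apply/andP; split; lra.
  - by move=> i; rewrite /q /e/= -kE !mxE; exact: rP.
rewrite bigcup_mkcond; apply: countable_bigcupT_measurable; first exact: countableP.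
move=> p; case: ifPn => [_|_]; last exact: measurable0.
rewrite [X in measurable X](_ : _ =
    \bigcap_(i in [set: 'I_d]) ((fun y => rV_coord i y) @^-1` (ball (q p ord0 i) (e p)))); last first.
  by apply/seteqP; split => y /= h i => [_|]; exact: h.
apply: fin_bigcap_measurable; first exact: finite_finset.
move=> i _; rewrite -[X in measurable X]setTI.
by apply: measurable_rV_coord => //; exact: measurable_ball.
Qed.

Lemma continuous_rV_measurable (f : 'rV[R]_d -> R) : continuous f -> measurable_fun setT f.
Proof.
move=> cf; apply: (measurability _ (RGenOpens.measurableE R)) => //.
move=> _ [_ [a [b ->] <-]]; rewrite setTI; apply: open_rV_measurable.
by move/continuousP : cf; apply; exact: interval_open.
Qed.

End rV_borel.

Section rcons.
Context (R : realType) (d : nat).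

Definition rV_init (x : 'rV[R]_d.+1) : 'rV[R]_d := \row_j x ord0 (lift ord_max j).
Definition rV_last (x : 'rV[R]_d.+1) : R := x ord0 ord_max.

Lemma rcons_last (x : 'rV[R]_d) t : rV_rcons x t ord0 ord_max = t.
Proof. by rewrite mxE unlift_none. Qed.

Lemma rcons_lift (x : 'rV[R]_d) t j : rV_rcons x t ord0 (lift ord_max j) = x ord0 j.
Proof. by rewrite mxE liftK. Qed.

Lemma rcons_init_last x : rV_rcons (rV_init x) (rV_last x) = x.
Proof.
apply/rowP => i; case: (unliftP ord_max i) => [j|] ->.
- by rewrite rcons_lift mxE.
- by rewrite rcons_last.
Qed.

Lemma rcons_affine (a : R) (x y : 'rV[R]_d) (s t : R) :
  rV_rcons (a *: x + y) (a * s + t) = a *: rV_rcons x s + rV_rcons y t.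
Proof.
apply/rowP => i; case: (unliftP ord_max i) => [j|] ->.
- by rewrite rcons_lift !mxE liftK.
- by rewrite rcons_last !mxE unlift_none.
Qed.

Lemma measurable_init : measurable_fun setT rV_init.
Proof.
apply: measurable_fun_rVP => i; under eq_fun do rewrite mxE.
exact: measurable_rV_coord.
Qed.

Lemma measurable_last : measurable_fun setT rV_last.
Proof. exact: measurable_rV_coord. Qed.

Lemma measurable_half_space : measurable (@half_space R d).
Proof.
have -> : @half_space R d = rV_last @^-1` `]0, +oo[.
  by apply/seteqP; split => x /=; rewrite in_itv/= andbT.
by rewrite -[X in measurable X]setTI; apply: measurable_last.
Qed.

End rcons.

Section rV_affine_measurable.
Context (R : realType) (d : nat).

Lemma measurable_rV_affine (a : R) (b : 'rV[R]_d) :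
  measurable_fun setT (fun x : 'rV[R]_d => a *: x + b).
Proof.
apply: measurable_fun_rVP => i; under eq_fun do rewrite !mxE.
apply: measurable_funD; last exact: measurable_cst.
by apply: measurable_funM; [exact: measurable_cst|exact: measurable_rV_coord].
Qed.

End rV_affine_measurable.

Section one_dim.
Context (R : realType).
Notation mu := (@lebesgue_measure R).

(** The pushforward of Lebesgue measure under the affine map, scaled by [a], agrees with Lebesgue
    measure on half-open intervals, and these determine it. *)
Lemma lebesgue_affine (a b : R) (a0 : 0 < a) (A : set R) : measurable A ->
  mu A = (a%:E * mu ((fun t => a * t + b)%R @^-1` A))%E.
Proof.
move=> mA.
have mphi : measurable_fun (setT : set (measurableTypeR R)) ((fun t : R => a * t + b) : _ -> measurableTypeR R).
  by apply: measurable_funD => //; exact: measurable_funM.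
pose nu : {measure set (measurableTypeR R) -> \bar R} := mscale (NngNum (ltW a0)) (pushm mu mphi).
rewrite -[RHS]/(nu A).
apply: (@lebesgue_measure_unique R nu) => // _ [[x y] /= _ <-].
rewrite /nu /mscale /= /pushforward.
rewrite (_ : _ @^-1` _ = `](x - b) / a, (y - b) / a]%classic).
  rewrite !lebesgue_measure_itv/= !lte_fin ltr_pM2r ?invr_gt0// ltrD2r.
  case: ifPn => xy; last by rewrite mule0.
  by rewrite -!EFinD -EFinM; congr EFin; field; rewrite gt_eqF.
apply/seteqP; split => t /=; rewrite !in_itv/= ltr_pdivrMr// ler_pdivlMr//.
- by rewrite ltrBlDr lerBrDr mulrC.
- by rewrite ltrBlDr lerBrDr mulrC.
Qed.

Lemma ge0_integral_affine (a b : R) (a0 : 0 < a) (f : R -> \bar R) :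
  measurable_fun setT f -> (forall t, 0 <= f t)%E ->
  (\int[mu]_t f t = a%:E * \int[mu]_t f (a * t + b)%R)%E.
Proof.
move=> mf f0.
have mphi : measurable_fun (setT : set (measurableTypeR R)) ((fun t : R => a * t + b) : _ -> measurableTypeR R).
  by apply: measurable_funD => //; exact: measurable_funM.
pose nu : {measure set (measurableTypeR R) -> \bar R} := mscale (NngNum (ltW a0)) (pushm mu mphi).
rewrite (eq_measure_integral nu); last by move=> A mA _; exact: lebesgue_affine.
rewrite ge0_integral_mscale//; congr (_ * _)%E.
by rewrite ge0_integral_pushforward// preimage_setT.
Qed.

End one_dim.

Section rV_sigma_finite.
Context (R : realType).

Definition rV_box d (k : R) : set 'rV[R]_d := [set x | forall i, `|x ord0 i| <= k].

Lemma measurable_rV_box d k : measurable (@rV_box d k).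
Proof.
rewrite [X in measurable X](_ : _ =
    \bigcap_(i in [set: 'I_d]) ((fun y => rV_coord i y) @^-1` `[- k, k])); last first.
  by apply/seteqP; split => y /= h i => [_|]; have := h i; rewrite /= in_itv/= -ler_norml//; apply.
apply: fin_bigcap_measurable; first exact: finite_finset.
by move=> i _; rewrite -[X in measurable X]setTI; exact: measurable_rV_coord.
Qed.

Lemma lebesgue_rV_box d (k : R) : 0 <= k ->
  lebesgue_rV R d (rV_box k) = ((2 * k) ^+ d)%:E.
Proof.
move=> k0; elim: d => [|d ih] /=.
  by rewrite diracE expr0 mem_set// => -[].
rewrite /lebesgue_rV_extend /pushforward.
rewrite (_ : _ @^-1` _ = @rV_box d k `*` `[- k, k]%classic); last first.
  apply/seteqP; split => -[x t] /=; rewrite /rV_of_pair /= in_itv/= -ler_norml.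
  - move=> h; split; last by have := h ord_max; rewrite rcons_last.
    by move=> i; have := h (lift ord_max i); rewrite rcons_lift.
  - move=> [h tk] i; case: (unliftP ord_max i) => [j|] ->; first by rewrite rcons_lift.
    by rewrite rcons_last.
rewrite product_measure1E//; last exact: measurable_rV_box.
rewrite [X in (X * _)%E]ih.
rewrite [X in (_ * X)%E](lebesgue_measure_itv `[- k, k])/= lte_fin.
case: ltP => kk; first by rewrite -EFinD -EFinM exprSr opprK; congr EFin; ring.
have -> : k = 0 by apply/eqP; rewrite eq_le k0 andbT; move: kk; rewrite -subr_ge0; lra.
by rewrite mulr0 exprS mul0r mule0.
Qed.

(** The boxes of integer half-width exhaust the space; this is what Tonelli and Fubini ask of the
    measure. *)
Lemma lebesgue_rV_sigma_finite d : sigma_finite setT (lebesgue_rV R d).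
Proof.
exists (fun n => @rV_box d n%:R).
- apply/seteqP; split => // x _.
  have [n nP] : exists n : nat, forall i, `|x ord0 i| <= n%:R.
    exists (\max_i `|Num.ceil `|x ord0 i| |%N) => i.
    rewrite (@le_trans _ _ (`|Num.ceil `|x ord0 i| |%N)%:R)//; last first.
      by rewrite ler_nat (leq_bigmax i).
    by rewrite natr_absz (le_trans (Num.Theory.ceil_ge _))// ler_int ler_norm.
  by exists n.
- by move=> n; split; [exact: measurable_rV_box|rewrite lebesgue_rV_box// ltry].
Qed.

(* an alias of [lebesgue_rV] whose head symbol can carry the structure *)
Definition leb d : set 'rV[R]_d -> \bar R := lebesgue_rV R d.
Arguments leb : clear implicits.

HB.instance Definition _ d := Measure.copy (leb d) (lebesgue_rV R d).

HB.instance Definition _ d := Measure_isSigmaFinite.Build _ _ _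
  (leb d) (lebesgue_rV_sigma_finite d).

End rV_sigma_finite.
Arguments leb : clear implicits.

Section rV_tonelli.
Context (R : realType) (d : nat).
Notation mu1 := (@lebesgue_measure R).
Implicit Types (f : 'rV[R]_d.+1 -> \bar R).

Lemma ge0_integral_rcons0 f : measurable_fun setT f -> (forall x, 0 <= f x)%E ->
  (\int[lebesgue_rV R d.+1]_x f x =
   \int[(lebesgue_rV R d \x mu1)%E]_p f (rV_of_pair p))%E.
Proof.
move=> mf f0.
rewrite (@eq_measure_integral _ _ _ setT
  (pushm (lebesgue_rV R d \x mu1)%E (@measurable_rV_of_pair R d)))//.
rewrite ge0_integral_pushforward//; exact: measurable_rV_of_pair.
Qed.

Lemma measurable_comp_rcons d' (T : measurableType d') (f : 'rV[R]_d.+1 -> T) :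
  measurable_fun setT f -> measurable_fun setT (f \o @rV_of_pair R d).
Proof. by move=> mf; apply: measurableT_comp => //; exact: measurable_rV_of_pair. Qed.

Lemma ge0_integral_rcons f : measurable_fun setT f -> (forall x, 0 <= f x)%E ->
  (\int[lebesgue_rV R d.+1]_x f x =
   \int[lebesgue_rV R d]_x \int[mu1]_t f (rV_rcons x t))%E.
Proof.
move=> mf f0; rewrite ge0_integral_rcons0//.
by apply: (@fubini_tonelli1 _ _ _ _ _ (leb R d) (@lebesgue_measure R) (f \o @rV_of_pair R d) (measurable_comp_rcons mf) (fun p => f0 _)).
Qed.

Lemma ge0_integral_rcons' f : measurable_fun setT f -> (forall x, 0 <= f x)%E ->
  (\int[lebesgue_rV R d.+1]_x f x =
   \int[mu1]_t \int[lebesgue_rV R d]_x f (rV_rcons x t))%E.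
Proof.
move=> mf f0; rewrite ge0_integral_rcons0//.
by apply: (@fubini_tonelli2 _ _ _ _ _ (leb R d) (@lebesgue_measure R) (f \o @rV_of_pair R d) (measurable_comp_rcons mf) (fun p => f0 _)).
Qed.

Lemma measurable_rcons_r (x : 'rV[R]_d) : measurable_fun setT (fun t : R => rV_rcons x t).
Proof. exact: (measurableT_comp (@measurable_rV_of_pair R d) (measurable_pair1 x)). Qed.

End rV_tonelli.

Section rV_affine.
Context (R : realType).

(** Induction on the dimension: the last variable is changed by the one-dimensional formula, the
    others by the induction hypothesis applied to the integral over the last variable. *)
Lemma ge0_integral_rV_affine d (a : R) (b : 'rV[R]_d) (f : 'rV[R]_d -> \bar R) :
  0 < a -> measurable_fun setT f -> (forall x, 0 <= f x)%E ->
  (\int[lebesgue_rV R d]_x f x =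
   (a ^+ d)%:E * \int[lebesgue_rV R d]_x f (a *: x + b)%R)%E.
Proof.
move=> a0; elim: d b f => [|d ih] b f mf f0.
  rewrite expr0 mul1e /= !integral_dirac// ?diracE ?mem_set//; last first.
    by apply: measurableT_comp => //; exact: measurable_rV_affine.
  by rewrite !mul1e; congr f; apply/rowP => -[].
have mfab : measurable_fun setT (fun x : 'rV[R]_d.+1 => f (a *: x + b)%R).
  by apply: measurableT_comp => //; exact: measurable_rV_affine.
pose g x := (\int[lebesgue_measure]_t f (rV_rcons x t))%E.
have mg : measurable_fun setT g.
  exact: (@measurable_fun_fubini_tonelli_F _ _ _ _ _ (@lebesgue_measure R) _
    (measurable_comp_rcons mf) (fun p => f0 _)).
have g0 x : (0 <= g x)%E by apply: integral_ge0.
rewrite (ge0_integral_rcons mf f0) (ge0_integral_rcons mfab (fun x => f0 _)).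
rewrite [LHS](ih (rV_init b) g mg g0) exprSr EFinM -muleA.
congr (_ * _)%E; rewrite -ge0_integralZl//.
- apply: eq_integral => x _; rewrite /g.
  rewrite (@ge0_integral_affine _ a (rV_last b))//.
  + congr (_ * _)%E; apply: eq_integral => t _; congr f.
    by rewrite rcons_affine rcons_init_last.
  + by apply: measurableT_comp => //; exact: measurable_rcons_r.
- exact: (@measurable_fun_fubini_tonelli_F _ _ _ _ _ (@lebesgue_measure R) _
    (measurable_comp_rcons mfab) (fun p => f0 _)).
- by move=> x _; apply: integral_ge0.
- by rewrite lee_fin ltW.
Qed.

End rV_affine.

Section change_of_variables.
Context (R : realType) (d : nat).
Notation mu := (lebesgue_rV R d).
Implicit Types (f : 'rV[R]_d -> R[i]) (h : 'rV[R]_d -> R).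

Variables (a : R) (b : 'rV[R]_d) (a0 : 0 < a).

Lemma measurable_comp_affine d' (T : measurableType d') (f : 'rV[R]_d -> T) :
  measurable_fun setT f -> measurable_fun setT (fun x : 'rV[R]_d => f (a *: x + b)).
Proof. by move=> mf; apply: measurableT_comp => //; exact: measurable_rV_affine. Qed.

Lemma integrable_rV_affine h : mu.-integrable setT (EFin \o h) ->
  mu.-integrable setT (fun x => (h (a *: x + b))%:E).
Proof.
move=> /integrableP[mh ih].
have mh' : measurable_fun setT h by exact/measurable_EFinP.
apply/integrableP; split; first exact: (measurable_comp_affine mh).
have mah : measurable_fun setT (fun x : 'rV[R]_d => `|(h x)%:E|)%E.
  by apply: measurableT_comp => //; exact/measurable_EFinP.
move: ih; rewrite [X in (X < _)%E](@ge0_integral_rV_affine _ _ a b _ a0 mah (fun=> abse_ge0 _)).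
have : (0 <= \int[mu]_x `|(h (a *: x + b))%:E|)%E by apply: integral_ge0.
case: (\int[mu]_x _)%E => [r _ _|_|//]; first exact: ltry.
by rewrite mulry gtr0_sg ?exprn_gt0// mul1e.
Qed.

Lemma integral_rV_affine h : mu.-integrable setT (EFin \o h) ->
  (\int[mu]_x (h x)%:E = (a ^+ d)%:E * \int[mu]_x (h (a *: x + b))%:E)%E.
Proof.
move=> ih; have mhE := measurable_int _ ih.
rewrite integralE [in X in _ = (_ * X)%E]integralE muleBr//; last first.
  apply: integrable_add_def => //.
  exact: integrable_rV_affine.
congr (_ - _)%E.
- rewrite [LHS](@ge0_integral_rV_affine _ _ a b (EFin \o h)^\+%E a0
    (measurable_funepos mhE) (funepos_ge0 _)).
  by congr (_ * _)%E; apply: eq_integral => x _; rewrite !funeposE.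
- rewrite [LHS](@ge0_integral_rV_affine _ _ a b (EFin \o h)^\-%E a0
    (measurable_funeneg mhE) (funeneg_ge0 _)).
  by congr (_ * _)%E; apply: eq_integral => x _; rewrite !funenegE.
Qed.

Lemma Rintegral_rV_affine h : mu.-integrable setT (EFin \o h) ->
  Rintegral mu setT h = a ^+ d * Rintegral mu setT (fun x => h (a *: x + b)).
Proof.
move=> ih; rewrite /Rintegral integral_rV_affine// fineM//.
by apply: integrable_fin_num => //; exact: integrable_rV_affine.
Qed.

Lemma cintegrable_rV_affine f : cintegrable mu setT f ->
  cintegrable mu setT (fun x => f (a *: x + b)).
Proof.
move=> [f1 f2]; split.
- exact: (integrable_rV_affine (h := fun x => Re (f x))).
- exact: (integrable_rV_affine (h := fun x => Im (f x))).
Qed.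

Lemma cintegral_rV_affine f : cintegrable mu setT f ->
  cintegral mu setT f = (a ^+ d)%:C * cintegral mu setT (fun x => f (a *: x + b)).
Proof.
move=> [f1 f2]; rewrite /cintegral (Rintegral_rV_affine f1) (Rintegral_rV_affine f2).
by apply/eqP; rewrite eq_complex/= !mul0r subr0 addr0 !eqxx.
Qed.

End change_of_variables.

(** * Fubini's theorem for real and complex integrands *)

Section fubini_real.
Context d1 d2 (T1 : measurableType d1) (T2 : measurableType d2) (R : realType).
Variables (m1 : {sigma_finite_measure set T1 -> \bar R})
  (m2 : {sigma_finite_measure set T2 -> \bar R}).
Implicit Types (g : T1 * T2 -> R) (f : T1 * T2 -> R[i]).

Lemma rfubini_l g : (m1 \x m2)%E.-integrable setT (EFin \o g) ->
  (forall x, m2.-integrable setT (fun y => (g (x, y))%:E)) ->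
  m1.-integrable setT (fun x => (Rintegral m2 setT (fun y => g (x, y)))%:E) /\
  Rintegral m1 setT (fun x => Rintegral m2 setT (fun y => g (x, y))) =
  Rintegral (m1 \x m2)%E setT g.
Proof.
move=> ig sg.
have E x : (Rintegral m2 setT (fun y => g (x, y)))%:E = fubini_F m2 (EFin \o g) x.
  by rewrite /Rintegral fineK//; apply: integrable_fin_num.
split.
- by under eq_fun do rewrite E; exact: integrable_fubini_F.
- rewrite {1}/Rintegral; under eq_integral do rewrite E.
  by rewrite (integral12_prod_meas1 ig).
Qed.

Lemma rfubini_r g : (m1 \x m2)%E.-integrable setT (EFin \o g) ->
  (forall y, m1.-integrable setT (fun x => (g (x, y))%:E)) ->
  m2.-integrable setT (fun y => (Rintegral m1 setT (fun x => g (x, y)))%:E) /\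
  Rintegral m2 setT (fun y => Rintegral m1 setT (fun x => g (x, y))) =
  Rintegral (m1 \x m2)%E setT g.
Proof.
move=> ig sg.
have E y : (Rintegral m1 setT (fun x => g (x, y)))%:E = fubini_G m1 (EFin \o g) y.
  by rewrite /Rintegral fineK//; apply: integrable_fin_num.
split.
- under eq_fun do rewrite E.
  have mg := measurable_int _ ig.
  apply/integrableP; split; first exact: (measurable_fubini_G ig).
  have lty := (integrable21ltyP m1 m2 mg).1 ig.
  apply: (le_lt_trans _ lty).
  apply: ge0_le_integral => //.
  + by apply: measurableT_comp => //; exact: (measurable_fubini_G ig).
  + apply: (@measurable_fun_fubini_tonelli_G _ _ _ _ _ m1 (fun p => `|(g p)%:E|%E)) => //.
    exact: measurableT_comp.
  + move=> y _; apply: le_abse_integral => //.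
    exact: (measurableT_comp mg (measurable_pair2 y)).
- rewrite {1}/Rintegral; under eq_integral do rewrite E.
  by rewrite (integral21_prod_meas1 ig).
Qed.

Lemma cfubini_l f : cintegrable (m1 \x m2)%E setT f ->
  (forall x, cintegrable m2 setT (fun y => f (x, y))) ->
  cintegrable m1 setT (fun x => cintegral m2 setT (fun y => f (x, y))) /\
  cintegral m1 setT (fun x => cintegral m2 setT (fun y => f (x, y))) =
  cintegral (m1 \x m2)%E setT f.
Proof.
move=> [f1 f2] sf.
have [i1 e1] := rfubini_l f1 (fun x => (sf x).1).
have [i2 e2] := rfubini_l f2 (fun x => (sf x).2).
by split; [split|rewrite /cintegral /= -e1 -e2].
Qed.

Lemma cfubini_r f : cintegrable (m1 \x m2)%E setT f ->
  (forall y, cintegrable m1 setT (fun x => f (x, y))) ->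
  cintegrable m2 setT (fun y => cintegral m1 setT (fun x => f (x, y))) /\
  cintegral m2 setT (fun y => cintegral m1 setT (fun x => f (x, y))) =
  cintegral (m1 \x m2)%E setT f.
Proof.
move=> [f1 f2] sf.
have [i1 e1] := rfubini_r f1 (fun x => (sf x).1).
have [i2 e2] := rfubini_r f2 (fun x => (sf x).2).
by split; [split|rewrite /cintegral /= -e1 -e2].
Qed.

Lemma prod_integrable (b1 : T1 -> R) (b2 : T2 -> R) :
  m1.-integrable setT (EFin \o b1) -> m2.-integrable setT (EFin \o b2) ->
  (m1 \x m2)%E.-integrable setT (fun p => (b1 p.1 * b2 p.2)%:E).
Proof.
move=> i1 i2.
have m1b : measurable_fun setT b1 by apply/measurable_EFinP; exact: measurable_int i1.
have m2b : measurable_fun setT b2 by apply/measurable_EFinP; exact: measurable_int i2.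
apply/integrable12ltyP.
  apply/measurable_EFinP; apply: measurable_funM.
  - exact: (measurableT_comp m1b measurable_fst).
  - exact: (measurableT_comp m2b measurable_snd).
have E x : (\int[m2]_y `|(b1 x * b2 y)%:E| = `|b1 x|%:E * \int[m2]_y `|(b2 y)%:E|)%E.
  rewrite -ge0_integralZl//.
  - by apply: eq_integral => y _; rewrite /= normrM EFinM.
  - by apply: measurableT_comp => //; exact/measurable_EFinP.
under eq_integral do rewrite /= E.
have /integrableP[_ l2] := i2; have /integrableP[_ l1] := i1.
rewrite ge0_integralZr//; last 2 first.
- by apply/measurable_EFinP; exact: measurableT_comp.
- by apply: integral_ge0.
by rewrite lte_mul_pinfty// ?integral_ge0// ge0_fin_numE ?integral_ge0.
Qed.

(** Domination by a product makes every section integrable, not only almost every one, so the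
    iterated integrals are meaningful at each point and no exceptional null set is carried along. *)
Lemma cfubini_dominated f (b1 : T1 -> R) (b2 : T2 -> R) : cmeasurable setT f ->
  m1.-integrable setT (EFin \o b1) -> m2.-integrable setT (EFin \o b2) ->
  (forall x y, nc (f (x, y)) <= b1 x * b2 y) ->
  [/\ cintegrable m1 setT (fun x => cintegral m2 setT (fun y => f (x, y))),
      cintegrable m2 setT (fun y => cintegral m1 setT (fun x => f (x, y))) &
      cintegral m1 setT (fun x => cintegral m2 setT (fun y => f (x, y))) =
      cintegral m2 setT (fun y => cintegral m1 setT (fun x => f (x, y)))].
Proof.
move=> [mf1 mf2] i1 i2 fb.
have fi : cintegrable (m1 \x m2)%E setT f.
  apply: (@cint_le _ _ _ (m1 \x m2)%E setT mT _ (fun p => b1 p.1 * b2 p.2)) => //.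
  - by case=> x y _; exact: fb.
  - exact: prod_integrable.
have sl x : cintegrable m2 setT (fun y => f (x, y)).
  apply: (@cint_le _ _ _ m2 setT mT _ (fun y => b1 x * b2 y)) => //.
  - by split; [exact: (measurableT_comp mf1 (measurable_pair1 x))|
               exact: (measurableT_comp mf2 (measurable_pair1 x))].
  - rewrite (_ : _ \o _ = (fun y => (b1 x)%:E * (b2 y)%:E)%E); last by [].
    exact: integrableZl.
have sr y : cintegrable m1 setT (fun x => f (x, y)).
  apply: (@cint_le _ _ _ m1 setT mT _ (fun x => b1 x * b2 y)) => //.
  - by split; [exact: (measurableT_comp mf1 (measurable_pair2 y))|
               exact: (measurableT_comp mf2 (measurable_pair2 y))].
  - rewrite (_ : _ \o _ = (fun x => (b1 x)%:E * (b2 y)%:E)%E); last by [].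
    exact: integrableZr.
have [j1 e1] := cfubini_l fi sl; have [j2 e2] := cfubini_r fi sr.
by split => //; rewrite e1.
Qed.

End fubini_real.

Section rcons_fubini.
Context (R : realType) (d : nat).
Notation mu1 := (@lebesgue_measure R).
Implicit Types (f : 'rV[R]_d.+1 -> R[i]).

Lemma integrable_rcons0 (h : 'rV[R]_d.+1 -> R) :
  (lebesgue_rV R d.+1).-integrable setT (EFin \o h) ->
  (leb R d \x mu1)%E.-integrable setT (EFin \o (h \o @rV_of_pair R d)).
Proof.
move=> /integrableP[mh ih]; apply/integrableP; split.
  exact: (measurable_comp_rcons mh).
rewrite ge0_integral_rcons0// in ih.
by apply: measurableT_comp.
Qed.

Lemma Rintegral_rcons0 (h : 'rV[R]_d.+1 -> R) :
  (lebesgue_rV R d.+1).-integrable setT (EFin \o h) ->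
  Rintegral (lebesgue_rV R d.+1) setT h =
  Rintegral (leb R d \x mu1)%E setT (h \o @rV_of_pair R d).
Proof.
move=> ih; have mh := measurable_int _ ih; rewrite /Rintegral; congr fine.
rewrite integralE [RHS]integralE; congr (_ - _)%E.
- rewrite (ge0_integral_rcons0 (measurable_funepos mh) (funepos_ge0 _)).
  by apply: eq_integral => x _; rewrite !funeposE.
- rewrite (ge0_integral_rcons0 (measurable_funeneg mh) (funeneg_ge0 _)).
  by apply: eq_integral => x _; rewrite !funenegE.
Qed.

Lemma cintegrable_rcons0 f : cintegrable (lebesgue_rV R d.+1) setT f ->
  cintegrable (leb R d \x mu1)%E setT (f \o @rV_of_pair R d).
Proof.
move=> [f1 f2]; split.
- exact: (integrable_rcons0 (h := fun x => Re (f x))).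
- exact: (integrable_rcons0 (h := fun x => Im (f x))).
Qed.

Lemma cintegral_rcons0 f : cintegrable (lebesgue_rV R d.+1) setT f ->
  cintegral (lebesgue_rV R d.+1) setT f =
  cintegral (leb R d \x mu1)%E setT (f \o @rV_of_pair R d).
Proof.
move=> [f1 f2]; rewrite /cintegral.
by rewrite (Rintegral_rcons0 f1) (Rintegral_rcons0 f2).
Qed.

Lemma cintegral_rcons f : cintegrable (lebesgue_rV R d.+1) setT f ->
  (forall x, cintegrable mu1 setT (fun t => f (rV_rcons x t))) ->
  cintegrable (lebesgue_rV R d) setT (fun x => cintegral mu1 setT (fun t => f (rV_rcons x t))) /\
  cintegral (lebesgue_rV R d.+1) setT f =
  cintegral (lebesgue_rV R d) setT (fun x => cintegral mu1 setT (fun t => f (rV_rcons x t))).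
Proof.
move=> fi sf; rewrite cintegral_rcons0//.
by have [? <-] := cfubini_l (cintegrable_rcons0 fi) sf.
Qed.

End rcons_fubini.

(** * Restriction to a set by an indicator factor, and functions of compact support *)

Section indicator.
Context d (T : measurableType d) (R : realType).
Variables (mu : {measure set T -> \bar R}) (D : set T) (mD : measurable D).
Implicit Types (f : T -> R[i]).

Lemma cintegral_indic f :
  cintegral mu D f = cintegral mu setT (fun x => (\1_D x)%:C * f x).
Proof.
rewrite /cintegral; congr (_ +i* _); rewrite Rintegral_mkcond; apply: eq_Rintegral => x _;
  rewrite patchE indicE; case: ifPn => xD; rewrite ?xD ?(negbTE xD) ?mul1r ?mul0r//.
Qed.

Lemma cintegrable_indic f :
  cintegrable mu D f <-> cintegrable mu setT (fun x => (\1_D x)%:C * f x).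
Proof.
have E (P : R[i] -> R) : P 0 = 0 -> (fun x => (P ((\1_D x)%:C * f x))%:E) =
    (fun x => (P (f x))%:E) \_ D.
  move=> P0; apply/funext => x; rewrite patchE indicE.
  by case: ifPn => xD; rewrite ?xD ?(negbTE xD) ?mul1r ?mul0r ?P0.
by split=> -[f1 f2]; split; move: f1 f2; rewrite !E//; by
  [move=> /(integrable_mkcond _ mD) | move=> _ /(integrable_mkcond _ mD)].
Qed.

Lemma Rintegral_indic (h : T -> R) :
  Rintegral mu D h = Rintegral mu setT (fun x => \1_D x * h x).
Proof.
rewrite Rintegral_mkcond; apply: eq_Rintegral => x _; rewrite patchE indicE.
by case: ifPn => xD; rewrite ?xD ?(negbTE xD) ?mul1r ?mul0r.
Qed.

Lemma integrable_indic (h : T -> R) : mu.-integrable D (EFin \o h) <->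
  mu.-integrable setT (fun x => (\1_D x * h x)%:E).
Proof.
have E : (fun x => (\1_D x * h x)%:E) = (EFin \o h) \_ D.
  apply/funext => x; rewrite patchE indicE.
  by case: ifPn => xD; rewrite ?xD ?(negbTE xD) ?mul1r ?mul0r.
by rewrite E; exact: integrable_mkcond.
Qed.

End indicator.

Section compact_support.
Context (R : realType) (d : nat).
Notation mu := (lebesgue_rV R d).
Implicit Types (f : 'rV[R]_d -> R[i]) (h : 'rV[R]_d -> R).

(** Compact supports are traded for boxes, whose measure is explicit and whose behaviour under
    dilations and slicing is immediate. *)
Lemma compact_box (K : set 'rV[R]_d) : compact K -> exists2 M : R, 0 <= M & K `<=` rV_box M.
Proof.
move=> /compact_bounded[M [Mr MP]]; exists (`|M| + 1) => [|x Kx i]; first by rewrite addr_ge0.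
have := MP (`|M| + 1); rewrite (le_lt_trans (ler_norm _))// ?ltrDl// => /(_ isT x Kx).
apply: le_trans; rewrite [X in _ <= X](mx_normrE x).
by apply: le_trans (le_bigmax _ _ (ord0, i)).
Qed.

Lemma box_integrable h (M C : R) : measurable_fun setT h ->
  (forall x, `|h x| <= C) -> (forall x, ~ rV_box M x -> h x = 0) ->
  mu.-integrable setT (EFin \o h).
Proof.
move=> mh hC h0.
have mB : measurable (rV_box `|M| : set 'rV[R]_d) by exact: measurable_rV_box.
have iC : mu.-integrable (rV_box `|M|) (EFin \o cst C).
  apply/integrableP; split; first exact/measurable_EFinP/measurable_cst.
  rewrite (eq_integral (cst `|C|%:E))// integral_cst//= lebesgue_rV_box// lte_mul_pinfty// ?lee_fin ?normr_ge0//.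
  by rewrite ltry.
have /integrable_indic : mu.-integrable (rV_box `|M|) (EFin \o h).
  apply: (@int_le _ _ _ mu _ mB _ (cst C)); [exact: measurable_funTS|by move=> x _; exact: hC|exact: iC].
move=> /(_ mB); rewrite (_ : (fun x => _) = EFin \o h)//.
apply/funext => x; rewrite /= indicE; case: (boolP (x \in _)) => xM; rewrite ?mul1r//.
rewrite mul0r h0// => xM'; move: xM; rewrite notin_setE; apply => i.
by rewrite (le_trans (xM' i))// ler_norm.
Qed.

Lemma box_cintegrable f (M C : R) : cmeasurable setT f ->
  (forall x, nc (f x) <= C) -> (forall x, ~ rV_box M x -> f x = 0) ->
  cintegrable mu setT f.
Proof.
move=> mf fC f0; apply/(cintP _ mT); split => //.
apply: (@box_integrable _ M C); first exact: meas_nc.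
- by move=> x; rewrite ger0_norm ?nc_ge0.
- by move=> x /f0 ->; rewrite Normc.normc0.
Qed.

Lemma box_L2 f (M C : R) : cmeasurable setT f ->
  (forall x, nc (f x) <= C) -> (forall x, ~ rV_box M x -> f x = 0) ->
  L2 mu setT f.
Proof.
move=> mf fC f0; split => //.
apply: (@box_integrable _ M (C ^+ 2)); first exact: meas_nc2.
- move=> x; rewrite ger0_norm ?sqr_ge0// lerXn2r ?nnegrE ?nc_ge0//.
  by rewrite (le_trans (nc_ge0 (f x))).
- by move=> x /f0 ->; rewrite Normc.normc0 expr0n.
Qed.

Lemma compact_support_bounded h (K : set 'rV[R]_d) : continuous h -> compact K ->
  (forall x, ~ K x -> h x = 0) -> exists2 C : R, 0 <= C & forall x, `|h x| <= C.
Proof.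
move=> ch cK h0.
have /compact_bounded[C [Cr CP]] : compact (h @` K).
  by apply: continuous_compact => //; exact: continuous_subspaceT.
exists (`|C| + 1) => [|x]; first by rewrite addr_ge0.
have [Kx|nKx] := pselect (K x); last by rewrite h0// normr0 addr_ge0.
by apply: (CP (`|C| + 1)); [rewrite (le_lt_trans (ler_norm _))// ltrDl|exists x].
Qed.

End compact_support.

Section L2_indicator.
Context d (T : measurableType d) (R : realType).
Variables (mu : {measure set T -> \bar R}) (D : set T) (mD : measurable D).
Implicit Types (f : T -> R[i]).

Lemma L2_indic f : cmeasurable D f ->
  L2 mu D f <-> L2 mu setT (fun x => (\1_D x)%:C * f x).
Proof.
move=> mf; have E x : nc ((\1_D x)%:C * f x) ^+ 2 = \1_D x * nc (f x) ^+ 2.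
  rewrite ncM nc_real exprMn indicE; case: (x \in D) => /=.
    by rewrite normr1 expr1n.
  by rewrite normr0 expr0n.
have mf' : cmeasurable setT (fun x => (\1_D x)%:C * f x).
  have H (P : R[i] -> R) : P 0 = 0 -> measurable_fun D (fun x => P (f x)) ->
      measurable_fun setT (fun x => P ((\1_D x)%:C * f x)).
    move=> P0 mP; rewrite (_ : (fun x => _) = (fun x => P (f x)) \_ D).
      exact/(measurable_restrictT _ mD).
    apply/funext => x; rewrite patchE indicE.
    by case: ifPn => xD; rewrite ?xD ?(negbTE xD) ?mul1r ?mul0r ?P0.
  by case: mf => m1 m2; split; apply: H.
split=> -[_ fi]; split => //.
- under eq_fun do rewrite E.
  exact/(integrable_indic _ mD (fun x => nc (f x) ^+ 2)).
- move: fi; under eq_fun do rewrite E.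
  by move/(integrable_indic _ mD (fun x => nc (f x) ^+ 2)).
Qed.

Lemma L2_sub f : L2 mu setT f -> L2 mu D f.
Proof.
move=> [[m1 m2] fi]; split; first by split; exact: measurable_funTS.
by apply: integrableS fi.
Qed.

Lemma cmeas_sub f : cmeasurable setT f -> cmeasurable D f.
Proof. by move=> [m1 m2]; split; exact: measurable_funTS. Qed.

End L2_indicator.

(** * Test functions and dilations *)

Section directional.
Context (R : realType) (V : normedModType R).
Implicit Types (f g : V -> R).

(** Moves a directional derivative to a derivative in one real variable, where the chain rule and
    the mean value theorem are available. *)
Lemma is_derive_line f (x v : V) (l : R) :
  is_derive x v f l <-> is_derive (0 : R) 1 (fun t : R => f (t *: v + x)) l.
Proof.
have E : (fun h : R => h^-1 *: ((f \o shift x) (h *: v) - f x)) =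
  (fun h : R => h^-1 *: (((fun t : R => f (t *: v + x)) \o shift 0) (h *: 1) -
     f (0 *: v + x))).
  by apply/funext => h /=; rewrite addr0 scale0r add0r [_%:A]mulr1.
by split=> -[d1 d2]; apply: DeriveDef; move: d1 d2; rewrite /derivable /derive E.
Qed.

End directional.

Section smooth.
Context (R : realType) (V : normedModType R).
Implicit Types (f g : V -> R).

Lemma is_derive_line_at f (x v : V) (s l : R) :
  is_derive (s *: v + x) v f l -> is_derive s 1 (fun t : R => f (t *: v + x)) l.
Proof.
move=> /is_derive_line h; apply/is_derive_line; move: h.
rewrite (_ : (fun t : R => f (t *: v + (s *: v + x))) =
  (fun t : R => f ((t *: 1 + s) *: v + x)))//.
by apply/funext => t; rewrite scalerDl [t%:A]mulr1 addrA.
Qed.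

Lemma is_derive_chain f (x v : V) (l : R) (h : R -> R) (h' : R) :
  is_derive (f x) 1 h h' -> is_derive x v f l -> is_derive x v (fun y => h (f y)) (h' * l).
Proof.
move=> dh /is_derive_line df; apply/is_derive_line.
apply: (@is_derive1_comp _ h (fun t : R => f (t *: v + x)) 0 h' l) => //.
by rewrite scale0r add0r.
Qed.

Lemma derivable_continuous1 (f : R -> R) (x : R) (l : R) :
  is_derive x 1 f l -> {for x, continuous f}.
Proof. by move=> [/derivable1_diffP/differentiable_continuous]. Qed.

Lemma MVT1 (f df : R -> R) (a b : R) : a < b ->
  (forall x, a <= x <= b -> is_derive x 1 f (df x)) ->
  exists2 c, a < c < b & f b - f a = df c * (b - a).
Proof.
move=> ab dfx; have [||c cab ->] := @MVT R f df a b ab.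
- move=> x; rewrite in_itv/= => /andP[ax xb]; apply: dfx.
  by rewrite !ltW.
- apply: derivable_within_continuous => x; rewrite in_itv/= => /dfx[] //.
- by exists c => //; move: cab; rewrite in_itv.
Qed.

Lemma CkS k f : Ck k.+1 f -> Ck k f.
Proof.
elim: k f => [|k ih] f [cf df]; first by split.
by split => // v; have [d1 d2] := df v; split => //; exact: ih.
Qed.

Lemma Ck_cst k (a : R) : Ck k (fun _ : V => a).
Proof.
elim: k a => [|k ih] a; split => //; try exact: cst_continuous.
move=> v; split => [x|]; first exact: derivable_cst.
by under eq_fun do rewrite (derive_cst a); exact: ih.
Qed.

Lemma CkD k f g : Ck k f -> Ck k g -> Ck k (fun x => f x + g x).
Proof.
elim: k f g => [|k ih] f g [cf df] [cg dg].
  by split => // x; apply: continuousD; [exact: cf|exact: cg].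
split; first by move=> x; apply: continuousD; [exact: cf|exact: cg].
move=> v; have [f1 f2] := df v; have [g1 g2] := dg v; split => [x|].
  exact: (derivableD (f1 x) (g1 x)).
rewrite (_ : (fun x => _) = (fun x => 'D_v f x + 'D_v g x)); first exact: ih.
by apply/funext => x; rewrite (deriveD (f1 x) (g1 x)).
Qed.

Lemma CkM k f g : Ck k f -> Ck k g -> Ck k (fun x => f x * g x).
Proof.
elim: k f g => [|k ih] f g Cf Cg; have [cf df] := Cf; have [cg dg] := Cg.
  by split => // x; apply: continuousM; [exact: cf|exact: cg].
split; first by move=> x; apply: continuousM; [exact: cf|exact: cg].
move=> v; have [f1 f2] := df v; have [g1 g2] := dg v; split => [x|].
  exact: (derivableM (f1 x) (g1 x)).
rewrite (_ : (fun x => _) = (fun x => f x * 'D_v g x + g x * 'D_v f x)).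
  by apply: CkD; apply: ih => //; exact: CkS.
by apply/funext => x; rewrite (deriveM (f1 x) (g1 x)).
Qed.

Lemma CkN k f : Ck k f -> Ck k (fun x => - f x).
Proof.
move=> Cf; rewrite (_ : (fun x => _) = (fun x => -1 * f x)).
  by apply: CkM => //; exact: Ck_cst.
by apply/funext => x; rewrite mulN1r.
Qed.

Lemma Ck_inv k f : (forall x, f x != 0) -> Ck k f -> Ck k (fun x => (f x)^-1).
Proof.
move=> f0; elim: k => [|k ih] Cf; have [cf df] := Cf.
  by split => // x; apply: continuousV => //; exact: cf.
split; first by move=> x; apply: continuousV => //; exact: cf.
move=> v; have [f1 f2] := df v; split => [x|].
  exact: (derivableV (f0 x) (f1 x)).
(* The derivative is again a product of inverses of [f] and a derivative of [f], so the induction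
   hypothesis at order [k] applies to its factors. *)
rewrite (_ : (fun x => _) = (fun x => - ((f x)^-1 * ((f x)^-1 * 'D_v f x)))).
  by apply/CkN/CkM/CkM => //; exact/ih/CkS.
apply/funext => x; rewrite (deriveV (f0 x) (f1 x)).
by rewrite -[_ *: _]/(_ * _); field.
Qed.

(** [h] is the whole sequence of successive derivatives of the outer function, which lets the
    induction on [k] pass from index [n] to [n.+1]. *)
Lemma Ck_comp k (h : nat -> R -> R) f : (forall n (t : R), is_derive t 1 (h n) (h n.+1 t)) ->
  Ck k f -> forall n, Ck k (fun x => h n (f x)).
Proof.
move=> dh; have ch n : continuous (h n).
  by move=> t; exact: (derivable_continuous1 (dh n t)).
elim: k => [|k ih] Cf n; have [cf df] := Cf.
  by split => // x; apply: (continuous_comp (cf x)); exact: ch.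
split; first by move=> x; apply: (continuous_comp (cf x)); exact: ch.
move=> v; have [f1 f2] := df v.
have H x : is_derive x v (fun y => h n (f y)) (h n.+1 (f x) * 'D_v f x).
  exact: (is_derive_chain (dh n (f x)) (derivableP (f1 x))).
split => [x|]; first by have [] := H x.
rewrite (_ : (fun x => _) = (fun x => h n.+1 (f x) * 'D_v f x)).
  by apply: CkM => //; exact/ih/CkS.
by apply/funext => x; have [_ ->] := H x.
Qed.

Lemma Ck_exp k f : Ck k f -> Ck k (fun x => expR (f x)).
Proof.
by move=> Cf; apply: (@Ck_comp k (fun=> expR) f _ Cf 0%N) => n t.
Qed.

(** The cycle of derivatives of [cos], of period 4; [sin] stands at index 3. *)
Let trig (n : nat) : R -> R :=
  match (n %% 4)%N with 0 => cos | 1 => (fun t => - sin t) | 2 => (fun t => - cos t) | _ => sin end.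

Let dtrig n (t : R) : is_derive t 1 (trig n) (trig n.+1 t).
Proof.
rewrite /trig -[n.+1]addn1 -modnDml; have : (n %% 4 < 4)%N by rewrite ltn_mod.
case: (n %% 4)%N => [|[|[|[|//]]]] _ /=.
- exact: is_derive_cos.
- exact: is_deriveN.
- by rewrite -[X in is_derive _ _ _ X]opprK; apply: is_deriveN.
- exact: is_derive_sin.
Qed.

Lemma Ck_cos k f : Ck k f -> Ck k (fun x => cos (f x)).
Proof. by move=> Cf; exact: (@Ck_comp k trig f dtrig Cf 0%N). Qed.

Lemma Ck_sin k f : Ck k f -> Ck k (fun x => sin (f x)).
Proof. by move=> Cf; exact: (@Ck_comp k trig f dtrig Cf 3%N). Qed.

Lemma Ck_sqrt k f : (forall x, 0 < f x) -> Ck k f -> Ck k (fun x => Num.sqrt (f x)).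
Proof.
move=> f0; elim: k => [|k ih] Cf; have [cf df] := Cf.
  by split => // x; apply: (continuous_comp (cf x)); exact: sqrt_continuous.
split; first by move=> x; apply: (continuous_comp (cf x)); exact: sqrt_continuous.
move=> v; have [f1 f2] := df v.
have H x : is_derive x v (fun y => Num.sqrt (f y)) ((2 * Num.sqrt (f x))^-1 * 'D_v f x).
  by apply: is_derive_chain; [exact: is_derive1_sqrt|exact: derivableP].
split => [x|]; first by have [] := H x.
rewrite (_ : (fun x => _) = (fun x => (2 * Num.sqrt (f x))^-1 * 'D_v f x)).
  apply: CkM => //; apply: Ck_inv.
    by move=> x; rewrite mulf_neq0// gt_eqF// sqrtr_gt0.
  by apply: CkM; [exact: Ck_cst|exact/ih/CkS].
by apply/funext => x; have [_ ->] := H x.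
Qed.

Lemma Ck_sum k (I : Type) (s : seq I) (F : I -> V -> R) :
  (forall i, Ck k (F i)) -> Ck k (fun x => \sum_(i <- s) F i x).
Proof.
move=> CF; elim: s => [|i s ih].
  by under eq_fun do rewrite big_nil; exact: Ck_cst.
by under eq_fun do rewrite big_cons; exact: CkD.
Qed.

Lemma deriveZv f (x v : V) (a : R) : derivable f x v -> 'D_(a *: v) f x = a * 'D_v f x.
Proof.
move=> /derivableP /is_derive_line df.
suff : is_derive x (a *: v) f ('D_v f x * a) by case=> _ ->; rewrite mulrC.
apply/is_derive_line.
rewrite (_ : (fun t => _) = (fun t : R => f (t *: v + x)) \o (fun t : R => t * a)).
  apply: is_derive1_comp; first by rewrite mul0r.
  rewrite (_ : (fun t : R => t * a) = a \*: id); last by apply/funext => t; rewrite mulrC.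
  by rewrite -[X in is_derive _ _ _ X]mulr1; exact: is_deriveZ.
by apply/funext => t /=; rewrite scalerA.
Qed.

(* the second increment is a derivative at a nearby point by the mean value theorem *)
Lemma deriveDv f (x v w : V) : Ck 1 f -> 'D_(v + w) f x = 'D_v f x + 'D_w f x.
Proof.
move=> [cf df]; have [fv cv] := df v; have [fw cw] := df w; have [fvw cvw] := df (v + w).
pose q (u : V) (h : R) := h^-1 *: (f (h *: u + x) - f x).
have qE u : (forall x, derivable f x u) -> q u @ (0 : R)^' --> 'D_u f x.
  by move=> fu; apply: (fu x).
have /cvg_unique : q (v + w) @ (0 : R)^' --> 'D_(v + w) f x by exact: qE.
apply; first exact: norm_hausdorff.
pose p (h : R) := h^-1 *: (f (h *: w + (h *: v + x)) - f (h *: v + x)).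
rewrite (_ : q (v + w) = q v \+ p); last first.
  apply/funext => h; rewrite /q /p /= -scalerDr.
  rewrite (_ : h *: (v + w) + x = h *: w + (h *: v + x)).
    by congr (_ *: _); ring.
  by rewrite scalerDr addrA [h *: w + _]addrC.
apply: cvgD; first exact: qE.
have [cw0 _] : Ck 0 ('D_w f) by exact: cw.
apply/cvgrPdist_le => e e0.
have /cvgrPdist_le/(_ e e0) := cw0 x.
move=> /nbhs_ballP[r /= r0 rP].
pose M := `|v| + `|w| + 1.
have M0 : 0 < M by rewrite ltr_pwDr// addr_ge0.
near=> h.
have h0 : h != 0 by near: h; exact: nbhs_dnbhs_neq.
have hr : `|h| * M < r.
  rewrite -ltr_pdivlMr//; near: h; apply: dnbhs0_lt; exact: divr_gt0.
have der (t : R) : is_derive t 1 (fun t : R => f (t *: w + (h *: v + x)))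
    ('D_w f (t *: w + (h *: v + x))).
  by apply: is_derive_line_at; exact: derivableP.
have [c ch pE] : exists2 c, `|c| <= `|h| & p h = 'D_w f (c *: w + (h *: v + x)).
  have [hp|hn] := ltP 0 h.
  - have [c /andP[c0 ch] E] := MVT1 hp (fun t _ => der t).
    exists c; first by rewrite !ger0_norm ?ltW.
    rewrite /p; move: E; rewrite scale0r add0r => ->.
    by rewrite subr0 -[_ *: _]/(_ * _) mulrC mulfK.
  - have {}hn : h < 0 by rewrite lt_neqAle h0.
    have [c /andP[c0 ch] E] := MVT1 hn (fun t _ => der t).
    exists c; first by rewrite !ler0_norm ?lerN2 ?ltW.
    rewrite /p; move: E; rewrite scale0r add0r => /eqP.
    rewrite -eqr_opp opprB => /eqP ->.
    by rewrite sub0r mulrN opprK -[_ *: _]/(_ * _) mulrC mulfK.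
rewrite pE; apply: rP; rewrite -ball_normE /=.
rewrite (_ : x - _ = - (c *: w + h *: v)); last by rewrite addrA opprD addrCA subrr addr0.
apply: le_lt_trans hr; rewrite normrN (le_trans (ler_normD _ _))//.
apply: (@le_trans _ _ (`|h| * `|w| + `|h| * `|v|)).
  rewrite lerD// ?normrZ// ler_wpM2r//.
rewrite -mulrDr ler_wpM2l// /M; lra.
Unshelve. all: end_near. Qed.

End smooth.

(** The hypotheses say that [A] is affine with linear part [L], which covers scalings, translations
    and the embedding [x |-> (x, t)] at once. *)
Lemma Ck_comp_affine (R : realType) (V W : normedModType R) k (f : W -> R)
    (A L : V -> W) : continuous A ->
  (forall (x v : V) (h : R), A (h *: v + x) = h *: L v + A x) ->
  Ck k f -> Ck k (fun x => f (A x)) /\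
  ((0 < k)%N -> forall v x, 'D_v (fun x => f (A x)) x = 'D_(L v) f (A x)).
Proof.
move=> cA AL.
have D1 (g : W -> R) v x : derivable g (A x) (L v) ->
    is_derive x v (fun x => g (A x)) ('D_(L v) g (A x)).
  move=> /derivableP/is_derive_line dg; apply/is_derive_line.
  by move: dg; under [X in _ -> is_derive _ _ X _]eq_fun do rewrite AL.
have C0 (g : W -> R) : continuous g -> continuous (fun x => g (A x)).
  by move=> cg x; apply: (continuous_comp (cA x)); exact: cg.
elim: k f => [|k ih] f Cf; have [cf df] := Cf.
  by split => //; split => //; exact: C0.
split; last by move=> _ v x; have [f1 _] := df (L v); have [_ ->] := D1 f v x (f1 _).
split; first exact: C0.
move=> v; have [f1 f2] := df (L v); split => [x|].
  by have [] := D1 f v x (f1 _).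
rewrite (_ : (fun x => _) = (fun x => 'D_(L v) f (A x))); first by have [] := ih _ f2.
by apply/funext => x; have [_ ->] := D1 f v x (f1 _).
Qed.

Section coordinates.
Context (R : realType) (n : nat).
Notation V := 'rV[R]_n.

Lemma Ck_coord k (i : 'I_n) : Ck k (fun x : V => x ord0 i).
Proof.
have H (x v : V) : is_derive x v (fun x : V => x ord0 i) (v ord0 i).
  apply/is_derive_line.
  rewrite (_ : (fun t => _) = (fun t : R => t * v ord0 i + x ord0 i)).
    rewrite -[X in is_derive _ _ _ X]addr0; apply: is_deriveD => //.
    rewrite -[X in is_derive _ _ _ X]add0r -[in X in is_derive _ _ _ X](mulr0 0).
    rewrite -[X in is_derive _ _ _ (_ + X)]mulr1.
    by apply: (is_deriveM (f := id) (g := cst (v ord0 i))).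
  by apply/funext => t; rewrite !mxE.
case: k => [|k]; split => //; try exact: coord_continuous.
move=> v; split => [x|]; first by have [] := H x v.
rewrite (_ : (fun x => _) = (fun=> v ord0 i)); first exact: Ck_cst.
by apply/funext => x; have [_ ->] := H x v.
Qed.

(** [Ck] treats one direction at a time; linearity in the direction comes from [deriveDv] and
    [deriveZv], summed here over the standard basis. *)
Lemma derive_coords (f : V -> R) (x v : V) : Ck 1 f ->
  'D_v f x = \sum_(j < n) v ord0 j * 'D_(delta_mx ord0 j) f x.
Proof.
move=> Cf; have [cf df] := Cf.
have H (s : seq 'I_n) : 'D_(\sum_(j <- s) v ord0 j *: delta_mx ord0 j) f x =
    \sum_(j <- s) v ord0 j * 'D_(delta_mx ord0 j) f x.
  elim: s => [|j s ih].
    rewrite !big_nil; have := @deriveZv R V f x 0 0; rewrite scaler0 mul0r; apply.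
    by have [+ _] := df 0; exact.
  rewrite !big_cons deriveDv// ih deriveZv//.
  by have [+ _] := df (delta_mx ord0 j); exact.
by rewrite {1}(row_sum_delta v) H.
Qed.

End coordinates.

(** * Smooth complex functions and their partial derivatives *)

Section csmooth.
Context (R : realType) (n : nat).
Notation V := 'rV[R]_n.
Implicit Types (phi psi : V -> R[i]) (f g : V -> R).

Definition csmooth phi : Prop :=
  (forall k, Ck k (fun x => Re (phi x))) /\
  (forall k, Ck k (fun x => Im (phi x))).

Lemma csmooth_real f : (forall k, Ck k f) -> csmooth (fun x => (f x)%:C).
Proof. by move=> Cf; split => //= k; exact: Ck_cst. Qed.

Lemma csmooth_cst z : csmooth (fun=> z).
Proof. by split => k; exact: Ck_cst. Qed.

Lemma csmoothD phi psi : csmooth phi -> csmooth psi -> csmooth (fun x => phi x + psi x).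
Proof.
move=> [f1 f2] [g1 g2]; split => k.
- by under eq_fun do rewrite raddfD/=; exact: CkD.
- by under eq_fun do rewrite raddfD/=; exact: CkD.
Qed.

Lemma csmoothM phi psi : csmooth phi -> csmooth psi -> csmooth (fun x => phi x * psi x).
Proof.
move=> [f1 f2] [g1 g2].
have E1 (z w : R[i]) : Re (z * w) =
  Re z * Re w + - (Im z * Im w) by case: z w => ? ? [].
have E2 (z w : R[i]) : Im (z * w) =
  Re z * Im w + Im z * Re w by case: z w => ? ? [].
split => k.
- by under eq_fun do rewrite E1; apply: CkD; [|apply: CkN]; exact: CkM.
- by under eq_fun do rewrite E2; apply: CkD; exact: CkM.
Qed.

Lemma csmooth_conj phi : csmooth phi -> csmooth (fun x => (phi x)^*).
Proof.
move=> [f1 f2]; split => k.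
- by rewrite (_ : (fun x => _) = fun x => Re (phi x))//; apply/funext => x; case: (phi x).
- rewrite (_ : (fun x => _) = fun x => - Im (phi x)); first exact: CkN.
  by apply/funext => x; case: (phi x).
Qed.

Lemma csmooth_expi f : (forall k, Ck k f) -> csmooth (fun x => expi (f x)).
Proof. by move=> Cf; split => k /=; [exact: Ck_cos|exact: Ck_sin]. Qed.

Lemma csmooth_coord j : csmooth (fun x : V => (x ord0 j)%:C).
Proof. by apply: csmooth_real => k; exact: Ck_coord. Qed.

Lemma csmooth_partial j phi : csmooth phi -> csmooth (partial j phi).
Proof.
move=> [f1 f2]; split => k /=.
- by have [_ /(_ (delta_mx ord0 j))[]] := f1 k.+1.
- by have [_ /(_ (delta_mx ord0 j))[]] := f2 k.+1.
Qed.

Lemma csmooth_cont phi : csmooth phi -> continuous (fun x => Re (phi x)) /\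
  continuous (fun x => Im (phi x)).
Proof. by move=> [f1 f2]; split; [case: (f1 0%N)|case: (f2 0%N)]. Qed.

Lemma csmooth_meas phi : csmooth phi -> cmeasurable setT phi.
Proof.
by move=> /csmooth_cont[f1 f2]; split; exact: continuous_rV_measurable.
Qed.

Lemma csmooth_derivable phi v x : csmooth phi ->
  derivable (fun x => Re (phi x)) x v /\
  derivable (fun x => Im (phi x)) x v.
Proof.
move=> [f1 f2]; split.
- by have [_ /(_ v)[]] := f1 1%N.
- by have [_ /(_ v)[]] := f2 1%N.
Qed.

Lemma partialD j phi psi x : csmooth phi -> csmooth psi ->
  partial j (fun x => phi x + psi x) x = partial j phi x + partial j psi x.
Proof.
move=> sf sg; pose v : V := delta_mx ord0 j.
have [f1 f2] := csmooth_derivable v x sf; have [g1 g2] := csmooth_derivable v x sg.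
rewrite /partial; apply/eqP; rewrite eq_complex /=; apply/andP; split; apply/eqP.
- by under [in LHS]eq_fun do rewrite raddfD; rewrite (deriveD f1 g1).
- by under [in LHS]eq_fun do rewrite raddfD; rewrite (deriveD f2 g2).
Qed.

Lemma partialM j phi psi x : csmooth phi -> csmooth psi ->
  partial j (fun x => phi x * psi x) x = phi x * partial j psi x + partial j phi x * psi x.
Proof.
move=> sf sg; pose v : V := delta_mx ord0 j.
have [f1 f2] := csmooth_derivable v x sf; have [g1 g2] := csmooth_derivable v x sg.
have E1 (z w : R[i]) : Re (z * w) =
  Re z * Re w - Im z * Im w by case: z w => ? ? [].
have E2 (z w : R[i]) : Im (z * w) =
  Re z * Im w + Im z * Re w by case: z w => ? ? [].
rewrite /partial; apply/eqP; rewrite eq_complex /= -/v; apply/andP; split; apply/eqP.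
- under [in LHS]eq_fun do rewrite E1.
  rewrite (deriveB (derivableM f1 g1) (derivableM f2 g2)) (deriveM f1 g1) (deriveM f2 g2).
  by case: (phi x) (psi x) => a b [c e] /=; rewrite -!/(_ * _) /GRing.scale/=; ring.
- under [in LHS]eq_fun do rewrite E2.
  rewrite (deriveD (derivableM f1 g2) (derivableM f2 g1)) (deriveM f1 g2) (deriveM f2 g1).
  by case: (phi x) (psi x) => a b [c e] /=; rewrite /GRing.scale/=; ring.
Qed.

Lemma partial_cst j z (x : V) : partial j (fun=> z) x = 0.
Proof. by rewrite /partial !(derive_cst (V := V)). Qed.

Lemma partialZ j z phi x : csmooth phi ->
  partial j (fun x => z * phi x) x = z * partial j phi x.
Proof.
by move=> sf; rewrite (partialM j x (csmooth_cst z) sf) partial_cst mul0r addr0.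
Qed.

Lemma partial_conj j phi x : csmooth phi ->
  partial j (fun x => (phi x)^*) x = (partial j phi x)^*.
Proof.
move=> sf; pose v : V := delta_mx ord0 j.
have [f1 f2] := csmooth_derivable v x sf.
rewrite /partial; apply/eqP; rewrite eq_complex /= -/v; apply/andP; split; apply/eqP.
- by congr ('D_v _ x); apply/funext => y; case: (phi y).
- rewrite -deriveN//; congr ('D_v _ x); apply/funext => y.
  by rewrite [RHS]/(- Im (phi y)); case: (phi y).
Qed.

Lemma partial_real j f (x : V) : partial j (fun x => (f x)%:C) x = ('D_(delta_mx ord0 j) f x)%:C.
Proof. by rewrite /partial /= (derive_cst (V := V)). Qed.

Lemma csmooth_deriveE phi (x v : V) : csmooth phi ->
  'D_v (fun x => Re (phi x)) x = Re (\sum_j (v ord0 j)%:C * partial j phi x) /\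
  'D_v (fun x => Im (phi x)) x = Im (\sum_j (v ord0 j)%:C * partial j phi x).
Proof.
move=> [f1 f2]; rewrite (derive_coords x v (f1 1%N)) (derive_coords x v (f2 1%N)).
split; rewrite raddf_sum/=; apply: eq_bigr => j _.
- by rewrite /partial /= mul0r subr0.
- by rewrite /partial /= mul0r addr0.
Qed.

End csmooth.

Section csmooth_affine.
Context (R : realType).

Lemma csmooth_comp m n (A L : 'rV[R]_m -> 'rV[R]_n) (phi : 'rV[R]_n -> R[i]) :
  continuous A -> (forall x v h, A (h *: v + x) = h *: L v + A x) ->
  csmooth phi -> csmooth (fun x => phi (A x)) /\
  forall j x, partial j (fun x => phi (A x)) x =
    \sum_i (L (delta_mx ord0 j) ord0 i)%:C * partial i phi (A x).
Proof.
move=> cA AL sf; have [f1 f2] := sf; split.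
  by split => k; [have [] := Ck_comp_affine cA AL (f1 k)|have [] := Ck_comp_affine cA AL (f2 k)].
move=> j x; have [_ /(_ isT) D1] := Ck_comp_affine cA AL (f1 1%N).
have [_ /(_ isT) D2] := Ck_comp_affine cA AL (f2 1%N).
have [E1 E2] := csmooth_deriveE (A x) (L (delta_mx ord0 j)) sf.
rewrite {1}/partial D1 D2 E1 E2.
by apply/eqP; rewrite eq_complex /= !eqxx.
Qed.

Lemma sum_delta n (F : 'I_n -> R[i]) j (a : R) :
  \sum_i ((a *: delta_mx ord0 j : 'rV[R]_n) ord0 i)%:C * F i = a%:C * F j.
Proof.
rewrite (bigD1 j)//= big1 ?addr0 => [|i ij]; first by rewrite !mxE !eqxx mulr1.
by rewrite !mxE eqxx (negbTE ij) mulr0 mul0r.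
Qed.

Lemma csmooth_scale n (a : R) (b : 'rV[R]_n) (phi : 'rV[R]_n -> R[i]) : csmooth phi ->
  csmooth (fun x => phi (a *: x + b)) /\
  forall j x, partial j (fun x => phi (a *: x + b)) x = a%:C * partial j phi (a *: x + b).
Proof.
move=> sf.
have cA : continuous (fun x : 'rV[R]_n => a *: x + b).
  by move=> x; apply: continuousD; [exact: scaler_continuous|exact: cst_continuous].
have [|s1 s2] := @csmooth_comp n n (fun x => a *: x + b) (fun v => a *: v) phi cA _ sf.
- by move=> x v h; rewrite scalerDr addrA !scalerA mulrC.
- by split => // j x; rewrite s2 sum_delta.
Qed.

Lemma rcons_continuous n (t : R) : continuous (fun x : 'rV[R]_n => rV_rcons x t).
Proof.
move=> x A /= [P Pn PA].
have /(_ _) Pn' i j := Pn i j.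
exists (fun i j => P i (lift ord_max j)) => [i j|y Py].
  by have := Pn i (lift ord_max j); rewrite ord1 rcons_lift.
apply: PA => i j; rewrite ord1; case: (unliftP ord_max j) => [k|] ->.
  by rewrite rcons_lift; have := Py ord0 k.
by rewrite rcons_last; have := Pn ord0 ord_max; rewrite rcons_last => /nbhs_singleton.
Qed.

Lemma init_continuous n : continuous (@rV_init R n).
Proof.
move=> x A /= [P Pn PA].
pose Q (i : 'I_1) (j : 'I_n.+1) : set R := if unlift ord_max j is Some k then P i k else setT.
exists Q => [i j|y Qy].
  rewrite /Q; case: (unliftP ord_max j) => [k jk|_]; last exact: filterT.
  by have := Pn i k; rewrite mxE -jk; have -> : i = ord0 by exact: ord1.
by apply: PA => i j; rewrite mxE ord1; have := Qy ord0 (lift ord_max j); rewrite /Q liftK ord1.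
Qed.

Lemma csmooth_rcons n (t : R) (phi : 'rV[R]_n.+1 -> R[i]) : csmooth phi ->
  csmooth (fun x => phi (rV_rcons x t)) /\
  forall j x, partial j (fun x => phi (rV_rcons x t)) x =
    partial (lift ord_max j) phi (rV_rcons x t).
Proof.
move=> sf.
have [|s1 s2] := @csmooth_comp n n.+1 (fun x => rV_rcons x t) (fun v => rV_rcons v 0)
  phi (@rcons_continuous n t) _ sf.
- by move=> x v h; rewrite -rcons_affine mulr0 add0r.
- split => // j x; rewrite s2.
  have -> : rV_rcons (delta_mx ord0 j) (0 : R) = 1 *: delta_mx ord0 (lift ord_max j).
    rewrite scale1r; apply/rowP => k; case: (unliftP ord_max k) => [l|] ->.
      by rewrite rcons_lift !mxE (inj_eq (@lift_inj _ _)).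
    by rewrite rcons_last !mxE (negbTE (neq_lift _ _)) andbF.
  by rewrite sum_delta mul1r.
Qed.

End csmooth_affine.

Section test_functions.
Context (R : realType) (n : nat).
Notation V := 'rV[R]_n.
Notation mu := (lebesgue_rV R n).
Implicit Types (phi psi : V -> R[i]).

Local Notation tf := (test_fun (setT : set V)).

Lemma tfP phi : tf phi <-> csmooth phi /\ exists2 K : set V, compact K & forall x, ~ K x -> phi x = 0.
Proof.
split=> [[f1 f2 [K [cK _ K0]]]|[[f1 f2] [K cK K0]]]; first by split => //; exists K.
by split => //; exists K.
Qed.

Lemma tf_smooth phi : tf phi -> csmooth phi. Proof. by case/tfP. Qed.

Lemma tf_sub D phi : test_fun D phi -> tf phi.
Proof. by move=> [f1 f2 [K [cK _ K0]]]; split => //; exists K. Qed.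

Lemma tfD phi psi : tf phi -> tf psi -> tf (fun x => phi x + psi x).
Proof.
move=> /tfP[sf [K cK K0]] /tfP[sg [L cL L0]]; apply/tfP; split; first exact: csmoothD.
exists (K `|` L); first exact: compactU.
by move=> x /not_orP[/K0 -> /L0 ->]; rewrite addr0.
Qed.

Lemma tfM phi psi : csmooth phi -> tf psi -> tf (fun x => phi x * psi x).
Proof.
move=> sf /tfP[sg [L cL L0]]; apply/tfP; split; first exact: csmoothM.
by exists L => // x /L0 ->; rewrite mulr0.
Qed.

Lemma tfZ z psi : tf psi -> tf (fun x => z * psi x).
Proof. by apply: tfM; exact: csmooth_cst. Qed.

Lemma tfN psi : tf psi -> tf (fun x => - psi x).
Proof.
by move=> /(tfZ (-1)); under eq_fun do rewrite mulN1r.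
Qed.

Lemma tfB phi psi : tf phi -> tf psi -> tf (fun x => phi x - psi x).
Proof. by move=> tp ts; apply: tfD => //; exact: tfN. Qed.

Lemma tf0 : tf (fun=> 0).
Proof. by apply/tfP; split; [exact: csmooth_cst|exists set0 => //; exact: compact0]. Qed.

Lemma tf_sum (I : Type) (s : seq I) (F : I -> V -> R[i]) :
  (forall i, tf (F i)) -> tf (fun x => \sum_(i <- s) F i x).
Proof.
move=> CF; elim: s => [|i s ih].
  by under eq_fun do rewrite big_nil; exact: tf0.
by under eq_fun do rewrite big_cons; exact: tfD.
Qed.

Lemma tf_conj phi : tf phi -> tf (fun x => (phi x)^*).
Proof.
move=> /tfP[sf [K cK K0]]; apply/tfP; split; first exact: csmooth_conj.
by exists K => // x /K0 ->; rewrite conjC0.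
Qed.

Lemma test_fun_partial (D : set V) j phi : test_fun D phi -> test_fun D (partial j phi).
Proof.
move=> [f1 f2 [K [cK KD K0]]].
have [g1 g2] := csmooth_partial j (conj f1 f2); split => //; exists K; split => // x Kx.
(* [K] is closed, so [phi] vanishes in a whole neighbourhood of [x], and with it the derivatives. *)
have nK : \forall y \near x, ~ K y.
  have : open (~` K) by apply: closed_openC; apply: compact_closed => //; exact: norm_hausdorff.
  by move=> /(_ x Kx).
rewrite /partial; rewrite (near_eq_derive (g := cst 0)); last first.
  by near=> y; rewrite K0//; near: y.
rewrite (near_eq_derive (f := fun y => Im (phi y)) (g := cst 0)); last first.
  by near=> y; rewrite K0//; near: y.
by rewrite !derive_cst.
Unshelve. all: end_near. Qed.

Lemma tf_partial j phi : tf phi -> tf (partial j phi).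
Proof. exact: test_fun_partial. Qed.

Lemma tf_scale (a : R) (b : V) phi : a != 0 -> tf phi -> tf (fun x => phi (a *: x + b)).
Proof.
move=> a0 /tfP[sf [K cK K0]]; apply/tfP; split; first by have [] := csmooth_scale a b sf.
exists ((fun y => a^-1 *: (y - b)) @` K).
  apply: continuous_compact => //; apply: continuous_subspaceT => x.
  apply: (continuous_comp (f := fun y : V => y - b) (g := fun y : V => a^-1 *: y)).
    by apply: continuousB => //; exact: cst_continuous.
  exact: scaler_continuous.
move=> x nx; apply: K0 => Kx; apply: nx; exists (a *: x + b) => //.
by rewrite addrK scalerA mulVf// scale1r.
Qed.

Lemma tf_box phi : tf phi -> exists2 M : R, 0 <= M & forall x, ~ rV_box M x -> phi x = 0.
Proof.
move=> /tfP[_ [K cK K0]]; have [M M0 MP] := compact_box cK.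
by exists M => // x xM; apply: K0 => /MP.
Qed.

Lemma tf_bnd phi : tf phi -> exists2 C : R, 0 <= C & forall x, nc (phi x) <= C.
Proof.
move=> /tfP[/csmooth_cont[c1 c2] [K cK K0]].
have [|C1 C10 C1P] := compact_support_bounded c1 cK.
  by move=> x /K0 ->.
have [|C2 C20 C2P] := compact_support_bounded c2 cK.
  by move=> x /K0 ->.
exists (C1 + C2); first exact: addr_ge0.
by move=> x; rewrite (le_trans (nc_le_ReIm _))// lerD.
Qed.

Lemma tf_meas phi : tf phi -> cmeasurable setT phi.
Proof. by move=> /tf_smooth /csmooth_meas. Qed.

Lemma tf_cint phi : tf phi -> cintegrable mu setT phi.
Proof.
move=> tp; have [C C0 CP] := tf_bnd tp; have [M M0 MP] := tf_box tp.
exact: (box_cintegrable (tf_meas tp) CP MP).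
Qed.

Lemma tf_L2 phi : tf phi -> L2 mu setT phi.
Proof.
move=> tp; have [C C0 CP] := tf_bnd tp; have [M M0 MP] := tf_box tp.
exact: (box_L2 (tf_meas tp) CP MP).
Qed.

(** The Euler operator [x . grad], the infinitesimal dilation. *)
Definition euler phi : V -> R[i] := fun x => \sum_j (x ord0 j)%:C * partial j phi x.

Lemma tf_euler phi : tf phi -> tf (euler phi).
Proof.
move=> tp; apply: tf_sum => j; apply: tfM; first exact: csmooth_coord.
exact: tf_partial.
Qed.

(** In the exponential parameter the chain rule produces the factor [e^t x], which is the dilated
    point itself; hence the derivative is the Euler operator at that point, for all [t] alike. *)
Lemma is_derive_dilation phi (x : V) (t : R) : csmooth phi ->
  is_derive t 1 (fun t : R => Re (phi (expR t *: x))) (Re (euler phi (expR t *: x))) /\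
  is_derive t 1 (fun t : R => Im (phi (expR t *: x))) (Im (euler phi (expR t *: x))).
Proof.
move=> sf.
have H (f : V -> R) : Ck 1 f -> is_derive t 1 (fun t : R => f (expR t *: x))
    (\sum_j (expR t *: x) ord0 j * 'D_(delta_mx ord0 j) f (expR t *: x)).
  move=> Cf; rewrite -(derive_coords _ _ Cf).
  have [_ /(_ x)[fx _]] := Cf.
  rewrite deriveZv; last by have [_ /(_ x)[+ _]] := Cf; exact.
  rewrite mulrC; apply: (@is_derive1_comp _ (fun s : R => f (s *: x)) expR) => //.
  have := @is_derive_line_at R V f 0 x (expR t) ('D_x f (expR t *: x)).
  rewrite (_ : (fun t : R => f (t *: x + 0)) = fun t : R => f (t *: x)); last first.
    by apply/funext => s; rewrite addr0.
  by rewrite addr0; apply; exact: derivableP.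
have [f1 f2] := sf; split.
- have := H _ (f1 1%N); congr is_derive; rewrite /euler raddf_sum/=; apply: eq_bigr => j _.
  by rewrite /partial /= mul0r subr0.
- have := H _ (f2 1%N); congr is_derive; rewrite /euler raddf_sum/=; apply: eq_bigr => j _.
  by rewrite /partial /= mul0r addr0.
Qed.

End test_functions.
Local Notation tf := (test_fun (setT : set 'rV__)).

Section trace_test.
Context (R : realType) (n : nat).

Lemma tf_rcons (phi : 'rV[R]_n.+1 -> R[i]) t : tf phi -> tf (fun x => phi (rV_rcons x t)).
Proof.
move=> /tfP[sf [K cK K0]]; apply/tfP; split; first by have [] := csmooth_rcons t sf.
exists (@rV_init R n @` K).
  by apply: continuous_compact => //; apply: continuous_subspaceT; exact: init_continuous.
move=> x nx; apply: K0 => Kx; apply: nx; exists (rV_rcons x t) => //.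
by apply/rowP => j; rewrite mxE rcons_lift.
Qed.

End trace_test.

Section diff_under.
Context d (T : measurableType d) (R : realType).
Variables (mu : {measure set T -> \bar R}).

Lemma is_derive_under (h h' : R -> T -> R) (a e : R) (G : T -> R) : 0 < e ->
  (forall t, `|t - a| < e -> mu.-integrable setT (EFin \o h t)) ->
  (forall (t : R) x, `|t - a| < e -> is_derive t 1 (h ^~ x) (h' t x)) ->
  mu.-integrable setT (EFin \o G) ->
  (forall t x, `|t - a| < e -> `|h' t x| <= G x) ->
  is_derive a 1 (fun t => Rintegral mu setT (h t)) (Rintegral mu setT (h' a)).
Proof.
move=> e0 ih dh iG hG.
have Ie t : (`]a - e, a + e[%classic : set R) t -> `|t - a| < e.
  by rewrite /= in_itv/= ltr_distl.
have Ia : (`]a - e, a + e[%classic : set R) a by rewrite /= in_itv/= ltrDl e0 gtrBl e0.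
have G0 x : 0 <= G x by rewrite (le_trans _ (hG a x _))// subrr normr0.
have E t x : `|t - a| < e -> partial1of2 h t x = h' t x.
  by move=> ta; rewrite partial1of2E; have [_ ->] := dh t x ta.
have der t x : (`]a - e, a + e[%classic : set R) t -> setT x -> derivable (h ^~ x) t 1.
  by move=> /Ie ta _; have [] := dh t x ta.
have bnd t x : (`]a - e, a + e[%classic : set R) t -> setT x -> `|partial1of2 h t x| <= G x.
  by move=> /Ie ta _; rewrite E// hG.
have D1 := @derivable_under_integral R _ T mu h setT mT a _ _ Ia
  (fun t It => ih t (Ie t It)) der G G0 iG bnd.
have D2 := @differentiation_under_integral R _ T mu h setT mT a _ _ Ia
  (fun t It => ih t (Ie t It)) der G G0 iG bnd.
apply: DeriveDef; first exact: D1.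
rewrite -derive1E D2; apply: eq_Rintegral => x _.
by rewrite E// subrr normr0.
Qed.

End diff_under.

Section translation.
Context (R : realType) (n : nat).
Notation V := 'rV[R]_n.
Notation mu := (lebesgue_rV R n).

(** Translation invariance makes [t |-> int phi(x + t e_j)] constant, and its derivative at 0, taken
    under the integral sign, is the integral in question. *)
Lemma integral_partial (phi : V -> R[i]) j : tf phi -> cintegral mu setT (partial j phi) = 0.
Proof.
move=> tp; pose ej : V := delta_mx ord0 j.
have sp := tf_smooth tp.
have [C C0 CP] := tf_bnd (tf_partial j tp); have [M M0 MP] := tf_box (tf_partial j tp).
have H (P : R[i] -> R) : (P = @Re R \/ P = @Im R) ->
    Rintegral mu setT (fun x => P (partial j phi x)) = 0.
  move=> PE.
  have Pnc z : `|P z| <= nc z by case: PE => ->; [exact: nc_Re|exact: nc_Im].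
  have iP : mu.-integrable setT (fun x => (P (phi x))%:E).
    by have [] := tf_cint tp; case: PE => ->.
  have cst t : Rintegral mu setT (fun x => P (phi (1 *: x + t *: ej))) =
      Rintegral mu setT (fun x => P (phi x)).
    by rewrite [RHS](Rintegral_rV_affine (t *: ej) (ltr01 : 0 < 1 :> R) iP) expr1n mul1r.
  have : is_derive (0 : R) 1 (fun t => Rintegral mu setT (fun x => P (phi (1 *: x + t *: ej))))
      (Rintegral mu setT (fun x => P (partial j phi (1 *: x + 0 *: ej)))).
    (* For [|t| < 1] the translates are supported in the box enlarged by 1, which gives the
       integrable majorant. *)
    apply: (@is_derive_under _ _ _ mu (fun t x => P (phi (1 *: x + t *: ej)))
      (fun t x => P (partial j phi (1 *: x + t *: ej))) 0 1
      (fun x => C * \1_(rV_box (M + 1)) x)) => //.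
    - move=> t _; exact: (integrable_rV_affine (t *: ej) (ltr01 : 0 < 1 :> R) iP).
    - move=> t x _; have E (f : V -> R) : (forall y, derivable f y ej) ->
          is_derive t 1 (fun t : R => f (1 *: x + t *: ej)) ('D_ej f (1 *: x + t *: ej)).
        move=> df; have := @is_derive_line_at R V f (1 *: x) ej t ('D_ej f (1 *: x + t *: ej)).
        rewrite (_ : (fun t : R => f (t *: ej + 1 *: x)) = fun t : R => f (1 *: x + t *: ej)); last first.
          by apply/funext => s; rewrite addrC.
        by rewrite [t *: ej + _]addrC; apply; exact: derivableP.
      case: PE => ->; apply: E => y; have [] := csmooth_derivable ej y sp; by [].
    - apply: (@box_integrable _ _ _ (M + 1) C).
      + apply: measurable_funM => //; apply: measurable_indic; exact: measurable_rV_box.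
      + move=> x; rewrite normrM (ger0_norm C0) indicE.
        by case: (x \in _); rewrite ?normr1 ?normr0 ?mulr1 ?mulr0.
      + by move=> x xM; rewrite indicE memNset// mulr0.
    - move=> t x; rewrite subr0 => t1; rewrite (le_trans (Pnc _))// indicE.
      have [xM|xM] := pselect (rV_box (M + 1) x); first by rewrite mem_set// mulr1.
      rewrite memNset// mulr0 MP ?Normc.normc0// scale1r => h; apply: xM => i.
      have := h i; rewrite !mxE ?eqxx/=; case: (i == j) => /=; rewrite ?mulr1 ?mulr0 ?addr0.
        move=> h'; have := ler_normB (x ord0 i + t) t; rewrite addrK => /le_trans; apply.
        by rewrite lerD// ltW.
      by move=> /le_trans; apply; rewrite lerDl.
  under [X in is_derive _ _ X _]eq_fun do rewrite cst.
  move=> [_]; rewrite (derive_cst (V := R^o)) => /esym.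
  by under eq_Rintegral do rewrite scale0r addr0 scale1r.
by rewrite /cintegral !H//; [right|left].
Qed.

Lemma integral_by_parts phi psi j : csmooth phi -> tf psi ->
  cintegral mu setT (fun x => phi x * partial j psi x) =
  - cintegral mu setT (fun x => partial j phi x * psi x).
Proof.
move=> sp tp; have ts := tfM sp tp; have sps := tf_smooth tp.
have := integral_partial j ts.
rewrite (@eq_cintegral _ _ _ mu setT _ (fun x => phi x * partial j psi x + partial j phi x * psi x)).
  rewrite cintegralD//.
  - by move=> /eqP; rewrite addr_eq0 => /eqP.
  - by apply: tf_cint; apply: tfM => //; exact: tf_partial.
  - by apply: tf_cint; apply: tfM => //; exact: csmooth_partial.
by move=> x _; rewrite partialM.
Qed.

End translation.

(** * The dilation group and its generator *)

Section dilation.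
Context (R : realType) (n : nat).
Notation V := 'rV[R]_n.
Notation mu := (lebesgue_rV R n).
Implicit Types (phi psi f g : V -> R[i]) (c t : R).

(** The exponent [c] records the normalisation: the operator is unitary on [L^2] of the whole space
    when [2 c = n]. Differentiation raises the exponent by 1, so [2 (c + 1) = n] is the choice that
    preserves the Dirichlet integral. *)
Definition dil c t f : V -> R[i] := fun x => (expR (c * t))%:C * f (expR t *: x).

Definition gen c phi : V -> R[i] := fun x => euler phi x + c%:C * phi x.

Lemma tf_gen c phi : tf phi -> tf (gen c phi).
Proof. by move=> tp; apply: tfD; [exact: tf_euler|exact: tfZ]. Qed.

Lemma tf_dil0 t phi : tf phi -> tf (fun x => phi (expR t *: x)).
Proof.
move=> tp; have := tf_scale (0 : V) (lt0r_neq0 (expR_gt0 t)) tp.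
by under eq_fun do rewrite addr0.
Qed.

Lemma tf_dil c t phi : tf phi -> tf (dil c t phi).
Proof. by move=> tp; apply: tfZ; exact: tf_dil0. Qed.

Lemma partial_dil0 t phi j x : csmooth phi ->
  partial j (fun x => phi (expR t *: x)) x = (expR t)%:C * partial j phi (expR t *: x).
Proof.
move=> sp; have [_ /(_ j x)] := csmooth_scale (expR t) (0 : V) sp.
by rewrite addr0; under [in X in X -> _]eq_fun do rewrite addr0.
Qed.

Lemma partial_dil c t phi j x : csmooth phi ->
  partial j (dil c t phi) x = dil (c + 1) t (partial j phi) x.
Proof.
move=> sp; rewrite /dil partialZ.
  by rewrite partial_dil0// mulrA -rmorphM/= -expRD mulrDl mul1r.
have [+ _] := csmooth_scale (expR t) (0 : V) sp.
by under eq_fun do rewrite addr0.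
Qed.

Lemma ReM_conj (a : R) (z w : R[i]) : Re (z * (a%:C * w)^*) =
  a * (Re z * Re w + Im z * Im w).
Proof. by case: z w => ? ? [? ?] /=; ring. Qed.

(** The [t]-derivative of [dil c t phi] is the same dilation of [gen c phi]. It falls entirely on
    the test function, which is why local integrability of [q] is enough. *)
Lemma is_derive_dil (q : V -> R[i]) c t phi : tf phi ->
  (forall M, cintegrable mu (rV_box M) q) -> cmeasurable setT q ->
  is_derive t 1 (fun t => Re (cintegral mu setT (fun x => q x * (dil c t phi x)^*)))
    (Re (cintegral mu setT (fun x => q x * (dil c t (gen c phi) x)^*))).
Proof.
move=> tp iq mq; have sp := tf_smooth tp; have tg := tf_gen c tp.
have [M M0 MP] := tf_box tp; have [M' M'0 MP'] := tf_box tg.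
have [C C0 CP] := tf_bnd tp; have [C' C'0 CP'] := tf_bnd tg.
(* For [|s - t| < 1] the dilates by [e^s] are supported in the box of half-width [B], and the
   prefactor [e^{c s}] is at most [e^{|c| (|t| + 1)}]; the majorant is therefore uniform in [s]. *)
pose B := (M + M') * expR (`|t| + 1).
pose K := expR (`|c| * (`|t| + 1)) * (C + C').
have K0 : 0 <= K by rewrite mulr_ge0 ?addr_ge0// expR_ge0.
have mB : measurable (rV_box B : set V) by exact: measurable_rV_box.
pose G x := K * (\1_(rV_box B) x * nc (q x)).
have iG : mu.-integrable setT (EFin \o G).
  rewrite (_ : _ \o _ = fun x => (K%:E * (\1_(rV_box B) x * nc (q x))%:E)%E); last first.
    by apply/funext => x; rewrite /= EFinM.
  apply: integrableZl => //; apply/(integrable_indic mu mB (fun x => nc (q x))).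
  by apply: cint_nc => //; exact: iq.
have bndt s : `|s - t| < 1 -> `|s| <= `|t| + 1.
  move=> st; rewrite -[s](subrK t) (le_trans (ler_normD _ _))// addrC lerD2l ltW//.
have key (h : V -> R[i]) s x : (forall x, nc (h x) <= C + C') ->
    (forall x, ~ rV_box (M + M') x -> h x = 0) -> `|s - t| < 1 ->
    nc (q x * (dil c s h x)^*) <= G x.
  move=> hC hM st; have sb := bndt s st.
  rewrite ncM nc_conj /dil ncM nc_real ger0_norm ?expR_ge0//.
  rewrite /G indicE; have [xB|xB] := pselect (rV_box B x).
    rewrite mem_set// mul1r mulrC ler_wpM2r ?nc_ge0// /K ler_pM ?expR_ge0 ?nc_ge0//.
    rewrite ler_expR (le_trans (ler_norm _))// normrM ler_wpM2l//.
  rewrite memNset// mul0r mulr0 hM ?Normc.normc0 ?mulr0// => h'; apply: xB => i.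
  have := h' i; rewrite mxE normrM ger0_norm ?expR_ge0// => h''.
  rewrite /B -ler_pdivrMr ?expR_gt0// -expRN mulrC (le_trans _ h'')//.
  by rewrite ler_wpM2r// ler_expR lerNl (le_trans _ sb)// -normrN ler_norm.
have mdil s (h : V -> R[i]) : tf h -> cmeasurable setT (fun x => q x * (dil c s h x)^*).
  by move=> th; apply: cmeasM => //; apply: cmeas_conj; apply: tf_meas; exact: tf_dil.
have hM1 x : ~ rV_box (M + M') x -> phi x = 0.
  by move=> h; apply: MP => h'; apply: h => i; rewrite (le_trans (h' i))// lerDl.
have hM2 x : ~ rV_box (M + M') x -> gen c phi x = 0.
  by move=> h; apply: MP' => h'; apply: h => i; rewrite (le_trans (h' i))// lerDr.
have hC1 x : nc (phi x) <= C + C' by rewrite (le_trans (CP x))// lerDl.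
have hC2 x : nc (gen c phi x) <= C + C' by rewrite (le_trans (CP' x))// lerDr.
apply: (@is_derive_under _ _ _ mu (fun t x => Re (q x * (dil c t phi x)^*))
  (fun t x => Re (q x * (dil c t (gen c phi) x)^*)) t 1 G) => //.
- move=> s st; have [] // : cintegrable mu setT (fun x => q x * (dil c s phi x)^*).
  by apply: (cint_le mT (mdil s phi tp) _ iG) => x _; exact: key.
- move=> s x st; rewrite /dil; under [X in is_derive _ _ X _]eq_fun do rewrite ReM_conj.
  rewrite ReM_conj.
  have [d1 d2] := is_derive_dilation x s sp.
  have d0 : is_derive s 1 (fun s : R => expR (c * s)) (expR (c * s) * c).
    apply: (@is_derive1_comp _ expR (fun s : R => c * s)) => //.
    by rewrite -[X in is_derive _ _ _ X]mulr1; exact: (is_deriveZ (f := id)).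
  set a := Re (q x); set b := Im (q x).
  have d1' : is_derive s 1 (fun s : R => a * Re (phi (expR s *: x)))
    (a * Re (euler phi (expR s *: x))) by exact: is_deriveZ.
  have d2' : is_derive s 1 (fun s : R => b * Im (phi (expR s *: x)))
    (b * Im (euler phi (expR s *: x))) by exact: is_deriveZ.
  have HH : is_derive s 1 (fun s : R => expR (c * s) *
      (a * Re (phi (expR s *: x)) + b * Im (phi (expR s *: x))))
    (expR (c * s) * (a * Re (euler phi (expR s *: x)) +
       b * Im (euler phi (expR s *: x))) +
     (a * Re (phi (expR s *: x)) + b * Im (phi (expR s *: x))) *
       (expR (c * s) * c)) := is_deriveM d0 (is_deriveD d1' d2').
  apply: (is_derive_eq HH); rewrite /gen !raddfD /=.
  by case: (euler phi _) (phi _) => ? ? [? ?] /=; rewrite !mul0r !subr0 !addr0; ring.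
- move=> s x st; rewrite (le_trans (nc_Re _))//; exact: key.
Qed.

Section invariant.
Variables (D : set V) (mD : measurable D).
Hypothesis Ddil : forall (a : R) x, 0 < a -> D (a *: x) <-> D x.

Let indD a x : 0 < a -> (\1_D (a *: x) : R) = \1_D x.
Proof.
move=> a0; rewrite !indicE; congr (_%:R); congr nat_of_bool.
by apply/idP/idP; rewrite !inE => /(Ddil _ a0).
Qed.

Lemma cint_dil a f : 0 < a -> cintegrable mu D f -> cintegrable mu D (fun x => f (a *: x)).
Proof.
move=> a0 /(cintegrable_indic _ mD) /(cintegrable_rV_affine 0 a0) h.
apply/(cintegrable_indic _ mD); move: h.
by under [X in cintegrable _ _ X -> _]eq_fun do rewrite addr0 indD//.
Qed.

Lemma cintegral_dil a f : 0 < a -> cintegrable mu D f ->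
  cintegral mu D f = (a ^+ n)%:C * cintegral mu D (fun x => f (a *: x)).
Proof.
move=> a0 fi; rewrite [LHS]cintegral_indic (cintegral_rV_affine 0 a0).
  by rewrite [in RHS]cintegral_indic; congr (_ * _); apply: eq_cintegral => x _; rewrite addr0 indD.
exact/(cintegrable_indic _ mD).
Qed.

Lemma cmeas_dil a f : 0 < a -> cmeasurable D f -> cmeasurable D (fun x => f (a *: x)).
Proof.
move=> a0 [m1 m2].
have H (h : V -> R) : measurable_fun D h -> measurable_fun D (fun x => h (a *: x)).
  move=> mh _ Y mY.
  rewrite (_ : _ `&` _ = (fun x => a *: x + 0) @^-1` (D `&` h @^-1` Y)).
    rewrite -[X in measurable X]setTI; apply: measurable_rV_affine => //; exact: mh.
  by apply/seteqP; split => x /=; rewrite addr0 => -[] /(Ddil _ a0).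
by split; [exact: (H (fun x => Re (f x)))|exact: (H (fun x => Im (f x)))].
Qed.

Lemma L2_dil a f : 0 < a -> L2 mu D f -> L2 mu D (fun x => f (a *: x)).
Proof.
move=> a0 [mf fi]; split; first exact: cmeas_dil.
by have [] := cint_dil a0 (cint_real (a := fun x => nc (f x) ^+ 2) fi).
Qed.

Lemma ip_dil a f g : 0 < a -> L2 mu D f -> L2 mu D g ->
  ip mu D f g = (a ^+ n)%:C * ip mu D (fun x => f (a *: x)) (fun x => g (a *: x)).
Proof. by move=> a0 lf lg; rewrite /ip [LHS](cintegral_dil a0)//; exact: ip_cint. Qed.

Lemma n2_dil a f : 0 < a -> L2 mu D f ->
  n2 mu D f ^+ 2 = a ^+ n * n2 mu D (fun x => f (a *: x)) ^+ 2.
Proof.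
move=> a0 lf; have := ip_dil a0 lf lf; rewrite !ip_self// -rmorphM.
by move=> /(@complexI R).
Qed.

End invariant.

End dilation.

Lemma conjR (R : realType) (x : R) : (x%:C : R[i])^* = x%:C.
Proof. exact: conjc_real. Qed.

(** * The Euclidean norm and Hardy's inequality *)

Section enorm.
Context (R : realType).

(** Lagrange's argument: the difference of the two sides is half the double sum of
    [(a_i b_j - a_j b_i)^2]. *)
Lemma sum_CS (I : finType) (a b : I -> R) :
  (\sum_j a j * b j) ^+ 2 <= (\sum_j a j ^+ 2) * \sum_j b j ^+ 2.
Proof.
have E1 : (\sum_j a j ^+ 2) * (\sum_j b j ^+ 2) = \sum_i \sum_j a i ^+ 2 * b j ^+ 2.
  by rewrite big_distrlr.
have E2 : (\sum_j a j ^+ 2) * (\sum_j b j ^+ 2) = \sum_i \sum_j a j ^+ 2 * b i ^+ 2.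
  by rewrite E1 exchange_big.
have E3 : (\sum_j a j * b j) ^+ 2 = \sum_i \sum_j a i * b i * (a j * b j).
  by rewrite expr2 big_distrlr.
suff : 2 * (\sum_j a j * b j) ^+ 2 <= (\sum_j a j ^+ 2) * (\sum_j b j ^+ 2) +
    (\sum_j a j ^+ 2) * (\sum_j b j ^+ 2) by lra.
rewrite {1}E1 E2 E3 -big_split mulr_sumr; apply: ler_sum => i _ /=.
rewrite -big_split mulr_sumr; apply: ler_sum => j _ /=.
by have := sqr_ge0 (a i * b j - a j * b i); nra.
Qed.

Lemma dot_ge0 n (x : 'rV[R]_n) : 0 <= dot x x.
Proof. by apply: sumr_ge0 => j _; rewrite -expr2 sqr_ge0. Qed.

Lemma enorm_ge0 n (x : 'rV[R]_n) : 0 <= enorm x.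
Proof. exact: sqrtr_ge0. Qed.

Lemma sqr_enorm n (x : 'rV[R]_n) : enorm x ^+ 2 = dot x x.
Proof. by rewrite sqr_sqrtr// dot_ge0. Qed.

Lemma dotZ n (a : R) (x : 'rV[R]_n) : dot (a *: x) (a *: x) = a ^+ 2 * dot x x.
Proof. by rewrite /dot mulr_sumr; apply: eq_bigr => j _; rewrite !mxE; ring. Qed.

Lemma enormZ n (a : R) (x : 'rV[R]_n) : 0 <= a -> enorm (a *: x) = a * enorm x.
Proof. by move=> a0; rewrite /enorm dotZ sqrtrM ?sqr_ge0// sqrtr_sqr ger0_norm. Qed.

Lemma coord_enorm n (x : 'rV[R]_n) j : `|x ord0 j| <= enorm x.
Proof.
rewrite -sqrtr_sqr ler_wsqrtr// /dot (bigD1 j)//= expr2 lerDl.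
by apply: sumr_ge0 => i _; rewrite -expr2 sqr_ge0.
Qed.

Lemma enorm_le_sum n (x : 'rV[R]_n) : enorm x <= \sum_j `|x ord0 j|.
Proof.
rewrite -(@ler_pXn2r _ 2) ?nnegrE ?enorm_ge0 ?sumr_ge0// sqr_enorm /dot.
rewrite expr2 mulr_suml; apply: ler_sum => j _.
rewrite -expr2 -real_normK ?num_real// expr2 ler_wpM2l//.
by rewrite (bigD1 j)//= lerDl sumr_ge0.
Qed.

Lemma enorm_rcons0 d (x : 'rV[R]_d) : enorm (rV_rcons x 0) = enorm x.
Proof.
rewrite /enorm; congr Num.sqrt; rewrite /dot big_ord_recr /=.
rewrite rcons_last mulr0 addr0; apply: eq_bigr => j _.
rewrite (_ : widen_ord _ j = lift ord_max j) ?rcons_lift//.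
by apply: val_inj => /=; rewrite /bump leqNgt ltn_ord.
Qed.

Lemma half_space_enorm d (x : 'rV[R]_d.+1) : half_space x -> 0 < enorm x.
Proof.
move=> xO; rewrite (lt_le_trans _ (coord_enorm x ord_max))// normr_gt0 gt_eqF//.
Qed.

Lemma half_space_dil d (a : R) (x : 'rV[R]_d.+1) : 0 < a -> half_space (a *: x) <-> half_space x.
Proof. by move=> a0; rewrite /half_space /= mxE pmulr_rgt0. Qed.

Lemma Ck_dot n k : Ck k (fun x : 'rV[R]_n => dot x x).
Proof. by apply: Ck_sum => j; apply: CkM; exact: Ck_coord. Qed.

Lemma dot_continuous n : continuous (fun x : 'rV[R]_n => dot x x).
Proof. by have [] := Ck_dot n 0. Qed.

Lemma enorm_continuous n : continuous (@enorm R n).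
Proof.
by move=> x; apply: (continuous_comp (@dot_continuous n x)); exact: sqrt_continuous.
Qed.

Lemma measurable_enorm n : measurable_fun setT (@enorm R n).
Proof. by apply: continuous_rV_measurable; exact: enorm_continuous. Qed.

(* a smooth substitute for [enorm] *)
Definition rdel n (e : R) (x : 'rV[R]_n) : R := Num.sqrt (dot x x + e ^+ 2).

Lemma rdel_gt0 n e (x : 'rV[R]_n) : 0 < e -> 0 < rdel e x.
Proof. by move=> e0; rewrite sqrtr_gt0 ltr_wpDl ?dot_ge0// exprn_gt0. Qed.

Lemma Ck_rdel n e k : 0 < e -> Ck k (@rdel n e).
Proof.
move=> e0; apply: Ck_sqrt; last by apply: CkD; [exact: Ck_dot|exact: Ck_cst].
by move=> x; rewrite ltr_wpDl ?dot_ge0// exprn_gt0.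
Qed.

Lemma enorm_rdel n e (x : 'rV[R]_n) : enorm x <= rdel e x.
Proof. by rewrite ler_wsqrtr// lerDl sqr_ge0. Qed.

Lemma rdel_enorm n e (x : 'rV[R]_n) : 0 <= e -> rdel e x <= enorm x + e.
Proof.
move=> e0; rewrite -(@ler_pXn2r _ 2) ?nnegrE ?addr_ge0 ?sqrtr_ge0//.
rewrite sqr_sqrtr ?addr_ge0 ?dot_ge0 ?sqr_ge0// sqrrD sqr_enorm.
by rewrite lerD2r lerDl mulrn_wge0// mulr_ge0 ?enorm_ge0.
Qed.

Lemma rdel_rcons0 d e (x : 'rV[R]_d) : rdel e (rV_rcons x 0) = rdel e x.
Proof. by rewrite /rdel -!sqr_enorm enorm_rcons0. Qed.

Lemma e_rdel n e (x : 'rV[R]_n) : 0 <= e -> e <= rdel e x.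
Proof.
by move=> e0; rewrite -[leLHS]ger0_norm// -sqrtr_sqr ler_wsqrtr// lerDr dot_ge0.
Qed.

Lemma derive_rdel n e (x : 'rV[R]_n) j : 0 < e ->
  'D_(delta_mx ord0 j) (@rdel n e) x = x ord0 j / rdel e x.
Proof.
move=> e0; pose v : 'rV[R]_n := delta_mx ord0 j.
have D : is_derive x v (fun x => dot x x + e ^+ 2) (2 * x ord0 j).
  apply/is_derive_line.
  rewrite (_ : (fun t => _) = (fun t : R => t * t + (2 * x ord0 j) * t + (dot x x + e ^+ 2))).
    have d1 : is_derive (0 : R) 1 (fun t : R => t * t) (0 * 1 + 0 * 1).
      exact: (is_deriveM (is_derive_id (0 : R) 1) (is_derive_id (0 : R) 1)).
    have d2 : is_derive (0 : R) 1 (fun t : R => (2 * x ord0 j) * t) ((2 * x ord0 j) * 1).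
      exact: (is_deriveZ (f := id)).
    have := is_deriveD (is_deriveD d1 d2) (is_derive_cst (dot x x + e ^+ 2) (0 : R) 1).
    move=> h; apply: (is_derive_eq h); by ring.
  apply/funext => t; rewrite addrA; congr (_ + _).
  rewrite /dot (bigD1 j)//= [in RHS](bigD1 j)//= !mxE !eqxx /= mulr1.
  rewrite (eq_bigr (fun i => x ord0 i * x ord0 i)); last first.
    by move=> i ij; rewrite !mxE (negbTE ij) andbF mulr0 add0r.
  by ring.
have p : 0 < dot x x + e ^+ 2 by rewrite ltr_wpDl ?dot_ge0// exprn_gt0.
have [_ ->] := @is_derive_chain R _ (fun x => dot x x + e ^+ 2) x v _ Num.sqrt _ (is_derive1_sqrt p) D.
by rewrite -/(rdel e x); field; rewrite gt_eqF// rdel_gt0.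
Qed.

End enorm.

Section one_dim_limits.
Context (R : realType).

Lemma is_derive_seq (F : R -> R) (a l : R) (s : R^nat) : is_derive a 1 F l ->
  s @ \oo --> (0 : R) -> (forall k, s k != 0) ->
  (fun k => (F (s k + a) - F a) / s k) @ \oo --> l.
Proof.
move=> [dF <-] s0 sn0.
have : h^-1 *: ((F \o shift a) (h *: 1) - F a) @[h --> (0 : R)^'] --> 'D_1 F a by exact: dF.
move=> /cvgr_dnbhsP /(_ s (conj sn0 s0)); apply: cvg_trans; apply: near_eq_cvg.
by near=> k; rewrite /= [s k *: 1]mulr1 mulrC.
Unshelve. all: end_near. Qed.

Definition hseq (k : nat) : R := k.+1%:R^-1.

Lemma hseq_gt0 k : 0 < hseq k. Proof. by rewrite invr_gt0 ltr0n. Qed.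

Lemma hseq_le1 k : hseq k <= 1. Proof. by rewrite invf_le1 ?ltr0n// ler1n. Qed.

Lemma hseq_cvg : hseq @ \oo --> (0 : R).
Proof. exact: cvg_harmonic. Qed.

Lemma derive_le_right (F : R -> R) (a l : R) : is_derive a 1 F l ->
  (forall t, 0 <= t -> F (t + a) <= F a) -> l <= 0.
Proof.
move=> dF Fa; have := is_derive_seq dF hseq_cvg (fun k => lt0r_neq0 (hseq_gt0 k)).
move=> /cvg_le_cst; apply => k.
by rewrite pmulr_lle0 ?invr_gt0 ?hseq_gt0// subr_le0 Fa// ltW// hseq_gt0.
Qed.

End one_dim_limits.

Section L2_local.
Context d (T : measurableType d) (R : realType).
Variables (mu : {measure set T -> \bar R}).

Lemma L2_loc (D D' : set T) (f : T -> R[i]) : measurable D -> measurable D' -> D' `<=` D ->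
  (mu D' < +oo)%E -> L2 mu D f -> cintegrable mu D' f.
Proof.
move=> mD mD' DD' fD' [[m1 m2] fi].
have mf : cmeasurable D' f by split; [apply: measurable_funS m1|apply: measurable_funS m2].
apply: (@cint_le _ _ _ mu D' mD' _ (fun x => 1 + nc (f x) ^+ 2)) => //.
  by move=> x _; have := sqr_ge0 (nc (f x) - 1); have := nc_ge0 (f x); nra.
rewrite (_ : _ \o _ = (fun x => (cst 1%:E x + (nc (f x) ^+ 2)%:E)%E)); last first.
  by apply/funext => x; rewrite /= EFinD.
apply: integrableD => //; last by apply: integrableS fi.
apply/integrableP; split; first exact: measurable_cst.
by rewrite (eq_integral (cst 1%:E)) ?integral_cst ?mul1e// => x _; rewrite /= normr1.
Qed.

End L2_local.

(** * Strong continuity of dilations *)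

Section dilation_limits.
Context (R : realType) (n : nat).
Notation V := 'rV[R]_n.
Notation mu := (lebesgue_rV R n).
Implicit Types (phi psi : V -> R[i]) (f g h q : V -> R[i]) (c t : R).
Variables (D : set V) (mD : measurable D).
Hypothesis Ddil : forall (a : R) x, 0 < a -> D (a *: x) <-> D x.

(* strong continuity at 1 of the dilation group, along sequences *)
Definition dcont f := L2 mu D f /\ forall s : R^nat, s @ \oo --> (0 : R) -> (forall k, `|s k| <= 1) ->
  cvg2 mu D (fun k x => f (expR (s k) *: x)) f.

Lemma L2_dilc c s f : L2 mu D f -> L2 mu D (dil c s f).
Proof. by move=> lf; apply: (L2Z mD); exact: (L2_dil mD Ddil (expR_gt0 s) lf). Qed.

(** Crude but uniform for [|s| <= 1]: the prefactor is at most [e^{|c|}], and the square root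
    [e^{-n s/2}] of the Jacobian at most [e^n]. *)
Lemma n2_dil_le c s f : `|s| <= 1 -> L2 mu D f ->
  n2 mu D (dil c s f) <= expR (`|c| + n%:R) * n2 mu D f.
Proof.
move=> s1 lf; have lfs := L2_dil mD Ddil (expR_gt0 s) lf.
rewrite /dil (n2Z mD _ lfs) nc_real ger0_norm ?expR_ge0// expRD -mulrA.
have E := n2_dil mD Ddil (expR_gt0 s) lf.
move: s1; rewrite ler_norml => /andP[s1 s2].
apply: ler_pM; rewrite ?expR_ge0 ?n2_ge0//.
  by rewrite ler_expR (le_trans (ler_norm _))// normrM ler_piMr// ler_norml s1.
rewrite -(@ler_pXn2r _ 2) ?nnegrE ?mulr_ge0 ?n2_ge0 ?expR_ge0// exprMn E mulrA.
rewrite ler_peMl ?sqr_ge0// -!expRM_natl -expRD -[leLHS]expR0 ler_expR.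
have n0 : (0 : R) <= n%:R by [].
have : n%:R * - s <= n%:R * 1 by rewrite ler_wpM2l// lerNl.
by rewrite mulrN mulr1; lra.
Qed.

(** The dilations with [|s| <= 1] are uniformly bounded, so strong continuity extends from
    approximants to their limits. *)
Lemma dcont_closed f : L2 mu D f ->
  (forall e, 0 < e -> exists2 psi, dcont psi & n2 mu D (fun x => f x - psi x) < e) -> dcont f.
Proof.
move=> lf af; split => // s s0 s1; apply/cvgrPdist_le => e e0.
pose C := expR (`|0 : R| + n%:R : R).
have C0 : 0 < C by exact: expR_gt0.
(* If [delta] is the distance from [f] to [psi], the three pieces of the triangle inequality add up
   to [C delta + e/2 + delta], whence the division by [C + 1]. *)
have [psi [lp cp] pe] := af (e / 2 / (C + 1)) (divr_gt0 (divr_gt0 e0 (ltr0Sn R 1)) (addr_gt0 C0 ltr01)).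
have := cp s s0 s1; move=> /cvgrPdist_le /(_ (e / 2) (divr_gt0 e0 (ltr0Sn R 1))) h.
near=> k.
have ek : n2 mu D (fun x => psi (expR (s k) *: x) - psi x) <= e / 2.
  have : `|0 - n2 mu D (fun x => psi (expR (s k) *: x) - psi x)| <= e / 2 by near: k; exact: h.
  by rewrite sub0r normrN ger0_norm ?n2_ge0.
rewrite sub0r normrN ger0_norm ?n2_ge0//.
have ldf := L2_dil mD Ddil (expR_gt0 (s k)) lf; have ldp := L2_dil mD Ddil (expR_gt0 (s k)) lp.
have H := n2_dil_le 0 (s1 k) (L2B mD lf lp); rewrite -/C in H.
rewrite (@eq_n2 _ _ _ mu D _ (fun x => f (expR (s k) *: x) - psi (expR (s k) *: x))) in H; last first.
  by move=> x _; rewrite /dil mul0r expR0 mul1r.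
have T1 := n2_tri mD ldf ldp lf; have T2 := n2_tri mD ldp lp lf.
rewrite [n2 _ _ (fun x => psi x - f x)]n2BC in T2.
move: pe; rewrite ltr_pdivlMr ?addr_gt0// => pe.
apply: (le_trans T1); apply: (@le_trans _ _ (C * n2 mu D (fun x => f x - psi x) + (e / 2 + n2 mu D (fun x => f x - psi x)))).
  by apply: lerD => //; rewrite (le_trans T2)// lerD2r.
move: (n2 _ _ _) (n2_ge0 mu D (fun x => f x - psi x)) pe => X X0 pe; clear - pe X0; lra.
Unshelve. all: end_near. Qed.

(** Dominated convergence: for [|s| <= 1] all dilates live in the box of half-width [M e]. Pointwise
    convergence is required on [D] only, which admits functions that are discontinuous at the
    origin. *)
Lemma box_dcont (M C : R) f : 0 <= C -> cmeasurable setT f -> (forall x, nc (f x) <= C) ->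
  (forall x, ~ rV_box M x -> f x = 0) ->
  (forall (s : R^nat) x, D x -> s @ \oo --> (0 : R) -> ccvg (fun k => f (expR (s k) *: x)) (f x)) -> dcont f.
Proof.
move=> C0 mf CP MP cf.
have mdf s : cmeasurable setT (fun x : V => f (expR s *: x)).
  have [m1 m2] := mf; split.
  - by have := measurable_comp_affine (expR s) 0 m1; under eq_fun do rewrite addr0.
  - by have := measurable_comp_affine (expR s) 0 m2; under eq_fun do rewrite addr0.
split; first by apply: L2_sub => //; exact: (box_L2 mf CP MP).
move=> s s0 s1; apply: (@cvg2_dominated _ _ _ mu D mD _ _ (fun x => C * \1_(rV_box (M * expR 1)) x)).
- by move=> k; exact: cmeas_sub.
- exact: cmeas_sub.
- by move=> x Dx; exact: cf.
- apply: integrableS (@box_integrable _ _ _ (M * expR 1) (C ^+ 2) _ _ _) => //.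
  + apply: measurable_funX; apply: measurable_funM => //.
    by apply: measurable_indic; exact: measurable_rV_box.
  + move=> x; rewrite exprMn normrM [`|C ^+ 2|]ger0_norm ?sqr_ge0// indicE.
    by case: (x \in _); rewrite ?expr1n ?expr0n ?normr1 ?normr0 ?mulr1 ?mulr0// sqr_ge0.
  + by move=> x xM; rewrite indicE memNset// mulr0 expr0n.
- move=> k x _; rewrite indicE; have [xB|xB] := pselect (rV_box (M * expR 1) x).
    by rewrite mem_set// mulr1.
  rewrite memNset// mulr0 MP ?Normc.normc0// => h; apply: xB => i.
  have := h i; rewrite mxE normrM ger0_norm ?expR_ge0// => h'.
  have M0 : 0 <= M by rewrite (le_trans _ h')// mulr_ge0 ?expR_ge0.
  rewrite -ler_pdivrMr ?expR_gt0// -expRN mulrC (le_trans _ h')//.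
  by rewrite ler_wpM2r// ler_expR lerNl (le_trans _ (s1 k))// -normrN ler_norm.
Qed.

Lemma dil_seq_cvg (s : R^nat) (x : V) : s @ \oo --> (0 : R) -> (fun k => expR (s k) *: x) @ \oo --> x.
Proof.
move=> s0; rewrite -[X in _ --> X]scale1r -expR0.
apply: (@cvg_comp _ _ _ _ (fun a : R => a *: x)); last exact: scalel_continuous.
by apply: continuous_cvg => //; exact: continuous_expR.
Qed.

Lemma tf_dil_cvg (s : R^nat) phi x : tf phi -> s @ \oo --> (0 : R) ->
  ccvg (fun k => phi (expR (s k) *: x)) (phi x).
Proof.
move=> tp s0; have [c1 c2] := csmooth_cont (tf_smooth tp); have sx := @dil_seq_cvg _ x s0.
apply/ccvgP; split.
- by apply: (@cvg_comp _ _ _ (fun k => expR (s k) *: x) (fun y => Re (phi y))); [exact: sx|exact: c1].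
- by apply: (@cvg_comp _ _ _ (fun k => expR (s k) *: x) (fun y => Im (phi y))); [exact: sx|exact: c2].
Qed.

Lemma tf_dcont phi : tf phi -> dcont phi.
Proof.
move=> tp; have [C C0 CP] := tf_bnd tp; have [M M0 MP] := tf_box tp.
apply: (box_dcont C0 (tf_meas tp) CP MP) => s x _; exact: tf_dil_cvg.
Qed.

(** Lets the dilated function vary with the index: uniform boundedness handles [f_ k - f], strong
    continuity handles [f], and the prefactors [e^{c s_k}] tend to 1. *)
Lemma dcont_dil c (s : R^nat) (f_ : nat -> V -> R[i]) f : dcont f -> (forall k, L2 mu D (f_ k)) ->
  cvg2 mu D f_ f -> s @ \oo --> (0 : R) -> (forall k, `|s k| <= 1) ->
  cvg2 mu D (fun k => dil c (s k) (f_ k)) f.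
Proof.
move=> [lf cf] lf_ ff s0 s1.
have es0 : (fun k => expR (c * s k) - 1) @ \oo --> (0 : R).
  have h : (fun k => c * s k) @ \oo --> (0 : R).
    by rewrite -[X in _ --> X](mulr0 c); apply: cvgM => //; exact: cvg_cst.
  rewrite -[X in _ --> X](subrr (1 : R)); apply: cvgB; last exact: cvg_cst.
  rewrite -expR0; apply: (@continuous_cvg _ R^o R^o _ _ (fun k => c * s k) expR 0 _ h).
  exact: continuous_expR.
pose K := expR (`|c| + n%:R : R).
apply: (@cvg0_le _ _ (fun k => K * n2 mu D (fun x => f_ k x - f x) +
   expR `|c| * n2 mu D (fun x => f (expR (s k) *: x) - f x) + `|expR (c * s k) - 1| * n2 mu D f)).
  move=> k; rewrite n2_ge0/=; have a0 := expR_gt0 (s k).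
  have lb := L2B mD (lf_ k) lf; have lbf := L2B mD (L2_dil mD Ddil a0 lf) lf.
  rewrite (@eq_n2 _ _ _ mu D _ (fun x => dil c (s k) (fun y => f_ k y - f y) x +
    ((expR (c * s k))%:C * (f (expR (s k) *: x) - f x) + ((expR (c * s k)) - 1)%:C * f x))); last first.
    by move=> x _; rewrite /dil rmorphB rmorph1; ring.
  have l2 := L2Z mD (expR (c * s k))%:C lbf; have l3 := L2Z mD ((expR (c * s k)) - 1)%:C lf.
  apply: (le_trans (n2D mD (L2_dilc c (s k) lb) (L2D mD l2 l3))).
  rewrite -addrA; apply: lerD; first exact: n2_dil_le.
  apply: (le_trans (n2D mD l2 l3)); rewrite (n2Z mD _ lbf) (n2Z mD _ lf) !nc_real lerD2r.
  rewrite ler_wpM2r ?n2_ge0// ger0_norm ?expR_ge0// ler_expR.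
  by rewrite (le_trans (ler_norm _))// normrM ler_piMr.
have h1 : (fun k => K * n2 mu D (fun x => f_ k x - f x)) @ \oo --> K * 0.
  by apply: cvgM => //; exact: cvg_cst.
have h2 : (fun k => expR `|c| * n2 mu D (fun x => f (expR (s k) *: x) - f x)) @ \oo --> expR `|c| * 0.
  by apply: cvgM; [exact: cvg_cst|exact: cf].
have h3 : (fun k => `|expR (c * s k) - 1| * n2 mu D f) @ \oo --> `|0 : R| * n2 mu D f.
  by apply: cvgM; [exact: (@cvg_norm _ R^o)|exact: cvg_cst].
have := cvgD (cvgD h1 h2) h3; rewrite !mulr0 normr0 mul0r !addr0; exact.
Qed.

(** The mean value theorem for the real function [s |-> Re <q, U_s phi>] on [[-t, t]]. A symmetric
    difference thus becomes one dilation of the generator, with no remainder to estimate. *)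
Lemma mvt_dil q c t phi : tf phi -> L2 mu D q -> 0 < t -> exists2 s, `|s| <= t &
  Re (ip mu D q (dil c t phi)) - Re (ip mu D q (dil c (- t) phi)) =
  2 * t * Re (ip mu D q (dil c s (gen c phi))).
Proof.
move=> tp lq t0; pose Q x : R[i] := (\1_D x)%:C * q x.
have mq : cmeasurable D q by case: lq.
have [mQ iQ] : L2 mu setT Q by apply/(L2_indic mu mD mq).
have lQ M : cintegrable mu (rV_box M) Q.
  have mB : measurable (rV_box M : set V) by exact: measurable_rV_box.
  apply: (L2_loc mT mB) => //.
  apply: (@le_lt_trans _ _ (mu (rV_box `|M| : set V))); last by rewrite lebesgue_rV_box// ltry.
  apply: le_measure; rewrite ?inE//; first exact: measurable_rV_box.
  by move=> x xM i; rewrite (le_trans (xM i))// ler_norm.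
have qE s h : cintegral mu setT (fun x => Q x * (dil c s h x)^*) = ip mu D q (dil c s h).
  by rewrite /ip [RHS]cintegral_indic; apply: eq_cintegral => x _; rewrite /Q mulrA.
have tt : - t < t by lra.
have dm s := is_derive_dil c s tp lQ mQ.
have [s /andP[ts st] E] := MVT1 tt (fun s _ => dm s).
cbv beta in E; rewrite !qE in E; exists s; last by rewrite E opprK mulrC; congr (_ * _); ring.
by rewrite ler_norml !ltW.
Qed.

End dilation_limits.

(** * Weighted Hardy inequalities from dilations *)

Section hardy.
Context (R : realType) (d : nat).
Notation n := d.+1.
Notation V := 'rV[R]_n.
Notation mu := (lebesgue_rV R n).
Notation Om := (@half_space R d).
Notation mOm := (@measurable_half_space R d).
Notation L2O := (L2 mu Om).
Notation n2O := (n2 mu Om).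
Notation ipO := (ip mu Om).
Implicit Types (phi psi : V -> R[i]).

Variables (w : V -> R) (g C : R).
Hypothesis w0 : forall x, 0 < w x.
Hypothesis wC : forall x, w x <= C.
Hypothesis mw : measurable_fun setT w.
Hypothesis g0 : 0 <= g.
Hypothesis gn : 2 * g < n%:R.
Hypothesis wg : forall s x, w (expR (- s) *: x) <= expR (g * `|s|) * w x.

(** The weight imitates [|x|^{-g}]: [wg] is homogeneity up to an inequality, and the bound [C] is
    the effect of smoothing [|x|] at the origin. The later uses have [g = 1] and [g = 1/2]. *)
Definition wn phi : R := n2O (fun x => (w x)%:C * phi x).

Lemma wL2 phi : L2O phi -> L2O (fun x => (w x)%:C * phi x).
Proof.
apply: (@L2_bnd _ _ _ mu Om mOm C); first by apply: cmeas_real; exact: measurable_funTS.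
by move=> x _; rewrite nc_real ger0_norm ?wC// ltW.
Qed.

Lemma tf_L2Om phi : tf phi -> L2O phi.
Proof. by move=> tp; apply: L2_sub; [exact: mOm|exact: tf_L2]. Qed.

(** The change of variable [y = e^s x] moves the dilation from [phi] to the weight and produces the
    Jacobian [e^{-n s}]; the dilated weight then costs [e^{2 g |s|}] after squaring. *)
Lemma wn_dil0 s phi : L2O phi ->
  wn (fun x => phi (expR s *: x)) ^+ 2 <= expR (2 * g * `|s| - n%:R * s) * wn phi ^+ 2.
Proof.
move=> lp.
pose f y := (w (expR (- s) *: y))%:C * phi y.
have lf : L2O f.
  apply: (@L2_bnd _ _ _ mu Om mOm C) => //.
  - apply: cmeas_real; apply: measurable_funTS.
    have := measurable_comp_affine (expR (- s)) 0 mw.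
    by under eq_fun do rewrite addr0.
  - by move=> x _; rewrite nc_real ger0_norm ?wC// ltW.
have := n2_dil mOm (@half_space_dil R d) (expR_gt0 s) lf.
rewrite (_ : n2 _ _ (fun x : V => f (expR s *: x)) = wn (fun x => phi (expR s *: x))); last first.
  by apply: eq_n2 => x _; rewrite /f scalerA -expRD addNr expR0 scale1r.
rewrite -expRM_natl => E.
have fw : n2O f <= expR (g * `|s|) * wn phi.
  rewrite (_ : expR (g * `|s|) * wn phi =
      n2O (fun x => (expR (g * `|s|))%:C * ((w x)%:C * phi x))); last first.
    by rewrite /wn (n2Z mOm _ (wL2 lp)) nc_real [`|expR _|]ger0_norm ?expR_ge0.
  apply: (n2_le mOm); [by apply: (L2Z mOm); exact: wL2|by case: lf|].
  move=> x _; rewrite /f !ncM !nc_real (gtr0_norm (w0 _)) (gtr0_norm (w0 x)).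
  by rewrite (gtr0_norm (expR_gt0 _)) mulrA ler_wpM2r ?nc_ge0.
rewrite expRB mulrAC ler_pdivlMr ?expR_gt0// mulrC -E.
rewrite (_ : expR (2 * g * `|s|) = expR (g * `|s|) ^+ 2); last first.
  by rewrite -expRM_natl mulrA.
by rewrite -exprMn lerXn2r ?nnegrE ?mulr_ge0 ?n2_ge0 ?expR_ge0.
Qed.

(** By [wn_dil0] the squared weighted norm of [phi(e^s x)] stays below [e^{(2 g - n) s}] times its
    value at 0 for [s >= 0], with equality at 0. Comparing derivatives at 0 gives [2 Re <w phi, w
    x.grad phi> <= -(n - 2 g) ||w phi||^2], and Cauchy-Schwarz concludes. *)
Lemma hardy phi : tf phi -> wn phi <= 2 / (n%:R - 2 * g) * wn (euler phi).
Proof.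
move=> tp; have sp := tf_smooth tp.
have te := tf_euler tp; have lp := tf_L2Om tp; have le := tf_L2Om te.
have lwp := wL2 lp; have lwe := wL2 le.
(* [|phi|^2] is itself a test function, so the squared norm is a pairing of its dilates with [w^2]
   on the half-space and [is_derive_dil] applies. *)
pose psi x := phi x * (phi x)^*.
have tpsi : tf psi by apply: tfM => //; exact: tf_conj.
pose q x : R[i] := (\1_Om x)%:C * (w x ^+ 2)%:C.
have mq : cmeasurable setT q.
  apply: cmeasM; apply: cmeas_real; last exact: measurable_funX.
  by apply: measurable_indic; exact: mOm.
have qC x : nc (q x) <= C ^+ 2.
  rewrite ncM !nc_real indicE [`|w x ^+ 2|]ger0_norm ?sqr_ge0//.
  have : w x ^+ 2 <= C ^+ 2 by rewrite lerXn2r ?nnegrE ?wC ?(ltW (w0 x))// (le_trans (ltW (w0 x)) (wC x)).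
  by move=> h; case: (x \in _); rewrite ?normr1 ?normr0 ?mul1r ?mul0r// sqr_ge0.
have lq M : cintegrable mu (rV_box M) q.
  have mB : measurable (rV_box `|M| : set V) by exact: measurable_rV_box.
  have mB' : measurable (rV_box M : set V) by exact: measurable_rV_box.
  apply: (@cint_le _ _ _ mu _ mB' _ (cst (C ^+ 2))); [exact: cmeas_sub|by move=> x _; exact: qC|].
  apply: integrableS (_ : mu.-integrable (rV_box `|M|) _) => //.
    by move=> x xM i; rewrite (le_trans (xM i))// ler_norm.
  apply/integrableP; split; first exact/measurable_EFinP/measurable_cst.
  rewrite (eq_integral (cst `|C ^+ 2|%:E))// integral_cst//= lebesgue_rV_box//.
  by rewrite lte_mul_pinfty// ?lee_fin ?normr_ge0// ltry.
have := is_derive_dil 0 0 tpsi lq mq.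
set m := (X in is_derive _ _ X _) => dm.
have mE s : m s = wn (fun x => phi (expR s *: x)) ^+ 2.
  rewrite /m -[RHS]/(Re (wn (fun x => phi (expR s *: x)) ^+ 2)%:C) -ip_self ?/ip; last exact: mOm.
  rewrite [in RHS]cintegral_indic; congr Re; apply: eq_cintegral => x _.
  by rewrite /q /dil mul0r expR0 mul1r /psi expr2 !rmorphM /= conjCK conjR; ring.
clearbody m.
have dE : Re (cintegral mu setT (fun x => q x * (dil 0 0 (gen 0 psi) x)^*)) =
    2 * Re (ipO (fun x => (w x)%:C * phi x) (fun x => (w x)%:C * euler phi x)).
  have fi := ip_cint mOm lwp lwe.
  rewrite (_ : cintegral _ _ _ = ipO (fun x => (w x)%:C * phi x) (fun x => (w x)%:C * euler phi x)
     + (ipO (fun x => (w x)%:C * phi x) (fun x => (w x)%:C * euler phi x))^*).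
    have ReC (z : R[i]) : Re (z + z^*) = 2 * Re z by case: z => a b /=; ring.
    by rewrite ReC.
  rewrite /ip -(cintegral_conj mOm fi) -(cintegralD mOm fi (cint_conj mOm fi)).
  rewrite [in RHS]cintegral_indic; apply: eq_cintegral => x _.
  have -> : dil 0 0 (gen 0 psi) x = phi x * (euler phi x)^* + euler phi x * (phi x)^*.
    rewrite /dil mul0r !expR0 scale1r mul1r /gen mul0r addr0 /euler rmorph_sum.
    rewrite mulr_sumr mulr_suml -big_split; apply: eq_bigr => j _ /=.
    rewrite (partialM j x sp (csmooth_conj sp)) partial_conj// rmorphM/= conjR; ring.
  by rewrite /q expr2 rmorphD !rmorphM/= !conjCK conjR; ring.
rewrite dE in dm.
have h2 := CS mOm lwp lwe; rewrite -/(wn phi) -/(wn (euler phi)) in h2.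
move: (ip _ _ _ _) dm h2 => I dm h2.
have d1 : is_derive (0 : R) 1 (fun s : R => (2 * g - n%:R) * s) ((2 * g - n%:R) * 1).
  exact: (is_deriveZ (f := id)).
have d2 : is_derive (0 : R) 1 (fun s : R => expR ((2 * g - n%:R) * s)) (1 * ((2 * g - n%:R) * 1)).
  apply: (@is_derive1_comp _ expR (fun s : R => (2 * g - n%:R) * s)) => //.
  by rewrite mulr0 -[X in is_derive _ _ _ X]expR0; exact: is_derive_expR.
have d3 : is_derive (0 : R) 1 (fun s : R => m 0 * expR ((2 * g - n%:R) * s))
    (m 0 * (1 * ((2 * g - n%:R) * 1))) := is_deriveZ (m 0) d2.
have d4 : is_derive (0 : R) 1 (fun s : R => m s - m 0 * expR ((2 * g - n%:R) * s))
    (2 * Re I - m 0 * (1 * ((2 * g - n%:R) * 1))) := is_deriveB dm d3.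
have h : 2 * Re I - m 0 * (1 * ((2 * g - n%:R) * 1)) <= 0.
  apply: (derive_le_right d4) => t t0.
  rewrite addr0 mulr0 expR0 mulr1 subrr subr_le0 !mE.
  rewrite (le_trans (wn_dil0 t lp))//.
  rewrite (_ : (fun x => phi (expR 0 *: x)) = phi); last first.
    by apply/funext => x; rewrite expR0 scale1r.
  by rewrite ger0_norm// mulrBl mulrC.
have m0 : m 0 = wn phi ^+ 2.
  by rewrite mE; congr (wn _ ^+ 2); apply/funext => x; rewrite expR0 scale1r.
rewrite m0 mul1r mulr1 in h.
have := nc_Re I; rewrite ler_norml => /andP[h1 _].
have a0 := n2_ge0 mu Om (fun x => (w x)%:C * phi x); rewrite -/(wn phi) in a0.
have b0 := n2_ge0 mu Om (fun x => (w x)%:C * euler phi x); rewrite -/(wn (euler phi)) in b0.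
have k0 : 0 < n%:R - 2 * g by rewrite subr_gt0.
rewrite mulrAC ler_pdivlMr//.
have [->|an0] := eqVneq (wn phi) 0; first by rewrite mul0r mulr_ge0.
have a1 : 0 < wn phi by rewrite lt_neqAle eq_sym an0.
rewrite -(ler_pM2l a1); move: (wn phi) (wn (euler phi)) (n%:R : R) (Re I) h h1 h2 => *; nra.
Qed.

Lemma wn_gen c phi : tf phi -> 0 <= c ->
  wn (gen c phi) <= (1 + c * (2 / (n%:R - 2 * g))) * wn (euler phi).
Proof.
move=> tp c0; have lp := tf_L2Om tp; have le := tf_L2Om (tf_euler tp).
rewrite /wn (@eq_n2 _ _ _ mu Om _ (fun x => (w x)%:C * euler phi x + c%:C * ((w x)%:C * phi x))); last first.
  by move=> x _; rewrite /gen; ring.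
apply: (le_trans (n2D mOm (wL2 le) (L2Z mOm _ (wL2 lp)))).
rewrite (n2Z mOm _ (wL2 lp)) nc_real ger0_norm// mulrDl mul1r lerD2l -mulrA.
by rewrite ler_wpM2l// hardy.
Qed.

(** The exponential bounds the dilations with [|s| <= 1] in the weighted norm; the other factor
    passes from [gen c] to the Euler operator by Hardy's inequality. *)
Definition Kd (c : R) := expR (c + g + n%:R) * (1 + c * (2 / (n%:R - 2 * g))).

Lemma Kd_ge0 c : 0 <= c -> 0 <= Kd c.
Proof.
by move=> c0; rewrite mulr_ge0 ?expR_ge0// addr_ge0// mulr_ge0// divr_ge0// subr_ge0 ltW.
Qed.

(** After division by [2 t] the bound is uniform in [t]: [mvt_dil] leaves a single dilation of the
    generator, and the weight is split between [F] and the test function before Cauchy-Schwarz. *)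
Lemma dual_dilation (F : V -> R[i]) c t phi : tf phi -> 0 <= c -> 0 < t <= 1 ->
  L2O F -> L2O (fun x => ((w x)^-1)%:C * F x) ->
  `|Re (ipO F (dil c t phi)) - Re (ipO F (dil c (- t) phi))| <=
  2 * t * (n2O (fun x => ((w x)^-1)%:C * F x) * (Kd c * wn (euler phi))).
Proof.
move=> tp c0 /andP[t0 t1] lF lwF; have tg := tf_gen c tp.
have [s st ->] := mvt_dil mOm c tp lF t0.
suff : `|Re (ipO F (dil c s (gen c phi)))| <=
    n2O (fun x => ((w x)^-1)%:C * F x) * (Kd c * wn (euler phi)).
  move: (Re _) (n2 _ _ _ * _) => X Y XY.
  by rewrite normrM [`|2 * t|]ger0_norm ?ler_wpM2l// mulr_ge0// ltW.
have ldg : L2O (dil c s (gen c phi)) by apply: tf_L2Om; exact: tf_dil.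
have lwd := wL2 ldg.
apply: (le_trans (nc_Re _)).
have -> : ipO F (dil c s (gen c phi)) = ipO (fun x => ((w x)^-1)%:C * F x)
    (fun x => (w x)%:C * dil c s (gen c phi) x).
  apply: eq_cintegral => x _; rewrite [in RHS]rmorphM/= conjR.
  rewrite mulrACA -rmorphM/= mulVf ?mul1r// gt_eqF//.
apply: (le_trans (CS mOm lwF lwd)); rewrite ler_wpM2l ?n2_ge0//.
have s1 := le_trans st t1.
have lg := tf_L2Om tg.
have H : n2O (fun x => (w x)%:C * dil c s (gen c phi) x) <=
   expR (c + g + n%:R) * wn (gen c phi).
  rewrite -(@ler_pXn2r _ 2) ?nnegrE ?mulr_ge0 ?n2_ge0 ?expR_ge0//.
  rewrite (@eq_n2 _ _ _ mu Om _ (fun x => (expR (c * s))%:C * ((w x)%:C * gen c phi (expR s *: x)))); last first.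
    by move=> x _; rewrite /dil; ring.
  have ld0 : L2O (fun x => gen c phi (expR s *: x)) by apply: tf_L2Om; exact: tf_dil0.
  rewrite (n2Z mOm _ (wL2 ld0)) exprMn nc_real ger0_norm ?expR_ge0//.
  apply: (@le_trans _ _ (expR (c * s) ^+ 2 * (expR (2 * g * `|s| - n%:R * s) * wn (gen c phi) ^+ 2))).
    by rewrite ler_wpM2l ?sqr_ge0// wn_dil0.
  rewrite mulrA [leRHS]exprMn ler_wpM2r ?sqr_ge0//.
  rewrite -!expRM_natl -expRD ler_expR.
  have n0 : (0 : R) <= n%:R by [].
  move: s1; rewrite ler_norml => /andP[s1 s2].
  have g1 : g * `|s| <= g by rewrite ler_piMr// ler_norml s1 s2.
  have c1 : c * s <= c by rewrite ler_piMr.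
  have n1 : - (n%:R * s) <= n%:R by rewrite -mulrN ler_piMr//; lra.
  lra.
apply: (le_trans H); rewrite /Kd -mulrA ler_wpM2l ?expR_ge0//.
exact: wn_gen.
Qed.

End hardy.

Lemma L2_locally_integrable (R : realType) k (D : set 'rV[R]_k) (f : 'rV[R]_k -> R[i]) :
  measurable D -> L2 (lebesgue_rV R k) D f ->
  Defs.locally_integrable D f.
Proof.
move=> mD lf; split; first exact: L2_meas lf.
move=> K cK KD; have cl : closed K by apply: compact_closed cK; exact: norm_hausdorff.
have mK : measurable K.
  rewrite -[K]setCK; apply: measurableC; apply: open_rV_measurable.
  by rewrite openC.
have [M M0 KM] := compact_box cK.
apply: (L2_loc mD mK KD _ lf); apply: le_lt_trans (_ : _ <= lebesgue_rV R k (rV_box M))%E _.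
  by apply: le_measure => //; rewrite inE//; exact: measurable_rV_box.
by rewrite lebesgue_rV_box// ltry.
Qed.

(** * The form domain *)

Section multipliers.
Context (R : realType).

(* functions [m] such that multiplication by [m(|x|)] preserves the form domain *)
Record multiplier (m m' : R -> R[i]) (C : R) : Prop := Multiplier {
  mult_bnd : forall s, 0 <= s -> nc (m s) <= C;
  mult_bnd' : forall s, 0 <= s -> nc (m' s) <= C;
  mult_cvg : forall (u : R^nat) a, u @ \oo --> (a : R) -> ccvg (fun k => m (u k)) (m a);
  mult_cvg' : forall (u : R^nat) a, u @ \oo --> (a : R) -> ccvg (fun k => m' (u k)) (m' a);
  mult_smooth : forall n (f : 'rV[R]_n -> R), (forall k, Ck k f) -> csmooth (fun x => m (f x));
  mult_partial : forall n (f : 'rV[R]_n -> R) j x, (forall k, Ck k f) ->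
    partial j (fun x => m (f x)) x = m' (f x) * ('D_(delta_mx ord0 j) f x)%:C }.

Lemma mult_expi (k : R) : multiplier (fun s => expi (k * s))
  (fun s => (0 +i* k) * expi (k * s)) (1 + `|k|).
Proof.
have nk : nc (0 +i* k) = `|k| by rewrite /= expr0n/= add0r sqrtr_sqr.
split.
- by move=> s _; rewrite nc_expi lerDl.
- by move=> s _; rewrite ncM nc_expi nk mulr1 lerDr.
- by move=> u a ua; apply: ccvg_expi; apply: cvgM => //; exact: cvg_cst.
- move=> u a ua; apply: ccvgM; first exact: ccvg_cst.
  by apply: ccvg_expi; apply: cvgM => //; exact: cvg_cst.
- by move=> n f Cf; apply: csmooth_expi => l; apply: CkM => //; exact: Ck_cst.
- move=> n f j x Cf; pose v : 'rV[R]_n := delta_mx ord0 j.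
  have [_ /(_ v)[fv _]] := Cf 1%N.
  have D0 : is_derive x v (fun x => k * f x) (k * 'D_v f x).
    by have := is_deriveZ k (derivableP (fv x)).
  have [_ D1] := @is_derive_chain R _ (fun x => k * f x) x v _ cos _ (is_derive_cos _) D0.
  have [_ D2] := @is_derive_chain R _ (fun x => k * f x) x v _ sin _ (is_derive_sin _) D0.
  rewrite /partial /expi /= -/v D1 D2.
  by apply/eqP; rewrite eq_complex /=; apply/andP; split; apply/eqP; ring.
Qed.

Lemma mult_real (h h' : R -> R) (C : R) :
  (forall n (f : 'rV[R]_n -> R), (forall k, Ck k f) -> forall k, Ck k (fun x => h (f x))) ->
  (forall t : R, is_derive t 1 h (h' t)) -> continuous h' ->
  (forall s, 0 <= s -> `|h s| <= C) -> (forall s, 0 <= s -> `|h' s| <= C) ->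
  multiplier (fun s => (h s)%:C) (fun s => (h' s)%:C) C.
Proof.
move=> hs dh ch' hC hC'; split.
- by move=> s s0; rewrite nc_real hC.
- by move=> s s0; rewrite nc_real hC'.
- move=> u a ua; apply: ccvg_real; apply: (@continuous_cvg _ R^o R^o _ _ u h a _ ua).
  exact: (derivable_continuous1 (dh a)).
- by move=> u a ua; apply: ccvg_real; exact: (@continuous_cvg _ R^o R^o _ _ u h' a (ch' a) ua).
- by move=> n f Cf; apply: csmooth_real; exact: hs.
- move=> n f j x Cf; rewrite partial_real -rmorphM; congr (_%:C).
  have [_ /(_ (delta_mx ord0 j))[fv _]] := Cf 1%N.
  by have [_ ->] := is_derive_chain (dh (f x)) (derivableP (fv x)).
Qed.

Lemma is_derive_expRN (eta t : R) :
  is_derive t 1 (fun s : R => expR (- eta * s)) (- eta * expR (- eta * t)).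
Proof.
have d1 : is_derive t 1 (fun s : R => - eta * s) (- eta * 1).
  exact: (is_deriveZ (f := id)).
have := @is_derive1_comp _ expR (fun s : R => - eta * s) t _ _ (is_derive_expR _) d1.
by move=> h; apply: (is_derive_eq h); ring.
Qed.

Lemma continuous_expRN (eta : R) : continuous (fun s : R => expR (- eta * s)).
Proof. by move=> t; exact: (derivable_continuous1 (is_derive_expRN eta t)). Qed.

Lemma mult_expR (eta : R) : 0 <= eta ->
  multiplier (fun s => (expR (- eta * s))%:C) (fun s => (- eta * expR (- eta * s))%:C) (1 + eta).
Proof.
move=> e0; have e1 s : 0 <= s -> expR (- eta * s) <= 1.
  by move=> s0; rewrite -expR0 ler_expR mulNr oppr_le0 mulr_ge0.
apply: mult_real.
- by move=> n f Cf k; apply: Ck_exp; apply: CkM => //; exact: Ck_cst.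
- exact: is_derive_expRN.
- by move=> t; apply: cvgM; [exact: cvg_cst|exact: continuous_expRN].
- by move=> s s0; rewrite ger0_norm ?expR_ge0// (le_trans (e1 _ s0))// lerDl.
- move=> s s0; rewrite normrM normrN !ger0_norm ?expR_ge0//.
  by rewrite -[leRHS]add0r [leRHS]addrCA add0r ler_wpDl// ler_piMr// e1.
Qed.

(** A bounded substitute for [s], which it approaches from below as [eta -> 0]. *)
Definition rho (eta s : R) : R := s * expR (- eta * s).
Definition rho' (eta s : R) : R := (1 - eta * s) * expR (- eta * s).

Lemma rho_ge0 eta s : 0 <= s -> 0 <= rho eta s.
Proof. by move=> s0; rewrite mulr_ge0 ?expR_ge0. Qed.

Lemma rho_le eta s : 0 <= eta -> 0 <= s -> rho eta s <= s.
Proof.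
move=> e0 s0; rewrite /rho ler_piMr// -expR0 ler_expR mulNr oppr_le0.
by rewrite mulr_ge0.
Qed.

Lemma rho_bnd eta s : 0 < eta -> 0 <= s -> rho eta s <= eta^-1.
Proof.
move=> e0 s0; rewrite /rho mulNr expRN ler_pdivrMr ?expR_gt0//.
rewrite mulrC ler_pdivlMr// mulrC (le_trans _ (expR_ge1Dx _))// lerDr//.
Qed.

(** [|1 - eta s| <= 1 + eta s <= e^{eta s}]. Uniformity in [eta] keeps the terms with the derivative
    of the cut-off under control in the limit. *)
Lemma rho'_bnd eta s : 0 <= eta -> 0 <= s -> `|rho' eta s| <= 1.
Proof.
move=> e0 s0; rewrite /rho' normrM [`|expR _|]ger0_norm ?expR_ge0//.
rewrite mulNr expRN ler_pdivrMr ?expR_gt0// mul1r (le_trans _ (expR_ge1Dx _))//.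
have : 0 <= eta * s by rewrite mulr_ge0.
by move=> h; rewrite ler_norml; apply/andP; split; lra.
Qed.

Lemma mult_rho (eta : R) : 0 < eta ->
  multiplier (fun s => (rho eta s)%:C) (fun s => (rho' eta s)%:C) (1 + eta^-1).
Proof.
move=> e0; have ei0 : 0 <= eta^-1 by rewrite invr_ge0 ltW.
apply: mult_real.
- move=> n f Cf k; apply: CkM => //; apply: Ck_exp; apply: CkM => //; exact: Ck_cst.
- move=> t; have := is_deriveM (is_derive_id t 1) (is_derive_expRN eta t).
  by move=> h; apply: (is_derive_eq h); rewrite /rho' /GRing.scale/=; ring.
- move=> t; apply: cvgM; last exact: continuous_expRN.
  apply: cvgB; first exact: cvg_cst.
  by apply: cvgM; [exact: cvg_cst|exact: cvg_id].
- by move=> s s0; rewrite ger0_norm ?rho_ge0// (le_trans (rho_bnd e0 s0))// lerDr.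
- by move=> s s0; rewrite (le_trans (rho'_bnd (ltW e0) s0))// lerDl.
Qed.

End multipliers.

Section form_domain.
Context (R : realType) (d : nat).
Notation n := d.+1.
Notation V := 'rV[R]_n.
Notation W := 'rV[R]_d.
Notation mu := (lebesgue_rV R n).
Notation nu := (lebesgue_rV R d).
Notation Om := (@half_space R d).
Notation mOm := (@measurable_half_space R d).
Notation L2O := (L2 mu Om).
Notation n2O := (n2 mu Om).
Notation ipO := (ip mu Om).
Notation cvg2O := (cvg2 mu Om).
Implicit Types (v : V -> R[i]) (G : 'I_n -> V -> R[i]) (g : W -> R[i]).

Definition near_test (phi : V -> R[i]) v G g (e : R) :=
  [/\ n2O (fun x => v x - phi x) < e,
      forall j, n2O (fun x => G j x - partial j phi x) < e &
      n2 nu setT (fun x => g x - phi (rV_rcons x 0)) < e].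

(* the form domain: triples (function, gradient, trace) approximable by test functions *)
Definition XS v G g :=
  [/\ L2O v, forall j, L2O (G j), L2 nu setT g &
      forall e, 0 < e -> exists2 phi, tf phi & near_test phi v G g e].

Lemma XS_tf phi : tf phi -> XS phi (fun j => partial j phi) (fun x => phi (rV_rcons x 0)).
Proof.
move=> tp; have tg := tf_rcons 0 tp; split.
- exact: tf_L2Om.
- by move=> j; apply: tf_L2Om; exact: tf_partial.
- exact: tf_L2.
- move=> e e0; exists phi => //; split => [|j|].
  + by rewrite (_ : n2 _ _ _ = 0)// -[RHS](n2_0 mu mOm); apply: eq_n2 => x _; rewrite subrr.
  + by rewrite (_ : n2 _ _ _ = 0)// -[RHS](n2_0 mu mOm); apply: eq_n2 => x _; rewrite subrr.
  + by rewrite (_ : n2 _ _ _ = 0)// -[RHS](n2_0 nu mT); apply: eq_n2 => x _; rewrite subrr.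
Qed.

Lemma XS_seq v G g : XS v G g -> exists phi : nat -> V -> R[i],
  [/\ forall k, tf (phi k), cvg2O phi v,
      forall j, cvg2O (fun k => partial j (phi k)) (G j) &
      cvg2 nu setT (fun k x => phi k (rV_rcons x 0)) g].
Proof.
move=> [lv lG lg ap].
have /choice[phi P] : forall k, exists phi, tf phi /\ near_test phi v G g (hseq R k).
  by move=> k; have [phi ? ?] := ap _ (hseq_gt0 R k); exists phi.
have h0 := hseq_cvg (R := R).
exists phi; split=> [k|||]; first by have [] := P k.
- apply: cvg0_le h0 => k; rewrite n2_ge0/= n2BC.
  by have [_ [h _ _]] := P k; exact: ltW.
- move=> j; apply: cvg0_le h0 => k; rewrite n2_ge0/= n2BC.
  by have [_ [_ h _]] := P k; exact: ltW.
- apply: cvg0_le h0 => k; rewrite n2_ge0/= n2BC.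
  by have [_ [_ _ h]] := P k; exact: ltW.
Qed.

Lemma XS_closed v G g : L2O v -> (forall j, L2O (G j)) -> L2 nu setT g ->
  (forall e, 0 < e -> exists v' G' g', [/\ XS v' G' g',
     n2O (fun x => v x - v' x) < e,
     forall j, n2O (fun x => G j x - G' j x) < e &
     n2 nu setT (fun x => g x - g' x) < e]) -> XS v G g.
Proof.
move=> lv lG lg h; split => // e e0; have e2 : 0 < e / 2 by rewrite divr_gt0.
have [v' [G' [g' [[lv' lG' lg' ap] h1 h2 h3]]]] := h _ e2.
have [phi tp [p1 p2 p3]] := ap _ e2; exists phi => //.
have lp := tf_L2Om tp; have lpj j := tf_L2Om (tf_partial j tp).
have lp0 := tf_L2 (tf_rcons 0 tp).
have -> : e = e / 2 + e / 2 by field.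
split=> [|j|].
- by rewrite (le_lt_trans (n2_tri mOm lv lv' lp))// ltrD.
- by rewrite (le_lt_trans (n2_tri mOm (lG j) (lG' j) (lpj j)))// ltrD.
- by rewrite (le_lt_trans (n2_tri mT lg lg' lp0))// ltrD.
Qed.

Lemma XS_closed_seq (v_ : nat -> V -> R[i]) (G_ : nat -> 'I_n -> V -> R[i])
    (g_ : nat -> W -> R[i]) v G g :
  L2O v -> (forall j, L2O (G j)) -> L2 nu setT g ->
  (forall k, XS (v_ k) (G_ k) (g_ k)) -> cvg2O v_ v ->
  (forall j, cvg2O (fun k => G_ k j) (G j)) -> cvg2 nu setT g_ g -> XS v G g.
Proof.
move=> lv lG lg Xk cv cG cg; apply: XS_closed => // e e0.
have lt0 (u : R^nat) : (forall k, 0 <= u k) -> u @ \oo --> (0 : R) -> \forall k \near \oo, u k < e.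
  move=> u0 /cvgrPdist_lt /(_ e e0); apply: filterS => k.
  by rewrite sub0r normrN ger0_norm.
have : \forall k \near \oo, [/\ n2O (fun x => v_ k x - v x) < e,
    forall j, n2O (fun x => G_ k j x - G j x) < e &
    n2 nu setT (fun x => g_ k x - g x) < e].
  near=> k; split.
  - by near: k; apply: lt0 => // k; exact: n2_ge0.
  - near: k; apply: filter_forall => j; apply: lt0; last exact: cG.
    by move=> k; exact: n2_ge0.
  - by near: k; apply: lt0 => // k; exact: n2_ge0.
move=> [N _ /(_ N (leqnn N))[h1 h2 h3]].
exists (v_ N), (G_ N), (g_ N); split => //; rewrite 1?n2BC// => j.
by rewrite n2BC.
Unshelve. all: end_near. Qed.

Lemma XS_D v G g v' G' g' : XS v G g -> XS v' G' g' ->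
  XS (fun x => v x + v' x) (fun j x => G j x + G' j x) (fun x => g x + g' x).
Proof.
move=> [lv lG lg ap] [lv' lG' lg' ap']; split.
- exact: L2D mOm _ _ lv lv'.
- by move=> j; apply: (L2D mOm).
- exact: L2D mT _ _ lg lg'.
move=> e e0; have e2 : 0 < e / 2 by rewrite divr_gt0.
have [phi tp [p1 p2 p3]] := ap _ e2; have [psi ts [q1 q2 q3]] := ap' _ e2.
exists (fun x => phi x + psi x); first exact: tfD.
have lp := tf_L2Om tp; have lpj j := tf_L2Om (tf_partial j tp).
have lp0 := tf_L2 (tf_rcons 0 tp).
have ls := tf_L2Om ts; have lsj j := tf_L2Om (tf_partial j ts).
have ls0 := tf_L2 (tf_rcons 0 ts).
have -> : e = e / 2 + e / 2 by field.
split=> [|j|].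
- rewrite (@eq_n2 _ _ _ mu Om _ (fun x => (v x - phi x) + (v' x - psi x))) => [|x _]; last by ring.
  by rewrite (le_lt_trans (n2D mOm (L2B mOm lv lp) (L2B mOm lv' ls)))// ltrD.
- rewrite (@eq_n2 _ _ _ mu Om _ (fun x => (G j x - partial j phi x) + (G' j x - partial j psi x))) => [|x _].
    by rewrite (le_lt_trans (n2D mOm (L2B mOm (lG j) (lpj j)) (L2B mOm (lG' j) (lsj j))))// ltrD.
  by rewrite partialD; [ring|exact: tf_smooth|exact: tf_smooth].
- rewrite (@eq_n2 _ _ _ nu setT _ (fun x => (g x - phi (rV_rcons x 0)) + (g' x - psi (rV_rcons x 0)))) => [|x _]; last by ring.
  by rewrite (le_lt_trans (n2D mT (L2B mT lg lp0) (L2B mT lg' ls0)))// ltrD.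
Qed.

Lemma XS_Z z v G g : XS v G g ->
  XS (fun x => z * v x) (fun j x => z * G j x) (fun x => z * g x).
Proof.
move=> [lv lG lg ap]; split.
- exact: (L2Z mOm).
- by move=> j; apply: (L2Z mOm).
- exact: (L2Z mT).
move=> e e0; have z1 : 0 < nc z + 1 by rewrite ltr_wpDl ?nc_ge0.
have [phi tp [p1 p2 p3]] := ap _ (divr_gt0 e0 z1).
exists (fun x => z * phi x); first exact: tfZ.
have lp := tf_L2Om tp; have lpj j := tf_L2Om (tf_partial j tp).
have lp0 := tf_L2 (tf_rcons 0 tp).
have H (a : R) : 0 <= a -> a < e / (nc z + 1) -> nc z * a < e.
  move=> a0; rewrite ltr_pdivlMr// => ae; rewrite (le_lt_trans _ ae)//.
  by rewrite mulrC ler_wpM2l// lerDl.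
split=> [|j|].
- rewrite (@eq_n2 _ _ _ mu Om _ (fun x => z * (v x - phi x))) => [|x _]; last by ring.
  by rewrite (n2Z mOm _ (L2B mOm lv lp)) H ?n2_ge0.
- rewrite (@eq_n2 _ _ _ mu Om _ (fun x => z * (G j x - partial j phi x))) => [|x _].
    by rewrite (n2Z mOm _ (L2B mOm (lG j) (lpj j))) H ?n2_ge0.
  by rewrite partialZ; [ring|exact: tf_smooth].
- rewrite (@eq_n2 _ _ _ nu setT _ (fun x => z * (g x - phi (rV_rcons x 0)))) => [|x _]; last by ring.
  by rewrite (n2Z mT _ (L2B mT lg lp0)) H ?n2_ge0.
Qed.

Lemma rcons0Z (a : R) (x : W) : rV_rcons (a *: x) 0 = a *: rV_rcons x 0.
Proof.
apply/rowP => i; rewrite !mxE; case: (unlift ord_max i) => [j|]; first by rewrite mxE.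
by rewrite mulr0.
Qed.

(** A derivative brings out one more factor [e^t], hence the exponent [c + 1] on the gradient; the
    trace keeps [c] because dilations map the boundary to itself. *)
Lemma XS_dil c t v G g : XS v G g ->
  XS (dil c t v) (fun j => dil (c + 1) t (G j)) (dil c t g).
Proof.
move=> X; have [phi [tp cv cG cg]] := XS_seq X; have [lv lG lg _] := X.
have a0 := expR_gt0 t.
have dilT (a : R) (x : W) : 0 < a -> setT (a *: x) <-> setT x by [].
have L2d c' f : L2O f -> L2O (dil c' t f).
  by move=> lf; apply: (L2Z mOm); exact: (L2_dil mOm (@half_space_dil R d) a0 lf).
have L2d' c' f : L2 nu setT f -> L2 nu setT (dil c' t f).
  by move=> lf; apply: (L2Z mT); exact: (L2_dil mT dilT a0 lf).
have scale n' (D : set 'rV[R]_n') (mD : measurable D)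
    (Dd : forall (a : R) x, 0 < a -> D (a *: x) <-> D x) c' (f_ : nat -> 'rV[R]_n' -> R[i]) f :
    (forall k, L2 (lebesgue_rV R n') D (f_ k)) -> L2 (lebesgue_rV R n') D f ->
    cvg2 (lebesgue_rV R n') D f_ f ->
    cvg2 (lebesgue_rV R n') D (fun k => dil c' t (f_ k)) (dil c' t f).
  move=> lf_ lf cf.
  (* With [q = e^{-n' t}] the dilation contributes [sqrt q] to the norm; [q + 1] bounds it without a
     square root. *)
  pose K := expR (c' * t) * (expR t ^- n' + 1).
  apply: (@cvg0_le _ _ (fun k => K * n2 (lebesgue_rV R n') D (fun x => f_ k x - f x))).
    move=> k; rewrite n2_ge0/=.
    have lb := L2B mD (lf_ k) lf.
    rewrite (@eq_n2 _ _ _ _ D _ (fun x => (expR (c' * t))%:C *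
      (fun y => f_ k y - f y) (expR t *: x))) => [|x _]; last by rewrite /dil; ring.
    rewrite (n2Z mD _ (L2_dil mD Dd a0 lb)) nc_real gtr0_norm ?expR_gt0// /K -mulrA.
    rewrite ler_wpM2l ?expR_ge0//.
    rewrite -(@ler_pXn2r _ 2) ?nnegrE ?mulr_ge0 ?addr_ge0 ?n2_ge0 ?invr_ge0 ?exprn_ge0 ?expR_ge0//.
    have p0 : 0 < expR t ^+ n' by rewrite exprn_gt0.
    have E := n2_dil mD Dd a0 lb.
    rewrite exprMn E mulrA ler_peMl ?sqr_ge0//.
    move: (expR t ^+ n') p0 => p p0.
    have q0 : 0 < p^-1 by rewrite invr_gt0.
    have pq : p^-1 * p = 1 by rewrite mulVf ?gt_eqF.
    move: p^-1 q0 pq => q q0 pq.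
    rewrite (_ : (q + 1) ^+ 2 * p = q * (q * p) + 2 * (q * p) + p); last by ring.
    by rewrite pq; lra.
  by rewrite -[X in _ --> X](mulr0 K); apply: cvgM => //; exact: cvg_cst.
apply: (@XS_closed_seq (fun k => dil c t (phi k)) (fun k j => dil (c + 1) t (partial j (phi k)))
  (fun k => dil c t (fun x => phi k (rV_rcons x 0)))).
- exact: L2d.
- by move=> j; exact: L2d.
- exact: L2d'.
- move=> k; have := XS_tf (tf_dil c t (tp k)).
  have -> : (fun j => partial j (dil c t (phi k))) = (fun j => dil (c + 1) t (partial j (phi k))).
    by apply/funext => j; apply/funext => x; rewrite partial_dil//; exact: tf_smooth.
  have -> // : (fun x : W => dil c t (phi k) (rV_rcons x 0)) = dil c t (fun x => phi k (rV_rcons x 0)).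
  by apply/funext => x; rewrite /dil rcons0Z.
- by apply: (scale _ _ mOm (@half_space_dil R d)) => // k; exact: tf_L2Om.
- move=> j; apply: (scale _ _ mOm (@half_space_dil R d)) => //.
  by move=> k; apply: tf_L2Om; exact: tf_partial.
- apply: (scale _ _ mT dilT) => //.
  by move=> k; apply: tf_L2; exact: tf_rcons.
Qed.

Definition xh (j : 'I_n) (x : V) : R := x ord0 j / enorm x.

Lemma xh_bnd j x : `|xh j x| <= 1.
Proof.
rewrite /xh; have [->|x0] := eqVneq (enorm x) 0; first by rewrite invr0 mulr0 normr0.
have x1 : 0 < enorm x by rewrite lt_neqAle eq_sym x0 enorm_ge0.
by rewrite normrM normfV [`|enorm x|]gtr0_norm// ler_pdivrMr// mul1r coord_enorm.
Qed.

Lemma rdel_cvg k (x : 'rV[R]_k) : (fun l => rdel (hseq R l) x) @ \oo --> enorm x.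
Proof.
have -> : enorm x = Num.sqrt (dot x x + 0 ^+ 2) by rewrite expr0n/= addr0.
apply: continuous_cvg; first exact: sqrt_continuous.
apply: cvgD; first exact: cvg_cst.
apply: (@cvg_comp _ _ _ (hseq R) (fun y : R => y ^+ 2)); first exact: hseq_cvg.
exact: exprn_continuous.
Qed.

(** Discontinuous at the origin, so obtained as a pointwise limit of the smooth [x_j / rdel]; at the
    origin both are 0, the inverse of 0 being 0. *)
Lemma meas_xh j : measurable_fun setT (xh j).
Proof.
have e0 := hseq_gt0 R.
apply: (@measurable_fun_cvg _ _ _ _ (fun k (x : V) => x ord0 j / rdel (hseq R k) x)) => //.
  move=> k; apply: continuous_rV_measurable.
  have [] // := @CkM _ _ 0%N (fun x : V => x ord0 j) (fun x => (rdel (hseq R k) x)^-1) (Ck_coord R 0 j) _.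
  by apply: Ck_inv; [move=> x; rewrite gt_eqF// rdel_gt0|exact: Ck_rdel].
move=> x _; rewrite /xh; have [x0|x0] := eqVneq (enorm x) 0.
  have -> : x ord0 j = 0.
    by apply/eqP; rewrite -normr_eq0 eq_le normr_ge0 andbT -x0 coord_enorm.
  by rewrite mul0r; under eq_fun do rewrite mul0r; exact: cvg_cst.
by apply: cvgM; [exact: cvg_cst|apply: cvgV => //; exact: rdel_cvg].
Qed.

Section mult.
Variables (m m' : R -> R[i]) (C : R) (mm : multiplier m m' C).

Lemma mult_meas k (f : 'rV[R]_k -> R) : measurable_fun setT f ->
  cmeasurable setT (fun x => m (f x)) /\ cmeasurable setT (fun x => m' (f x)).
Proof.
move=> mf.
have H (P : R[i] -> R) (h : R -> R[i]) :
    (forall (u : R^nat) a, u @ \oo --> (a : R) -> (fun k => P (h (u k))) @ \oo --> P (h a)) ->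
    measurable_fun setT (fun x => P (h (f x))).
  move=> ch; apply: (measurableT_comp (f := fun s => P (h s))) => //.
  apply: continuous_measurable_fun => a; apply/(@cvg_nbhsP _ R^o) => u ua.
  exact: ch.
split; split; apply: H => u a ua.
- by have /ccvgP[] := mult_cvg mm ua.
- by have /ccvgP[] := mult_cvg mm ua.
- by have /ccvgP[] := mult_cvg' mm ua.
- by have /ccvgP[] := mult_cvg' mm ua.
Qed.

Lemma tf_mult e (phi : V -> R[i]) : 0 < e -> tf phi -> tf (fun x => m (rdel e x) * phi x).
Proof.
move=> e0 tp; apply: tfM => //; apply: (mult_smooth mm) => k; exact: Ck_rdel.
Qed.

Lemma partial_mult e (phi : V -> R[i]) j (x : V) : 0 < e -> tf phi ->
  partial j (fun x => m (rdel e x) * phi x) x =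
  m (rdel e x) * partial j phi x + m' (rdel e x) * (x ord0 j / rdel e x)%:C * phi x.
Proof.
move=> e0 tp; have Cr k := @Ck_rdel R n e k e0.
rewrite partialM; [|exact: (mult_smooth mm)|exact: tf_smooth].
by rewrite (mult_partial mm) ?derive_rdel.
Qed.

Lemma box_enorm k (M : R) (x : 'rV[R]_k) : 0 <= M -> rV_box M x -> enorm x <= k%:R * M.
Proof.
move=> M0 xM; rewrite (le_trans (enorm_le_sum x))//.
rewrite (@le_trans _ _ (\sum_(j < k) M))//; first by apply: ler_sum => j _; exact: xM.
by rewrite sumr_const card_ord mulr_natl.
Qed.

(** With [|x|] smoothed into [rdel] the products are test functions, and they converge by domination
    on a bounded support; the origin, where [xh] is singular, is not in the open half-space. The
    weight [om] is 1 for the form norm and [|x|^{1/2}] for the weighted norm. *)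
Lemma mult_tf_cvg (om : V -> R) (phi : V -> R[i]) : tf phi -> measurable_fun setT om ->
  (forall x, 0 <= om x <= 1 + enorm x) ->
  cvg2O (fun k x => (om x)%:C * (m (rdel (hseq R k) x) * phi x))
    (fun x => (om x)%:C * (m (enorm x) * phi x)) /\
  forall j, cvg2O
    (fun k x => (om x)%:C * partial j (fun x => m (rdel (hseq R k) x) * phi x) x)
    (fun x => (om x)%:C * (m (enorm x) * partial j phi x + m' (enorm x) * (xh j x)%:C * phi x)).
Proof.
move=> tp mom omb.
have C0 : 0 <= C by rewrite (le_trans _ (mult_bnd mm (lexx 0))) ?nc_ge0.
have mden : measurable_fun setT (@enorm R n) by exact: measurable_enorm.
have [mm1 mm2] := mult_meas mden.
have dom (f_ : nat -> V -> R[i]) (f : V -> R[i]) (K M : R) : 0 <= K -> 0 <= M ->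
    (forall k, cmeasurable Om (f_ k)) -> cmeasurable Om f ->
    (forall x, Om x -> ccvg (f_ ^~ x) (f x)) ->
    (forall k x, Om x -> nc (f_ k x) <= K) -> (forall k x, ~ rV_box M x -> f_ k x = 0) ->
    cvg2O (fun k x => (om x)%:C * f_ k x) (fun x => (om x)%:C * f x).
  move=> K0 M0 mf_ mf ff fK fM.
  have momO : cmeasurable Om (fun x => (om x)%:C) by apply: cmeas_real; exact: measurable_funTS.
  apply: (@cvg2_dominated _ _ _ mu Om mOm _ _
    (fun x => (1 + n%:R * M) * K * \1_(rV_box M) x)).
  - by move=> k; apply: cmeasM => //; exact: mOm.
  - by apply: cmeasM => //; exact: mOm.
  - by move=> x Ox; apply: ccvgM; [exact: ccvg_cst|exact: ff].
  - apply: integrableS (@box_integrable _ _ _ M (((1 + n%:R * M) * K) ^+ 2) _ _ _) => //; first exact: mOm.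
    + apply: measurable_funX; apply: measurable_funM => //.
      by apply: measurable_indic; exact: measurable_rV_box.
    + move=> x; rewrite exprMn normrM [`|_ ^+ 2|]ger0_norm ?sqr_ge0// indicE.
      by case: (x \in _); rewrite ?expr1n ?expr0n ?normr1 ?normr0 ?mulr1 ?mulr0// sqr_ge0.
    + by move=> x xM; rewrite indicE memNset// mulr0 expr0n.
  - move=> k x Ox; rewrite indicE; have [xB|xB] := pselect (rV_box M x); last first.
      by rewrite fM// mulr0 Normc.normc0 memNset// mulr0.
    rewrite mem_set// mulr1 ncM nc_real; have /andP [w0 w1] := omb x.
    rewrite ger0_norm// ler_pM ?nc_ge0 ?fK// (le_trans w1)// lerD2l.
    exact: box_enorm.
have [Cp Cp0 CpP] := tf_bnd tp; have [M M0 MP] := tf_box tp.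
have mdel k : measurable_fun setT (@rdel R n (hseq R k)).
  by apply: continuous_rV_measurable; have [] := @Ck_rdel R n (hseq R k) 0 (hseq_gt0 R k).
have rd0 k (x : V) : 0 <= rdel (hseq R k) x by rewrite ltW// rdel_gt0// hseq_gt0.
have tpm := tf_meas tp.
split.
  apply: (dom _ _ (C * Cp) M) => //.
  - exact: mulr_ge0.
  - move=> k; apply: cmeas_sub.
    by apply: tf_meas; apply: tf_mult => //; exact: hseq_gt0.
  - apply: cmeas_sub.
    by apply: cmeasM => //; exact: mT.
  - move=> x Ox; apply: ccvgM; last exact: ccvg_cst.
    by apply: (mult_cvg mm); exact: rdel_cvg.
  - by move=> k x Ox; rewrite ncM ler_pM ?nc_ge0 ?(mult_bnd mm).
  - by move=> k x xM; rewrite MP// mulr0.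
move=> j; have tpj := tf_partial j tp.
have [Cj Cj0 CjP] := tf_bnd tpj; have [Mj Mj0 MjP] := tf_box tpj.
apply: (dom _ _ (C * Cj + C * Cp) (M + Mj)).
- by rewrite addr_ge0// mulr_ge0.
- exact: addr_ge0.
- move=> k; apply: cmeas_sub.
  by apply: tf_meas; apply: tf_partial; apply: tf_mult => //; exact: hseq_gt0.
- apply: cmeas_sub.
  apply: cmeasD.
    by apply: cmeasM => //; exact: tf_meas.
  apply: cmeasM => //; apply: cmeasM => //.
  by apply: cmeas_real; exact: meas_xh.
- move=> x Ox; have r0 := half_space_enorm Ox.
  rewrite (_ : (fun k => _) = (fun k => m (rdel (hseq R k) x) * partial j phi x +
      m' (rdel (hseq R k) x) * (x ord0 j / rdel (hseq R k) x)%:C * phi x)); last first.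
    by apply/funext => k; rewrite partial_mult// hseq_gt0.
  have rc := @rdel_cvg n x.
  apply: ccvgD; apply: ccvgM; try exact: ccvg_cst.
    exact: (mult_cvg mm).
  apply: ccvgM; first exact: (mult_cvg' mm).
  apply: ccvg_real; apply: cvgM; first exact: cvg_cst.
  by apply: cvgV => //; rewrite gt_eqF.
- move=> k x Ox; rewrite partial_mult ?hseq_gt0// (le_trans (le_normcD _ _))// lerD//.
    by rewrite ncM ler_pM ?nc_ge0 ?(mult_bnd mm).
  rewrite !ncM ler_pM ?mulr_ge0 ?nc_ge0//.
  rewrite -[leRHS]mulr1 ler_pM ?nc_ge0 ?(mult_bnd' mm)// nc_real normrM normfV.
  rewrite [`|rdel _ x|]ger0_norm// ler_pdivrMr ?rdel_gt0 ?hseq_gt0// mul1r.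
  by rewrite (le_trans (coord_enorm _ _))// enorm_rdel.
- move=> k x xM; rewrite partial_mult ?hseq_gt0// MjP; last first.
    by move=> h; apply: xM => i; rewrite (le_trans (h i))// lerDr.
  rewrite MP ?mulr0 ?addr0//.
  by move=> h; apply: xM => i; rewrite (le_trans (h i))// lerDl.
Qed.

Lemma mult_trace_cvg (phi : V -> R[i]) : tf phi ->
  cvg2 nu setT (fun k x => m (rdel (hseq R k) (rV_rcons x 0)) * phi (rV_rcons x 0))
    (fun x => m (enorm x) * phi (rV_rcons x 0)).
Proof.
move=> tp; have tg := tf_rcons 0 tp.
have C0 : 0 <= C by rewrite (le_trans _ (mult_bnd mm (lexx 0))) ?nc_ge0.
have [Cp Cp0 CpP] := tf_bnd tg; have [M M0 MP] := tf_box tg.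
have [mm1 mm2] := mult_meas (measurable_enorm (R := R) (n := d)).
apply: (@cvg2_dominated _ _ _ nu setT mT _ _ (fun x => C * Cp * \1_(rV_box M) x)).
- move=> k; have := tf_rcons 0 (tf_mult (hseq_gt0 R k) tp).
  exact: tf_meas.
- apply: (@cmeasM _ _ _ setT (fun x : W => m (enorm x)) _ mm1).
  exact: tf_meas.
- move=> x _; apply: ccvgM; last exact: ccvg_cst.
  apply: (mult_cvg mm); under eq_fun do rewrite rdel_rcons0; exact: rdel_cvg.
- apply: (@box_integrable _ _ _ M ((C * Cp) ^+ 2)).
  + apply: measurable_funX; apply: measurable_funM => //.
    by apply: measurable_indic; exact: measurable_rV_box.
  + move=> x; rewrite exprMn normrM [`|_ ^+ 2|]ger0_norm ?sqr_ge0// indicE.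
    by case: (x \in _); rewrite ?expr1n ?expr0n ?normr1 ?normr0 ?mulr1 ?mulr0// sqr_ge0.
  + by move=> x xM; rewrite indicE memNset// mulr0 expr0n.
- move=> k x _; rewrite indicE; have [xB|xB] := pselect (rV_box M x); last first.
    by rewrite MP// mulr0 Normc.normc0 memNset// mulr0.
  rewrite mem_set// mulr1 ncM ler_pM ?nc_ge0// ?(mult_bnd mm)//.
  exact: sqrtr_ge0.
Qed.

Lemma L2_mult k (D : set 'rV[R]_k) (mD : measurable D) f :
  L2 (lebesgue_rV R k) D f -> L2 (lebesgue_rV R k) D (fun x => m (enorm x) * f x).
Proof.
move=> lf; have [mm1 mm2] := mult_meas (measurable_enorm (R := R) (n := k)).
apply: (@L2_bnd _ _ _ _ D mD C) => //; first exact: cmeas_sub.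
by move=> x _; apply: (mult_bnd mm); exact: enorm_ge0.
Qed.

Lemma L2_mult' j f : L2O f -> L2O (fun x => m' (enorm x) * (xh j x)%:C * f x).
Proof.
move=> lf; have [mm1 mm2] := mult_meas (measurable_enorm (R := R) (n := n)).
have C0 : 0 <= C by rewrite (le_trans _ (mult_bnd mm (lexx 0))) ?nc_ge0.
apply: (@L2_bnd _ _ _ _ Om mOm C) => //.
  apply: cmeas_sub.
  by apply: cmeasM => //; apply: cmeas_real; exact: meas_xh.
move=> x _; rewrite ncM -[leRHS]mulr1 ler_pM ?nc_ge0//.
  by apply: (mult_bnd' mm); exact: enorm_ge0.
by rewrite nc_real xh_bnd.
Qed.

(** Two approximations, as [m(|x|)] need not be smooth at the origin: for a test function [|x|] is
    smoothed into [rdel]; then test functions are replaced by their limits, thanks to the bounds on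
    [m] and [m']. *)
Lemma XS_mult v G g : XS v G g ->
  XS (fun x => m (enorm x) * v x)
     (fun j x => m (enorm x) * G j x + m' (enorm x) * (xh j x)%:C * v x)
     (fun x => m (enorm x) * g x).
Proof.
have base phi : tf phi -> XS (fun x => m (enorm x) * phi x)
     (fun j x => m (enorm x) * partial j phi x + m' (enorm x) * (xh j x)%:C * phi x)
     (fun x => m (enorm x) * phi (rV_rcons x 0)).
  move=> tp; have lp := tf_L2Om tp.
  have om1 (x : V) : 0 <= (1 : R) <= 1 + enorm x by rewrite ler01/= lerDl enorm_ge0.
  have [c1 c2] := mult_tf_cvg tp (measurable_cst (1 : R)) om1.
  apply: (@XS_closed_seq (fun k x => m (rdel (hseq R k) x) * phi x)
    (fun k j => partial j (fun x => m (rdel (hseq R k) x) * phi x))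
    (fun k x => m (rdel (hseq R k) (rV_rcons x 0)) * phi (rV_rcons x 0))).
  - exact: (L2_mult mOm).
  - move=> j; apply: (L2D mOm); last exact: L2_mult'.
    by apply: (L2_mult mOm); apply: tf_L2Om; exact: tf_partial.
  - by apply: (L2_mult mT); apply: tf_L2; exact: tf_rcons.
  - by move=> k; apply: XS_tf; apply: tf_mult => //; exact: hseq_gt0.
  - by move: c1; rewrite /cvg2; under eq_fun do under eq_n2 do rewrite !mul1r.
  - by move=> j; move: (c2 j); rewrite /cvg2; under eq_fun do under eq_n2 do rewrite !mul1r.
  - exact: mult_trace_cvg.
move=> X; have [lv lG lg _] := X; have [phi [tp cv cG cg]] := XS_seq X.
have [mm1 mm2] := mult_meas (measurable_enorm (R := R) (n := n)).
have [nn1 nn2] := mult_meas (measurable_enorm (R := R) (n := d)).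
have mO1 : cmeasurable Om (fun x => m (enorm x)) by apply: cmeas_sub => //; exact: mOm.
have lp k := tf_L2Om (tp k); have lpj j k := tf_L2Om (tf_partial j (tp k)).
have lp0 k := tf_L2 (tf_rcons 0 (tp k)).
have b1 (x : V) : Om x -> nc (m (enorm x)) <= C.
  by move=> _; apply: (mult_bnd mm); exact: enorm_ge0.
apply: (@XS_closed_seq (fun k x => m (enorm x) * phi k x)
  (fun k j x => m (enorm x) * partial j (phi k) x + m' (enorm x) * (xh j x)%:C * phi k x)
  (fun k x => m (enorm x) * phi k (rV_rcons x 0))).
- exact: (L2_mult mOm).
- by move=> j; apply: (L2D mOm); [exact: (L2_mult mOm)|exact: L2_mult'].
- exact: (L2_mult mT).
- by move=> k; exact: base.
- exact: (cvg2_bnd mOm mO1 b1).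
- move=> j; apply: (cvg2D mOm).
  + by move=> k; exact: (L2_mult mOm).
  + exact: (L2_mult mOm).
  + by move=> k; exact: L2_mult'.
  + exact: L2_mult'.
  + exact: (cvg2_bnd mOm mO1 b1).
  + apply: (cvg2_bnd (C := C) mOm) => //.
      apply: cmeas_sub.
      by apply: cmeasM => //; apply: cmeas_real; exact: meas_xh.
    have C0 : 0 <= C by rewrite (le_trans _ (mult_bnd mm (lexx 0))) ?nc_ge0.
    move=> x _; rewrite ncM -[leRHS]mulr1 ler_pM ?nc_ge0//.
      by apply: (mult_bnd' mm); exact: enorm_ge0.
    by rewrite nc_real xh_bnd.
- apply: (cvg2_bnd (C := C) mT) => //.
  by move=> x _; apply: (mult_bnd mm); exact: enorm_ge0.
Qed.

End mult.

Definition sqr_r (x : V) : R[i] := (Num.sqrt (enorm x))%:C.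

Lemma measurable_sqrt_enorm : measurable_fun setT (fun x : V => Num.sqrt (enorm x)).
Proof.
apply: continuous_rV_measurable => x.
by apply: (continuous_comp (@enorm_continuous R n x)); exact: sqrt_continuous.
Qed.

Lemma meas_sqr_r (D : set V) : cmeasurable D sqr_r.
Proof. by apply: cmeas_sub; apply: cmeas_real; exact: measurable_sqrt_enorm. Qed.

Lemma sqrt_le1D (s : R) : 0 <= s -> Num.sqrt s <= 1 + s.
Proof.
move=> s0; rewrite -[leRHS]ger0_norm ?addr_ge0// -sqrtr_sqr ler_wsqrtr//.
by rewrite sqrrD expr1n mul1r; have := sqr_ge0 s; lra.
Qed.

Lemma tf_weighted phi j : tf phi -> L2O (fun x => sqr_r x * partial j phi x).
Proof.
move=> tp; have tj := tf_partial j tp; have [M M0 MP] := tf_box tj.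
have [C C0 CP] := tf_bnd tj.
apply: L2_sub; first exact: mOm.
apply: (@box_L2 _ _ _ M ((1 + n%:R * M) * C)).
+ by apply: cmeasM; [exact: meas_sqr_r|exact: tf_meas].
+ move=> x; have [xM|/MP ->] := pselect (rV_box M x); last first.
    by rewrite mulr0 Normc.normc0 mulr_ge0// addr_ge0// mulr_ge0.
  rewrite ncM ler_pM ?nc_ge0// nc_real ger0_norm ?sqrtr_ge0//.
  rewrite (le_trans (sqrt_le1D (enorm_ge0 x)))// lerD2l.
  exact: box_enorm.
+ by move=> x /MP ->; rewrite mulr0.
Qed.

Definition XW v G g := [/\ L2O v, forall j, L2O (G j), L2 nu setT g &
  forall j, L2O (fun x => sqr_r x * G j x)].

(** The form distance plus that of the gradients weighted by [|x|^{1/2}], which the limits of the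
    weighted radial terms call for. *)
Definition wdist v G g v' G' g' : R :=
  n2O (fun x => v x - v' x) + \sum_(j < n) n2O (fun x => G j x - G' j x) +
  n2 nu setT (fun x => g x - g' x) +
  \sum_(j < n) n2O (fun x => sqr_r x * G j x - sqr_r x * G' j x).

Lemma wdist_tri v1 G1 g1 v2 G2 g2 v3 G3 g3 : XW v1 G1 g1 -> XW v2 G2 g2 -> XW v3 G3 g3 ->
  wdist v1 G1 g1 v3 G3 g3 <= wdist v1 G1 g1 v2 G2 g2 + wdist v2 G2 g2 v3 G3 g3.
Proof.
move=> [a1 a2 a3 a4] [b1 b2 b3 b4] [c1 c2 c3 c4].
have h1 := n2_tri mOm a1 b1 c1; have h3 := n2_tri mT a3 b3 c3.
have h2 : \sum_(j < n) n2O (fun x => G1 j x - G3 j x) <=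
    \sum_(j < n) n2O (fun x => G1 j x - G2 j x) + \sum_(j < n) n2O (fun x => G2 j x - G3 j x).
  by rewrite -big_split/=; apply: ler_sum => j _; exact: (n2_tri mOm (a2 j) (b2 j) (c2 j)).
have h4 : \sum_(j < n) n2O (fun x => sqr_r x * G1 j x - sqr_r x * G3 j x) <=
    \sum_(j < n) n2O (fun x => sqr_r x * G1 j x - sqr_r x * G2 j x) +
    \sum_(j < n) n2O (fun x => sqr_r x * G2 j x - sqr_r x * G3 j x).
  by rewrite -big_split/=; apply: ler_sum => j _; exact: (n2_tri mOm (a4 j) (b4 j) (c4 j)).
have := lerD (lerD (lerD h1 h2) h3) h4.
rewrite /wdist => /le_trans h; apply: h.
suff E (a b c e a' b' c' e' : R) : a + a' + (b + b') + (c + c') + (e + e') =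
  a + b + c + e + (a' + b' + c' + e') by rewrite E.
by ring.
Qed.

Lemma cvg0_ex (u : R^nat) (e : R) : u @ \oo --> (0 : R) -> 0 < e -> exists k, u k < e.
Proof.
move=> /cvgrPdist_lt h /h [N _ /(_ N (leqnn N))]; rewrite sub0r normrN => h'.
by exists N; rewrite (le_lt_trans (ler_norm _)).
Qed.

Lemma cvg0_sum (I : Type) (s : seq I) (u : I -> R^nat) :
  (forall i, u i @ \oo --> (0 : R)) -> (fun k => \sum_(i <- s) u i k) @ \oo --> (0 : R).
Proof.
move=> u0; elim: s => [|i s ih].
  by under eq_fun do rewrite big_nil; exact: cvg_cst.
under eq_fun do rewrite big_cons; have := cvgD (u0 i) ih; rewrite addr0; exact.
Qed.

Lemma wdist_cvg (v_ : nat -> V -> R[i]) (G_ : nat -> 'I_n -> V -> R[i]) (g_ : nat -> W -> R[i])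
    v G g (e : R) : cvg2O v_ v -> (forall j, cvg2O (fun k => G_ k j) (G j)) ->
  cvg2 nu setT g_ g ->
  (forall j, cvg2O (fun k x => sqr_r x * G_ k j x) (fun x => sqr_r x * G j x)) ->
  0 < e -> exists k, wdist v G g (v_ k) (G_ k) (g_ k) < e.
Proof.
move=> cv cG cg cw; apply: cvg0_ex; rewrite /wdist.
have C n' (D : set 'rV[R]_n') (f_ : nat -> 'rV[R]_n' -> R[i]) f : cvg2 (lebesgue_rV R n') D f_ f ->
    (fun k => n2 (lebesgue_rV R n') D (fun x => f x - f_ k x)) @ \oo --> (0 : R).
  by rewrite /cvg2 => h; under eq_fun do rewrite n2BC.
have c1 := C _ _ _ _ cv; have c3 := C _ _ _ _ cg.
have c2 := cvg0_sum (index_enum 'I_n) (fun j => C _ _ _ _ (cG j)).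
have c4 := cvg0_sum (index_enum 'I_n) (fun j => C _ _ _ _ (cw j)).
by have := cvgD (cvgD (cvgD c1 c2) c3) c4; rewrite !addr0; exact.
Qed.

Section exp_multiplier.
Variable eta : R.
Hypothesis eta0 : 0 < eta.

Definition em (s : R) : R[i] := (expR (- eta * s))%:C.
Definition em' (s : R) : R[i] := (- eta * expR (- eta * s))%:C.

Let mm : multiplier em em' (1 + eta). Proof. exact: mult_expR (ltW eta0). Qed.

Definition emv v x : R[i] := em (enorm x) * v x.
Definition emG v G j x : R[i] := em (enorm x) * G j x + em' (enorm x) * (xh j x)%:C * v x.

Lemma meas_em k (D : set 'rV[R]_k) : cmeasurable D (fun x : 'rV[R]_k => em (enorm x)).
Proof. by apply: cmeas_sub; have [] := mult_meas mm (@measurable_enorm R k). Qed.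

Lemma meas_em' j (D : set V) : cmeasurable D (fun x => em' (enorm x) * (xh j x)%:C).
Proof.
apply: cmeas_sub; have [_ h] := mult_meas mm (@measurable_enorm R n).
by apply: cmeasM => //; apply: cmeas_real; exact: meas_xh.
Qed.

Lemma nc_em s : 0 <= s -> nc (em s) <= 1.
Proof.
move=> s0; rewrite nc_real ger0_norm ?expR_ge0// -expR0 ler_expR mulNr oppr_le0.
by rewrite mulr_ge0// ltW.
Qed.

Lemma nc_em' j (x : V) : nc (em' (enorm x) * (xh j x)%:C) <= eta.
Proof.
rewrite ncM -[leRHS]mulr1 ler_pM ?nc_ge0//; last by rewrite nc_real xh_bnd.
rewrite /em' nc_real normrM normrN (gtr0_norm eta0) -[leRHS]mulr1 ler_wpM2l ?(ltW eta0)//.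
by rewrite -nc_real; apply: nc_em; exact: enorm_ge0.
Qed.

(** The exponential absorbs the weight at the price of a constant depending on [eta]; for fixed
    [eta], unweighted convergence then yields weighted convergence of the cut-off functions. *)
Lemma nc_sqr_em x : nc (sqr_r x * em (enorm x)) <= 1 + eta^-1.
Proof.
have s0 := enorm_ge0 x; rewrite /sqr_r; move: (enorm x) s0 => s s0.
rewrite ncM /em !nc_real !ger0_norm ?expR_ge0 ?sqrtr_ge0//.
apply: (@le_trans _ _ ((1 + s) * expR (- eta * s))).
  apply: ler_wpM2r; first exact: expR_ge0.
  exact: sqrt_le1D.
rewrite [in leLHS]mulrDl mul1r lerD//; last exact: rho_bnd.
by rewrite -[leLHS]ger0_norm ?expR_ge0// -nc_real; exact: nc_em.
Qed.

(** With [s = |x|], the square of the left side is at most [eta (eta s) e^{-2 eta s}], and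
    [eta s <= e^{2 eta s}]. Unlike that of [nc_sqr_em], this bound vanishes with [eta], so the
    derivative of the cut-off disappears from the weighted norm. *)
Lemma nc_sqr_em' j x : nc (sqr_r x * (em' (enorm x) * (xh j x)%:C)) <= Num.sqrt eta.
Proof.
have s0 := enorm_ge0 x; rewrite /sqr_r !ncM mulrA -[leRHS]mulr1.
rewrite ler_pM ?mulr_ge0 ?nc_ge0//; last by rewrite nc_real xh_bnd.
move: (enorm x) s0 => s s0.
rewrite /em' !nc_real normrM normrN (ger0_norm (sqrtr_ge0 _)) (gtr0_norm eta0) ger0_norm ?expR_ge0//.
rewrite -[leLHS]ger0_norm ?mulr_ge0 ?sqrtr_ge0 ?expR_ge0 ?(ltW eta0)//.
rewrite -sqrtr_sqr ler_wsqrtr// !exprMn sqr_sqrtr//.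
have h := expR_ge1Dx (eta * s); have p0 : 0 <= eta * s by rewrite mulr_ge0// ltW.
rewrite mulNr expRN; move: (expR _) h (expR_gt0 (eta * s)) => E h E0.
rewrite exprVn mulrA ler_pdivrMr ?exprn_gt0//.
have h2 : eta * s <= E ^+ 2.
  by rewrite (@le_trans _ _ E)//; [lra|rewrite expr2 ler_peMl//; [exact: ltW|lra]].
rewrite (_ : _ * _ = eta * (eta * s)); [by rewrite ler_pM2l|ring].
Qed.

Lemma sqr_emG v G j x : sqr_r x * emG v G j x =
  sqr_r x * em (enorm x) * G j x + sqr_r x * (em' (enorm x) * (xh j x)%:C) * v x.
Proof. by rewrite /emG; ring. Qed.

Lemma XW_em v G g : L2O v -> (forall j, L2O (G j)) -> L2 nu setT g ->
  XW (emv v) (emG v G) (fun x => em (enorm x) * g x).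
Proof.
move=> lv lG lg; split.
- exact: (L2_mult mm mOm).
- by move=> j; apply: (L2D mOm); [exact: (L2_mult mm mOm)|exact: (L2_mult' mm)].
- exact: (L2_mult mm mT).
- move=> j; rewrite (_ : (fun x => _) = fun x => sqr_r x * em (enorm x) * G j x +
    sqr_r x * (em' (enorm x) * (xh j x)%:C) * v x); last by apply/funext => x; exact: sqr_emG.
  apply: (L2D mOm).
    apply: (@L2_bnd _ _ _ _ Om mOm (1 + eta^-1)) => //; last by move=> x _; exact: nc_sqr_em.
    by apply: cmeasM; [exact: meas_sqr_r|exact: meas_em].
  apply: (@L2_bnd _ _ _ _ Om mOm (Num.sqrt eta)) => //; last by move=> x _; exact: nc_sqr_em'.
  by apply: cmeasM; [exact: meas_sqr_r|exact: meas_em'].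
Qed.

(** Since the cut-off tames the weight, approximants of [v] in the form norm, once cut off,
    approximate the cut-off [v] in the weighted norm; a second approximation replaces [|x|] by
    [rdel] to reach genuine test functions. *)
Lemma em_density v G g (e : R) : XS v G g -> 0 < e -> exists2 phi, tf phi &
  wdist (emv v) (emG v G) (fun x => em (enorm x) * g x)
    phi (fun j => partial j phi) (fun x => phi (rV_rcons x 0)) < e.
Proof.
move=> X e0; have [lv lG lg _] := X; have [phi [tp cv cG cg]] := XS_seq X.
have e2 : 0 < e / 2 by rewrite divr_gt0.
have lp k := tf_L2Om (tp k); have lpj k j := tf_L2Om (tf_partial j (tp k)).
have lp0 k := tf_L2 (tf_rcons 0 (tp k)).
have [k hk] : exists k, wdist (emv v) (emG v G) (fun x => em (enorm x) * g x)
    (emv (phi k)) (emG (phi k) (fun j => partial j (phi k)))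
    (fun x => em (enorm x) * phi k (rV_rcons x 0)) < e / 2.
  have b1 k' (D : set 'rV[R]_k') x : D x -> nc (em (enorm x)) <= 1.
    by move=> _; apply: nc_em; exact: enorm_ge0.
  apply: (@wdist_cvg (fun k => emv (phi k)) (fun k => emG (phi k) (fun j => partial j (phi k)))
    (fun k x => em (enorm x) * phi k (rV_rcons x 0))); last exact: e2.
  - exact: (cvg2_bnd mOm (@meas_em n Om) (b1 n Om)).
  - move=> j; apply: (cvg2D mOm).
    + by move=> k; exact: (L2_mult mm mOm).
    + exact: (L2_mult mm mOm).
    + by move=> k; exact: (L2_mult' mm).
    + exact: (L2_mult' mm).
    + exact: (cvg2_bnd mOm (@meas_em n Om) (b1 n Om)).
    + by apply: (cvg2_bnd (C := eta) mOm) => //; [exact: meas_em'|move=> x _; exact: nc_em'].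
  - exact: (cvg2_bnd mT (@meas_em d setT) (b1 d setT)).
  - move=> j; have mw1 : cmeasurable Om (fun x => sqr_r x * em (enorm x)).
      by apply: cmeasM; [exact: meas_sqr_r|exact: meas_em].
    have mw2 : cmeasurable Om (fun x => sqr_r x * (em' (enorm x) * (xh j x)%:C)).
      by apply: cmeasM; [exact: meas_sqr_r|exact: meas_em'].
    have bw1 x : Om x -> nc (sqr_r x * em (enorm x)) <= 1 + eta^-1 by move=> _; exact: nc_sqr_em.
    have bw2 x : Om x -> nc (sqr_r x * (em' (enorm x) * (xh j x)%:C)) <= Num.sqrt eta.
      by move=> _; exact: nc_sqr_em'.
    rewrite (_ : (fun x => sqr_r x * emG v G j x) = fun x =>
      sqr_r x * em (enorm x) * G j x + sqr_r x * (em' (enorm x) * (xh j x)%:C) * v x); last first.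
      by apply/funext => x; exact: sqr_emG.
    rewrite (_ : (fun k x => _) = fun k x =>
      sqr_r x * em (enorm x) * partial j (phi k) x +
      sqr_r x * (em' (enorm x) * (xh j x)%:C) * phi k x); last first.
      by apply/funext => k; apply/funext => x; exact: sqr_emG.
    apply: (cvg2D mOm).
    + by move=> k; exact: (L2_bnd mOm mw1 bw1).
    + exact: (L2_bnd mOm mw1 bw1).
    + by move=> k; exact: (L2_bnd mOm mw2 bw2).
    + exact: (L2_bnd mOm mw2 bw2).
    + exact: (cvg2_bnd mOm mw1 bw1).
    + exact: (cvg2_bnd mOm mw2 bw2).
have [l hl] : exists l, wdist (emv (phi k)) (emG (phi k) (fun j => partial j (phi k)))
    (fun x => em (enorm x) * phi k (rV_rcons x 0))
    (fun x => em (rdel (hseq R l) x) * phi k x)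
    (fun j => partial j (fun x => em (rdel (hseq R l) x) * phi k x))
    (fun x => em (rdel (hseq R l) (rV_rcons x 0)) * phi k (rV_rcons x 0)) < e / 2.
  have om1 (x : V) : 0 <= (1 : R) <= 1 + enorm x by rewrite ler01/= lerDl enorm_ge0.
  have om2 (x : V) : 0 <= Num.sqrt (enorm x) <= 1 + enorm x.
    by rewrite sqrtr_ge0 sqrt_le1D// enorm_ge0.
  have [c1 c2] := mult_tf_cvg mm (tp k) (measurable_cst (1 : R)) om1.
  have [_ c3] := mult_tf_cvg mm (tp k) measurable_sqrt_enorm om2.
  apply: (@wdist_cvg (fun l x => em (rdel (hseq R l) x) * phi k x)
    (fun l j => partial j (fun x => em (rdel (hseq R l) x) * phi k x))
    (fun l x => em (rdel (hseq R l) (rV_rcons x 0)) * phi k (rV_rcons x 0))); last exact: e2.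
  - by move: c1; rewrite /cvg2; under eq_fun do under eq_n2 do rewrite !mul1r.
  - by move=> j; move: (c2 j); rewrite /cvg2; under eq_fun do under eq_n2 do rewrite !mul1r.
  - exact: (mult_trace_cvg mm).
  - exact: c3.
have tl : tf (fun x => em (rdel (hseq R l) x) * phi k x).
  by apply: (tf_mult mm) => //; exact: hseq_gt0.
exists (fun x => em (rdel (hseq R l) x) * phi k x) => //.
have Xl : XW (fun x => em (rdel (hseq R l) x) * phi k x)
    (fun j => partial j (fun x => em (rdel (hseq R l) x) * phi k x))
    (fun x => em (rdel (hseq R l) (rV_rcons x 0)) * phi k (rV_rcons x 0)).
  split; first exact: tf_L2Om.
  - by move=> j; apply: tf_L2Om; exact: tf_partial.
  - by apply: tf_L2; exact: (tf_rcons 0 tl).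
  - by move=> j; exact: tf_weighted.
rewrite (le_lt_trans (wdist_tri (XW_em lv lG lg) (XW_em (lp k) (lpj k) (lp0 k)) Xl))//.
by rewrite (_ : e = e / 2 + e / 2); [exact: ltrD|field].
Qed.

End exp_multiplier.

(* the exponential cut-off makes the approximants of [XS] weighted *)
Lemma weighted_density v G g (e : R) : XS v G g -> (forall j, L2O (fun x => sqr_r x * G j x)) ->
  0 < e -> exists2 phi, tf phi &
  wdist v G g phi (fun j => partial j phi) (fun x => phi (rV_rcons x 0)) < e.
Proof.
move=> X lw e0; have [lv lG lg _] := X; have e2 : 0 < e / 2 by rewrite divr_gt0.
have X0 : XW v G g by [].
pose h k := hseq R k; have h0 k : 0 < h k by exact: hseq_gt0.
have cem k' (D : set 'rV[R]_k') (mD : measurable D) (f : 'rV[R]_k' -> R[i]) :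
    L2 (lebesgue_rV R k') D f ->
    cvg2 (lebesgue_rV R k') D (fun k x => em (h k) (enorm x) * f x) f.
  move=> lf; apply: (@cvg2_dominated _ _ _ _ D mD _ _ (fun x => nc (f x))).
  - by move=> k; apply: cmeasM; [exact: (meas_em (h0 k))|exact: L2_meas lf].
  - exact: L2_meas lf.
  - move=> x _; rewrite -[X in ccvg _ X]mul1r; apply: ccvgM; last exact: ccvg_cst.
    apply: (@ccvg_real _ (fun k => expR (- h k * enorm x)) 1).
    rewrite -[X in _ --> X]expR0; apply: (@continuous_cvg _ R^o R^o); first exact: continuous_expR.
    rewrite -[X in _ --> X](mul0r (enorm x)); apply: cvgM; last exact: cvg_cst.
    by rewrite -oppr0; apply: cvgN; exact: hseq_cvg.
  - by case: lf.
  - move=> k x _; rewrite ncM -[leRHS]mul1r ler_wpM2r ?nc_ge0//.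
    by apply: nc_em => //; exact: enorm_ge0.
have zero (F : nat -> V -> R[i]) (b : R^nat) : L2O v -> (forall k, cmeasurable Om (F k)) ->
    (forall k x, nc (F k x) <= b k) -> (forall k, 0 <= b k) -> b @ \oo --> (0 : R) ->
    cvg2O (fun k x => F k x * v x) (fun=> 0).
  move=> _ mF Fb b0 cb; apply: (@cvg0_le _ _ (fun k => b k * n2O v)).
    move=> k; rewrite n2_ge0/=; under eq_n2 do rewrite subr0.
    by apply: (n2_bnd mOm) => // x _; exact: Fb.
  by rewrite -[X in _ --> X](mul0r (n2O v)); apply: cvgM => //; exact: cvg_cst.
have L0 : L2O (fun=> 0 : R[i]) by exact: L2_0.
have [k hk] : exists k, wdist v G g (emv (h k) v) (emG (h k) v G)
    (fun x => em (h k) (enorm x) * g x) < e / 2.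
  have lE k := XW_em (h0 k) lv lG lg.
  apply: (@wdist_cvg (fun k => emv (h k) v) (fun k => emG (h k) v G)
    (fun k x => em (h k) (enorm x) * g x)) => //.
  - exact: (cem n _ mOm).
  - move=> j; rewrite /cvg2 -/(cvg2 _ _ _ _).
    rewrite (_ : G j = fun x => G j x + 0); last by apply/funext => x; rewrite addr0.
    apply: (cvg2D mOm (f_ := fun k x => em (h k) (enorm x) * G j x)
      (g_ := fun k x => em' (h k) (enorm x) * (xh j x)%:C * v x)) => //.
    + by move=> k; apply: (L2_mult (mult_expR (ltW (h0 k))) mOm).
    + by move=> k; apply: (L2_mult' (mult_expR (ltW (h0 k)))).
    + exact: (cem n _ mOm).
    + apply: (zero _ h) => //; [by move=> k; exact: meas_em'|by move=> k x; exact: nc_em'| |].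
        by move=> k; exact: ltW.
      exact: hseq_cvg.
  - exact: (cem d _ mT).
  - move=> j.
    rewrite (_ : (fun x => sqr_r x * G j x) = fun x => sqr_r x * G j x + 0); last first.
      by apply/funext => x; rewrite addr0.
    rewrite (_ : (fun k x => _) = fun k x => em (h k) (enorm x) * (sqr_r x * G j x) +
      sqr_r x * (em' (h k) (enorm x) * (xh j x)%:C) * v x); last first.
      by apply/funext => k; apply/funext => x; rewrite sqr_emG; ring.
    have mq k : cmeasurable Om (fun x => sqr_r x * (em' (h k) (enorm x) * (xh j x)%:C)).
      by apply: cmeasM; [exact: meas_sqr_r|exact: meas_em'].
    apply: (cvg2D mOm (f_ := fun k x => em (h k) (enorm x) * (sqr_r x * G j x))
      (g_ := fun k x => sqr_r x * (em' (h k) (enorm x) * (xh j x)%:C) * v x)) => //.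
    + by move=> k; apply: (L2_mult (mult_expR (ltW (h0 k))) mOm).
    + move=> k; apply: (@L2_bnd _ _ _ _ Om mOm (Num.sqrt (h k))) => //.
      by move=> x _; exact: nc_sqr_em'.
    + exact: (cem n _ mOm).
    + apply: (zero _ (fun k => Num.sqrt (h k))) => //.
      * by move=> k x; exact: nc_sqr_em'.
      * rewrite -[X in _ --> X]sqrtr0; apply: (@continuous_cvg _ R^o R^o).
          exact: sqrt_continuous.
        exact: hseq_cvg.
have [phi tp hp] := em_density (h0 k) X e2; exists phi => //.
have Xp : XW phi (fun j => partial j phi) (fun x => phi (rV_rcons x 0)).
  split; first exact: tf_L2Om.
  - by move=> j; apply: tf_L2Om; exact: tf_partial.
  - by apply: tf_L2; exact: tf_rcons.
  - by move=> j; exact: tf_weighted.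
rewrite (le_lt_trans (wdist_tri X0 (XW_em (h0 k) lv lG lg) Xp))//.
by rewrite (_ : e = e / 2 + e / 2); [exact: ltrD|field].
Qed.

Definition gn G : R := n2O (fun x => (Num.sqrt (\sum_(j < n) nc (G j x) ^+ 2))%:C).

Lemma L2_grad G : (forall j, L2O (G j)) ->
  L2O (fun x => (Num.sqrt (\sum_(j < n) nc (G j x) ^+ 2))%:C).
Proof.
move=> lG; have mG : measurable_fun Om (fun x => \sum_(j < n) nc (G j x) ^+ 2).
  by apply: measurable_sum => j; apply: meas_nc2; exact: L2_meas (lG j).
apply: (@L2_le _ _ _ mu Om mOm _ (fun x => \sum_(j < n) nc (G j x) ^+ 2)).
- apply: cmeas_real; apply: (@measurableT_comp _ _ _ _ _ _ (@Num.sqrt R) Om (fun x => \sum_(j < n) nc (G j x) ^+ 2)) => //.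
  by apply: continuous_measurable_fun; exact: sqrt_continuous.
- by move=> x _; rewrite nc_real ger0_norm ?sqrtr_ge0// sqr_sqrtr// sumr_ge0// => j _; exact: sqr_ge0.
- rewrite (_ : EFin \o _ = fun x => \sum_(j < n) (nc (G j x) ^+ 2)%:E); last first.
    by apply/funext => x; rewrite /= -sumEFin.
  by apply: integrable_sum => [|j _]; [exact: mOm|case: (lG j)].
Qed.

Lemma sqr_gn G : (forall j, L2O (G j)) -> gn G ^+ 2 = \sum_(j < n) n2O (G j) ^+ 2.
Proof.
move=> lG; rewrite /gn sqr_n2.
under eq_Rintegral => x _.
  rewrite nc_real ger0_norm ?sqrtr_ge0// sqr_sqrtr; last by rewrite sumr_ge0// => j _; exact: sqr_ge0.
  over.
rewrite (_ : (fun x => _) = fun x => \sum_(j <- index_enum 'I_n) nc (G j x) ^+ 2)//.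
under [RHS]eq_bigr do rewrite sqr_n2.
elim: (index_enum 'I_n) => [|j s ih].
  by under eq_fun do rewrite big_nil; rewrite big_nil /Rintegral integral0.
under eq_fun do rewrite big_cons; rewrite big_cons RintegralD//; [by rewrite ih|exact: mOm|by case: (lG j)|].
rewrite (_ : EFin \o _ = fun x => \sum_(j <- s) (nc (G j x) ^+ 2)%:E); last first.
  by apply/funext => x; rewrite /= -sumEFin.
by apply: integrable_sum => [|i _]; [exact: mOm|case: (lG i)].
Qed.

Lemma gn_ge0 G : 0 <= gn G. Proof. exact: n2_ge0. Qed.

Lemma n2_gn G j : (forall j, L2O (G j)) -> n2O (G j) <= gn G.
Proof.
move=> lG; rewrite -(@ler_pXn2r _ 2) ?nnegrE ?n2_ge0 ?gn_ge0// sqr_gn// (bigD1 j)//= lerDl.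
by apply: sumr_ge0 => i _; exact: sqr_ge0.
Qed.

Lemma vL2norm_gn G : (forall j, L2O (G j)) -> vL2norm Om G = (gn G)%:E.
Proof. by move=> lG; rewrite /vL2norm (L2_cLnorm mOm)//; exact: L2_grad. Qed.

(** The test functions that define the trace converge in the full form norm, so they are the
    approximants asked for by [XS]. *)
Lemma trace_XS v G g : L2O v -> (forall j, L2O (G j)) -> is_trace v G g -> XS v G g.
Proof.
move=> lv lG [/(L2P nu mT) lg [phi [tp c1 c2 c3]]].
have lp k := tf_L2Om (tp k); have lpj k j := tf_L2Om (tf_partial j (tp k)).
have lp0 k := tf_L2 (tf_rcons 0 (tp k)).
have ex (a : R^nat) e : (fun k => (a k)%:E) @ \oo --> 0%E -> 0 < e -> \forall k \near \oo, a k < e.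
  move=> /fine_cvgP[_ /cvgrPdist_lt h] /h; apply: filterS => k /=.
  by rewrite sub0r normrN; apply: le_lt_trans; exact: ler_norm.
split => // e e0.
have lB k j : L2O (fun x => G j x - partial j (phi k) x) by exact: (L2B mOm).
have : \forall k \near \oo, near_test (phi k) v G g e.
  near=> k; split.
  - near: k; apply: ex e0; move: c1; under eq_fun do rewrite (L2_cLnorm mOm (L2B mOm lv (lp _))).
    exact.
  - move=> j; apply: le_lt_trans (n2_gn j (lB k)) _; near: k; apply: ex e0; move: c2.
    by under eq_fun do rewrite (vL2norm_gn (lB _)).
  - near: k; apply: ex e0; move: c3; under eq_fun do rewrite (L2_cLnorm mT (L2B mT lg (lp0 _))).
    exact.
by move=> [N _ /(_ N (leqnn N)) h]; exists (phi N).
Unshelve. all: end_near. Qed.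

(** Makes every element of [XS] admissible as a test function in the Robin form. The weak gradient
    identity is the limit of integration by parts for the approximants. *)
Lemma XS_H1 v G g : XS v G g -> H1 Om v G /\ is_trace v G g.
Proof.
move=> X; have [lv lG lg _] := X; have [phi [tp c1 c2 c3]] := XS_seq X.
have lp k := tf_L2Om (tp k); have lpj k j := tf_L2Om (tf_partial j (tp k)).
have lp0 k := tf_L2 (tf_rcons 0 (tp k)).
have lB k j : L2O (fun x => G j x - partial j (phi k) x) by exact: (L2B mOm).
split.
  split; [exact/(L2P mu mOm)|by move=> j; apply/(L2P mu mOm)|].
  split; [exact: L2_locally_integrable mOm lv|by move=> j; exact: L2_locally_integrable mOm (lG j)|].
  move=> psi tpsi j; have ts := tf_sub tpsi; have tsj := tf_partial j ts.
  have [_ _ [K [cK KO K0]]] := tpsi; have [_ _ [K' [_ KO' K0']]] := test_fun_partial j tpsi.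
  have ls := tf_L2Om (tf_conj ts); have lsj := tf_L2Om (tf_conj tsj).
  have E (f h : V -> R[i]) : cintegral mu Om (fun x => f x * h x) = ipO f (fun x => (h x)^*).
    by apply: eq_cintegral => x _; rewrite conjCK.
  have X1 := cvg2_ipl mOm lp lv lsj c1; have X2 := cvg2_ipl mOm (lpj^~ j) (lG j) ls (c2 j).
  rewrite !E; apply: (ccvg_unique X1).
  rewrite (_ : (fun k => _) = fun k => - ipO (partial j (phi k)) (fun x => (psi x)^*)).
    by rewrite -mulN1r; under eq_fun do rewrite -mulN1r; apply: ccvgM => //; exact: ccvg_cst.
  (* The support of [psi] lies inside the open half-space, so the integrals extend to the whole
     space and no boundary term appears. *)
  apply/funext => k; rewrite -!E !(@cintegral_indic _ _ _ mu Om).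
  rewrite (_ : (fun x => _) = fun x => phi k x * partial j psi x); last first.
    apply/funext => x; rewrite indicE; have [xO|xO] := pselect (Om x); first by rewrite mem_set// mul1r.
    by rewrite memNset// mul0r K0' ?mulr0// => /KO'.
  rewrite (_ : (fun x => (\1__ x)%:C * (partial _ _ _ * _)) = fun x => partial j (phi k) x * psi x); last first.
    apply/funext => x; rewrite indicE; have [xO|xO] := pselect (Om x); first by rewrite mem_set// mul1r.
    by rewrite memNset// mul0r K0 ?mulr0// => /KO.
  by apply: integral_by_parts => //; exact: tf_smooth.
split; first exact/(L2P nu mT).
have toE (a : R^nat) : a @ \oo --> (0 : R) -> (fun k => (a k)%:E) @ \oo --> 0%E.
  by move=> h; apply: cvg_EFin => //; exact: nearW.
have C n' (D : set 'rV[R]_n') (f_ : nat -> 'rV[R]_n' -> R[i]) f : cvg2 (lebesgue_rV R n') D f_ f ->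
    (fun k => n2 (lebesgue_rV R n') D (fun x => f x - f_ k x)) @ \oo --> (0 : R).
  by rewrite /cvg2 => h; under eq_fun do rewrite n2BC.
exists phi; split => //.
- under eq_fun do rewrite (L2_cLnorm mOm (L2B mOm lv (lp _))); apply: toE; exact: C c1.
- under eq_fun do rewrite (vL2norm_gn (lB _)); apply: toE.
  apply: (@cvg0_le _ _ (fun k => \sum_(j < n) n2O (fun x => G j x - partial j (phi k) x))).
    move=> k; rewrite gn_ge0/= -(@ler_pXn2r _ 2) ?nnegrE ?gn_ge0 ?sumr_ge0//; last by move=> j _; exact: n2_ge0.
    rewrite sqr_gn// expr2 mulr_suml; apply: ler_sum => j _; rewrite expr2 ler_wpM2l ?n2_ge0//.
    by rewrite (bigD1 j)//= lerDl; apply: sumr_ge0 => i _; exact: n2_ge0.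
  by apply: cvg0_sum => j; exact: C (c2 j).
- under eq_fun do rewrite (L2_cLnorm mT (L2B mT lg (lp0 _))); apply: toE; exact: C c3.
Qed.

End form_domain.

(** * Fourier transform of test functions *)

Section poisson_kernel.
Context (R : realType).
Notation mu1 := (@lebesgue_measure R).
Implicit Types (a eps x t : R).

Lemma ge0_integral_sym (f : R -> R) : (forall x, 0 <= f x) -> continuous f ->
  (\int[mu1]_x (f x)%:E = \int[mu1]_(x in `[0%R, +oo[) (f x)%:E +
    \int[mu1]_(x in `[0%R, +oo[) (f (- x))%:E)%E.
Proof.
move=> f0 cf; have mf : measurable_fun [set: R] f by exact: continuous_measurable_fun.
have mp : measurable [set x : R | 0 <= x] by rewrite -set_itvcy.
rewrite -(setUv [set x : R | 0 <= x]) ge0_integral_setU//=; last 4 first.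
  exact: measurableC.
  by apply/measurable_EFinP; rewrite setUv.
  by move=> x _; rewrite lee_fin.
  exact/disj_setPCl.
rewrite -set_itvcy// setCitvr; congr +%E.
rewrite integral_itv_bndo_bndc; last exact/measurable_EFinP/measurable_funTS.
rewrite -{1}oppr0 ge0_integration_by_substitutionNy//.
exact: continuous_subspaceT.
Qed.

(** The damping factor of Abel summation. Its Fourier integral has an explicit primitive, and its
    transform is the Cauchy kernel. *)
Definition pk eps x : R := expR (- (eps * `|x|)).

Lemma pk_ge0 eps x : 0 <= pk eps x. Proof. exact: expR_ge0. Qed.

Lemma pk_le1 eps x : 0 <= eps -> pk eps x <= 1.
Proof. by move=> e0; rewrite -expR0 ler_expR oppr_le0 mulr_ge0. Qed.

Lemma continuous_pk eps : continuous (pk eps).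
Proof.
move=> x; apply: (@continuous_comp _ _ _ (fun x : R => - (eps * `|x|)) expR); last exact: continuous_expR.
by apply: cvgN; apply: cvgM; [exact: cvg_cst|exact: norm_continuous].
Qed.

Section damped_oscillation.
Variables (eps a u v : R).
Hypothesis e0 : 0 < eps.

Let c x := u * cos (a * x) + v * sin (a * x).
Let c' x := a * (v * cos (a * x) - u * sin (a * x)).
Let Q := eps ^+ 2 + a ^+ 2.
Let F x := expR (- (eps * x)) * (- eps^-1 - (eps * c x + c' x) / Q).

Let Q0 : 0 < Q. Proof. by rewrite ltr_pwDl ?exprn_gt0// sqr_ge0. Qed.

Let dcos x : is_derive x 1 (fun x : R => cos (a * x)) (- (a * sin (a * x))).
Proof.
have d1 : is_derive x 1 (fun x : R => a * x) (a * 1) by exact: (is_deriveZ (f := id)).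
have h := @is_derive1_comp _ cos (fun x : R => a * x) x _ _ (is_derive_cos _) d1.
by apply: (is_derive_eq h); ring.
Qed.

Let dsin x : is_derive x 1 (fun x : R => sin (a * x)) (a * cos (a * x)).
Proof.
have d1 : is_derive x 1 (fun x : R => a * x) (a * 1) by exact: (is_deriveZ (f := id)).
have h := @is_derive1_comp _ sin (fun x : R => a * x) x _ _ (is_derive_sin _) d1.
by apply: (is_derive_eq h); ring.
Qed.

Let dexp x : is_derive x 1 (fun x : R => expR (- (eps * x))) (- eps * expR (- (eps * x))).
Proof.
have -> : (fun x : R => expR (- (eps * x))) = fun s => expR (- eps * s).
  by apply/funext => y; rewrite mulNr.
by rewrite -[in X in is_derive _ _ _ X]mulNr; exact: is_derive_expRN.
Qed.

Let dF x : is_derive x 1 F ((1 + c x) * expR (- (eps * x))).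
Proof.
have dc := is_deriveD (is_deriveZ u (dcos x)) (is_deriveZ v (dsin x)).
have dc' := is_deriveZ a (is_deriveB (is_deriveZ v (dcos x)) (is_deriveZ u (dsin x))).
have d2 := is_deriveZ Q^-1 (is_deriveD (is_deriveZ eps dc) dc').
have d3 := is_deriveB (is_derive_cst (- eps^-1) x (1 : R)) d2.
have d4 := is_deriveM (dexp x) d3.
have -> : F = (fun x : R => expR (- (eps * x))) *
  (cst (- eps^-1) - Q^-1 *: (eps *: (u *: (fun x : R => cos (a * x)) + v *: (fun x : R => sin (a * x))) +
    a *: (v *: (fun x : R => cos (a * x)) - u *: (fun x : R => sin (a * x))))).
  by apply/funext => y; rewrite /F /c /c' /= !fctE /GRing.scale/= [_ / Q]mulrC.
apply: (is_derive_eq d4); rewrite /c !fctE /GRing.scale/= /GRing.scale/=.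
have Qn : Q != 0 by rewrite gt_eqF. have en : eps != 0 by rewrite gt_eqF.
move: (cos _) (sin _) (expR _) => C S E; rewrite /Q in Qn *.
by field; rewrite Qn en.
Qed.

Let continuous_osc : continuous (fun x => (1 + c x) * expR (- (eps * x))).
Proof.
move=> x; apply: cvgM; last exact: (derivable_continuous1 (dexp x)).
apply: cvgD; first exact: cvg_cst.
apply: cvgD; (apply: cvgM; first exact: cvg_cst).
- exact: (derivable_continuous1 (dcos x)).
- exact: (derivable_continuous1 (dsin x)).
Qed.

Let cvgF : F x @[x --> +oo%R] --> (0 : R).
Proof.
pose M := eps^-1 + (eps * (`|u| + `|v|) + `|a| * (`|v| + `|u|)) / Q.
have H : (fun x => M * expR (- (eps * x))) @ +oo%R --> (0 : R).
  rewrite -[X in _ --> X](mulr0 M); apply: cvgM; first exact: cvg_cst.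
  apply: (@cvg_comp _ _ _ (fun x => eps * x) (fun y : R => expR (- y))); last exact: cvgr_expR.
  exact: gt0_cvgMry.
apply/norm_cvg0P; apply: (@squeeze_cvgr _ _ _ _ (fun=> 0) (fun x => M * expR (- (eps * x)))) => //.
  near=> x; rewrite normr_ge0/= /F normrM [`|expR _|]ger0_norm ?expR_ge0// mulrC.
  rewrite ler_wpM2r ?expR_ge0// -opprD normrN (le_trans (ler_normD _ _))//.
  rewrite gtr0_norm ?invr_gt0// lerD2l normrM normfV (gtr0_norm Q0) ler_wpM2r ?invr_ge0 ?(ltW Q0)//.
  have h (p q y z : R) : `|y| <= 1 -> `|z| <= 1 -> `|p * y| + `|q * z| <= `|p| + `|q|.
    by move=> y1 z1; rewrite !normrM lerD// ler_piMr.
  have C1 := cos_max (a * x); have S1 := sin_max (a * x).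
  rewrite (le_trans (ler_normD _ _))// lerD//.
    rewrite normrM (gtr0_norm e0) ler_wpM2l ?(ltW e0)//.
    by rewrite (le_trans (ler_normD _ _))// h.
  rewrite normrM ler_wpM2l// (le_trans (ler_normB _ _))// h//.
exact: cvg_cst.
Unshelve. all: end_near. Qed.

Hypothesis c1 : forall x, `|c x| <= 1.

(** The summand 1 keeps the integrand nonnegative, the setting of the fundamental theorem on a
    half-line used here; [F] is the explicit primitive and tends to 0 at infinity. *)
Lemma half_osc : (\int[mu1]_(x in `[0%R, +oo[) ((1 + c x) * expR (- (eps * x)))%:E =
  (eps^-1 + (eps * u + a * v) / (eps ^+ 2 + a ^+ 2))%:E)%E.
Proof.
have c0 x : 0 <= 1 + c x by have := c1 x; rewrite ler_norml => /andP[h _]; lra.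
rewrite (@ge0_continuous_FTC2y _ _ F 0 0).
- congr EFin; rewrite /F /c /c' !mulr0 cos0 sin0 oppr0 expR0 !mulr0 !mulr1 addr0 subr0; ring.
- by move=> x _; rewrite mulr_ge0 ?expR_ge0.
- exact/continuous_subspaceT.
- exact: cvgF.
- by move=> x _; have [] := dF x.
- by apply: cvg_at_right_filter; exact: (derivable_continuous1 (dF 0)).
- by move=> x _; rewrite derive1E; have [_ ->] := dF x.
Qed.

End damped_oscillation.

Section poisson.
Variables (eps a : R).
Hypothesis e0 : 0 < eps.

Let osc u v x := (1 + (u * cos (a * x) + v * sin (a * x))) * pk eps x.

Lemma osc_integral (u v : R) : (forall y, `|u * cos (a * y) + v * sin (a * y)| <= 1) ->
  mu1.-integrable setT (EFin \o osc u v) /\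
  Rintegral mu1 setT (osc u v) = 2 / eps + u * (2 * eps / (eps ^+ 2 + a ^+ 2)).
Proof.
move=> c1.
have c0 x : 0 <= osc u v x.
  by rewrite mulr_ge0 ?pk_ge0//; have := c1 x; rewrite ler_norml => /andP[h _]; lra.
have cosc : continuous (osc u v).
  move=> x; apply: cvgM; last exact: continuous_pk.
  have cl : (fun x : R => a * x) @ x --> a * x by apply: cvgM; [exact: cvg_cst|exact: cvg_id].
  apply: cvgD; first exact: cvg_cst.
  apply: cvgD; (apply: cvgM; first exact: cvg_cst).
  - exact: (@continuous_comp _ _ _ (fun x : R => a * x) cos _ cl (@continuous_cos R _)).
  - exact: (@continuous_comp _ _ _ (fun x : R => a * x) sin _ cl (@continuous_sin R _)).
have E : (\int[mu1]_x (osc u v x)%:E = (2 / eps + u * (2 * eps / (eps ^+ 2 + a ^+ 2)))%:E)%E.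
  rewrite ge0_integral_sym//.
  rewrite (_ : (\int[mu1]_(x in `[0%R, +oo[) (osc u v x)%:E)%E =
    (eps^-1 + (eps * u + a * v) / (eps ^+ 2 + a ^+ 2))%:E); last first.
    rewrite -(half_osc e0 c1); apply: eq_integral => x; rewrite inE/= in_itv/= andbT => x0.
    by rewrite /osc /pk ger0_norm.
  rewrite (_ : (\int[mu1]_(x in `[0%R, +oo[) (osc u v (- x))%:E)%E =
    (eps^-1 + (eps * u + a * - v) / (eps ^+ 2 + a ^+ 2))%:E); last first.
    have c1' y : `|u * cos (a * y) + - v * sin (a * y)| <= 1.
      by have := c1 (- y); rewrite mulrN cosN sinN mulrN mulNr.
    rewrite -(half_osc e0 c1'); apply: eq_integral => x; rewrite inE/= in_itv/= andbT => x0.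
    by rewrite /osc /pk normrN ger0_norm// mulrN cosN sinN mulrN mulNr.
  rewrite -EFinD; congr EFin.
  have Q0 : 0 < eps ^+ 2 + a ^+ 2 by rewrite ltr_pwDl ?exprn_gt0// sqr_ge0.
  by field; rewrite !gt_eqF.
split; last by rewrite /Rintegral E.
apply/integrableP; split; first by apply/measurable_EFinP; exact: continuous_measurable_fun.
under eq_integral do rewrite gee0_abs ?lee_fin//.
by rewrite E ltry.
Qed.

Let bcos y : `|1 * cos (a * y) + 0 * sin (a * y)| <= 1.
Proof. by rewrite mul0r addr0 mul1r cos_max. Qed.
Let bsin y : `|0 * cos (a * y) + 1 * sin (a * y)| <= 1.
Proof. by rewrite mul0r add0r mul1r sin_max. Qed.
Let b00 y : `|0 * cos (a * y) + 0 * sin (a * y)| <= 1.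
Proof. by rewrite !mul0r addr0 normr0. Qed.

(** The pairs [(u, v) = (1, 0)] and [(0, 1)] give the cosine and sine parts; subtracting the pair
    [(0, 0)] removes the auxiliary summand 1. *)
Lemma fourier_pk : cintegrable mu1 setT (fun x => expi (a * x) * (pk eps x)%:C) /\
  cintegral mu1 setT (fun x => expi (a * x) * (pk eps x)%:C) =
  (2 * eps / (eps ^+ 2 + a ^+ 2))%:C.
Proof.
have [i1 e1] := osc_integral bcos; have [i2 e2] := osc_integral bsin.
have [i3 e3] := osc_integral b00.
have E1 : (fun x => Re (expi (a * x) * (pk eps x)%:C)) = fun x => osc 1 0 x - osc 0 0 x.
  by apply/funext => x; rewrite /osc /=; ring.
have E2 : (fun x => Im (expi (a * x) * (pk eps x)%:C)) = fun x => osc 0 1 x - osc 0 0 x.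
  by apply/funext => x; rewrite /osc /=; ring.
split.
  split.
    rewrite (_ : (fun x => _) = ((EFin \o osc 1 0) \- (EFin \o osc 0 0))%E).
      exact: integrableB.
    by apply/funext => x; rewrite /= -EFinB -[X in _ = X%:E](congr1 (@^~ x) E1).
  rewrite (_ : (fun x => _) = ((EFin \o osc 0 1) \- (EFin \o osc 0 0))%E).
    exact: integrableB.
  by apply/funext => x; rewrite /= -EFinB -[X in _ = X%:E](congr1 (@^~ x) E2).
rewrite /cintegral E1 E2 !RintegralB// e1 e2 e3.
by apply/eqP; rewrite eq_complex/=; apply/andP; split; apply/eqP; ring.
Qed.

End poisson.

Lemma cauchy_int : mu1.-integrable setT (fun x => (2 / (1 + x ^+ 2))%:E) /\
  Rintegral mu1 setT (fun x => 2 / (1 + x ^+ 2)) = 2 * pi.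
Proof.
have h0 (x : R) : 0 <= (1 + x ^+ 2)^-1 by rewrite invr_ge0 addr_ge0// sqr_ge0.
have ch : continuous (fun x : R => (1 + x ^+ 2)^-1) by move=> x; exact: continuous_oneDsqrV.
have mh := continuous_measurable_fun ch.
have E : (\int[mu1]_x ((1 + x ^+ 2)^-1)%:E = pi%:E)%E.
  rewrite ge0_integral_sym//; under [X in (_ + X)%E]eq_integral do rewrite sqrrN.
  by have -> := @integral0y_oneDsqr R; rewrite -EFinD; congr EFin; field.
have ih : mu1.-integrable setT (fun x => ((1 + x ^+ 2)^-1)%:E).
  apply/integrableP; split; first exact/measurable_EFinP.
  by under eq_integral do rewrite gee0_abs ?lee_fin//; rewrite E ltry.
split; last by rewrite RintegralZl// /Rintegral E.
by under eq_fun do rewrite EFinM; exact: integrableZl.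
Qed.

End poisson_kernel.

Section products.
Context (R : realType).
Notation mu1 := (@lebesgue_measure R).

(** Fubini along the recursive construction of the measure; in dimension 0 the empty product is
    integrated against a Dirac mass. *)
Lemma cprod_integral d (F : 'I_d -> R -> R[i]) : (forall j, cintegrable mu1 setT (F j)) ->
  cintegrable (lebesgue_rV R d) setT (fun x => \prod_j F j (x ord0 j)) /\
  cintegral (lebesgue_rV R d) setT (fun x => \prod_j F j (x ord0 j)) =
  \prod_j cintegral mu1 setT (F j).
Proof.
elim: d F => [|d ih] F iF.
  have -> : (fun x : 'rV[R]_0 => \prod_j F j (x ord0 j)) = fun=> 1.
    by apply/funext => x; rewrite big_ord0.
  rewrite big_ord0; split.
    split; apply/integrableP; split; try exact: measurable_cst.
    - by rewrite integral_cst//= normr1 mul1e diracT ltry.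
    - by rewrite integral_cst//= normr0 mul0e ltry.
  rewrite /cintegral /Rintegral /= !integral_dirac//; try exact: measurable_cst.
  by rewrite diracT !mul1e.
pose F' (j : 'I_d) := F (lift ord_max j).
have [ih1 ih2] := ih F' (fun j => iF _).
pose f (x : 'rV[R]_d) := \prod_j F' j (x ord0 j).
have fE x t : \prod_j F j (rV_rcons x t ord0 j) = f x * F ord_max t.
  rewrite big_ord_recr /= rcons_last; congr (_ * _); apply: eq_bigr => j _.
  rewrite (_ : widen_ord _ j = lift ord_max j) ?rcons_lift//.
  by apply: val_inj => /=; rewrite /bump leqNgt ltn_ord.
have mF : cmeasurable setT (fun x : 'rV[R]_d.+1 => \prod_j F j (x ord0 j)).
  have mj j : cmeasurable setT (fun x : 'rV[R]_d.+1 => F j (x ord0 j)).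
    have [[m1 m2] _] := (cintP _ mT _).1 (iF j).
    split.
    - exact: (measurableT_comp m1 (@measurable_rV_coord R d.+1 j)).
    - exact: (measurableT_comp m2 (@measurable_rV_coord R d.+1 j)).
  elim: (index_enum _) => [|j s ihs]; first by under eq_fun do rewrite big_nil; exact: cmeas_cst.
  by under eq_fun do rewrite big_cons; exact: cmeasM.
have [mf if_] := (cintP _ mT _).1 ih1.
have [ml il] := (cintP _ mT _).1 (iF ord_max).
have iT : cintegrable (lebesgue_rV R d.+1) setT (fun x => \prod_j F j (x ord0 j)).
  apply/(cintP _ mT); split => //; apply/integrableP; split.
    by apply/measurable_EFinP; exact: meas_nc.
  under eq_integral do rewrite gee0_abs ?lee_fin ?nc_ge0//.
  have mnc : measurable_fun setT (fun x : 'rV[R]_d.+1 => (nc (\prod_j F j (x ord0 j)))%:E).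
    by apply/measurable_EFinP; exact: meas_nc.
  rewrite (ge0_integral_rcons mnc); last by move=> x; rewrite lee_fin nc_ge0.
  under eq_integral => x _.
    under eq_integral do rewrite fE ncM EFinM.
    rewrite ge0_integralZl//; last 3 first.
    - by apply/measurable_EFinP; exact: meas_nc.
    - by move=> y _; rewrite lee_fin nc_ge0.
    - by rewrite lee_fin nc_ge0.
    over.
  rewrite ge0_integralZr//; last 3 first.
  - by apply/measurable_EFinP; exact: meas_nc.
  - by move=> y _; rewrite lee_fin nc_ge0.
  - by apply: integral_ge0 => y _; rewrite lee_fin nc_ge0.
  move: if_ il => /integrableP[_ h1] /integrableP[_ h2].
  apply: lte_mul_pinfty.
  - by apply: integral_ge0 => y _; rewrite lee_fin nc_ge0.
  - rewrite ge0_fin_numE; last by apply: integral_ge0 => y _; rewrite lee_fin nc_ge0.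
    by move: h1; under eq_integral do rewrite gee0_abs ?lee_fin ?nc_ge0//.
  - by move: h2; under eq_integral do rewrite gee0_abs ?lee_fin ?nc_ge0//.
split => //.
have iS x : cintegrable mu1 setT (fun t => \prod_j F j (rV_rcons x t ord0 j)).
  by under eq_fun do rewrite fE; apply: cintZ => //; exact: mT.
have [_ ->] := cintegral_rcons iT iS.
under eq_cintegral => x _.
  under eq_cintegral do rewrite fE.
  rewrite (cintegralZ mT)// mulrC; over.
rewrite (cintegralZ mT)// ih2 mulrC big_ord_recr /=; congr (_ * _).
apply: eq_bigr => j _; rewrite /F' (_ : lift ord_max j = widen_ord (leqnSn d) j)//.
by apply: val_inj => /=; rewrite /bump leqNgt ltn_ord.
Qed.

End products.

Section fatou.
Context d (T : measurableType d) (R : realType) (mu : {measure set T -> \bar R}).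
Variables (D : set T) (mD : measurable D).

(** Fatou's lemma in the form where a uniform bound on nonnegative approximations yields
    integrability of the limit. *)
Lemma fatou_le (f_ : nat -> T -> R) (f : T -> R) (C : R) :
  (forall k x, D x -> 0 <= f_ k x) -> (forall k, measurable_fun D (f_ k)) ->
  (forall x, D x -> f_ ^~ x @ \oo --> f x) ->
  (forall k, (\int[mu]_(x in D) (f_ k x)%:E <= C%:E)%E) ->
  mu.-integrable D (EFin \o f) /\ Rintegral mu D f <= C.
Proof.
move=> f0 mf ff fC.
have fge0 x : D x -> 0 <= f x.
  move=> Dx; rewrite -(cvg_lim (@norm_hausdorff _ R^o) (ff x Dx)).
  by apply: limr_ge; [apply/cvg_ex; exists (f x); exact: ff|apply: nearW => k; exact: f0].
have mfl : measurable_fun D f by exact: (measurable_fun_cvg mf ff).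
have H : (\int[mu]_(x in D) (f x)%:E <= C%:E)%E.
  have := @fatou _ _ _ mu D mD (fun k x => (f_ k x)%:E).
  move=> /(_ (fun k => (measurable_EFinP _ _).2 (mf k)) (fun k x Dx => f0 k x Dx)).
  rewrite (@eq_integral _ _ _ mu D (fun x => (f x)%:E)); last first.
    move=> x; rewrite inE => Dx.
    have L : (fun k => (f_ k x)%:E) @ \oo --> (f x)%:E by apply: cvg_EFin; [exact: nearW|exact: ff].
    by rewrite (cvg_limn_einf_sup L).1.
  move=> /le_trans; apply; rewrite limn_einf_lim; apply: lime_le; first exact: is_cvg_einfs.
  apply: nearW => k; apply: le_trans (fC k); apply: ereal_inf_lbound.
  by exists k => /=.
have i0 : (0 <= \int[mu]_(x in D) (f x)%:E)%E by apply: integral_ge0 => x Dx; rewrite lee_fin fge0.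
split.
  apply/integrableP; split; first exact/measurable_EFinP.
  rewrite (eq_integral (fun x => (f x)%:E)) ?(le_lt_trans H)// ?ltry// => x; rewrite inE => Dx.
  by rewrite /= ger0_norm// fge0.
rewrite /Rintegral -lee_fin fineK// ge0_fin_numE//.
by rewrite (le_lt_trans H)// ltry.
Qed.

End fatou.

Section fourier_transform.
Context (R : realType) (d : nat).
Notation W := 'rV[R]_d.
Notation nu := (lebesgue_rV R d).
Notation lb := (leb R d).
Notation kap := (Num.sqrt (2 * pi) ^- d : R).
Implicit Types (f g : W -> R[i]) (s : R) (x xi : W).

(** The sign [s] is -1 for the transform and 1 for its inverse; under [s ^+ 2 = 1] the same lemmas
    serve both. *)
Definition ft s f xi : R[i] :=
  kap%:C * cintegral nu setT (fun x => expi (s * dot x xi) * f x).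

Lemma dotC (x y : W) : dot x y = dot y x.
Proof. by apply: eq_bigr => j _; rewrite mulrC. Qed.

Lemma dotDl (x y z : W) : dot (x + y) z = dot x z + dot y z.
Proof. by rewrite /dot -big_split/=; apply: eq_bigr => j _; rewrite mxE mulrDl. Qed.

Lemma dotNl (x z : W) : dot (- x) z = - dot x z.
Proof. by rewrite /dot -sumrN; apply: eq_bigr => j _; rewrite mxE mulNr. Qed.

Lemma fourierE f : fourier f = ft (-1) f.
Proof. by apply/funext => xi; congr (_ * _); apply: eq_cintegral => x _; rewrite mulN1r. Qed.

Lemma inv_fourierE f : inv_fourier f = ft 1 f.
Proof. by apply/funext => xi; congr (_ * _); apply: eq_cintegral => x _; rewrite mul1r dotC. Qed.

Lemma kap_gt0 : 0 < kap.
Proof. by rewrite invr_gt0 exprn_gt0// sqrtr_gt0 mulr_gt0// pi_gt0. Qed.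

Lemma kap_sqr : kap ^+ 2 * (2 * pi) ^+ d = 1.
Proof.
have p0 : 0 <= 2 * pi :> R by rewrite mulr_ge0// pi_ge0.
rewrite -exprVn -exprM mulnC exprM exprVn sqr_sqrtr// -exprMn mulVf ?expr1n//.
by rewrite gt_eqF// mulr_gt0// pi_gt0.
Qed.

Lemma measurable_dot d' (T : measurableType d') (f g : T -> W) :
  measurable_fun setT f -> measurable_fun setT g -> measurable_fun setT (fun t => dot (f t) (g t)).
Proof.
move=> mf mg; apply: measurable_sum => j; apply: measurable_funM.
- exact: (measurableT_comp (@measurable_rV_coord R d j) mf).
- exact: (measurableT_comp (@measurable_rV_coord R d j) mg).
Qed.

Lemma meas_expi d' (T : measurableType d') (h : T -> R) : measurable_fun setT h ->
  cmeasurable setT (fun t => expi (h t)).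
Proof.
move=> mh; split.
- by apply: measurableT_comp mh; apply: continuous_measurable_fun; exact: continuous_cos.
- by apply: measurableT_comp mh; apply: continuous_measurable_fun; exact: continuous_sin.
Qed.

Lemma cmeas_comp d' (T : measurableType d') (h : T -> W) f : measurable_fun setT h ->
  cmeasurable setT f -> cmeasurable setT (fun t => f (h t)).
Proof. by move=> mh [f1 f2]; split; [exact: (measurableT_comp f1 mh)|exact: (measurableT_comp f2 mh)]. Qed.

Lemma ft_cint s f xi : cintegrable nu setT f ->
  cintegrable nu setT (fun x => expi (s * dot x xi) * f x).
Proof.
move=> fi; apply: (@cintM_bnd _ _ _ _ setT mT 1) => //; last by move=> x _; rewrite nc_expi.
by apply: meas_expi; apply: measurable_funM => //; exact: measurable_dot.
Qed.

Lemma ft_bnd s f xi : cintegrable nu setT f ->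
  nc (ft s f xi) <= kap * Rintegral nu setT (fun x => nc (f x)).
Proof.
move=> fi; rewrite ncM nc_real (gtr0_norm kap_gt0) ler_wpM2l ?(ltW kap_gt0)//.
apply: (le_nc_cintegral mT); [exact: ft_cint|by move=> x _; rewrite ncM nc_expi mul1r|].
exact: (cint_nc mT).
Qed.

Definition pkn eps xi : R := \prod_j pk eps (xi ord0 j).

Lemma pkn_ge0 eps xi : 0 <= pkn eps xi.
Proof. by apply: prodr_ge0 => j _; exact: pk_ge0. Qed.

Lemma pkn_gt0 eps xi : 0 < pkn eps xi.
Proof. by apply: prodr_gt0 => j _; exact: expR_gt0. Qed.

Lemma pkn_le1 eps xi : 0 <= eps -> pkn eps xi <= 1.
Proof. by move=> e0; apply: prodr_ile1 => j _; rewrite pk_ge0 pk_le1. Qed.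

Lemma measurable_pkn eps : measurable_fun setT (pkn eps).
Proof.
rewrite /pkn; elim: (index_enum _) => [|j s ih].
  by under eq_fun do rewrite big_nil; exact: measurable_cst.
under eq_fun do rewrite big_cons; apply: measurable_funM => //.
apply: (measurableT_comp _ (@measurable_rV_coord R d j)).
by apply: continuous_measurable_fun; exact: continuous_pk.
Qed.

Lemma measurable_pknV : measurable_fun setT (fun xi => (pkn 1 xi)^-1).
Proof.
rewrite (_ : (fun xi => _) = fun xi : W => \prod_j expR `|xi ord0 j|).
  elim: (index_enum _) => [|j r ih].
    by under eq_fun do rewrite big_nil; exact: measurable_cst.
  under eq_fun do rewrite big_cons; apply: measurable_funM => //.
  have c1 : continuous (fun t : R => expR `|t|).
    by move=> t; apply: (continuous_comp (@norm_continuous _ _ _)); exact: continuous_expR.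
  exact: (measurableT_comp (continuous_measurable_fun c1) (@measurable_rV_coord R d j)).
apply/funext => xi; rewrite /pkn -prodfV; apply: eq_bigr => j _.
by rewrite /pk expRN invrK mul1r.
Qed.

Lemma real_prod (I : Type) (r : seq I) (F : I -> R) :
  (\prod_(i <- r) F i)%:C = \prod_(i <- r) (F i)%:C :> R[i].
Proof. by elim/big_rec2: _ => // i y1 y2 _ <-; rewrite rmorphM. Qed.

Lemma expi_sum (I : Type) (r : seq I) (F : I -> R) :
  expi (\sum_(i <- r) F i) = \prod_(i <- r) expi (F i).
Proof. by elim/big_rec2: _ => [|i y1 y2 _ <-]; rewrite ?expi0// expiD. Qed.

(** The product Cauchy kernel, that is [(2 pi)^{-d}] times the Fourier integral of [pkn eps]; an
    approximate identity as [eps -> 0]. *)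
Definition cker eps (z : W) : R := kap ^+ 2 * \prod_j (2 * eps / (eps ^+ 2 + z ord0 j ^+ 2)).

Lemma pkn_fourier eps (z : W) : 0 < eps ->
  cintegrable nu setT (fun xi => expi (dot xi z) * (pkn eps xi)%:C) /\
  cintegral nu setT (fun xi => expi (dot xi z) * (pkn eps xi)%:C) =
  (\prod_j (2 * eps / (eps ^+ 2 + z ord0 j ^+ 2)))%:C.
Proof.
move=> e0; pose F (j : 'I_d) (t : R) := expi (z ord0 j * t) * (pk eps t)%:C.
have E xi : expi (dot xi z) * (pkn eps xi)%:C = \prod_j F j (xi ord0 j).
  rewrite /F big_split/= -expi_sum real_prod; congr (expi _ * _).
  by apply: eq_bigr => j _; rewrite mulrC.
have [i1 e1] := @cprod_integral R d F (fun j => (fourier_pk (z ord0 j) e0).1).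
split; first by apply: (eq_cint mT _ i1) => x _; rewrite E.
rewrite (@eq_cintegral _ _ _ nu setT _ (fun x => \prod_j F j (x ord0 j))) => [|x _]; last exact: E.
by rewrite e1 real_prod; apply: eq_bigr => j _; have [_ ->] := fourier_pk (z ord0 j) e0.
Qed.

Lemma pkn_int eps : 0 < eps -> nu.-integrable setT (EFin \o pkn eps).
Proof.
move=> e0; have [h _] := @pkn_fourier eps 0 e0; have [h1 _] := h.
have D0 xi : dot xi (0 : W) = 0 by apply: big1 => j _; rewrite mxE mulr0.
apply: eq_integrable h1 => // x _.
by rewrite D0 expi0 mul1r.
Qed.

Lemma cker_ge0 eps z : 0 <= eps -> 0 <= cker eps z.
Proof.
move=> e0; rewrite mulr_ge0 ?sqr_ge0// prodr_ge0// => j _.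
by rewrite divr_ge0 ?mulr_ge0// addr_ge0// sqr_ge0.
Qed.

Lemma measurable_cker eps : 0 < eps -> measurable_fun setT (cker eps).
Proof.
move=> e0; apply: measurable_funM => //.
elim: (index_enum _) => [|j s ih].
  by under eq_fun do rewrite big_nil; exact: measurable_cst.
under eq_fun do rewrite big_cons; apply: measurable_funM => //.
apply: continuous_rV_measurable.
have [] // := @CkM R W 0%N (fun=> 2 * eps) (fun z : W => (eps ^+ 2 + z ord0 j ^+ 2)^-1) (Ck_cst _ _ _) _.
apply: Ck_inv => [x|]; first by rewrite gt_eqF// ltr_pwDl ?exprn_gt0// sqr_ge0.
by apply: CkD; [exact: Ck_cst|under eq_fun do rewrite expr2; apply: CkM; exact: Ck_coord].
Qed.

Lemma cker_bnd eps z : 0 < eps -> cker eps z <= cker eps 0.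
Proof.
move=> e0; rewrite ler_wpM2l ?sqr_ge0//; apply: ler_prod => j _.
have p0 (t : R) : 0 < eps ^+ 2 + t ^+ 2 by rewrite ltr_pwDl ?exprn_gt0// sqr_ge0.
rewrite divr_ge0 ?mulr_ge0 ?(ltW e0) ?(ltW (p0 _))//= ler_wpM2l ?mulr_ge0 ?(ltW e0)//.
by rewrite lef_pV2 ?posrE// mxE expr0n/= addr0 lerDl sqr_ge0.
Qed.

Lemma ckerN eps z : cker eps (- z) = cker eps z.
Proof. by congr (_ * _); apply: eq_bigr => j _; rewrite mxE sqrrN. Qed.

Lemma cker1_integral : nu.-integrable setT (EFin \o cker 1) /\ Rintegral nu setT (cker 1) = 1.
Proof.
have [i1 e1] := cauchy_int R.
pose F (j : 'I_d) (t : R) : R[i] := (2 / (1 + t ^+ 2))%:C.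
have iF j : cintegrable lebesgue_measure setT (F j) by exact: (cint_real i1).
have [i2 e2] := @cprod_integral R d F iF.
have E z : (cker 1 z)%:C = (kap ^+ 2)%:C * \prod_j F j (z ord0 j).
  rewrite /cker rmorphM/= real_prod; congr (_ * _); apply: eq_bigr => j _.
  by rewrite /F mulr1 expr1n.
have i3 : cintegrable nu setT (fun z => (cker 1 z)%:C).
  by under eq_fun do rewrite E; exact: (cintZ mT).
split; first by case: i3.
have : cintegral nu setT (fun z => (cker 1 z)%:C) = 1.
  under eq_cintegral do rewrite E.
  rewrite (cintegralZ mT)// e2 (eq_bigr (fun=> (2 * pi)%:C)); last first.
    by move=> j _; rewrite /F (cintegral_real lebesgue_measure mT) e1.
  rewrite -real_prod -rmorphM/= prodr_const card_ord kap_sqr//.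
by rewrite (cintegral_real nu mT) => -[].
Qed.

Lemma cker_scale eps (z : W) : 0 < eps -> eps ^+ d * cker eps (eps *: z) = cker 1 z.
Proof.
move=> e0; rewrite /cker mulrCA; congr (_ * _).
rewrite (_ : eps ^+ d = \prod_(j < d) eps); last by rewrite prodr_const card_ord.
rewrite -big_split/=; apply: eq_bigr => j _; rewrite mxE expr1n exprMn mulr1.
have p0 : 1 + z ord0 j ^+ 2 != 0 by rewrite gt_eqF// ltr_pwDl// sqr_ge0.
have en : eps != 0 by rewrite gt_eqF.
move: (z ord0 j) p0 => t p0.
rewrite (_ : eps ^+ 2 + eps ^+ 2 * t ^+ 2 = eps ^+ 2 * (1 + t ^+ 2)); last by ring.
by field; rewrite p0 en.
Qed.

Lemma cker_integral eps y : 0 < eps ->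
  nu.-integrable setT (fun x => (cker eps (x - y))%:E) /\
  Rintegral nu setT (fun x => cker eps (x - y)) = 1.
Proof.
move=> e0; have [i1 e1] := cker1_integral.
have ei0 : 0 < eps^-1 by rewrite invr_gt0.
pose h z : R := eps ^- d * cker 1 z.
have ih : nu.-integrable setT (EFin \o h).
  rewrite (_ : EFin \o h = fun z => ((eps ^- d)%:E * (cker 1 z)%:E)%E); first exact: integrableZl.
  by apply/funext => z; rewrite /= -EFinM.
have E x : h (eps^-1 *: x + (- (eps^-1 *: y))) = cker eps (x - y).
  rewrite -scalerBr /h -(cker_scale (eps^-1 *: (x - y)) e0) scalerA divff ?gt_eqF// scale1r.
  by rewrite mulrA mulVf ?mul1r// expf_neq0// gt_eqF.
split.
  have := integrable_rV_affine (- (eps^-1 *: y)) ei0 ih.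
  by under eq_fun do rewrite E.
have e2 := Rintegral_rV_affine (- (eps^-1 *: y)) ei0 ih.
have Ih : Rintegral nu setT h = eps^-1 ^+ d by rewrite /h RintegralZl// e1 mulr1 exprVn.
have : eps^-1 ^+ d != 0 by rewrite expf_neq0// invr_neq0// gt_eqF.
move=> /mulfI; apply; rewrite mulr1 -[RHS]Ih e2; congr (_ * _).
by apply: eq_Rintegral => x _; rewrite E.
Qed.

Lemma measurable_sub2 : measurable_fun setT (fun p : W * W => p.2 - p.1).
Proof.
apply: measurable_fun_rVP => i; under eq_fun do rewrite !mxE.
apply: measurable_funB.
- exact: (measurableT_comp (@measurable_rV_coord R d i) measurable_snd).
- exact: (measurableT_comp (@measurable_rV_coord R d i) measurable_fst).
Qed.

(** Measurability in [xi] is read off Fubini's theorem. The transform itself need not be integrable,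
    so the integrand is multiplied by the integrable [pkn 1] and the result divided by it again. *)
Lemma meas_ft s f : cintegrable nu setT f -> cmeasurable setT (ft s f).
Proof.
move=> fi; have [mf if_] := (cintP _ mT _).1 fi.
have ip := pkn_int (@ltr01 R).
have mF : cmeasurable setT (fun p : W * W => (pkn 1 p.1)%:C * (expi (s * dot p.2 p.1) * f p.2)).
  apply: cmeasM.
    by apply: cmeas_real; exact: measurableT_comp (measurable_pkn 1) measurable_fst.
  apply: cmeasM; last exact: (cmeas_comp measurable_snd).
  by apply: meas_expi; apply: measurable_funM => //; apply: measurable_dot.
have [|h _ _] := @cfubini_dominated _ _ W W R lb lb _ (pkn 1) (fun x => nc (f x)) mF ip if_.
  move=> x y; rewrite !ncM nc_expi mul1r nc_real ger0_norm ?pkn_ge0//.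
have [mh _] := (cintP _ mT _).1 h.
have E xi : ft s f xi = kap%:C * (((pkn 1 xi)^-1)%:C *
    cintegral lb setT (fun x => (pkn 1 xi)%:C * (expi (s * dot x xi) * f x))).
  congr (_ * _); rewrite (cintegralZ mT); last exact: ft_cint.
  by rewrite mulrA -rmorphM/= mulVf ?mul1r// gt_eqF// pkn_gt0.
have -> := funext E.
apply: cmeasM; first exact: cmeas_cst.
apply: cmeasM => //; apply: cmeas_real.
exact: measurable_pknV.
Qed.

Lemma ft_pkn_cint s f eps : 0 < eps -> cintegrable nu setT f ->
  cintegrable nu setT (fun xi => (pkn eps xi)%:C * ft s f xi).
Proof.
move=> e0 fi; apply: (@cint_le _ _ _ _ setT mT _
  (fun xi => kap * Rintegral nu setT (fun x => nc (f x)) * pkn eps xi)).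
- by apply: cmeasM; [apply: cmeas_real; exact: measurable_pkn|exact: meas_ft].
- move=> x _; rewrite ncM nc_real ger0_norm ?pkn_ge0// mulrC ler_wpM2r ?pkn_ge0//.
  exact: ft_bnd.
- rewrite (_ : EFin \o _ = fun z => ((kap * Rintegral nu setT (fun x => nc (f x)))%:E * (pkn eps z)%:E)%E).
    by apply: integrableZl => //; exact: pkn_int.
  by apply/funext => z; rewrite /= -EFinM.
Qed.

(** Abel-summed Fourier inversion: the damping makes the double integral absolutely convergent, and
    the inner integral over the frequency is the Cauchy kernel. *)
Lemma poisson_ft s f eps y : s ^+ 2 = 1 -> 0 < eps -> cintegrable nu setT f ->
  ft (- s) (fun xi => (pkn eps xi)%:C * ft s f xi) y =
  cintegral nu setT (fun x => f x * (cker eps (x - y))%:C).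
Proof.
move=> s1 e0 fi; have [mf if_] := (cintP _ mT _).1 fi.
pose F (p : W * W) := (expi (- s * dot p.1 y) * expi (s * dot p.2 p.1)) * ((pkn eps p.1)%:C * f p.2).
have mF : cmeasurable setT F.
  apply: cmeasM; apply: cmeasM.
  - by apply: meas_expi; apply: measurable_funM => //; apply: measurable_dot.
  - by apply: meas_expi; apply: measurable_funM => //; apply: measurable_dot.
  - by apply: cmeas_real; exact: measurableT_comp (measurable_pkn eps) measurable_fst.
  - exact: (cmeas_comp measurable_snd).
have [|i1 i2 E] := @cfubini_dominated _ _ W W R lb lb _ (pkn eps) (fun x => nc (f x)) mF (pkn_int e0) if_.
  move=> x z; rewrite !ncM !nc_expi !mul1r nc_real ger0_norm ?pkn_ge0//.
have L : ft (- s) (fun xi => (pkn eps xi)%:C * ft s f xi) y =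
    (kap ^+ 2)%:C * cintegral lb setT (fun xi => cintegral lb setT (fun x => F (xi, x))).
  rewrite [LHS]/ft (@eq_cintegral _ _ _ nu setT _ (fun xi => kap%:C * cintegral nu setT (fun x => F (xi, x)))).
    rewrite expr2 [in RHS]rmorphM -mulrA; congr (_ * _); exact: (cintegralZ mT (kap%:C) i1).
  move=> xi _.
  rewrite (@eq_cintegral _ _ _ nu setT _ (fun x => (expi (- s * dot xi y) * (pkn eps xi)%:C) *
    (expi (s * dot x xi) * f x))) => [|x _]; last by rewrite /F /=; ring.
  rewrite (cintegralZ mT _ (ft_cint s xi fi)) /ft.
  move: (cintegral _ _ _) (expi _) => I J; ring.
rewrite L E -(cintegralZ mT _ i2); apply: eq_cintegral => x _.
have [j1 j2] := @pkn_fourier eps (s *: (x - y)) e0.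
rewrite (@eq_cintegral _ _ _ lb setT _ (fun xi => f x *
  (expi (dot xi (s *: (x - y))) * (pkn eps xi)%:C))) => [|xi _]; last first.
  rewrite /F /= -expiD (_ : - s * dot xi y + s * dot x xi = dot xi (s *: (x - y))).
    by ring.
  rewrite (dotC x) /dot !mulr_sumr -big_split/=; apply: eq_bigr => j _.
  by rewrite !mxE; ring.
rewrite (cintegralZ (mu := lb) mT _ j1) (j2 : cintegral lb setT _ = _) mulrCA -rmorphM/= /cker; congr (_ * (_ * _)%:C).
by apply: eq_bigr => j _; rewrite mxE exprMn s1 mul1r.
Qed.

(** The kernel has mass 1 in either variable, so Tonelli integrates out whichever variable [a] does
    not involve. *)
Lemma cker_tonelli eps (a : W -> R) : 0 < eps -> (forall x, 0 <= a x) ->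
  nu.-integrable setT (EFin \o a) ->
  ((lb \x lb)%E.-integrable setT (fun p : W * W => (a p.1 * cker eps (p.2 - p.1))%:E) /\
   Rintegral (lb \x lb)%E setT (fun p : W * W => a p.1 * cker eps (p.2 - p.1)) = Rintegral nu setT a) /\
  ((lb \x lb)%E.-integrable setT (fun p : W * W => (a p.2 * cker eps (p.2 - p.1))%:E) /\
   Rintegral (lb \x lb)%E setT (fun p : W * W => a p.2 * cker eps (p.2 - p.1)) = Rintegral nu setT a).
Proof.
move=> e0 a0 ia; have ma : measurable_fun setT a by apply/measurable_EFinP; exact: measurable_int ia.
have mc : measurable_fun setT (fun p : W * W => cker eps (p.2 - p.1)).
  exact: (measurableT_comp (measurable_cker e0) measurable_sub2).
have c0 z : 0 <= cker eps z by apply: cker_ge0; exact: ltW.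
have k1 y : (\int[lb]_x (cker eps (x - y))%:E = 1)%E.
  have [i e] := cker_integral y e0.
  by rewrite -(fineK (integrable_fin_num mT i)) -[X in X%:E]/(Rintegral nu setT _) e.
have k2 x : (\int[lb]_y (cker eps (x - y))%:E = 1)%E.
  by rewrite -(k1 x); apply: eq_integral => y _; rewrite -ckerN opprB.
have fa : (\int[lb]_x (a x)%:E)%E = (Rintegral nu setT a)%:E.
  by rewrite /Rintegral fineK//; exact: (integrable_fin_num mT ia).
have H (h : W * W -> R) : measurable_fun setT h -> (forall p, 0 <= h p) ->
    (\int[lb \x lb]_p (h p)%:E = (Rintegral nu setT a)%:E)%E ->
    (lb \x lb)%E.-integrable setT (fun p => (h p)%:E) /\
    Rintegral (lb \x lb)%E setT h = Rintegral nu setT a.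
  move=> mh h0 E; split; last by rewrite [LHS]/Rintegral E.
  apply/integrableP; split; first exact/measurable_EFinP.
  by under eq_integral do rewrite gee0_abs ?lee_fin//; rewrite E ltry.
split; apply: H.
- by apply: measurable_funM => //; exact: (measurableT_comp ma measurable_fst).
- by move=> p; rewrite mulr_ge0.
- rewrite fubini_tonelli1/=; last 2 first.
  + by apply/measurable_EFinP; apply: measurable_funM => //; exact: (measurableT_comp ma measurable_fst).
  + by move=> p; rewrite lee_fin mulr_ge0.
  rewrite -fa; apply: eq_integral => y _; rewrite /fubini_F /=.
  under eq_integral do rewrite EFinM.
  rewrite ge0_integralZl//= ?k1 ?mule1//.
  + by apply/measurable_EFinP; exact: (measurableT_comp mc (measurable_pair1 y)).
  + by move=> x _; rewrite lee_fin.
  + by rewrite lee_fin.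
- by apply: measurable_funM => //; exact: (measurableT_comp ma measurable_snd).
- by move=> p; rewrite mulr_ge0.
- rewrite fubini_tonelli2/=; last 2 first.
  + by apply/measurable_EFinP; apply: measurable_funM => //; exact: (measurableT_comp ma measurable_snd).
  + by move=> p; rewrite lee_fin mulr_ge0.
  rewrite -fa; apply: eq_integral => x _; rewrite /fubini_G /=.
  under eq_integral do rewrite EFinM.
  rewrite ge0_integralZl//= ?k2 ?mule1//.
  + by apply/measurable_EFinP; exact: (measurableT_comp mc (measurable_pair2 x)).
  + by move=> y _; rewrite lee_fin.
  + by rewrite lee_fin.
Qed.

(** By Fubini and [poisson_ft] the left side is the double integral of [conj(f(y)) f(x)] against the
    Cauchy kernel. The kernel having mass 1, the bound [|f(x) f(y)| <= (|f(x)|^2 + |f(y)|^2) / 2]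
    gives [||f||^2]. *)
Lemma bessel_pkn s f eps : s ^+ 2 = 1 -> 0 < eps -> cintegrable nu setT f -> L2 nu setT f ->
  (\int[nu]_xi (pkn eps xi * nc (ft s f xi) ^+ 2)%:E <= (n2 nu setT f ^+ 2)%:E)%E.
Proof.
move=> s1 e0 fi lf; have [mf if_] := (cintP _ mT _).1 fi.
pose g := ft s f; pose wg xi := (pkn eps xi)%:C * g xi.
have iwg : cintegrable nu setT wg by exact: ft_pkn_cint.
have [mg2 _] := (cintP _ mT _).1 iwg.
have mg : cmeasurable setT g by exact: meas_ft.
have [i0 inc] := (cintP _ mT _).1 iwg.
pose C := kap * Rintegral nu setT (fun x => nc (f x)).
have gC xi : nc (g xi) <= C by exact: ft_bnd.
have iC : nu.-integrable setT (fun xi => (C * nc (wg xi))%:E).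
  by under eq_fun do rewrite EFinM; exact: integrableZl.
have iG : nu.-integrable setT (fun xi => (pkn eps xi * nc (g xi) ^+ 2)%:E).
  apply: (@int_le _ _ _ _ setT mT _ (fun xi => C * nc (wg xi))).
  - by apply: measurable_funM; [exact: measurable_pkn|exact: (meas_nc2 mg)].
  - move=> x _; rewrite ger0_norm; last by apply: mulr_ge0; [exact: pkn_ge0|exact: sqr_ge0].
    have -> : nc (wg x) = pkn eps x * nc (g x).
      by rewrite /wg ncM nc_real ger0_norm ?pkn_ge0.
    apply: (@le_trans _ _ (nc (g x) * (pkn eps x * nc (g x)))); first by rewrite expr2 mulrCA.
    by apply: ler_wpM2r; [rewrite mulr_ge0 ?pkn_ge0 ?nc_ge0|exact: gC].
  - exact: iC.
have A1 : (Rintegral nu setT (fun xi => pkn eps xi * nc (g xi) ^+ 2))%:C =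
    cintegral nu setT (fun xi => wg xi * (g xi)^*).
  rewrite -(cintegral_real nu mT); apply: eq_cintegral => xi _.
  by rewrite /wg -mulrA mulconj -rmorphM.
pose P y := ft (- s) wg y.
have A2 : cintegral nu setT (fun xi => wg xi * (g xi)^*) =
    cintegral nu setT (fun y => (f y)^* * P y).
  pose F (p : W * W) := (wg p.1 * kap%:C) * (expi (- s * dot p.2 p.1) * (f p.2)^*).
  have mF : cmeasurable setT F.
    apply: cmeasM; apply: cmeasM.
    - exact: (cmeas_comp measurable_fst).
    - exact: cmeas_cst.
    - by apply: meas_expi; apply: measurable_funM => //; apply: measurable_dot.
    - by apply: cmeas_conj; exact: (cmeas_comp measurable_snd).
  have ik : nu.-integrable setT (EFin \o (fun xi => kap * nc (wg xi))).
    rewrite (_ : EFin \o _ = fun z => (kap%:E * (nc (wg z))%:E)%E); first exact: integrableZl.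
    by apply/funext => z; rewrite /= -EFinM.
  have [|_ _ E] := @cfubini_dominated _ _ W W R lb lb _ (fun xi => kap * nc (wg xi))
    (fun x => nc (f x)) mF ik if_.
    move=> x z; rewrite (_ : F (x, z) = (wg x * kap%:C) * (expi (- s * dot z x) * (f z)^*))//.
    rewrite (ncM (wg x * kap%:C)) (ncM (wg x)) (ncM (expi _)).
    by rewrite nc_expi mul1r nc_real (gtr0_norm kap_gt0) nc_conj [nc (wg _) * _]mulrC.
  transitivity (cintegral lb setT (fun xi => cintegral lb setT (fun x => F (xi, x)))).
    apply: eq_cintegral => xi _; rewrite /F /= (cintegralZ mT); last first.
      by apply: ft_cint; exact: cint_conj.
    rewrite -mulrA; congr (_ * _); rewrite /g /ft [LHS]rmorphM; congr (_ * _); first exact: conjR.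
    transitivity (cintegral nu setT (fun x => (expi (s * dot x xi) * f x)^*)).
      exact: (esym (cintegral_conj mT (ft_cint s xi fi))).
    by apply: eq_cintegral => x _; rewrite rmorphM mulNr; congr (_ * _); exact: conj_expi.
  rewrite E; apply: eq_cintegral => x _; rewrite /P /ft mulrCA -(cintegralZ mT); last exact: ft_cint.
  rewrite -(cintegralZ mT); last by apply: (cintZ mT); exact: ft_cint.
  by apply: eq_cintegral => xi _; rewrite /F /= [dot x xi]dotC; ring.
pose B (p : W * W) := (f p.1)^* * (f p.2 * (cker eps (p.2 - p.1))%:C).
have [mf2 lf2] := lf.
have [[t1 t2] [t3 t4]] := cker_tonelli e0 (fun x => sqr_ge0 (nc (f x))) lf2.
pose H (p : W * W) : R := 2^-1 * (nc (f p.1) ^+ 2 * cker eps (p.2 - p.1)) +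
  2^-1 * (nc (f p.2) ^+ 2 * cker eps (p.2 - p.1)).
have t1' : (lb \x lb)%E.-integrable setT (fun p : W * W => (2^-1 * (nc (f p.1) ^+ 2 * cker eps (p.2 - p.1)))%:E).
  by under eq_fun do rewrite EFinM; exact: integrableZl.
have t3' : (lb \x lb)%E.-integrable setT (fun p : W * W => (2^-1 * (nc (f p.2) ^+ 2 * cker eps (p.2 - p.1)))%:E).
  by under eq_fun do rewrite EFinM; exact: integrableZl.
have iH : (lb \x lb)%E.-integrable setT (EFin \o H).
  rewrite (_ : EFin \o H = ((fun p : W * W => (2^-1 * (nc (f p.1) ^+ 2 * cker eps (p.2 - p.1)))%:E) \+
    (fun p : W * W => (2^-1 * (nc (f p.2) ^+ 2 * cker eps (p.2 - p.1)))%:E))%E); first exact: integrableD.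
  by apply/funext => p.
have c0 z : 0 <= cker eps z by apply: cker_ge0; exact: ltW.
have BH p : nc (B p) <= H p.
  rewrite /B /H !ncM nc_conj nc_real ger0_norm//.
  move: (nc _) (nc _) (cker _ _) (c0 (p.2 - p.1)) => a b K K0.
  rewrite -subr_ge0 (_ : _ - _ = 2^-1 * (K * (a - b) ^+ 2)); last by field.
  by rewrite mulr_ge0// mulr_ge0// sqr_ge0.
have iB : cintegrable (lb \x lb)%E setT B.
  apply: (@cint_le _ _ _ _ setT mT _ H) => //; apply: cmeasM.
    by apply: cmeas_conj; exact: (cmeas_comp measurable_fst).
  apply: cmeasM; first exact: (cmeas_comp measurable_snd).
  by apply: cmeas_real; exact: (measurableT_comp (measurable_cker e0) measurable_sub2).
have iBx y : cintegrable nu setT (fun x => f x * (cker eps (x - y))%:C).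
  apply: (eq_cint mT (f := fun x => (cker eps (x - y))%:C * f x)) => [x _|]; first by rewrite mulrC.
  apply: (@cintM_bnd _ _ _ _ setT mT (cker eps 0)) => //.
    by apply: cmeas_real; apply: (measurableT_comp (measurable_cker e0)); exact: (measurableT_comp measurable_sub2 (measurable_pair1 y)).
  by move=> x _; rewrite nc_real ger0_norm// cker_bnd.
have A3 : cintegral nu setT (fun y => (f y)^* * P y) = cintegral (lb \x lb)%E setT B.
  have [|_ <-] := @cfubini_l _ _ W W R lb lb B iB.
    by move=> y; exact: (cintZ mT ((f y)^*) (iBx y)).
  apply: eq_cintegral => y _; rewrite /P poisson_ft//.
  exact: (esym (cintegralZ mT ((f y)^*) (iBx y))).
have fin : Rintegral nu setT (fun xi => pkn eps xi * nc (g xi) ^+ 2) <= n2 nu setT f ^+ 2.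
  have X : nc (cintegral (lb \x lb)%E setT B) <= Rintegral (lb \x lb)%E setT H.
    by apply: (le_nc_cintegral mT).
  have EH : Rintegral (lb \x lb)%E setT H = n2 nu setT f ^+ 2.
    rewrite /H RintegralD// RintegralZl// RintegralZl// t2 t4 sqr_n2.
    by rewrite -mulrDl -[RHS]mul1r; congr (_ * _); field.
  move: X; rewrite EH -A3 -A2 -A1 nc_real => X.
  by rewrite (le_trans (ler_norm _)).
rewrite -lee_fin in fin; apply: le_trans fin.
by rewrite /Rintegral fineK//; exact: (integrable_fin_num mT iG).
Qed.

Lemma pk_cvg (t : R) : (fun k => pk (hseq R k) t) @ \oo --> (1 : R).
Proof.
rewrite -[X in _ --> X]expR0; apply: (@continuous_cvg _ R^o R^o); first exact: continuous_expR.
rewrite -oppr0 -(mul0r `|t|); apply: cvgN; apply: cvgM; [exact: hseq_cvg|exact: cvg_cst].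
Qed.

Lemma pkn_cvg xi : (fun k => pkn (hseq R k) xi) @ \oo --> (1 : R).
Proof.
rewrite /pkn; elim: (index_enum _) => [|j r ih].
  by under eq_fun do rewrite big_nil; exact: cvg_cst.
under eq_fun do rewrite big_cons.
by have := cvgM (pk_cvg (xi ord0 j)) ih; rewrite mulr1; exact.
Qed.

(** Fatou's lemma removes the damping from [bessel_pkn] and at the same time shows that the
    transform is square integrable. *)
Lemma bessel s f : s ^+ 2 = 1 -> cintegrable nu setT f -> L2 nu setT f ->
  L2 nu setT (ft s f) /\ n2 nu setT (ft s f) <= n2 nu setT f.
Proof.
move=> s1 fi lf; have mg : cmeasurable setT (ft s f) by exact: meas_ft.
have [||x _|k|i1 e1] := @fatou_le _ W R nu setT mT (fun k xi => pkn (hseq R k) xi * nc (ft s f xi) ^+ 2)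
  (fun xi => nc (ft s f xi) ^+ 2) (n2 nu setT f ^+ 2).
- by move=> k x _; rewrite mulr_ge0 ?pkn_ge0 ?sqr_ge0.
- by move=> k; apply: measurable_funM; [exact: measurable_pkn|exact: (meas_nc2 mg)].
- rewrite -[X in _ --> X]mul1r; apply: cvgM; [exact: pkn_cvg|exact: cvg_cst].
- by apply: bessel_pkn => //; exact: hseq_gt0.
split; first by split.
by rewrite -(@ler_pXn2r _ 2) ?nnegrE ?n2_ge0// sqr_n2.
Qed.

End fourier_transform.

(** * Invariance of Lebesgue measure under [x |-> -x] *)

Section reflection.
Context (R : realType).

Lemma ge0_integral_opp (f : R -> \bar R) : measurable_fun setT f -> (forall t, 0 <= f t)%E ->
  (\int[@lebesgue_measure R]_t f t = \int[@lebesgue_measure R]_t f (- t)%R)%E.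
Proof.
move=> mf f0.
have mphi : measurable_fun (setT : set (measurableTypeR R)) ((fun t : R => - t) : _ -> measurableTypeR R).
  by apply: continuous_measurable_fun => t; exact: opp_continuous.
pose nu : {measure set (measurableTypeR R) -> \bar R} := pushm (@lebesgue_measure R) mphi.
rewrite (eq_measure_integral nu).
  by rewrite ge0_integral_pushforward// preimage_setT.
move=> A mA _; apply: (@lebesgue_measure_unique R nu) => // _ [[x y] /= _ <-].
rewrite /nu /= /pushforward (_ : _ @^-1` _ = `[- y, - x[%classic).
  rewrite !lebesgue_measure_itv/= !lte_fin ltrN2; case: ifPn => // xy.
  by rewrite -!EFinD opprK addrC.
by apply/seteqP; split => t /=; rewrite !in_itv/= => /andP[h1 h2]; apply/andP; split; lra.
Qed.

Lemma rcons_opp d (x : 'rV[R]_d) (t : R) : rV_rcons (- x) (- t) = - rV_rcons x t.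
Proof. by apply/rowP => i; rewrite !mxE; case: (unlift ord_max i) => [j|//]; rewrite mxE. Qed.

Lemma measurable_rV_opp d : measurable_fun setT (fun x : 'rV[R]_d => - x).
Proof.
apply: measurable_fun_rVP => i; under eq_fun do rewrite mxE.
by apply: measurableT_comp => //; exact: measurable_rV_coord.
Qed.

Lemma ge0_integral_rV_opp d (f : 'rV[R]_d -> \bar R) :
  measurable_fun setT f -> (forall x, 0 <= f x)%E ->
  (\int[lebesgue_rV R d]_x f x = \int[lebesgue_rV R d]_x f (- x)%R)%E.
Proof.
elim: d f => [|d ih] f mf f0.
  by apply: eq_integral => x _; congr f; apply/rowP => -[].
have mfo : measurable_fun setT (fun x : 'rV[R]_d.+1 => f (- x)%R).
  by apply: measurableT_comp => //; exact: measurable_rV_opp.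
have mg : measurable_fun setT (fun x => \int[lebesgue_measure]_t f (rV_rcons x t))%E.
  exact: (@measurable_fun_fubini_tonelli_F _ _ _ _ _ (@lebesgue_measure R) _
    (measurable_comp_rcons mf) (fun p => f0 _)).
have g0 x : (0 <= \int[lebesgue_measure]_t f (rV_rcons x t))%E by apply: integral_ge0.
rewrite (ge0_integral_rcons mf f0) (ge0_integral_rcons mfo (fun x => f0 _)) [LHS](ih _ mg g0).
apply: eq_integral => x _; rewrite ge0_integral_opp//.
  by apply: eq_integral => t _; rewrite rcons_opp.
by apply: measurableT_comp => //; exact: measurable_rcons_r.
Qed.

Lemma cint_rV_opp d (f : 'rV[R]_d -> R[i]) : cintegrable (lebesgue_rV R d) setT f ->
  cintegral (lebesgue_rV R d) setT f = cintegral (lebesgue_rV R d) setT (fun x => f (- x)).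
Proof.
have H (h : 'rV[R]_d -> R) : (lebesgue_rV R d).-integrable setT (EFin \o h) ->
    Rintegral (lebesgue_rV R d) setT h = Rintegral (lebesgue_rV R d) setT (fun x => h (- x)).
  move=> ih; have mh := measurable_int _ ih; rewrite /Rintegral; congr fine.
  rewrite integralE [RHS]integralE; congr (_ - _)%E.
  - rewrite (ge0_integral_rV_opp (measurable_funepos mh) (funepos_ge0 _)).
    by apply: eq_integral => x _; rewrite !funeposE.
  - rewrite (ge0_integral_rV_opp (measurable_funeneg mh) (funeneg_ge0 _)).
    by apply: eq_integral => x _; rewrite !funenegE.
by move=> [f1 f2]; rewrite /cintegral (H _ f1) (H _ f2).
Qed.

End reflection.

Section fourier_test.
Context (R : realType) (d : nat).
Notation W := 'rV[R]_d.
Notation nu := (lebesgue_rV R d).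
Notation lb := (leb R d).
Notation kap := (Num.sqrt (2 * pi) ^- d : R).
Implicit Types (f g phi psi : W -> R[i]) (s : R) (x xi : W).

Lemma ftZ s z f xi : cintegrable nu setT f -> ft s (fun x => z * f x) xi = z * ft s f xi.
Proof.
move=> fi; rewrite /ft mulrCA -(cintegralZ mT z (ft_cint s xi fi)); congr (_ * _).
by apply: eq_cintegral => x _; rewrite mulrCA.
Qed.

Lemma ftD s f g xi : cintegrable nu setT f -> cintegrable nu setT g ->
  ft s (fun x => f x + g x) xi = ft s f xi + ft s g xi.
Proof.
move=> fi gi; rewrite /ft -mulrDr -(cintegralD mT (ft_cint s xi fi) (ft_cint s xi gi)).
by congr (_ * _); apply: eq_cintegral => x _; rewrite mulrDr.
Qed.

Lemma ftB s f g xi : cintegrable nu setT f -> cintegrable nu setT g ->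
  ft s (fun x => f x - g x) xi = ft s f xi - ft s g xi.
Proof.
move=> fi gi; rewrite -[ft s g xi]mul1r -mulNr -(ftZ s (-1) xi gi) -ftD//.
  by congr (ft s _ xi); apply/funext => x; rewrite mulN1r.
exact: (cintZ mT).
Qed.

Lemma ft_opp s f xi : ft (- s) f xi = ft s f (- xi).
Proof.
congr (_ * _); apply: eq_cintegral => x _; rewrite (dotC x (- xi)) dotNl (dotC xi).
by rewrite mulNr mulrN.
Qed.

(** The multiplication formula: the phase is symmetric in its two variables and [f(x) g(y)] is
    integrable on the product. *)
Lemma ft_swap s f g : cintegrable nu setT f -> cintegrable nu setT g ->
  cintegral nu setT (fun x => f x * ft s g x) = cintegral nu setT (fun xi => g xi * ft s f xi).
Proof.
move=> fi gi; have [mf if_] := (cintP _ mT _).1 fi; have [mg ig] := (cintP _ mT _).1 gi.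
pose F (p : W * W) := (f p.1 * g p.2) * expi (s * dot p.1 p.2).
have mF : cmeasurable setT F.
  apply: cmeasM; first by apply: cmeasM; [exact: (cmeas_comp measurable_fst)|exact: (cmeas_comp measurable_snd)].
  by apply: meas_expi; apply: measurable_funM => //; apply: measurable_dot.
have [|i1 i2 E] := @cfubini_dominated _ _ W W R lb lb _ (fun x => nc (f x)) (fun x => nc (g x)) mF if_ ig.
  by move=> x y; rewrite /F !ncM nc_expi mulr1.
transitivity (kap%:C * cintegral lb setT (fun x => cintegral lb setT (fun y => F (x, y)))).
  rewrite -(cintegralZ mT _ i1); apply: eq_cintegral => x _; rewrite /ft mulrCA; congr (_ * _).
  rewrite -(cintegralZ mT _ (ft_cint s x gi)); apply: eq_cintegral => y _.
  by rewrite /F /= dotC; ring.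
rewrite E -(cintegralZ mT _ i2); apply: eq_cintegral => y _; rewrite /ft mulrCA; congr (_ * _).
rewrite -(cintegralZ mT _ (ft_cint s y fi)); apply: eq_cintegral => x _.
by rewrite /F /=; ring.
Qed.

Lemma derive_dot (x v xi : W) : is_derive x v (fun y => dot y xi) (dot v xi).
Proof.
apply/is_derive_line.
rewrite (_ : (fun t => _) = (fun t : R => t * dot v xi + dot x xi)).
  rewrite -[X in is_derive _ _ _ X]addr0; apply: is_deriveD => //.
  rewrite -[X in is_derive _ _ _ X]add0r -[in X in is_derive _ _ _ X](mulr0 0).
  rewrite -[X in is_derive _ _ _ (_ + X)]mulr1.
  by apply: (is_deriveM (f := id) (g := cst (dot v xi))).
apply/funext => t; rewrite dotDl; congr (_ + _).
by rewrite /dot mulr_sumr; apply: eq_bigr => j _; rewrite mxE mulrA.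
Qed.

Lemma Ck_dotl k xi : Ck k (fun x => dot x xi).
Proof.
by rewrite /dot; apply: Ck_sum => j; apply: CkM; [exact: Ck_coord|exact: Ck_cst].
Qed.

Lemma ft_partial s phi j xi : tf phi ->
  ft s (partial j phi) xi = (0 +i* (- (s * xi ord0 j))) * ft s phi xi.
Proof.
move=> tp; rewrite /ft mulrCA; congr (_ * _).
have Ce k : Ck k (fun x => dot x xi) by exact: Ck_dotl.
have se : csmooth (fun x => expi (s * dot x xi)) := mult_smooth (mult_expi s) Ce.
rewrite (integral_by_parts j se tp) -(cintegralZ mT _ (ft_cint s xi (tf_cint tp))).
rewrite -(cintegralN mT).
  apply: eq_cintegral => x _; rewrite (mult_partial (mult_expi s) j x Ce).
  have [_ ->] := derive_dot x (delta_mx ord0 j) xi.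
  rewrite (_ : dot (delta_mx ord0 j) xi = xi ord0 j).
    rewrite (_ : 0 +i* - (s * xi ord0 j) = - ((0 +i* s) * (xi ord0 j)%:C)).
      by move: (expi _) (phi x) => E p; ring.
    by apply/eqP; rewrite eq_complex /=; apply/andP; split; apply/eqP; ring.
  rewrite /dot (bigD1 j)//= mxE !eqxx mul1r big1 ?addr0// => i ij.
  by rewrite mxE eqxx (negbTE ij) mul0r.
have tp' : tf (fun x => partial j (fun y => expi (s * dot y xi)) x * phi x).
  by apply: tfM => //; exact: csmooth_partial.
exact: tf_cint.
Qed.

Lemma ft_laplace s phi j xi : s ^+ 2 = 1 -> tf phi ->
  ft s (fun x => phi x - partial j (partial j phi) x) xi = (1 + xi ord0 j ^+ 2)%:C * ft s phi xi.
Proof.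
move=> s1 tp; have tj := tf_partial j tp; have tjj := tf_partial j tj.
rewrite (@ftB s phi (partial j (partial j phi)) xi (tf_cint tp) (tf_cint tjj)) !ft_partial// mulrA -{1}[ft s phi xi]mul1r -mulrBl.
congr (_ * _); apply/eqP; rewrite eq_complex/=; apply/andP; split; apply/eqP; last by ring.
by rewrite -[in RHS](mul1r (_ ^+ 2)) -s1; ring.
Qed.

(** An integrable majorant for transforms of test functions, the reciprocal of the symbol of
    [prod_j (1 - d_j^2)]. *)
Definition decay xi : R := \prod_j (1 + xi ord0 j ^+ 2)^-1.

Lemma decay_ge0 xi : 0 <= decay xi.
Proof. by apply: prodr_ge0 => j _; rewrite invr_ge0 addr_ge0// sqr_ge0. Qed.

Lemma decay_le1 xi : decay xi <= 1.
Proof.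
apply: prodr_ile1 => j _; have p : 1 <= 1 + xi ord0 j ^+ 2 by rewrite lerDl sqr_ge0.
by rewrite invr_ge0 (le_trans ler01 p) invf_le1// (lt_le_trans ltr01 p).
Qed.

Lemma decay_int : nu.-integrable setT (EFin \o decay).
Proof.
have [i1 _] := cauchy_int R.
have i1' : (@lebesgue_measure R).-integrable setT (fun t => ((1 + t ^+ 2)^-1)%:E).
  have := integrableZl mT 2^-1 i1; congr (_.-integrable setT _); apply/funext => t.
  by rewrite -EFinM mulKf.
have [[i2 _] _] := @cprod_integral R d (fun _ t => ((1 + t ^+ 2)^-1)%:C) (fun j => cint_real i1').
apply: eq_integrable i2 => // x _.
by rewrite /decay /= -real_prod.
Qed.

(** Each [1 - d_j^2] multiplies the transform by [1 + xi_j^2]; after all coordinates have been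
    treated, the transform of a test function remains, which is bounded. *)
Lemma tf_decay0 s phi : s ^+ 2 = 1 -> tf phi ->
  exists2 C, 0 <= C & forall xi, nc (ft s phi xi) <= C * decay xi.
Proof.
move=> s1 tp.
(* The product runs over a list so that the induction can change [phi] into [phi - d_j d_j phi] at
   each coordinate. *)
suff [C C0 CP] : exists2 C : R, 0 <= C & forall xi,
    nc (ft s phi xi) * \prod_(j <- index_enum 'I_d) (1 + xi ord0 j ^+ 2) <= C.
  exists C => // xi; rewrite /decay prodfV ler_pdivlMr//.
  by apply: prodr_gt0 => j _; rewrite ltr_pwDl// sqr_ge0.
elim: (index_enum _) phi tp => [|j r ih] phi tp.
  exists (kap * Rintegral nu setT (fun x => nc (phi x))).
    by rewrite mulr_ge0 ?(ltW (kap_gt0 _ _))// Rintegral_ge0// => x _; exact: nc_ge0.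
  by move=> xi; rewrite big_nil mulr1; apply: ft_bnd; exact: tf_cint.
have tl : tf (fun x => phi x - partial j (partial j phi) x).
  by apply: tfB => //; apply: tf_partial; exact: tf_partial.
have [C C0 CP] := ih _ tl; exists C => // xi.
have := CP xi; rewrite ft_laplace// ncM nc_real ger0_norm ?addr_ge0 ?sqr_ge0//.
by rewrite big_cons [nc _ * (_ * _)]mulrCA mulrA.
Qed.

(** [|xi|] is at most the sum of the [|xi_j|], each of which turns [phi] into one of its partial
    derivatives. *)
Lemma tf_decay s phi : s ^+ 2 = 1 -> tf phi ->
  exists2 C, 0 <= C & forall xi, (1 + enorm xi) * nc (ft s phi xi) <= C * decay xi.
Proof.
move=> s1 tp; have [C C0 CP] := tf_decay0 s1 tp.
have /choice[D DP] : forall j : 'I_d, exists D : R, 0 <= D /\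
    forall xi, nc (ft s (partial j phi) xi) <= D * decay xi.
  by move=> j; have [D D0 DP] := tf_decay0 s1 (tf_partial j tp); exists D.
exists (C + \sum_j D j) => [|xi].
  by rewrite addr_ge0// sumr_ge0// => j _; have [] := DP j.
rewrite mulrDl mul1r mulrDl lerD// (le_trans (ler_wpM2r _ (enorm_le_sum xi))) ?nc_ge0//.
rewrite !mulr_suml; apply: ler_sum => j _; have [_ /(_ xi)] := DP j.
rewrite ft_partial// ncM (_ : nc (0 +i* _) = `|xi ord0 j|)//.
rewrite /= expr0n/= add0r sqrtr_sqr normrN normrM.
have -> : `|s| = 1; last by rewrite mul1r.
by apply/eqP; rewrite -(@eqrXn2 _ 2%N) ?normr_ge0// expr1n -normrX s1 normr1.
Qed.

Definition sqx xi : R[i] := (Num.sqrt (enorm xi))%:C.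

Lemma meas_sqx : cmeasurable setT sqx.
Proof.
apply: cmeas_real; apply: continuous_rV_measurable => x.
by apply: (continuous_comp (@enorm_continuous R d x)); exact: sqrt_continuous.
Qed.

Lemma nc_sqx xi : nc (sqx xi) <= 1 + enorm xi.
Proof. by rewrite nc_real ger0_norm ?sqrtr_ge0// sqrt_le1D// enorm_ge0. Qed.

Section multiplied.
Variables (s : R) (phi : W -> R[i]) (M : W -> R[i]) (K : R).
Hypotheses (s1 : s ^+ 2 = 1) (tp : tf phi) (mM : cmeasurable setT M).
Hypothesis MK : forall xi, nc (M xi) <= K * (1 + enorm xi).

Let bnd : exists2 C, 0 <= C & forall xi, nc (M xi * ft s phi xi) <= C * decay xi.
Proof.
have [C C0 CP] := tf_decay s1 tp.
have K0 : 0 <= K.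
  by have := le_trans (nc_ge0 (M 0)) (MK 0); rewrite pmulr_lge0// ltr_wpDr ?enorm_ge0.
exists (K * C) => [|xi]; first exact: mulr_ge0.
rewrite ncM (le_trans (ler_wpM2r (nc_ge0 _) (MK xi)))// -!mulrA ler_wpM2l//.
Qed.

Let mMf : cmeasurable setT (fun xi => M xi * ft s phi xi).
Proof. by apply: cmeasM => //; apply: meas_ft; exact: tf_cint. Qed.

Lemma mul_ft_cint : cintegrable nu setT (fun xi => M xi * ft s phi xi).
Proof.
have [C C0 CP] := bnd; apply: (@cint_le _ _ _ _ setT mT _ (fun xi => C * decay xi)) => //.
have := integrableZl mT C decay_int; congr (_.-integrable setT _).
Qed.

Lemma mul_ft_L2 : L2 nu setT (fun xi => M xi * ft s phi xi).
Proof.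
have [C C0 CP] := bnd; apply: (@L2_le _ _ _ nu setT mT _ (fun xi => C ^+ 2 * decay xi)) => //.
  move=> xi _; rewrite (le_trans (lerXn2r 2 _ _ (CP xi))) ?nnegrE ?nc_ge0 ?mulr_ge0 ?decay_ge0//.
  rewrite exprMn ler_wpM2l ?sqr_ge0// expr2 ler_piMr ?decay_ge0 ?decay_le1//.
have := integrableZl mT (C ^+ 2) decay_int; congr (_.-integrable setT _).
Qed.

End multiplied.

Lemma one_bnd xi : nc (1 : R[i]) <= 1 * (1 + enorm xi).
Proof. by rewrite Normc.normc1 mul1r lerDl enorm_ge0. Qed.

Lemma ft_tf_cint s phi : s ^+ 2 = 1 -> tf phi -> cintegrable nu setT (ft s phi).
Proof.
move=> s1 tp; have := mul_ft_cint s1 tp (cmeas_cst setT 1) one_bnd.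
by under eq_fun do rewrite mul1r.
Qed.

(** With the damping [pkn] inserted, dominated convergence leads to the left side; by [poisson_ft]
    and a rescaling, the same quantity is the average of [phi(x + h z)] against [cker 1], which
    tends to [phi x]. *)
Lemma ft_inversion s phi x : s ^+ 2 = 1 -> tf phi -> ft (- s) (ft s phi) x = phi x.
Proof.
move=> s1 tp; have ci := tf_cint tp; have [C C0 CP] := tf_bnd tp.
have hk k : 0 < hseq R k by exact: hseq_gt0.
have c1 : ccvg (fun k => ft (- s) (fun xi => (pkn (hseq R k) xi)%:C * ft s phi xi) x)
    (ft (- s) (ft s phi) x).
  apply: ccvgM; first exact: ccvg_cst.
  have fi := ft_tf_cint s1 tp; have [mf if_] := (cintP _ mT _).1 fi.
  have me : cmeasurable setT (fun xi : W => expi (- s * dot xi x)).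
    by apply: meas_expi; apply: measurable_funM => //; apply: measurable_dot.
  have [||y _|k y _|_ //] := @cdominated _ _ _ nu setT mT
    (fun k xi => expi (- s * dot xi x) * ((pkn (hseq R k) xi)%:C * ft s phi xi))
    (fun xi => expi (- s * dot xi x) * ft s phi xi) (fun xi => nc (ft s phi xi)) _ _ _ if_.
  - move=> k; apply: cmeasM => //; apply: cmeasM => //.
    by apply: cmeas_real; exact: measurable_pkn.
  - exact: cmeasM.
  - apply: ccvgM; first exact: ccvg_cst.
    rewrite -[X in ccvg _ X]mul1r; apply: ccvgM; last exact: ccvg_cst.
    by apply: ccvg_real; exact: pkn_cvg.
  - rewrite (ncM (expi _)) (ncM (pkn _ _)%:C) nc_expi mul1r nc_real.
    rewrite ger0_norm ?pkn_ge0// ler_piMl ?nc_ge0//.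
    by apply: pkn_le1; exact: ltW.
have c2 : ccvg (fun k => ft (- s) (fun xi => (pkn (hseq R k) xi)%:C * ft s phi xi) x) (phi x).
  have [i1 e1] := cker1_integral R d.
  have E k : ft (- s) (fun xi => (pkn (hseq R k) xi)%:C * ft s phi xi) x =
      cintegral nu setT (fun z => phi (hseq R k *: z + x) * (cker 1 z)%:C).
    rewrite (poisson_ft x s1 (hk k) ci) (cintegral_rV_affine x (hk k)); last first.
      apply: (@eq_cint _ _ _ nu setT mT (fun y : W => (cker (hseq R k) (y - x))%:C * phi y)) => [y _|]; first by rewrite mulrC.
      apply: (@cintM_bnd _ _ _ _ setT mT (cker (hseq R k) (0 : W))) => //.
        apply: cmeas_real; apply: (measurableT_comp (measurable_cker (hk k))).
        exact: (measurableT_comp (@measurable_sub2 R d) (measurable_pair1 x)).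
      by move=> y _; rewrite nc_real ger0_norm ?cker_ge0 ?(ltW (hk k))// cker_bnd.
    rewrite -(cintegralZ mT).
      apply: eq_cintegral => z _; rewrite addrK -(cker_scale z (hk k)) mulrCA; congr (_ * _).
      exact: (esym (rmorphM _ (hseq R k ^+ d) (cker (hseq R k) (hseq R k *: z)))).
    apply: (@cint_le _ _ _ _ setT mT _ (fun z => C * (hseq R k ^- d * cker 1 z))).
    - apply: cmeasM.
        exact: (@cmeas_comp R d _ W (fun z : W => hseq R k *: z + x) phi (measurable_rV_affine _ _) (tf_meas tp)).
      apply: cmeas_real; apply: (measurableT_comp (measurable_cker (hk k))).
      under eq_fun do rewrite addrK.
      by have := @measurable_rV_affine R d (hseq R k) 0; under eq_fun do rewrite addr0.
    - move=> z _; rewrite addrK ncM nc_real ger0_norm ?cker_ge0 ?(ltW (hk k))//.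
      rewrite ler_pM ?nc_ge0 ?cker_ge0 ?(ltW (hk k))//.
      by rewrite -(cker_scale z (hk k)) mulKf// expf_neq0// gt_eqF.
    - have := integrableZl mT (C * hseq R k ^- d) i1; congr (_.-integrable setT _).
      by apply/funext => z; rewrite /= -EFinM -mulrA.
  have -> : phi x = cintegral nu setT (fun z => phi x * (cker 1 z)%:C).
    rewrite (cintegralZ mT); last exact: cint_real.
    by rewrite (cintegral_real nu mT) e1 mulr1.
  under eq_fun do rewrite E.
  have m1 : cmeasurable setT (fun z : W => (cker 1 z)%:C).
    by apply: cmeas_real; exact: measurable_cker.
  have iC : nu.-integrable setT (fun z => (C * cker 1 z)%:E).
    by under eq_fun do rewrite EFinM; exact: integrableZl.
  have [||y _|k y _|_ //] := @cdominated _ _ _ nu setT mT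
    (fun k z => phi (hseq R k *: z + x) * (cker 1 z)%:C)
    (fun z => phi x * (cker 1 z)%:C) (fun z => C * cker 1 z) _ _ _ iC.
  - move=> k; apply: cmeasM => //.
    exact: (@cmeas_comp R d _ W (fun z : W => hseq R k *: z + x) phi (measurable_rV_affine _ _) (tf_meas tp)).
  - by apply: cmeasM => //; exact: cmeas_cst.
  - apply: ccvgM; last exact: ccvg_cst.
    have [f1 f2] := csmooth_cont (tf_smooth tp).
    have L : (fun k => hseq R k *: y + x) @ \oo --> x.
      rewrite -[X in _ --> X]add0r -(scale0r y); apply: cvgD; last exact: cvg_cst.
      by apply: cvgZ; [exact: hseq_cvg|exact: cvg_cst].
    apply/ccvgP; split.
    + exact: (@cvg_comp _ _ _ (fun k => hseq R k *: y + x) (fun z => Re (phi z)) _ _ _ L (f1 x)).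
    + exact: (@cvg_comp _ _ _ (fun k => hseq R k *: y + x) (fun z => Im (phi z)) _ _ _ L (f2 x)).
  - rewrite ncM nc_real ger0_norm ?cker_ge0//.
    by rewrite ler_wpM2r ?cker_ge0.
exact: (ccvg_unique c1 c2).
Qed.

End fourier_test.

(** * The operator (-Delta)^{1/4} on test functions *)

Section frac_lap.
Context (R : realType) (d : nat).
Notation W := 'rV[R]_d.
Notation nu := (lebesgue_rV R d).
Notation lb := (leb R d).
Notation kap := (Num.sqrt (2 * pi) ^- d : R).
Implicit Types (f g phi psi : W -> R[i]) (s : R) (x xi : W).

Lemma sqr_N1 : (-1) ^+ 2 = 1 :> R. Proof. by rewrite sqrrN expr1n. Qed.

Definition sqft phi xi : R[i] := sqx xi * ft (-1) phi xi.

(** The seminorm of the homogeneous space of order 1/2, taken on the Fourier side. *)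
Definition energy phi : R := n2 nu setT (sqft phi).

Lemma frac_lapE phi : frac_lap_test phi = ft 1 (sqft phi).
Proof. by rewrite /frac_lap_test inv_fourierE fourierE. Qed.

Lemma sqx_bnd xi : nc (sqx xi) <= 1 * (1 + enorm xi).
Proof. by rewrite mul1r nc_sqx. Qed.

Lemma sqft_cint phi : tf phi -> cintegrable nu setT (sqft phi).
Proof. by move=> tp; exact: (mul_ft_cint sqr_N1 tp (@meas_sqx R d) sqx_bnd). Qed.

Lemma sqft_L2 phi : tf phi -> L2 nu setT (sqft phi).
Proof. by move=> tp; exact: (mul_ft_L2 sqr_N1 tp (@meas_sqx R d) sqx_bnd). Qed.

Lemma frac_lap_L2 phi : tf phi ->
  L2 nu setT (frac_lap_test phi) /\ n2 nu setT (frac_lap_test phi) <= energy phi.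
Proof.
move=> tp; rewrite frac_lapE; apply: bessel; [by rewrite expr1n|exact: sqft_cint|exact: sqft_L2].
Qed.

Lemma cint_ft s f g : cintegrable nu setT f -> cintegrable nu setT g ->
  cintegrable nu setT (fun x => f x * ft s g x).
Proof.
move=> fi gi; apply: (@eq_cint _ _ _ nu setT mT (fun x => ft s g x * f x)) => [x _|]; first by rewrite mulrC.
apply: (@cintM_bnd _ _ _ _ setT mT (kap * Rintegral nu setT (fun x => nc (g x)))) => //.
  exact: meas_ft.
by move=> x _; exact: ft_bnd.
Qed.

(** By [ft_swap] both pairings become frequency integrals; they agree after the reflection
    [xi |-> -xi], under which [|xi|^{1/2}] is even. *)
Lemma frac_lap_tf phi : tf phi -> is_frac_lap phi (frac_lap_test phi).
Proof.
move=> tp; have cp := tf_cint tp; have sp := sqft_cint tp.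
split; first exact: tf_meas.
  by rewrite frac_lapE; exact: meas_ft.
move=> psi ts; have cs := tf_cint ts; have ss := sqft_cint ts.
rewrite !frac_lapE.
split; first exact: cint_ft.
  apply: (@eq_cint _ _ _ nu setT mT (fun x => psi x * ft 1 (sqft phi) x)) => [x _|]; first by rewrite mulrC.
  exact: cint_ft.
transitivity (cintegral nu setT (fun x => psi x * ft 1 (sqft phi) x)); last first.
  by apply: eq_cintegral => x _; rewrite mulrC.
apply: (etrans (ft_swap 1 cp ss)); apply: (etrans _ (esym (ft_swap 1 cs sp))).
apply: (etrans (cint_rV_opp (cint_ft 1 ss cp))).
apply: eq_cintegral => xi _; rewrite /sqft.
rewrite (_ : sqx (- xi) = sqx xi); last first.
  by rewrite /sqx /enorm dotNl dotC dotNl opprK.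
by rewrite !(ft_opp 1) opprK mulrAC.
Qed.

Lemma homogeneous_tf phi : tf phi -> homogeneous_H12 phi.
Proof.
move=> tp; have cp := tf_cint tp.
have l2 := (bessel sqr_N1 cp (tf_L2 tp)).1.
split; first exact: tf_meas.
  by exists 0%N; under eq_fun do rewrite expr0 invr1 mul1r.
exists (ft (-1) phi); split.
- exact: L2_locally_integrable.
- by apply/(L2P nu mT); exact: sqft_L2.
- move=> psi ts; rewrite fourierE ft_swap//; last exact: tf_cint.
  by apply: eq_cintegral => x _; rewrite mulrC.
Qed.

(** Two dominated convergences: in the frequency, and then against the integrable [q], the
    transforms being bounded by a multiple of the integral of [b]. *)
Lemma ft_dominated q (F_ : nat -> W -> R[i]) (F : W -> R[i]) (b : W -> R) : cintegrable nu setT q ->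
  (forall k, cmeasurable setT (F_ k)) -> cmeasurable setT F -> nu.-integrable setT (EFin \o b) ->
  (forall k xi, nc (F_ k xi) <= b xi) -> (forall xi, ccvg (F_ ^~ xi) (F xi)) ->
  ccvg (fun k => cintegral nu setT (fun x => q x * ft 1 (F_ k) x))
       (cintegral nu setT (fun x => q x * ft 1 F x)).
Proof.
move=> qi mF_ mF ib Fb FF; have [mq iq] := (cintP _ mT _).1 qi.
have iF_ k : cintegrable nu setT (F_ k) by apply: (@cint_le _ _ _ _ setT mT _ b).
have Fb' xi : nc (F xi) <= b xi by apply: (ccvg_le (FF xi)).
have iF : cintegrable nu setT F by apply: (@cint_le _ _ _ _ setT mT _ b).
have cl x : ccvg (fun k => ft 1 (F_ k) x) (ft 1 F x).
  apply: ccvgM; first exact: ccvg_cst.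
  have me : cmeasurable setT (fun xi : W => expi (1 * dot xi x)).
    by apply: meas_expi; apply: measurable_funM => //; apply: measurable_dot.
  have [||y _|k y _|_ //] := @cdominated _ _ _ nu setT mT
    (fun k xi => expi (1 * dot xi x) * F_ k xi) (fun xi => expi (1 * dot xi x) * F xi) b _ _ _ ib.
  - by move=> k; exact: cmeasM.
  - exact: cmeasM.
  - by apply: ccvgM; [exact: ccvg_cst|exact: FF].
  - by rewrite ncM nc_expi mul1r.
pose D := kap * Rintegral nu setT b.
have fD (N : W -> R[i]) x : cintegrable nu setT N -> (forall xi, nc (N xi) <= b xi) -> nc (ft 1 N x) <= D.
  move=> iN Nb; apply: (le_trans (ft_bnd 1 x iN)); rewrite ler_wpM2l ?(ltW (kap_gt0 _ _))//.
  by apply: le_Rintegral => //; exact: (cint_nc mT).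
have iD : nu.-integrable setT (fun x => (D * nc (q x))%:E).
  by under eq_fun do rewrite EFinM; exact: integrableZl.
have [||y _|k y _|_ //] := @cdominated _ _ _ nu setT mT
  (fun k x => q x * ft 1 (F_ k) x) (fun x => q x * ft 1 F x) (fun x => D * nc (q x)) _ _ _ iD.
- by move=> k; apply: cmeasM => //; exact: meas_ft.
- by apply: cmeasM => //; exact: meas_ft.
- by apply: ccvgM; [exact: ccvg_cst|exact: cl].
- by rewrite (ncM (q y)) mulrC; apply: ler_wpM2r; [exact: nc_ge0|exact: fD].
Qed.

(* limits of trigonometric polynomials *)
Inductive trig : (W -> R[i]) -> Prop :=
| trig_exp a z : trig (fun xi => z * expi (dot a xi))
| trig_add M N : trig M -> trig N -> trig (fun xi => M xi + N xi)
| trig_lim (M_ : nat -> W -> R[i]) M (C : R) : (forall k, trig (M_ k)) ->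
    (forall k xi, nc (M_ k xi) <= C) -> (forall xi, ccvg (M_ ^~ xi) (M xi)) -> trig M.

Lemma trig_bnd M : trig M -> cmeasurable setT M /\ exists2 C : R, 0 <= C & forall xi, nc (M xi) <= C.
Proof.
elim=> [a z|M1 N _ [m1 [C1 C10 b1]] _ [m2 [C2 C20 b2]]|M_ M' C _ ih MC cM].
- split; last by exists (nc z) => [|xi]; rewrite ?nc_ge0// ncM nc_expi mulr1.
  apply: cmeasM; first exact: cmeas_cst.
  by apply: meas_expi; apply: measurable_dot => //; exact: measurable_cst.
- split; first exact: cmeasD.
  exists (C1 + C2) => [|xi]; first exact: addr_ge0.
  by rewrite (le_trans (le_normcD _ _))// lerD.
- split; last first.
    exists C => [|xi]; first by rewrite (le_trans _ (MC 0%N 0))// nc_ge0.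
    by apply: (ccvg_le (cM xi)) => k.
  split.
  + apply: (@measurable_fun_cvg _ _ _ _ (fun k xi => Re (M_ k xi))).
      by move=> k; have [[]] := ih k.
    by move=> xi _; have /ccvgP[] := cM xi.
  + apply: (@measurable_fun_cvg _ _ _ _ (fun k xi => Im (M_ k xi))).
      by move=> k; have [[]] := ih k.
    by move=> xi _; have /ccvgP[] := cM xi.
Qed.

Lemma trig_cst z : trig (fun=> z).
Proof.
have := trig_exp 0 z; congr trig; apply/funext => xi.
by rewrite /dot big1 ?expi0 ?mulr1// => j _; rewrite mxE mul0r.
Qed.

(** Induction on the first factor and, for an exponential, on the second; boundedness of [N]
    supplies the uniform bound in the limit case. *)
Lemma trig_mul M N : trig M -> trig N -> trig (fun xi => M xi * N xi).
Proof.
move=> tM tN; have [_ [CN CN0 bN]] := trig_bnd tN.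
elim: tM => [a z|M1 M2 _ ih1 _ ih2|M_ M' C _ ih MC cM].
- elim: {bN} tN => [b w|N1 N2 _ ih1 _ ih2|N_ N' C _ ih NC cN].
  + have := trig_exp (a + b) (z * w); congr trig; apply/funext => xi.
    by rewrite dotDl expiD; ring.
  + have := trig_add ih1 ih2; congr trig; apply/funext => xi; ring.
  + apply: (@trig_lim (fun k xi => z * expi (dot a xi) * N_ k xi) _ (nc z * C)) => // [k xi|xi].
      by rewrite !ncM nc_expi mulr1 ler_wpM2l ?nc_ge0.
    by apply: ccvgM => //; exact: ccvg_cst.
- by have := trig_add ih1 ih2; congr trig; apply/funext => xi; ring.
- apply: (@trig_lim (fun k xi => M_ k xi * N xi) _ (C * CN)) => // [k xi|xi].
    by rewrite ncM ler_pM ?nc_ge0.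
  by apply: ccvgM => //; exact: ccvg_cst.
Qed.

Lemma trig_sum (I : Type) (r : seq I) (F : I -> W -> R[i]) :
  (forall i, trig (F i)) -> trig (fun xi => \sum_(i <- r) F i xi).
Proof.
move=> tF; elim: r => [|i r ih].
  by under eq_fun do rewrite big_nil; exact: trig_cst.
by under eq_fun do rewrite big_cons; exact: trig_add.
Qed.

Section duality.
Variables (q h : W -> R[i]).
Hypotheses (qi : cintegrable nu setT q) (lh : L2 nu setT h).
Hypothesis qh : forall psi, tf psi ->
  cintegral nu setT (fun x => q x * frac_lap_test psi x) = cintegral nu setT (fun x => h x * psi x).

Let mft M phi := fun xi => M xi * ft (-1) phi xi.

Section bounded_multiplier.
Variables (M : W -> R[i]) (C : R) (phi : W -> R[i]).
Hypotheses (mM : cmeasurable setT M) (MC : forall xi, nc (M xi) <= C) (tp : tf phi).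

Let MC' xi : nc (M xi) <= C * (1 + enorm xi).
Proof.
rewrite (le_trans (MC xi))// ler_peMr ?lerDl ?enorm_ge0//.
by rewrite (le_trans _ (MC 0))// nc_ge0.
Qed.

Lemma mft_cint : cintegrable nu setT (mft M phi).
Proof. exact: (mul_ft_cint sqr_N1 tp mM MC'). Qed.

Lemma mft_L2 : L2 nu setT (mft M phi).
Proof. exact: (mul_ft_L2 sqr_N1 tp mM MC'). Qed.

Let sMC xi : nc (sqx xi * M xi) <= C * (1 + enorm xi).
Proof. by rewrite ncM mulrC ler_pM ?nc_ge0 ?nc_sqx. Qed.

Lemma smft_cint : cintegrable nu setT (fun xi => sqx xi * mft M phi xi).
Proof.
have := mul_ft_cint sqr_N1 tp (cmeasM (@meas_sqx R d) mM) sMC.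
by apply: eq_cint => // x _; rewrite /mft mulrA.
Qed.

End bounded_multiplier.

(** The hypothesis on [q] and [h] concerns test functions, and a multiplier in general destroys
    compact support. An exponential acts as a translation and preserves it; sums follow by
    linearity, and bounded pointwise limits by dominated convergence on both sides. *)
Lemma trig_duality M phi : trig M -> tf phi ->
  cintegral nu setT (fun x => q x * ft 1 (fun xi => sqx xi * mft M phi xi) x) =
  cintegral nu setT (fun x => h x * ft 1 (mft M phi) x).
Proof.
move=> tM; elim: tM phi => [a z|M1 M2 t1 ih1 t2 ih2|M_ M' C tk ih MC cM] phi tp.
- pose psi x := z * phi (1 *: x + a).
  have t1 : tf (fun x => phi (1 *: x + a)) by apply: tf_scale => //; exact: oner_neq0.
  have ts : tf psi by apply: tfZ.
  have E xi : ft (-1) psi xi = mft (fun xi => z * expi (dot a xi)) phi xi.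
    rewrite ftZ; last exact: tf_cint.
    rewrite /mft -mulrA; congr (_ * _); rewrite /ft mulrCA; congr (_ * _).
    rewrite (cintegral_rV_affine a (@ltr01 R) (ft_cint (-1) xi (tf_cint tp))) expr1n mul1r.
    rewrite -(cintegralZ mT); last first.
      have ca : 0 < (1 : R) by [].
      exact: (cintegrable_rV_affine a ca (ft_cint (-1) xi (tf_cint tp))).
    apply: eq_cintegral => x _; rewrite mulrA -expiD; congr (expi _ * _).
    by rewrite scale1r dotDl; ring.
  rewrite -(funext E); have := qh ts; rewrite frac_lapE /sqft => ->.
  apply: eq_cintegral => x _; congr (_ * _).
  by have := ft_inversion x sqr_N1 ts; rewrite opprK.
- have [m1 [C1 _ b1]] := trig_bnd t1; have [m2 [C2 _ b2]] := trig_bnd t2.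
  have E (k : W -> R[i]) x : ft 1 (fun xi => k xi * mft (fun xi => M1 xi + M2 xi) phi xi) x =
      ft 1 (fun xi => k xi * mft M1 phi xi + k xi * mft M2 phi xi) x.
    by congr (ft 1 _ x); apply/funext => xi; rewrite /mft; ring.
  have i1 := smft_cint m1 b1 tp; have i2 := smft_cint m2 b2 tp.
  have j1 := mft_cint m1 b1 tp; have j2 := mft_cint m2 b2 tp.
  have L1 := (bessel (expr1n _ 2) j1 (mft_L2 m1 b1 tp)).1.
  have L2' := (bessel (expr1n _ 2) j2 (mft_L2 m2 b2 tp)).1.
  transitivity (cintegral nu setT (fun x => q x * ft 1 (fun xi => sqx xi * mft M1 phi xi) x +
      q x * ft 1 (fun xi => sqx xi * mft M2 phi xi) x)).
    by apply: eq_cintegral => x _; rewrite E ftD// mulrDr.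
  rewrite (cintegralD mT (cint_ft 1 qi i1) (cint_ft 1 qi i2)) ih1// ih2//.
  rewrite -(cintegralD mT (L2_cintM mT lh L1) (L2_cintM mT lh L2')).
  apply: eq_cintegral => x _; rewrite -mulrDr -ftD//; congr (_ * ft 1 _ x).
  by apply/funext => xi; rewrite /mft; ring.
- have tM' : trig M' by exact: (trig_lim tk MC cM).
  have [mM _] := trig_bnd tM'; have mk k := (trig_bnd (tk k)).1.
  have M'C xi : nc (M' xi) <= C by apply: (ccvg_le (cM xi)).
  have C0 : 0 <= C by rewrite (le_trans _ (M'C 0))// nc_ge0.
  have ip := tf_cint tp; have fi := ft_tf_cint sqr_N1 tp.
  have lf := (bessel sqr_N1 ip (tf_L2 tp)).1.
  have si := sqft_cint tp; have [ms is_] := (cintP _ mT _).1 si.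
  have sk k := smft_cint (mk k) (MC k) tp; have sM := smft_cint mM M'C tp.
  have iC : nu.-integrable setT (fun xi => (C * nc (sqft phi xi))%:E).
    by under eq_fun do rewrite EFinM; exact: integrableZl.
  have sb (N : W -> R[i]) xi : nc (N xi) <= C -> nc (sqx xi * mft N phi xi) <= C * nc (sqft phi xi).
    move=> NC; rewrite /mft mulrCA (ncM (N xi)); apply: ler_wpM2r => //; exact: nc_ge0.
  have X1 : ccvg (fun k => cintegral nu setT (fun x => q x * ft 1 (fun xi => sqx xi * mft (M_ k) phi xi) x))
      (cintegral nu setT (fun x => q x * ft 1 (fun xi => sqx xi * mft M' phi xi) x)).
    apply: (ft_dominated qi _ _ iC) => [k||k xi|xi].
    - by have [] := (cintP _ mT _).1 (sk k).
    - by have [] := (cintP _ mT _).1 sM.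
    - exact: sb.
    - by apply: ccvgM; [exact: ccvg_cst|apply: ccvgM; [exact: cM|exact: ccvg_cst]].
  have X2 : ccvg (fun k => cintegral nu setT (fun x => h x * ft 1 (mft (M_ k) phi) x))
      (cintegral nu setT (fun x => h x * ft 1 (mft M' phi) x)).
    have jk k := mft_cint (mk k) (MC k) tp; have jM := mft_cint mM M'C tp.
    have lk k := mft_L2 (mk k) (MC k) tp; have lM := mft_L2 mM M'C tp.
    (* The majorant [C |ft (-1) phi|] is square integrable; Bessel's inequality then carries this
       convergence back through [ft 1]. *)
    have c2 : cvg2 nu setT (fun k => mft (M_ k) phi) (mft M' phi).
      apply: (@cvg2_dominated _ _ _ nu setT mT _ _ (fun xi => C * nc (ft (-1) phi xi))).
      - by move=> k; exact: L2_meas (lk k).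
      - exact: L2_meas lM.
      - by move=> xi _; apply: ccvgM; [exact: cM|exact: ccvg_cst].
      - under eq_fun do rewrite exprMn EFinM; apply: integrableZl => //; by case: lf.
      - by move=> k xi _; rewrite (ncM (M_ k xi)); apply: ler_wpM2r; [exact: nc_ge0|].
    apply: (@ccvg_squeeze _ _ _ (fun k => n2 nu setT h * n2 nu setT (fun xi => mft (M_ k) phi xi - mft M' phi xi))).
      move=> k; have b1 := bessel (expr1n _ 2) (jk k) (lk k).
      have b2 := bessel (expr1n _ 2) jM lM.
      have b3 := bessel (expr1n _ 2) (cintB mT (jk k) jM) (L2B mT (lk k) lM).
      rewrite -(cintegralB mT (L2_cintM mT lh b1.1) (L2_cintM mT lh b2.1)).
      rewrite (@eq_cintegral _ _ _ nu setT _ (fun x => h x *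
        ft 1 (fun xi => mft (M_ k) phi xi - mft M' phi xi) x)); last first.
        by move=> x _; rewrite ftB// mulrBr.
      apply: (le_trans (CS' mT lh b3.1)); rewrite ler_wpM2l ?n2_ge0//; exact: b3.2.
    by rewrite -[X in _ --> X](mulr0 (n2 nu setT h)); apply: cvgM => //; exact: cvg_cst.
  by apply: (ccvg_unique X1); under eq_fun do rewrite ih//.
Qed.

End duality.

End frac_lap.

(** * Trigonometric approximation of [i xi_j |xi|^{-1/2}] *)

Section fourth_root.
Context (R : realType).

(** [|xi|^{1/2}] is the fourth root of the polynomial [dot xi xi]. *)
Definition r4 (x : R) : R := Num.sqrt (Num.sqrt x).

Lemma r4_ge0 x : 0 <= r4 x. Proof. exact: sqrtr_ge0. Qed.

Lemma r4_gt0 x : 0 < x -> 0 < r4 x. Proof. by move=> x0; rewrite !sqrtr_gt0. Qed.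

Lemma r4_4 x : 0 <= x -> r4 x ^+ 4 = x.
Proof. by move=> x0; rewrite -[4%N]/(2 * 2)%N exprM !sqr_sqrtr// sqrtr_ge0. Qed.

Lemma r4_le x y : x <= y -> r4 x <= r4 y.
Proof. by move=> xy; rewrite !ler_wsqrtr. Qed.

Lemma r4M x y : 0 <= x -> r4 (x * y) = r4 x * r4 y.
Proof. by move=> x0; rewrite /r4 sqrtrM// sqrtrM// sqrtr_ge0. Qed.

(** A fixed-point iteration for [z^{-1/4}] made of ring operations and constants, so that it turns
    elements of the algebra [trig] into elements of [trig]. *)
Fixpoint root_it (k : nat) (z : R) : R :=
  if k is k'.+1 then root_it k' z + (1 - z * root_it k' z ^+ 4) / 4 else 0.

(* the error [1 - y_k], [y_k = r4 z * root_it k z], is multiplied at each step by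
   [1 - (r4 z / 4) (1 + y_k + y_k^2 + y_k^3)] *)
Lemma root_it_err z k : 0 < z <= 1 ->
  0 <= 1 - r4 z * root_it k z <= (1 - r4 z / 4) ^+ k /\ 0 <= root_it k z.
Proof.
move=> /andP[z0 z1]; have s0 := r4_gt0 z0; have zE : z = r4 z ^+ 4 by rewrite r4_4// ltW.
have s1 : r4 z <= 1 by rewrite /r4 -sqrtr1 ler_wsqrtr// -[leRHS]sqrtr1 ler_wsqrtr.
elim: k => [|k [/andP[h1 h2] h3]].
  by rewrite /= mulr0 subr0 expr0 ler01 lexx.
rewrite [root_it k.+1 z]/=; move: (root_it k z) h1 h2 h3 => p h1 h2 h3.
move: (r4 z) zE s0 s1 h1 h2 => s -> s0 s1 h1 h2.
set y := s * p in h1 h2; have y0 : 0 <= y by rewrite mulr_ge0// ltW.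
have E : 1 - s * (p + (1 - s ^+ 4 * p ^+ 4) / 4) =
    (1 - y) * (1 - s / 4 * (1 + y + y ^+ 2 + y ^+ 3)) by rewrite /y; field.
have y1 : y <= 1 by lra.
have y2 : 0 <= y ^+ 2 by exact: sqr_ge0.
have y2' : y ^+ 2 <= 1 by rewrite expr_le1.
have y3 : 0 <= y ^+ 3 by exact: exprn_ge0.
have y3' : y ^+ 3 <= 1 by rewrite expr_le1.
have t1 : s / 4 <= s / 4 * (1 + y + y ^+ 2 + y ^+ 3).
  by apply: ler_peMr; [rewrite divr_ge0// ltW|lra].
have t2 : s / 4 * (1 + y + y ^+ 2 + y ^+ 3) <= 1.
  rewrite (@le_trans _ _ (s / 4 * 4))//; last by rewrite divfK//.
  by apply: ler_wpM2l; [rewrite divr_ge0// ltW|lra].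
rewrite E [_ ^+ k.+1]exprSr; split.
  apply/andP; split; first by apply: mulr_ge0; lra.
  by apply: ler_pM => //; lra.
have h : s ^+ 4 * p ^+ 4 <= 1 by rewrite -exprMn expr_le1.
by apply: addr_ge0 => //; apply: divr_ge0 => //; lra.
Qed.

Lemma root_it_cvg z : 0 < z <= 1 -> (fun k => root_it k z) @ \oo --> (r4 z)^-1.
Proof.
move=> zb; have /andP[z0 z1] := zb; have s0 := r4_gt0 z0.
have s1 : r4 z <= 1 by rewrite /r4 -sqrtr1 ler_wsqrtr// -[leRHS]sqrtr1 ler_wsqrtr.
have c : (fun k => 1 - r4 z * root_it k z) @ \oo --> (0 : R).
  apply: (@cvg0_le _ _ (fun k => (1 - r4 z / 4) ^+ k)).
    by move=> k; have [] := root_it_err k zb.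
  by apply: cvg_expr; rewrite ger0_norm; lra.
have : (fun k => (r4 z)^-1 * (1 - (1 - r4 z * root_it k z))) @ \oo --> (r4 z)^-1 * (1 - 0).
  apply: cvgM; first exact: cvg_cst.
  by apply: cvgB => //; exact: cvg_cst.
rewrite subr0 mulr1; under eq_fun do rewrite opprB addrC subrK mulKf ?gt_eqF//.
exact.
Qed.

Lemma root_it_le z k : 0 < z <= 1 -> `|root_it k z| <= (r4 z)^-1.
Proof.
move=> zb; have /andP[z0 z1] := zb; have [/andP[h1 _] h3] := root_it_err k zb.
by rewrite ger0_norm// -[leRHS]mul1r ler_pdivlMr ?r4_gt0// mulrC; lra.
Qed.

(** A bounded trigonometric substitute for [t], never larger than [t] in modulus and converging to
    it. *)
Definition dsin (k : nat) (t : R) : R := sin (hseq R k * t) / hseq R k.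

Lemma sin_le_norm (t : R) : `|sin t| <= `|t|.
Proof.
have H (u : R) : 0 < u -> `|sin u| <= u.
  move=> u0; have [c _] := @MVT1 R sin cos 0 u u0 (fun x _ => is_derive_sin x).
  rewrite sin0 !subr0 => ->; rewrite normrM (gtr0_norm u0).
  by apply: ler_piMl; [exact: ltW|exact: cos_max].
have [t0|t0|->] := ltgtP t 0; last by rewrite sin0 normr0.
- by rewrite -normrN -sinN (ltr0_norm t0) H// oppr_gt0.
- by rewrite (gtr0_norm t0) H.
Qed.

Lemma dsin_le k t : `|dsin k t| <= `|t|.
Proof.
have h0 := hseq_gt0 R k.
rewrite /dsin normrM normfV (gtr0_norm h0) ler_pdivrMr// (le_trans (sin_le_norm _))//.
by rewrite normrM (gtr0_norm h0) mulrC.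
Qed.

Lemma dsin_cvg t : (fun k => dsin k t) @ \oo --> t.
Proof.
have d1 : is_derive (0 : R) 1 (fun s : R => sin (s * t)) t.
  have d0 : is_derive (0 : R) 1 (fun s : R => s * t) (1 * t).
    have := is_deriveZ t (is_derive_id (0 : R) (1 : R)).
    by rewrite (_ : _ \*: _ = fun s : R => s * t)// ?mul1r ?mulr1; [move=> h; apply: (is_derive_eq h); rewrite /GRing.scale/= mulr1|apply/funext => s; rewrite /GRing.scale/= mulrC].
  have := @is_derive1_comp _ sin (fun s : R => s * t) 0 _ _ (is_derive_sin _) d0.
  by move=> h; apply: (is_derive_eq h); rewrite mul0r cos0; ring.
have := is_derive_seq d1 (@hseq_cvg R) (fun k => lt0r_neq0 (hseq_gt0 R k)).
by under eq_fun do rewrite addr0 mul0r sin0 subr0.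
Qed.

Lemma dsin_bnd k t : `|dsin k t| <= (hseq R k)^-1.
Proof.
have h0 := hseq_gt0 R k.
by rewrite /dsin normrM normfV (gtr0_norm h0) ler_piMl ?invr_ge0 ?(ltW h0)// sin_max.
Qed.

End fourth_root.

Section derivative_multiplier.
Context (R : realType) (d : nat).
Notation W := 'rV[R]_d.
Notation nu := (lebesgue_rV R d).

Lemma trig_sin (b c : R) (j : 'I_d) : trig (fun xi : W => (c * sin (b * xi ord0 j))%:C).
Proof.
pose a : W := b *: delta_mx ord0 j.
have Da xi : dot a xi = b * xi ord0 j.
  rewrite /dot (bigD1 j)//= !mxE !eqxx mulr1 big1 ?addr0// => i ij.
  by rewrite !mxE eqxx (negbTE ij) mulr0 mul0r.
have := trig_add (trig_exp a (0 +i* (- (c / 2)))) (trig_exp (- a) (0 +i* (c / 2))).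
congr trig; apply/funext => xi; rewrite dotNl Da; move: (b * _) => t.
rewrite /expi cosN sinN; apply/eqP; rewrite eq_complex /=; apply/andP; split; apply/eqP; by field.
Qed.

(** The upper bound 1 makes the iteration converge; the lower bound [e] bounds all iterates
    uniformly, as the limit case of [trig] demands. *)
Lemma trig_root (zz : W -> R) (e : R) : trig (fun xi => (zz xi)%:C) -> 0 < e ->
  (forall xi, e <= zz xi <= 1) -> trig (fun xi => ((r4 (zz xi))^-1)%:C).
Proof.
move=> tz e0 zb; have zb' xi : 0 < zz xi <= 1.
  by have /andP[h1 ->] := zb xi; rewrite (lt_le_trans e0 h1).
apply: (@trig_lim _ _ (fun k xi => (root_it k (zz xi))%:C) _ ((r4 e)^-1)).
- elim=> [|k ih]; first exact: (trig_cst d 0).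
  have t4 : trig (fun xi => (root_it k (zz xi))%:C * (root_it k (zz xi))%:C *
    ((root_it k (zz xi))%:C * (root_it k (zz xi))%:C)) by apply: trig_mul; exact: trig_mul.
  have := trig_add ih (trig_add (trig_cst d (4^-1)%:C) (trig_mul (trig_cst d (- 4^-1)%:C) (trig_mul tz t4))).
  congr trig; apply/funext => xi; rewrite [root_it k.+1 _]/=; move: (root_it k (zz xi)) => p; move: (zz xi) => z.
  by apply/eqP; rewrite eq_complex /=; apply/andP; split; apply/eqP; by field.
- move=> k xi; rewrite nc_real (le_trans (root_it_le k (zb' xi)))// lef_pV2 ?posrE ?r4_gt0//.
    by apply: r4_le; have /andP[] := zb xi.
  by have /andP[] := zb' xi.
- by move=> xi; apply: ccvg_real; exact: root_it_cvg.
Qed.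

Definition zsum k (xi : W) : R := \sum_i dsin k (xi ord0 i) ^+ 2.

Lemma zsum_ge0 k xi : 0 <= zsum k xi.
Proof. by apply: sumr_ge0 => i _; exact: sqr_ge0. Qed.

Lemma zsum_le k xi : zsum k xi <= dot xi xi.
Proof.
apply: ler_sum => i _; rewrite -expr2 -[leLHS]real_normK ?num_real// -[leRHS]real_normK ?num_real//.
by rewrite lerXn2r ?nnegrE// dsin_le.
Qed.

(** Approximates [i xi_j |xi|^{-1/2}] with the coordinates replaced by [dsin]; the summand
    [hseq R k] keeps the root away from 0. *)
Definition dmult k j (xi : W) : R[i] :=
  (0 +i* dsin k (xi ord0 j)) * ((r4 (zsum k xi + hseq R k))^-1)%:C.

Lemma trig_dmult k j : trig (dmult k j).
Proof.
(* [B] bounds [zsum k xi + h], so division by it brings the argument of the root into [[h/B, 1]], as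
   [trig_root] requires; the factor [B^{-1/4}] is restored at the end. *)
have h0 := hseq_gt0 R k; pose h := hseq R k; pose B : R := d%:R * h^-1 ^+ 2 + h.
have B0 : 0 < B by rewrite ltr_wpDl// mulr_ge0// sqr_ge0.
have zB xi : zsum k xi + h <= B.
  rewrite lerD2r /zsum mulr_natl -[X in _ <= _ *+ X](card_ord d) -sumr_const.
  apply: ler_sum => i _; rewrite -[leLHS]real_normK ?num_real//.
  by rewrite lerXn2r ?nnegrE ?invr_ge0 ?(ltW h0)// dsin_bnd.
have tz : trig (fun xi => ((zsum k xi + h) / B)%:C).
  have ts : trig (fun xi : W => \sum_i ((h^-1 * sin (h * xi ord0 i))%:C * (h^-1 * sin (h * xi ord0 i))%:C)).
    by apply: trig_sum => i; apply: trig_mul; exact: trig_sin.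
  have := trig_mul (trig_cst d (B^-1)%:C) (trig_add ts (trig_cst d h%:C)).
  congr trig; apply/funext => xi; rewrite -[RHS]/(real_complex R ((zsum k xi + h) / B)).
  rewrite rmorphM rmorphD mulrC; congr ((_ + _) * _); rewrite /zsum rmorph_sum; apply: eq_bigr => i _.
  rewrite (_ : dsin k (xi ord0 i) = h^-1 * sin (h * xi ord0 i)); last by rewrite /dsin mulrC.
  by rewrite expr2; exact: (esym (rmorphM (real_complex R) _ _)).
have e0 : 0 < h / B by rewrite divr_gt0.
have tr := trig_root tz e0 _.
have {}tr : trig (fun xi => ((r4 ((zsum k xi + h) / B))^-1)%:C).
  apply: tr => xi; apply/andP; split; last by rewrite ler_pdivrMr// mul1r.
  by rewrite ler_pM2r ?invr_gt0// lerDr zsum_ge0.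
have := trig_mul (trig_mul (trig_cst d (0 +i* (h^-1))) (trig_sin h 1 j))
  (trig_mul (trig_cst d ((r4 B)^-1)%:C) tr).
congr trig; apply/funext => xi; rewrite /dmult; congr (_ * _).
  by rewrite /dsin -/h; apply/eqP; rewrite eq_complex /=; apply/andP; split; apply/eqP; ring.
have -> : r4 (zsum k xi + hseq R k) = r4 B * r4 ((zsum k xi + h) / B).
  by rewrite -r4M ?(ltW B0)// mulrC divfK// gt_eqF.
rewrite invfM.
exact: (esym (rmorphM (real_complex R) _ _)).
Qed.

(** The numerator is at most [zsum^{1/2}] and the denominator at least [zsum^{1/4}], which leaves
    [zsum^{1/4} <= |xi|^{1/2}]. The constant is 1, so [duality_partial] loses nothing. *)
Lemma nc_dmult k j xi : nc (dmult k j xi) <= nc (sqx xi).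
Proof.
have h0 := hseq_gt0 R k; have z0 := zsum_ge0 k xi.
have p0 : 0 < zsum k xi + hseq R k by rewrite ltr_wpDl.
rewrite ncM nc_real normfV (ger0_norm (r4_ge0 _)) ler_pdivrMr ?r4_gt0//.
rewrite /sqx nc_real ger0_norm ?sqrtr_ge0// -/(r4 (dot xi xi)).
apply: (@le_trans _ _ (r4 (zsum k xi) * r4 (zsum k xi + hseq R k))); last first.
  by rewrite ler_wpM2r ?r4_ge0// r4_le// zsum_le.
apply: (@le_trans _ _ (r4 (zsum k xi) ^+ 2)); last first.
  by rewrite expr2 ler_wpM2l ?r4_ge0// r4_le// lerDl ltW.
rewrite sqr_sqrtr ?sqrtr_ge0// (_ : nc (0 +i* _) = Num.sqrt (dsin k (xi ord0 j) ^+ 2)).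
  rewrite ler_wsqrtr// /zsum (bigD1 j)//= lerDl; apply: sumr_ge0 => i _; exact: sqr_ge0.
by rewrite /= expr0n/= add0r.
Qed.

(** The factor [|xi|^{1/2}] removes the singularity of the symbol at the origin, where both sides
    vanish. *)
Lemma dmult_cvg j xi : ccvg (fun k => sqx xi * dmult k j xi) (0 +i* xi ord0 j).
Proof.
have [x0|x0] := eqVneq (enorm xi) 0.
  have -> : xi ord0 j = 0.
    by apply/eqP; rewrite -normr_eq0 eq_le normr_ge0 andbT -x0 coord_enorm.
  have -> : 0 +i* 0 = 0 :> R[i] by [].
  under eq_fun do rewrite /sqx x0 sqrtr0 mul0r; exact: ccvg_cst.
have e0 : 0 < enorm xi by rewrite lt_neqAle eq_sym x0 enorm_ge0.
have D0 : 0 < dot xi xi by rewrite -sqr_enorm exprn_gt0.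
have cz : (fun k => zsum k xi + hseq R k) @ \oo --> dot xi xi.
  rewrite -[X in _ --> X]addr0; apply: cvgD; last exact: hseq_cvg.
  rewrite /zsum /dot; elim: (index_enum _) => [|i r ih].
    by rewrite big_nil; under eq_fun do rewrite big_nil; exact: cvg_cst.
  rewrite big_cons; under eq_fun do rewrite big_cons; apply: cvgD => //.
  by under eq_fun do rewrite expr2; apply: cvgM; exact: dsin_cvg.
have cr : (fun k => (r4 (zsum k xi + hseq R k))^-1) @ \oo --> (r4 (dot xi xi))^-1.
  apply: cvgV; first by rewrite gt_eqF// r4_gt0.
  have c1 := @continuous_cvg _ R^o R^o _ _ _ (@Num.sqrt R) _ (@sqrt_continuous R _) cz.
  exact: (continuous_cvg _ (@sqrt_continuous R _) (c1 _)).
have -> : 0 +i* xi ord0 j = sqx xi * ((0 +i* xi ord0 j) * ((r4 (dot xi xi))^-1)%:C).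
  rewrite /sqx -/(r4 (dot xi xi)) mulrCA -rmorphM/= divff ?mulr1// gt_eqF// r4_gt0//.
apply: ccvgM; first exact: ccvg_cst.
apply: ccvgM; last exact: ccvg_real.
by apply/ccvgP; split; [exact: cvg_cst|exact: dsin_cvg].
Qed.

(* [d_j = |xi|^(1/2) . dmult] in the limit, and [|dmult| <= |xi|^(1/2)] *)
Lemma duality_partial (q h : W -> R[i]) phi j : cintegrable nu setT q -> L2 nu setT h ->
  (forall psi, tf psi ->
    cintegral nu setT (fun x => q x * frac_lap_test psi x) = cintegral nu setT (fun x => h x * psi x)) ->
  tf phi -> nc (cintegral nu setT (fun x => q x * partial j phi x)) <= n2 nu setT h * energy phi.
Proof.
move=> qi lh qh tp; pose m k xi := dmult k j xi * ft (-1) phi xi.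
have mk k := (trig_bnd (trig_dmult k j)).1.
have M0 : cmeasurable setT (fun xi : W => (1 + enorm xi)%:C).
  by apply: cmeas_real; apply: measurable_funD => //; exact: measurable_enorm.
have M0b (xi : W) : nc (1 + enorm xi)%:C <= 1 * (1 + enorm xi).
  by rewrite nc_real mul1r ger0_norm// addr_ge0// enorm_ge0.
have i0 := mul_ft_cint (sqr_N1 R) tp M0 M0b; have [m0 i0'] := (cintP _ mT _).1 i0.
have tj := tf_partial j tp.
have E x : partial j phi x = ft 1 (fun xi => (0 +i* xi ord0 j) * ft (-1) phi xi) x.
  have := ft_inversion x (sqr_N1 R) tj; rewrite opprK => <-; congr (ft 1 _ x).
  by apply/funext => xi; rewrite ft_partial// mulN1r opprK.
have mf := meas_ft (-1) (tf_cint tp).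
have X1 : ccvg (fun k => cintegral nu setT (fun x => q x * ft 1 (fun xi => sqx xi * m k xi) x))
    (cintegral nu setT (fun x => q x * partial j phi x)).
  rewrite (_ : (fun x => q x * partial j phi x) = fun x => q x *
    ft 1 (fun xi => (0 +i* xi ord0 j) * ft (-1) phi xi) x); last by apply/funext => x; rewrite E.
  apply: (ft_dominated qi _ _ i0') => [k||k xi|xi].
  - by apply: cmeasM; [exact: meas_sqx|exact: cmeasM].
  - apply: cmeasM => //; split => /=; first exact: measurable_cst.
    exact: measurable_rV_coord.
  - rewrite /m mulrA !(ncM _ (ft (-1) phi xi)) ler_wpM2r ?nc_ge0//.
    rewrite ncM (le_trans (ler_wpM2l (nc_ge0 _) (nc_dmult k j xi)))//.
    rewrite /sqx !nc_real ger0_norm ?sqrtr_ge0// ger0_norm; last by rewrite addr_ge0// enorm_ge0.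
    by rewrite -expr2 sqr_sqrtr ?enorm_ge0// lerDr.
  - by rewrite /m; under eq_fun do rewrite mulrA; apply: ccvgM; [exact: dmult_cvg|exact: ccvg_cst].
apply: (ccvg_le X1) => k.
have [_ [C C0 Cb]] := trig_bnd (trig_dmult k j).
rewrite (trig_duality qi lh qh (trig_dmult k j) tp).
have lm := mft_L2 (mk k) Cb tp; have im := mft_cint (mk k) Cb tp.
have [b1 b2] := bessel (expr1n _ 2) im lm.
apply: (le_trans (CS' mT lh b1)); rewrite ler_wpM2l ?n2_ge0// (le_trans b2)//.
apply: (n2_le mT (sqft_L2 tp)); first exact: L2_meas lm.
by move=> xi _; rewrite /sqft !(ncM _ (ft (-1) phi xi)) ler_wpM2r ?nc_ge0// nc_dmult.
Qed.

End derivative_multiplier.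

(** * Traces *)

Section trace_energy.
Context (R : realType) (d : nat).
Notation n := d.+1.
Notation V := 'rV[R]_n.
Notation W := 'rV[R]_d.
Notation mu := (lebesgue_rV R n).
Notation nu := (lebesgue_rV R d).
Notation mu1 := (@lebesgue_measure R).
Notation Om := (@half_space R d).
Notation mOm := (@measurable_half_space R d).
Notation kap := (Num.sqrt (2 * pi) ^- d : R).
Implicit Types (Phi : V -> R[i]).

Lemma rcons_line (x : W) (t : R) : rV_rcons x t = t *: delta_mx ord0 ord_max + rV_rcons x 0 :> V.
Proof.
apply/rowP => i; rewrite !mxE; case: (unliftP ord_max i) => [j|] ->.
- by rewrite [lift _ _ == _]eq_sym (negbTE (neq_lift _ _)) andbF mulr0 add0r.
- by rewrite !eqxx mulr1 addr0.
Qed.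

Lemma rcons_box (M : R) (x : W) (t : R) : rV_box M (rV_rcons x t) -> rV_box M x.
Proof. by move=> h j; have := h (lift ord_max j); rewrite rcons_lift. Qed.

Lemma is_derive_slice (c : W -> R[i]) (C : R) Phi (t : R) : cmeasurable setT c ->
  (forall x, nc (c x) <= C) -> tf Phi ->
  is_derive t 1 (fun t => Re (cintegral nu setT (fun x => c x * Phi (rV_rcons x t))))
    (Re (cintegral nu setT (fun x => c x * partial ord_max Phi (rV_rcons x t)))).
Proof.
move=> mc cC tP; have tj := tf_partial ord_max tP; have sP := tf_smooth tP.
have [K K0 KP] := tf_bnd tj; have [M M0 MP] := tf_box tj.
have C0 : 0 <= C by rewrite (le_trans _ (cC 0))// nc_ge0.
have mB : measurable (rV_box M : set W) by exact: measurable_rV_box.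
have ci Psi s : tf Psi -> cintegrable nu setT (fun x => c x * Psi (rV_rcons x s)).
  by move=> tPs; apply: (@cintM_bnd _ _ _ _ setT mT C) => //; apply: tf_cint; exact: tf_rcons.
apply: (@is_derive_under _ _ _ nu (fun t x => Re (c x * Phi (rV_rcons x t)))
  (fun t x => Re (c x * partial ord_max Phi (rV_rcons x t))) t 1
  (fun x => C * K * \1_(rV_box M) x)) => //.
- by move=> s _; have [] := ci Phi s tP.
- move=> s x _; pose e : V := delta_mx ord0 ord_max; pose y : V := s *: e + rV_rcons x 0.
  have [f1 f2] := csmooth_derivable e y sP.
  have D1 := is_derive_line_at (derivableP f1); have D2 := is_derive_line_at (derivableP f2).
  have D := is_deriveB (is_deriveZ (Re (c x)) D1) (is_deriveZ (Im (c x)) D2).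
  have -> : (fun s : R => Re (c x * Phi (rV_rcons x s))) =
      Re (c x) *: (fun t : R => Re (Phi (t *: e + rV_rcons x 0))) -
      Im (c x) *: (fun t : R => Im (Phi (t *: e + rV_rcons x 0))).
    by apply/funext => u; rewrite rcons_line -/e !fctE; case: (c x) (Phi _) => a b [a' b'].
  apply: (is_derive_eq D); rewrite (rcons_line x s) -/e -/y /partial -/e.
  by case: (c x) => a b; rewrite /GRing.scale.
- rewrite (_ : EFin \o _ = fun x => ((C * K)%:E * (\1_(rV_box M) x)%:E)%E); last first.
    by apply/funext => x; rewrite /= EFinM.
  apply: integrableZl => //; apply: (@box_integrable _ _ _ M 1).
  + by apply: measurable_indic.
  + by move=> x; rewrite indicE; case: (x \in _); rewrite ?normr1 ?normr0.
  + by move=> x xM; rewrite indicE memNset.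
- move=> s x _; rewrite (le_trans (nc_Re _))// ncM indicE.
  have [xB|xB] := pselect (rV_box M x).
    by rewrite mem_set// mulr1 ler_pM ?nc_ge0.
  by rewrite MP ?Normc.normc0 ?mulr0 ?memNset ?mulr0// => /rcons_box.
Qed.

(* partial Fourier transform in the tangential variables *)
Definition pft Phi (z : V) : R[i] := ft (-1) (fun x => Phi (rV_rcons x (rV_last z))) (rV_init z).

Lemma init_rcons (x : W) (t : R) : rV_init (rV_rcons x t) = x.
Proof. by apply/rowP => j; rewrite mxE rcons_lift. Qed.

Lemma pft_rcons Phi (xi : W) (t : R) : pft Phi (rV_rcons xi t) = ft (-1) (fun x => Phi (rV_rcons x t)) xi.
Proof. by rewrite /pft init_rcons /rV_last rcons_last. Qed.

(** The device of [meas_ft]: an integrable factor is inserted for Fubini's theorem and divided out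
    afterwards. *)
Lemma meas_pft Phi : tf Phi -> cmeasurable setT (pft Phi).
Proof.
move=> tP; have [C C0 CP] := tf_bnd tP; have [M M0 MP] := tf_box tP.
have iB : nu.-integrable setT (EFin \o (fun x : W => C * \1_(rV_box M) x)).
  apply: (@box_integrable _ _ _ M C).
  + by apply: measurable_funM => //; apply: measurable_indic; exact: measurable_rV_box.
  + by move=> x; rewrite indicE normrM (ger0_norm C0); case: (x \in _); rewrite ?normr1 ?normr0 ?mulr1 ?mulr0.
  + by move=> x xM; rewrite indicE memNset// mulr0.
have mi : measurable_fun setT (@rV_init R d) by exact: measurable_init.
have ml : measurable_fun setT (@rV_last R d) by exact: measurable_last.
have mF : cmeasurable setT (fun p : V * W => (pkn 1 p.1)%:C *
    (expi (-1 * dot p.2 (rV_init p.1)) * Phi (rV_rcons p.2 (rV_last p.1)))).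
  apply: cmeasM.
    by apply: cmeas_real; exact: measurableT_comp (measurable_pkn 1) measurable_fst.
  apply: cmeasM.
    apply: meas_expi; apply: measurable_funM => //; apply: measurable_dot => //.
    exact: (measurableT_comp mi measurable_fst).
  apply: (@cmeas_comp _ _ _ (V * W)%type (fun p => rV_rcons p.2 (rV_last p.1)) Phi _ (tf_meas tP)).
  have mp : measurable_fun setT (fun p : V * W => (p.2, rV_last p.1)).
    apply: measurable_fun_pair; first exact: measurable_snd.
    exact: (measurableT_comp ml measurable_fst).
  exact: (measurableT_comp (@measurable_rV_of_pair R d) mp).
have [|h _ _] := @cfubini_dominated _ _ V W R (leb R n) (leb R d) _ (pkn 1) _ mF (@pkn_int R n 1 ltr01) iB.
  move=> z x; rewrite !ncM nc_expi mul1r nc_real ger0_norm ?pkn_ge0// ler_wpM2l ?pkn_ge0//.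
  rewrite indicE; have [xB|xB] := pselect (rV_box M x); first by rewrite mem_set// mulr1.
  by rewrite MP ?Normc.normc0 ?memNset ?mulr0// => /rcons_box.
have [mh _] := (cintP _ mT _).1 h.
have E z : pft Phi z = kap%:C * (((pkn 1 z)^-1)%:C * cintegral (leb R d) setT (fun x => (pkn 1 z)%:C *
    (expi (-1 * dot x (rV_init z)) * Phi (rV_rcons x (rV_last z))))).
  congr (_ * _); rewrite (cintegralZ (mu := leb R d) mT _ (ft_cint (-1) _ (tf_cint (tf_rcons (rV_last z) tP)))).
  by rewrite mulrA -rmorphM/= mulVf ?mul1r// gt_eqF// pkn_gt0.
rewrite (funext E); apply: cmeasM; first exact: cmeas_cst.
by apply: cmeasM => //; apply: cmeas_real; exact: measurable_pknV.
Qed.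

(** The squared gradient after Fourier transform in the tangential variables. By [sliceE] it is
    [|xi|^2 |A|^2 + |A'|^2], with [A(t)] the transform of the slice at height [t]. *)
Definition slice Phi (z : V) : R := \sum_(i < n) nc (pft (partial i Phi) z) ^+ 2.

Lemma slice_ge0 Phi z : 0 <= slice Phi z.
Proof. by apply: sumr_ge0 => i _; exact: sqr_ge0. Qed.

Lemma sliceE Phi (xi : W) (t : R) : tf Phi -> slice Phi (rV_rcons xi t) =
  enorm xi ^+ 2 * nc (ft (-1) (fun x => Phi (rV_rcons x t)) xi) ^+ 2 +
  nc (ft (-1) (fun x => partial ord_max Phi (rV_rcons x t)) xi) ^+ 2.
Proof.
move=> tP; rewrite /slice; under eq_bigr do rewrite pft_rcons.
rewrite big_ord_recr; congr (_ + _).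
rewrite sqr_enorm /dot mulr_suml; apply: eq_bigr => j _.
rewrite (_ : widen_ord _ j = lift ord_max j); last first.
  by apply: val_inj => /=; rewrite /bump leqNgt ltn_ord.
have [_ D] := csmooth_rcons t (tf_smooth tP).
rewrite -(_ : partial j (fun x => Phi (rV_rcons x t)) = fun x => partial (lift ord_max j) Phi (rV_rcons x t)); last first.
  by apply/funext => x; rewrite D.
rewrite ft_partial; last exact: tf_rcons.
rewrite ncM exprMn mulN1r opprK; congr (_ * _).
by rewrite /= expr0n/= add0r sqr_sqrtr ?sqr_ge0// expr2.
Qed.

(** For fixed [xi], [|xi| |A(0)|^2] is minus the integral over [t > 0] of the derivative of
    [|xi| |A(t)|^2], and [-2 |xi| Re (A conj(A')) <= |xi|^2 |A|^2 + |A'|^2]. This yields the trace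
    inequality with constant 1. *)
Lemma slice_bound Phi (xi : W) : tf Phi ->
  ((enorm xi * nc (ft (-1) (fun x => Phi (rV_rcons x 0)) xi) ^+ 2)%:E <=
   \int[mu1]_t (\1_Om (rV_rcons xi t) * slice Phi (rV_rcons xi t))%:E)%E.
Proof.
move=> tP; have tj := tf_partial ord_max tP; have tjj := tf_partial ord_max tj.
pose A Psi (t : R) := ft (-1) (fun x => Psi (rV_rcons x t)) xi.
have dA Psi (t : R) : tf Psi ->
    is_derive t 1 (fun t => Re (A Psi t)) (Re (A (partial ord_max Psi) t)) /\
    is_derive t 1 (fun t => Im (A Psi t)) (Im (A (partial ord_max Psi) t)).
  move=> tPs.
  have me : cmeasurable setT (fun x : W => expi (-1 * dot x xi)).
    by apply: meas_expi; apply: measurable_funM => //; apply: measurable_dot => //; exact: measurable_cst.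
  (* A free factor [w] is carried along so that the imaginary part is the case [w = -i] of the real
     one. *)
  have H (w : R[i]) : is_derive t 1 (fun t => Re (w * A Psi t))
      (Re (w * A (partial ord_max Psi) t)).
    have E Q (s : R) : tf Q -> w * A Q s =
        cintegral nu setT (fun x => (w * kap%:C * expi (-1 * dot x xi)) * Q (rV_rcons x s)).
      move=> tQ; rewrite /A /ft mulrA -(cintegralZ mT _ (ft_cint (-1) xi (tf_cint (tf_rcons s tQ)))).
      by apply: eq_cintegral => x _; rewrite mulrA.
    have -> : (fun t => Re (w * A Psi t)) = fun t => Re (cintegral nu setT
        (fun x => (w * kap%:C * expi (-1 * dot x xi)) * Psi (rV_rcons x t))).
      by apply/funext => s; rewrite E.
    rewrite (E _ t (tf_partial ord_max tPs)); apply: (@is_derive_slice _ (nc (w * kap%:C))) => //.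
      by apply: cmeasM => //; exact: cmeas_cst.
    by move=> x; rewrite ncM nc_expi mulr1.
  split.
    by have := H 1; rewrite mul1r; under [X in is_derive _ _ X _]eq_fun do rewrite mul1r.
  have IE (z : R[i]) : Im z = Re ((0 +i* -1) * z) by case: z => a b /=; ring.
  by have := H (0 +i* -1); rewrite -IE; under [X in is_derive _ _ X _]eq_fun do rewrite -IE.
(* The height [M] lies above the support of [Phi], so the upper boundary term in the fundamental
   theorem is 0. *)
have [M0 M00 MP] := tf_box tP; pose M := M0 + 1; have Mp : 0 < M by rewrite ltr_wpDl.
have AM : A Phi M = 0.
  rewrite /A /ft (@eq_cintegral _ _ _ nu setT _ (fun=> 0)); first by rewrite (cintegral0 nu mT) mulr0.
  move=> x _; rewrite MP ?mulr0// => /(_ ord_max); rewrite rcons_last ger0_norm ?(ltW Mp)// /M.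
  by rewrite gerDl ler10.
pose e := enorm xi; have e0 : 0 <= e by exact: enorm_ge0.
pose F (t : R) := - (e * (Re (A Phi t) ^+ 2 + Im (A Phi t) ^+ 2)).
pose A' := A (partial ord_max Phi).
pose f (t : R) := - (e * (2 * (Re (A Phi t) * Re (A' t) + Im (A Phi t) * Im (A' t)))).
have dF (t : R) : is_derive t 1 F (f t).
  have [d1 d2] := dA Phi t tP.
  have D := is_deriveN (is_deriveZ e (is_deriveD (is_deriveM d1 d1) (is_deriveM d2 d2))).
  have -> : F = - (e *: ((fun t => Re (A Phi t)) * (fun t => Re (A Phi t)) +
    (fun t => Im (A Phi t)) * (fun t => Im (A Phi t)))).
    by apply/funext => s; rewrite /F !fctE !expr2.
  by apply: (is_derive_eq D); rewrite /f /A' /GRing.scale/=; ring.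
have cA Psi : tf Psi -> continuous (fun t => Re (A Psi t)) /\ continuous (fun t => Im (A Psi t)).
  by move=> tPs; split => t; have [d1 d2] := dA Psi t tPs; [exact: (derivable_continuous1 d1)|exact: (derivable_continuous1 d2)].
have [c1 c2] := cA Phi tP; have [c3 c4] := cA _ tj.
have cf : continuous f.
  move=> t; apply: cvgN; apply: cvgM; first exact: cvg_cst.
  apply: cvgM; first exact: cvg_cst.
  by apply: cvgD; apply: cvgM; [exact: c1|exact: c3|exact: c2|exact: c4].
pose k (t : R) := slice Phi (rV_rcons xi t).
have sq (z : R[i]) : nc z ^+ 2 = Re z ^+ 2 + Im z ^+ 2.
  by case: z => a b; rewrite /= sqr_sqrtr// addr_ge0// sqr_ge0.
have kE t : k t = e ^+ 2 * (Re (A Phi t) ^+ 2 + Im (A Phi t) ^+ 2) +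
    (Re (A' t) ^+ 2 + Im (A' t) ^+ 2).
  by rewrite /k sliceE// !sq.
have ck : continuous k.
  rewrite (funext kE) => t; apply: cvgD.
    apply: cvgM; first exact: cvg_cst.
    by apply: cvgD; under eq_fun do rewrite expr2; apply: cvgM; [exact: c1|exact: c1|exact: c2|exact: c2].
  by apply: cvgD; under eq_fun do rewrite expr2; apply: cvgM; [exact: c3|exact: c3|exact: c4|exact: c4].
have fk t : f t <= k t.
  rewrite kE /f; move: (Re (A Phi t)) (Im (A Phi t)) (Re (A' t)) (Im (A' t)) => a b a' b'.
  have h1 := sqr_ge0 (e * a + a'); have h2 := sqr_ge0 (e * b + b').
  rewrite -subr_ge0 (_ : _ - _ = (e * a + a') ^+ 2 + (e * b + b') ^+ 2); first exact: addr_ge0.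
  by ring.
have FT : (\int[mu1]_(x in `[0%R, M]) (f x)%:E = (F M)%:E - (F 0)%:E)%E.
  apply: continuous_FTC2 => //.
  - exact: continuous_subspaceT.
  - split; [by move=> x _; have [] := dF x| |].
    + by apply: cvg_at_right_filter; exact: (derivable_continuous1 (dF 0)).
    + by apply: cvg_at_left_filter; exact: (derivable_continuous1 (dF M)).
  - by move=> x _; rewrite derive1E; have [_ ->] := dF x.
have FM : F M = 0 by rewrite /F AM /= expr0n/= addr0 mulr0 oppr0.
have F0 : - F 0 = e * nc (A Phi 0) ^+ 2 by rewrite /F opprK sq.
have E0 : (e * nc (A Phi 0) ^+ 2)%:E = (\int[mu1]_(x in `[0%R, M]) (f x)%:E)%E.
  by rewrite FT FM -F0 sub0e EFinN.
rewrite -/e -/(A Phi 0) E0.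
have im (g : R -> R) : continuous g -> mu1.-integrable `[0, M] (EFin \o g).
  move=> cg; apply: continuous_compact_integrable; first exact: segment_compact.
  exact: continuous_subspaceT.
apply: (@le_trans _ _ (\int[mu1]_(x in `[0%R, M]) (k x)%:E)%E).
  by apply: le_integral => //; [exact: im|exact: im|move=> x _; rewrite lee_fin].
(* The endpoint 0 is dropped because the half-space is open. *)
rewrite -integral_itv_obnd_cbnd; last first.
  by apply/measurable_EFinP; apply: measurable_funTS; exact: continuous_measurable_fun.
rewrite integral_mkcond; apply: ge0_le_integral => //.
- by move=> t _; rewrite patchE; case: ifP => // _; rewrite lee_fin slice_ge0.
- apply/(measurable_restrictT _ _).1 => //; apply/measurable_EFinP; apply: measurable_funTS.
  exact: continuous_measurable_fun.
- apply/measurable_EFinP; apply: measurable_funM.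
    apply: (measurableT_comp (f := fun z : V => \1_Om z : R)); last exact: measurable_rcons_r.
    by apply: measurable_indic; exact: mOm.
  exact: continuous_measurable_fun ck.
- move=> t _; rewrite patchE indicE; case: ifPn => tM; last first.
    by rewrite lee_fin mulr_ge0// slice_ge0.
  rewrite mem_set ?mul1r//= /half_space /= rcons_last.
  by move: tM; rewrite inE/= in_itv/= => /andP[].
Qed.

Lemma bessel_slice Phi (t : R) : tf Phi ->
  (\int[nu]_xi (slice Phi (rV_rcons xi t))%:E <=
   \int[nu]_x (\sum_(i < n) nc (partial i Phi (rV_rcons x t)) ^+ 2)%:E)%E.
Proof.
move=> tP; pose g i := fun x => partial i Phi (rV_rcons x t).
have tg i : tf (g i) by apply: tf_rcons; exact: tf_partial.
have b i := bessel (sqr_N1 R) (tf_cint (tg i)) (tf_L2 (tg i)).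
have E (h : 'I_n -> W -> R[i]) : (forall i, L2 nu setT (h i)) ->
    (\int[nu]_x (\sum_(i < n) nc (h i x) ^+ 2)%:E = (\sum_(i < n) n2 nu setT (h i) ^+ 2)%:E)%E.
  move=> lh; under eq_integral do rewrite -sumEFin.
  rewrite ge0_integral_sum//.
  - rewrite -sumEFin; apply: eq_bigr => i _; rewrite sqr_n2 /Rintegral fineK//.
    by apply: integrable_fin_num => //; case: (lh i).
  - by move=> i; apply/measurable_EFinP; apply: meas_nc2; exact: L2_meas (lh i).
  - by move=> i x _; rewrite lee_fin sqr_ge0.
rewrite [leRHS](E g) => [|i]; last exact: tf_L2.
under eq_integral => xi _.
  rewrite /slice; under eq_bigr do rewrite pft_rcons.
  over.
rewrite (E (fun i => ft (-1) (g i))) => [|i]; last by case: (b i).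
rewrite lee_fin; apply: ler_sum => i _.
by rewrite lerXn2r ?nnegrE ?n2_ge0//; case: (b i).
Qed.

(** [slice_bound] is integrated over [xi], the order of integration exchanged, and Bessel's
    inequality applied in the tangential variables at each height. *)
Lemma energy_grad Phi : tf Phi -> energy (fun x => Phi (rV_rcons x 0)) <= gn (fun j => partial j Phi).
Proof.
move=> tP; have t0 := tf_rcons 0 tP.
have lG j : L2 mu Om (partial j Phi) by apply: tf_L2Om; exact: tf_partial.
have m1O : measurable_fun setT (fun z : V => \1_Om z : R) by apply: measurable_indic; exact: mOm.
have mS : measurable_fun setT (fun z : V => (\1_Om z * slice Phi z)%:E).
  apply/measurable_EFinP; apply: measurable_funM => //.
  by apply: measurable_sum => i; apply: meas_nc2; apply: meas_pft; exact: tf_partial.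
pose D (z : V) : R := \sum_(i < n) nc (partial i Phi z) ^+ 2.
have mD : measurable_fun setT (fun z : V => (\1_Om z * D z)%:E).
  apply/measurable_EFinP; apply: measurable_funM => //.
  by apply: measurable_sum => i; apply: meas_nc2; apply: tf_meas; exact: tf_partial.
have D0 z : 0 <= D z by apply: sumr_ge0 => i _; exact: sqr_ge0.
have i0 (z : V) : 0 <= \1_Om z :> R by rewrite indicE.
have mE : measurable_fun setT (fun xi : W => (enorm xi * nc (ft (-1) (fun x => Phi (rV_rcons x 0)) xi) ^+ 2)%:E).
  apply/measurable_EFinP; apply: measurable_funM; first exact: measurable_enorm.
  by apply: meas_nc2; apply: meas_ft; exact: tf_cint.
have H1 : (\int[nu]_xi (enorm xi * nc (ft (-1) (fun x => Phi (rV_rcons x 0)) xi) ^+ 2)%:E <=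
    \int[mu]_z (\1_Om z * slice Phi z)%:E)%E.
  rewrite (ge0_integral_rcons mS); last by move=> z; rewrite lee_fin mulr_ge0// slice_ge0.
  apply: ge0_le_integral => //.
  - by move=> xi _; rewrite lee_fin mulr_ge0 ?enorm_ge0 ?sqr_ge0.
  - apply: (@measurable_fun_fubini_tonelli_F _ _ _ _ _ mu1 _ (measurable_comp_rcons mS)).
    by move=> p; rewrite lee_fin mulr_ge0// slice_ge0.
  - by move=> xi _; exact: slice_bound.
have H2 : (\int[mu]_z (\1_Om z * slice Phi z)%:E <= \int[mu]_z (\1_Om z * D z)%:E)%E.
  rewrite (ge0_integral_rcons' mS); last by move=> z; rewrite lee_fin mulr_ge0// slice_ge0.
  rewrite (ge0_integral_rcons' mD); last by move=> z; rewrite lee_fin mulr_ge0.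
  apply: ge0_le_integral => //.
  - by move=> t _; apply: integral_ge0 => x _; rewrite lee_fin mulr_ge0// slice_ge0.
  - apply: (@measurable_fun_fubini_tonelli_G _ _ _ _ _ (leb R d) _ (measurable_comp_rcons mS)).
    by move=> p; rewrite lee_fin mulr_ge0// slice_ge0.
  - apply: (@measurable_fun_fubini_tonelli_G _ _ _ _ _ (leb R d) _ (measurable_comp_rcons mD)).
    by move=> p; rewrite lee_fin mulr_ge0.
  - move=> t _; have [t1|t1] := ltP 0 t.
      have E (h : V -> R) : (\int[nu]_x (\1_Om (rV_rcons x t) * h (rV_rcons x t))%:E =
          \int[nu]_x (h (rV_rcons x t))%:E)%E.
        apply: eq_integral => x _; rewrite indicE mem_set ?mul1r//=.
        by rewrite /half_space /= rcons_last.
      by rewrite (E (slice Phi)) (E D); exact: bessel_slice.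
    have E (h : V -> R) : (\int[nu]_x (\1_Om (rV_rcons x t) * h (rV_rcons x t))%:E = 0)%E.
      apply: integral0_eq => x _; rewrite indicE memNset ?mul0r//=.
      by rewrite /half_space /= rcons_last; apply/negP; rewrite -leNgt.
    by rewrite (E (slice Phi)) (E D).
have H3 : (\int[mu]_z (\1_Om z * D z)%:E = (gn (fun j => partial j Phi) ^+ 2)%:E)%E.
  have lg := L2_grad lG.
  rewrite /gn sqr_n2 Rintegral_indic /Rintegral fineK.
    apply: eq_integral => z _; rewrite nc_real ger0_norm ?sqrtr_ge0// sqr_sqrtr//; exact: D0.
  have [_ lg2] := lg; have ii := (integrable_indic mu mOm _).1 lg2.
  exact: (integrable_fin_num mT ii).
rewrite -(@ler_pXn2r _ 2) ?nnegrE ?gn_ge0 ?n2_ge0// -lee_fin -H3.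
apply: le_trans H2; apply: le_trans H1.
rewrite /energy sqr_n2 /Rintegral fineK; last first.
  by apply: integrable_fin_num => //; case: (sqft_L2 t0).
apply: ge0_le_integral => //.
- by move=> xi _; rewrite lee_fin sqr_ge0.
- by apply/measurable_EFinP; apply: meas_nc2; exact: L2_meas (sqft_L2 t0).
- move=> xi _; rewrite /sqft (ncM (sqx xi)) exprMn /sqx nc_real.
  by rewrite ger0_norm ?sqrtr_ge0// sqr_sqrtr ?enorm_ge0.
Qed.

End trace_energy.

(** * Null sets and a pointwise bounded representative of the coefficient *)

Section almost_everywhere.
Context d (T : measurableType d) (R : realType) (mu : {measure set T -> \bar R}).

Lemma ae_cintegral (D : set T) (f g : T -> R[i]) : measurable D -> cmeasurable D f -> cmeasurable D g ->
  {ae mu, forall x, D x -> f x = g x} -> cintegral mu D f = cintegral mu D g.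
Proof.
move=> mD [f1 f2] [g1 g2] fg; rewrite /cintegral /Rintegral; congr (fine _ +i* fine _).
- apply: ae_eq_integral => //; [exact/measurable_EFinP|exact/measurable_EFinP|].
  by apply: filterS fg => x h Dx; rewrite h.
- apply: ae_eq_integral => //; [exact/measurable_EFinP|exact/measurable_EFinP|].
  by apply: filterS fg => x h Dx; rewrite h.
Qed.

Lemma measurable_ler (f g : T -> R) : measurable_fun setT f -> measurable_fun setT g ->
  measurable [set x | f x <= g x].
Proof.
move=> mf mg.
have := @measurable_fun_ler _ T R setT f g mf mg mT [set true] Logic.I.
by rewrite setTI; congr measurable; apply/seteqP; split => x.
Qed.

End almost_everywhere.

Section norms.
Context (R : realType) (d : nat).
Notation W := 'rV[R]_d.
Notation nu := (lebesgue_rV R d).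
Implicit Types (f : W -> R[i]).

Lemma lebesgue_rV_gt0 : (0 < nu setT)%E.
Proof.
apply: (@lt_le_trans _ _ (nu (rV_box 1))); last by apply: le_measure => //; rewrite inE//; exact: measurable_rV_box.
by rewrite lebesgue_rV_box// lte_fin exprn_gt0// mulr_gt0.
Qed.

Lemma cLnorm_oo_ae f (C : R) : (cLnorm nu setT +oo f <= C%:E)%E ->
  {ae nu, forall x, nc (f x) <= C}.
Proof.
rewrite /cLnorm unlock lebesgue_rV_gt0 => /ess_supP; apply: filterS => x /=.
by rewrite indicE in_setT mul1r lee_fin ger0_norm ?nc_ge0.
Qed.

Lemma cLnorm_ge0 p f : (0 <= cLnorm nu setT p f)%E.
Proof. exact: Lnorm_ge0. Qed.

Lemma tf_cLp (p : R) phi : 0 < p -> tf phi -> cLp nu setT p%:E phi.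
Proof.
move=> p0 tp; split; first exact: tf_meas.
have [C C0 CP] := tf_bnd tp; have [M M0 MP] := tf_box tp.
rewrite /cLnorm unlock; apply: poweR_lty.
have mn : measurable_fun setT (fun x : W => nc (phi x)) by apply: meas_nc; exact: tf_meas.
apply: (@le_lt_trans _ _ (\int[nu]_x ((C `^ p) * \1_(rV_box M) x)%:E)%E).
  apply: ge0_le_integral => //.
  - by move=> x _; exact: poweR_ge0.
  - under eq_fun do rewrite indicE in_setT mul1r abse_EFin ger0_norm ?nc_ge0// poweR_EFin.
    by apply/measurable_EFinP; apply: (measurableT_comp (measurable_powR p)).
  - apply/measurable_EFinP; apply: measurable_funM => //; apply: measurable_indic.
    exact: measurable_rV_box.
  - move=> x _; rewrite indicE in_setT mul1r abse_EFin ger0_norm ?nc_ge0// poweR_EFin lee_fin indicE.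
    have [xB|xB] := pselect (rV_box M x).
      by rewrite mem_set// mulr1 ge0_ler_powR ?nnegrE ?nc_ge0 ?(ltW p0).
    by rewrite MP// Normc.normc0 powR0 ?gt_eqF// memNset// mulr0.
have iB : nu.-integrable setT (EFin \o (fun x => C `^ p * \1_(rV_box M) x)).
  apply: (@box_integrable _ _ _ M (C `^ p)).
  - by apply: measurable_funM => //; apply: measurable_indic; exact: measurable_rV_box.
  - move=> x; rewrite indicE normrM (ger0_norm (powR_ge0 _ _)).
    by case: (x \in _); rewrite ?normr1 ?normr0 ?mulr1 ?mulr0// powR_ge0.
  - by move=> x xM; rewrite indicE memNset// mulr0.
by have := integrable_fin_num mT iB; rewrite ge0_fin_numE//; apply: integral_ge0 => x _; rewrite lee_fin mulr_ge0// powR_ge0.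
Qed.

(** The bounds hold jointly on a measurable set of full measure; off it the coefficient is set to 0,
    which satisfies them all. Everywhere valid bounds can then be used throughout. *)
Lemma regular_coefficient (alpha : W -> R[i]) (A : R) (B : 'I_d -> R) : cmeasurable setT alpha ->
  0 <= A -> (forall j, 0 <= B j) -> {ae nu, forall x, nc (alpha x) <= A} ->
  {ae nu, forall x, `|Im (alpha x)| <= Re (alpha x)} ->
  (forall j, {ae nu, forall x, nc (x_alpha alpha j x) <= B j}) ->
  exists al : W -> R[i], [/\ cmeasurable setT al, forall x, nc (al x) <= A,
    forall x, `|Im (al x)| <= Re (al x),
    forall j x, nc (x_alpha al j x) <= B j & {ae nu, forall x, alpha x = al x}].
Proof.
move=> ma A0 B0 hA hI hB.
have mx j : cmeasurable setT (x_alpha alpha j).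
  by apply: cmeasM => //; apply: cmeas_real; exact: measurable_rV_coord.
pose D := [set x | nc (alpha x) <= A] `&` [set x | `|Im (alpha x)| <= Re (alpha x)] `&`
  \bigcap_(j in [set: 'I_d]) [set x | nc (x_alpha alpha j x) <= B j].
have mD : measurable D.
  apply: measurableI; first apply: measurableI.
  - by apply: measurable_ler; [exact: (meas_nc ma)|exact: measurable_cst].
  - have [m1 m2] := ma; apply: measurable_ler => //.
    exact: measurableT_comp.
  - apply: fin_bigcap_measurable => // j _.
    by apply: measurable_ler; [exact: (meas_nc (mx j))|exact: measurable_cst].
have aeD : {ae nu, forall x, D x}.
  have hB' : {ae nu, forall x, forall j, nc (x_alpha alpha j x) <= B j} by exact: filter_forall.
  by apply: filterS3 hA hI hB' => x h1 h2 h3; split; [split|move=> i _; exact: h3].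
exists (fun x => (\1_D x)%:C * alpha x).
have E x : (\1_D x)%:C * alpha x = if x \in D then alpha x else 0.
  by rewrite indicE; case: ifP => _; rewrite ?mul1r ?mul0r.
split.
- by apply: cmeasM => //; apply: cmeas_real; exact: measurable_indic.
- by move=> x; rewrite E; case: ifPn => [/set_mem[[]]//|_]; rewrite Normc.normc0.
- by move=> x; rewrite E; case: ifPn => [/set_mem[[]]//|_]; rewrite normr0.
- move=> j x; rewrite /x_alpha E; case: ifPn => [/set_mem[_ /(_ j Logic.I)]//|_].
  by rewrite mulr0 Normc.normc0.
- by apply: filterS aeD => x Dx; rewrite E mem_set.
Qed.

End norms.

(** * Symmetric difference quotients of dilations *)

Section difference_quotients.
Context (R : realType) (n : nat).
Notation V := 'rV[R]_n.
Notation mu := (lebesgue_rV R n).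
Implicit Types (phi psi : V -> R[i]) (f g h p q v : V -> R[i]) (a b c t : R).
Variables (D : set V) (mD : measurable D).
Hypothesis Ddil : forall (a : R) x, 0 < a -> D (a *: x) <-> D x.

(** Symmetric in [t] and [-t] because the adjoint of a dilation is, up to a scalar, the dilation
    with opposite parameter; in the unitary normalisation this operator is antisymmetric. *)
Definition Dt c t f : V -> R[i] := fun x => ((2 * t)^-1)%:C * (dil c t f x - dil c (- t) f x).

Lemma L2_Dt c t f : L2 mu D f -> L2 mu D (Dt c t f).
Proof. by move=> lf; apply: (L2Z mD); apply: (L2B mD); exact: (L2_dilc mD Ddil). Qed.

Lemma n2_Dt c t f : 0 < t <= 1 -> L2 mu D f -> n2 mu D (Dt c t f) <= expR (`|c| + n%:R) / t * n2 mu D f.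
Proof.
move=> /andP[t0 t1] lf; have l1 := L2_dilc mD Ddil c t lf; have l2 := L2_dilc mD Ddil c (- t) lf.
rewrite /Dt (n2Z mD _ (L2B mD l1 l2)) nc_real gtr0_norm ?invr_gt0 ?mulr_gt0//.
have t2 : `|t| <= 1 by rewrite gtr0_norm.
have t3 : `|- t| <= 1 by rewrite normrN.
have h1 := n2_dil_le mD Ddil c t2 lf; have h2 := n2_dil_le mD Ddil c t3 lf.
have h3 := n2B mD l1 l2; rewrite mulrC ler_pdivrMr ?mulr_gt0//.
rewrite (_ : _ * (2 * t) = 2 * (expR (`|c| + n%:R) * n2 mu D f)); last by field; rewrite gt_eqF.
by apply: (le_trans h3); rewrite mulr_natl mulr2n; exact: (lerD h1 h2).
Qed.

(** The operator bound degenerates like [1/t]; passing to approximants is harmless in the limit once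
    their error is of order [t^2]. *)
Lemma Dt_ip_le c t q q' v v' : 0 < t <= 1 -> L2 mu D q -> L2 mu D q' -> L2 mu D v -> L2 mu D v' ->
  nc (ip mu D q (Dt c t v) - ip mu D q' (Dt c t v')) <= expR (`|c| + n%:R) / t *
    (n2 mu D (fun x => q x - q' x) * n2 mu D v + n2 mu D q' * n2 mu D (fun x => v x - v' x)).
Proof.
move=> t01 lq lq' lv lv'; have lqq := L2B mD lq lq'; have lvv := L2B mD lv lv'.
have E : ip mu D q (Dt c t v) - ip mu D q' (Dt c t v') =
    ip mu D (fun x => q x - q' x) (Dt c t v) + ip mu D q' (Dt c t (fun x => v x - v' x)).
  rewrite (ipBl mD lq lq' (L2_Dt c t lv)).
  rewrite (@eq_ip _ _ _ mu D q' (Dt c t (fun x => v x - v' x)) q' (fun x => Dt c t v x - Dt c t v' x))//.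
    by rewrite (ipBr mD (L2_Dt c t lv) (L2_Dt c t lv') lq'); ring.
  by move=> x _; rewrite /Dt /dil; ring.
rewrite E; apply: (le_trans (le_normcD _ _)).
have h1 := CS mD lqq (L2_Dt c t lv); have h2 := CS mD lq' (L2_Dt c t lvv).
have h3 := n2_Dt c t01 lv; have h4 := n2_Dt c t01 lvv.
move: (expR _ / t) h3 h4 => K h3 h4.
rewrite mulrDr; apply: lerD.
- by apply: (le_trans h1); rewrite mulrCA ler_wpM2l ?n2_ge0.
- by apply: (le_trans h2); rewrite mulrCA ler_wpM2l ?n2_ge0.
Qed.

Lemma ip_Dt c t q v : L2 mu D q -> L2 mu D v ->
  ip mu D q (Dt c t v) = ((2 * t)^-1)%:C * (ip mu D q (dil c t v) - ip mu D q (dil c (- t) v)).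
Proof.
move=> lq lv; have l1 := L2_dilc mD Ddil c t lv; have l2 := L2_dilc mD Ddil c (- t) lv.
by rewrite /Dt (ipZr mD _ lq (L2B mD l1 l2)) conjR (ipBr mD l1 l2 lq).
Qed.

Lemma mvt_Dt q c t phi : tf phi -> L2 mu D q -> 0 < t -> exists2 s, `|s| <= t &
  Re (ip mu D q (Dt c t phi)) = Re (ip mu D q (dil c s (gen c phi))).
Proof.
move=> tp lq t0; have [s st E] := mvt_dil mD c tp lq t0; exists s => //.
have lp : L2 mu D phi by apply: L2_sub => //; exact: tf_L2.
rewrite ip_Dt//.
by rewrite ReRM ReB E mulrA mulVf ?mul1r// mulf_neq0// gt_eqF.
Qed.

(** A change of variable transfers the dilation to the other factor; Jacobian and prefactors combine
    into the exponent [n - a - b], which is 0 for gradients, where [a = b = c + 1] and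
    [2 (c + 1) = n]. *)
Lemma dil_opp a b t f g : L2 mu D f -> L2 mu D g ->
  ip mu D f (dil a (- t) g) = (expR ((n%:R - a - b) * t))%:C * ip mu D (dil b t f) g.
Proof.
move=> lf lg; have a0 := expR_gt0 t.
rewrite (ip_dil mD Ddil a0 lf (L2_dilc mD Ddil a (- t) lg)).
rewrite (@eq_ip _ _ _ mu D _ _ (fun x => f (expR t *: x)) (fun x => (expR (- (a * t)))%:C * g x))//; last first.
  by move=> x _; rewrite /dil scalerA -expRD addNr expR0 scale1r mulrN.
rewrite (ipZr mD _ (L2_dil mD Ddil a0 lf) lg) conjR /dil (ipZl mD _ (L2_dil mD Ddil a0 lf) lg).
rewrite !mulrA -!(rmorphM (real_complex R)); congr (_%:C * _).
by rewrite -expRM_natl -!expRD; congr expR; ring.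
Qed.

Lemma n2_dil_eq c t f : 2 * c = n%:R -> L2 mu D f -> n2 mu D (dil c t f) = n2 mu D f.
Proof.
move=> cn lf; have a0 := expR_gt0 t; have lft := L2_dil mD Ddil a0 lf.
apply/eqP; rewrite -(@eqrXn2 _ 2) ?n2_ge0//; apply/eqP.
rewrite (n2_dil mD Ddil a0 lf) /dil (n2Z mD _ lft) nc_real ger0_norm ?expR_ge0//.
rewrite exprMn; congr (_ * _); rewrite -!expRM_natl -cn; congr expR; ring.
Qed.

Lemma hseq_itv k : 0 < hseq R k <= 1.
Proof. by rewrite hseq_gt0 hseq_le1. Qed.

Lemma le_hseq_cvg0 (s : R^nat) : (forall k, `|s k| <= hseq R k) ->
  s @ \oo --> (0 : R) /\ forall k, `|s k| <= 1.
Proof.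
move=> sh; split; last by move=> k; rewrite (le_trans (sh k))// hseq_le1.
by apply: cvg0_abs; apply: cvg0_le (@hseq_cvg R) => k; rewrite normr_ge0 sh.
Qed.

Lemma dcont_ip c (s : R^nat) q f : dcont D f -> L2 mu D q ->
  s @ \oo --> (0 : R) -> (forall k, `|s k| <= 1) ->
  ccvg (fun k => ip mu D q (dil c (s k) f)) (ip mu D q f).
Proof.
move=> df lq s0 s1; have [lf _] := df.
apply: (cvg2_ipr mD) => //; first by move=> k; exact: (L2_dilc mD Ddil).
by apply: (dcont_dil mD Ddil) => //; exact: cvg2_cst.
Qed.

End difference_quotients.

Section dilation_algebra.
Context (R : realType).

(** Algebra of the first order term, with [z] and [w] the pairings of the radial derivative with
    [U_t v] and [U_{-t} v]. What remains are quotients of exponentials, whose limits are given by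
    [expR_quotient]. *)
Lemma Re_antisymmetric (k t : R) (z w : R[i]) : 0 < t ->
  Re ((0 +i* k) * (((2 * t)^-1)%:C * ((expR (- t))%:C * w^* - (expR t)%:C * z^*) -
    ((2 * t)^-1)%:C * (z - w))) =
  - k * ((expR (1 * t) - 1) / (2 * t) * Im z - (expR (-1 * t) - 1) / (2 * t) * Im w).
Proof.
move=> t0; rewrite ReIM ImB !ImRM !ImB !ImRM !Im_conj mul1r mulN1r.
by field; rewrite gt_eqF.
Qed.

Lemma expR_quotient (a : R) : (fun k => (expR (a * hseq R k) - 1) / (2 * hseq R k)) @ \oo --> a / 2.
Proof.
have d0 : is_derive (0 : R) 1 (fun s : R => a * s) (a * 1) by exact: (is_deriveZ (f := id)).
have d1 : is_derive (0 : R) 1 (fun s : R => expR (a * s)) (1 * (a * 1)).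
  apply: (@is_derive1_comp _ expR (fun s : R => a * s)) => //.
  by rewrite mulr0 -[X in is_derive _ _ _ X]expR0; exact: is_derive_expR.
have := is_derive_seq d1 (@hseq_cvg R) (fun k => lt0r_neq0 (hseq_gt0 R k)).
rewrite mul1r mulr1 => h.
have h2 : (fun=> 2^-1 : R) @ \oo --> (2^-1 : R) by exact: cvg_cst.
have -> : (fun k => (expR (a * hseq R k) - 1) / (2 * hseq R k)) =
    (fun k => (expR (a * (hseq R k + 0)) - expR (a * 0)) / hseq R k * 2^-1).
  by apply/funext => k; rewrite addr0 mulr0 expR0 invfM mulrA mulrAC.
exact: cvgM h h2.
Qed.

End dilation_algebra.

(** * Multiplier identities and estimates *)

Section half_space_forms.
Context (R : realType) (d : nat).
Notation n := d.+1.
Notation V := 'rV[R]_n.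
Notation W := 'rV[R]_d.
Notation mu := (lebesgue_rV R n).
Notation nu := (lebesgue_rV R d).
Notation Om := (@half_space R d).
Notation mOm := (@measurable_half_space R d).
Notation hd := (@half_space_dil R d).
Notation L2O := (L2 mu Om).
Notation n2O := (n2 mu Om).
Notation ipO := (ip mu Om).
Notation cvg2O := (cvg2 mu Om).
Implicit Types (v F : V -> R[i]) (G : 'I_n -> V -> R[i]) (g : W -> R[i]).

(** The Leibniz rule for [x_j alpha] and the trace of [Phi1] produces
    [h_j = (-Delta)^{1/4}(x_j alpha Phi1)] in [L^2], and [duality_partial] bounds the pairing by
    [||h_j||] times the energy of the second trace. The Sobolev inequality and [energy_grad] turn
    all norms of traces into Dirichlet norms. *)
Lemma boundary_gradient (Cs S b1 b2 : R) (alpha al : W -> R[i]) (B be : 'I_d -> R)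
    (Dxa : 'I_d -> W -> R[i]) (Phi1 Phi2 : V -> R[i]) : (2 <= d)%N ->
  leibniz_constant d Cs -> sobolev_constant d S -> 0 <= b2 ->
  cmeasurable setT alpha -> cmeasurable setT al -> {ae nu, forall x, alpha x = al x} ->
  (forall j, cLnorm nu setT +oo (x_alpha alpha j) = (B j)%:E) ->
  (forall j x, nc (x_alpha al j x) <= B j) -> \sum_j B j <= b1 ->
  (forall j, is_frac_lap (x_alpha alpha j) (Dxa j)) ->
  (forall j, cLnorm nu setT (2 * d%:R)%:E (Dxa j) = (be j)%:E) -> \sum_j be j <= b2 ->
  tf Phi1 -> tf Phi2 ->
  \sum_j nc (cintegral nu setT (fun x => x_alpha al j x * Phi1 (rV_rcons x 0) *
     (partial j (fun x => Phi2 (rV_rcons x 0)) x)^*)) <=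
  Num.max 0 (Cs * (b1 + S * b2)) * gn (fun j => partial j Phi1) * gn (fun j => partial j Phi2).
Proof.
move=> d2 hC hS b20 ma mal aal HB alB sB Hfl Hbe sbe t1 t2.
pose p1 (x : W) := Phi1 (rV_rcons x 0); pose p2 (x : W) := Phi2 (rV_rcons x 0).
have tp1 : tf p1 by exact: tf_rcons.
have [L2L nL] := frac_lap_L2 tp1; pose L := n2 nu setT (frac_lap_test p1).
have L0 : 0 <= L by exact: n2_ge0.
have La : L <= gn (fun j => partial j Phi1) by rewrite (le_trans nL)// energy_grad.
have B0 j : 0 <= B j by rewrite -lee_fin -HB cLnorm_ge0.
have be0 j : 0 <= be j by rewrite -lee_fin -Hbe cLnorm_ge0.
have fl1 := frac_lap_tf tp1.
have d1 : 0 < d%:R - 1 :> R by rewrite subr_gt0 ltr1n.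
have ts0 : 0 < two_star R d by rewrite divr_gt0// mulr_gt0// ltr0n (leq_trans _ d2).
have cp := tf_cLp ts0 tp1.
have [P [P0 PE PS]] : exists P : R, [/\ 0 <= P, cLnorm nu setT (two_star R d)%:E p1 = P%:E & P <= S * L].
  have := hS p1 _ (homogeneous_tf tp1) fl1; have [_ fin] := cp; have ge0 := cLnorm_ge0 (two_star R d)%:E p1.
  rewrite (L2_cLnorm mT L2L) -/L -EFinM; move: ge0 fin.
  case: (cLnorm _ _ _ _) => [r|//|//]; rewrite lee_fin => r0 _; rewrite lee_fin => rS.
  by exists r.
have ex j : exists h, [/\ L2 nu setT h, n2 nu setT h <= Cs * (B j * L + be j * P) &
    forall psi, tf psi -> cintegral nu setT (fun x => x_alpha alpha j x * p1 x * frac_lap_test psi x) =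
      cintegral nu setT (fun x => h x * psi x)].
  have c1 : cLp nu setT +oo%E (x_alpha alpha j).
    by split; [have [] := Hfl j|rewrite HB ltry].
  have c2 : cLp nu setT (2 * d%:R)%:E (Dxa j).
    by split; [have [] := Hfl j|rewrite Hbe ltry].
  have c3 : cLp nu setT 2%:E (frac_lap_test p1) by exact/(L2P nu mT).
  have [h [[_ mh flh] hn]] := hC _ _ _ _ c1 (Hfl j) c2 cp fl1 c3.
  rewrite HB Hbe PE (L2_cLnorm mT L2L) -/L in hn.
  have {}hn : (cLnorm nu setT 2%:E h <= (Cs * (B j * L + be j * P))%:E)%E := hn.
  have lh : L2 nu setT h by apply/(L2P nu mT); split => //; rewrite (le_lt_trans hn)// ltry.
  exists h; split => //; first by move: hn; rewrite (L2_cLnorm mT lh) lee_fin.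
  by move=> psi tpsi; have [_ _] := flh _ tpsi.
have /choice[h hP] := ex.
(* The pairing in [duality_partial] is bilinear, so the second trace enters conjugated. *)
pose cp2 (x : W) := (p2 x)^*.
have tcp2 : tf cp2 by apply: tf_conj; exact: tf_rcons.
have tcP2 : tf (fun z => (Phi2 z)^*) by exact: tf_conj.
have en2 : energy cp2 <= gn (fun j => partial j Phi2).
  apply: (le_trans (energy_grad tcP2)); rewrite /gn le_eqVlt; apply/orP; left; apply/eqP.
  apply: eq_n2 => x _; congr ((Num.sqrt _)%:C); apply: eq_bigr => j _.
  by rewrite partial_conj ?nc_conj//; exact: tf_smooth.
have term j : nc (cintegral nu setT (fun x => x_alpha al j x * p1 x * (partial j p2 x)^*)) <=
    n2 nu setT (h j) * gn (fun j => partial j Phi2).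
  have [lh _ hh] := hP j.
  have mxa : cmeasurable setT (x_alpha al j).
    by apply: cmeasM => //; apply: cmeas_real; exact: measurable_rV_coord.
  have qi : cintegrable nu setT (fun x => x_alpha al j x * p1 x).
    apply: (@cintM_bnd _ _ _ _ setT mT (B j)) => //; exact: tf_cint.
  (* The Leibniz rule is known for [alpha], the pointwise bounds for [al]; the integrals agree. *)
  have qh psi : tf psi -> cintegral nu setT (fun x => x_alpha al j x * p1 x * frac_lap_test psi x) =
      cintegral nu setT (fun x => h j x * psi x).
    move=> tpsi; rewrite -hh//; apply: ae_cintegral => //.
    - apply: cmeasM; first by apply: cmeasM => //; exact: tf_meas.
      by rewrite frac_lapE; apply: meas_ft; exact: sqft_cint.
    - apply: cmeasM; last by rewrite frac_lapE; apply: meas_ft; exact: sqft_cint.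
      apply: cmeasM; last exact: tf_meas.
      by apply: cmeasM => //; apply: cmeas_real; exact: measurable_rV_coord.
    - by apply: filterS aal => x e _; rewrite /x_alpha e.
  have := duality_partial j qi lh qh tcp2.
  rewrite (@eq_cintegral _ _ _ nu setT _ (fun x => x_alpha al j x * p1 x * (partial j p2 x)^*)); last first.
    by move=> x _; rewrite partial_conj//; apply: tf_smooth; exact: tf_rcons.
  by move=> /le_trans; apply; rewrite ler_wpM2l ?n2_ge0.
apply: (le_trans (ler_sum _ (fun j _ => term j))); rewrite -mulr_suml ler_wpM2r ?gn_ge0//.
have sh : \sum_j n2 nu setT (h j) <= Cs * ((\sum_j B j) * L + (\sum_j be j) * P).
  rewrite !mulr_suml -big_split/= mulr_sumr; apply: ler_sum => j _; by have [] := hP j.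
apply: (le_trans sh); have sB0 : 0 <= \sum_j B j by apply: sumr_ge0.
have sbe0 : 0 <= \sum_j be j by apply: sumr_ge0.
have g0 : 0 <= gn (fun j => partial j Phi1) by exact: gn_ge0.
move: (\sum_j B j) (\sum_j be j) (gn _) sB0 sbe0 sB sbe La g0 => X Y a X0 Y0 Xb Yb La a0.
(* The signs of [Cs] and of [Cs * (b1 + S * b2)] are not known beforehand; the maximum with 0 covers
   the negative cases. *)
have [C0|C0] := leP 0 Cs; last first.
  apply: (@le_trans _ _ 0); last by rewrite mulr_ge0// le_max lexx.
  by rewrite nmulr_rle0// addr_ge0// mulr_ge0.
apply: (@le_trans _ _ (Cs * (b1 + S * b2) * L)).
  rewrite -mulrA ler_wpM2l// mulrDl lerD ?ler_wpM2r//.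
  by rewrite (le_trans (ler_wpM2r P0 Yb))// -mulrA mulrCA ler_wpM2l.
have [m0|m0] := leP 0 (Cs * (b1 + S * b2)).
  by rewrite ler_wpM2l.
by rewrite mul0r nmulr_rle0.
Qed.

Lemma setT_dil k (a : R) (x : 'rV[R]_k) : 0 < a -> setT (a *: x) <-> setT x.
Proof. by []. Qed.

Lemma XS_dcont v G g : XS v G g -> dcont Om v.
Proof.
move=> [lv _ _ ap]; apply: (dcont_closed mOm hd lv) => e /ap[phi tp [h _ _]].
by exists phi => //; exact: (tf_dcont mOm tp).
Qed.

Lemma XS_dcont_trace v G g : XS v G g -> dcont setT g.
Proof.
move=> [_ _ lg ap]; apply: (dcont_closed mT (@setT_dil d) lg) => e /ap[phi tp [_ _ h]].
by exists (fun x => phi (rV_rcons x 0)) => //; exact: (tf_dcont mT (tf_rcons 0 tp)).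
Qed.

Lemma xh_dil j (a : R) (x : V) : 0 < a -> xh j (a *: x) = xh j x.
Proof.
move=> a0; rewrite /xh enormZ ?ltW// mxE invfM mulrACA divff ?mul1r// gt_eqF//.
Qed.

Lemma sqr_r_dil (s : R) (x : V) : sqr_r (expR s *: x) = (expR (s / 2))%:C * sqr_r x.
Proof.
rewrite /sqr_r enormZ ?expR_ge0// sqrtrM ?expR_ge0// rmorphM; congr (_%:C * _).
by rewrite -[in LHS](divfK (_ : (2 : R) != 0) s)// mulrC expRM_natl sqrtr_sqr ger0_norm// expR_ge0.
Qed.

Lemma meas_radial j (phi : V -> R[i]) : tf phi -> cmeasurable setT (fun x : V => (xh j x)%:C * (sqr_r x * partial j phi x)).
Proof.
move=> tp; apply: cmeasM; first by apply: cmeas_real; exact: meas_xh.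
by apply: cmeasM; [exact: meas_sqr_r|apply: tf_meas; exact: tf_partial].
Qed.

(** [xh] is invariant under dilations and [|x|^{1/2}] homogeneous, so the dilates converge at each
    point of the half-space despite the discontinuity of [xh] at the origin. *)
Lemma radial_tf_dcont j (phi : V -> R[i]) : tf phi -> dcont Om (fun x : V => (xh j x)%:C * (sqr_r x * partial j phi x)).
Proof.
move=> tp; have tj := tf_partial j tp; have [M M0 MP] := tf_box tj.
have [C C0 CP] := tf_bnd tj.
have nM : 0 <= 1 + n%:R * M by rewrite addr_ge0// mulr_ge0.
apply: (@box_dcont _ _ _ mOm M ((1 + n%:R * M) * C)).
- exact: mulr_ge0.
- exact: meas_radial.
- move=> x; have [xM|/MP ->] := pselect (rV_box M x); last first.
    by rewrite !mulr0 Normc.normc0 mulr_ge0.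
  rewrite ncM nc_real -[leRHS]mul1r ler_pM ?nc_ge0 ?xh_bnd//.
  rewrite ncM ler_pM ?nc_ge0// nc_real ger0_norm ?sqrtr_ge0//.
  rewrite (le_trans (sqrt_le1D (enorm_ge0 x)))// lerD2l.
  exact: box_enorm.
- by move=> x /MP ->; rewrite !mulr0.
- move=> s x _ s0; under eq_fun do rewrite xh_dil ?expR_gt0// sqr_r_dil.
  apply: ccvgM; first exact: ccvg_cst.
  apply: ccvgM; last exact: tf_dil_cvg.
  rewrite -[X in ccvg _ X]mul1r; apply: ccvgM; last exact: ccvg_cst.
  apply: ccvg_real; rewrite -[X in _ --> X](expR0 R).
  have h : (fun k => s k / 2) @ \oo --> (0 : R).
    by rewrite -[X in _ --> X](mul0r (2^-1 : R)); apply: cvgM => //; exact: cvg_cst.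
  apply: (@continuous_cvg _ R^o R^o _ _ (fun k => s k / 2) expR 0 _ h).
  exact: continuous_expR.
Qed.

Lemma L2_xh j (f : V -> R[i]) : L2O f -> L2O (fun x => (xh j x)%:C * f x).
Proof.
apply: (@L2_bnd _ _ _ mu Om mOm 1); first by apply: cmeas_sub; apply: cmeas_real; exact: meas_xh.
by move=> x _; rewrite nc_real xh_bnd.
Qed.

Lemma n2_xh j (f : V -> R[i]) : L2O f -> n2O (fun x => (xh j x)%:C * f x) <= n2O f.
Proof.
move=> lf; rewrite -[leRHS]mul1r; apply: (n2_bnd mOm) => //.
- by apply: cmeas_sub; apply: cmeas_real; exact: meas_xh.
- by move=> x _; rewrite nc_real xh_bnd.
Qed.

(** The factor [|x|] of the Euler operator is split evenly between [v] and the gradient. The half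
    given to [v] is not dilated, and the missing [e^{t/2}] raises the exponent to [c + 1/2]. *)
Lemma euler_dil (v phi : V -> R[i]) c t : tf phi -> L2O v -> L2O (fun x => sqr_r x * v x) ->
  ipO v (dil c t (euler phi)) = \sum_j ipO (fun x => sqr_r x * v x)
    (dil (c + 2^-1) t (fun x => (xh j x)%:C * (sqr_r x * partial j phi x))).
Proof.
move=> tp lv lrv; rewrite /ip -(cintegral_sum mOm); last first.
  move=> j; apply: (ip_cint mOm) => //; apply: (L2_dilc mOm hd).
  by apply: L2_xh; exact: tf_weighted.
apply: eq_cintegral => x Ox; have r0 := half_space_enorm Ox.
rewrite /dil /euler [X in _ * X]rmorphM rmorph_sum mulrA mulr_sumr; apply: eq_bigr => j _.
rewrite xh_dil ?expR_gt0// sqr_r_dil.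
have -> : (expR t *: x) ord0 j = expR (t / 2) * expR (t / 2) *
    (xh j x * (Num.sqrt (enorm x) * Num.sqrt (enorm x))).
  rewrite -[Num.sqrt _ * _]expr2 sqr_sqrtr ?(ltW r0)//.
  rewrite mxE /xh mulfVK ?gt_eqF// -expRD; congr (expR _ * _); by field.
have -> : expR ((c + 2^-1) * t) = expR (c * t) * expR (t / 2).
  by rewrite -expRD; congr expR; ring.
rewrite /sqr_r; move: (xh j x) (Num.sqrt (enorm x)) (expR (t / 2)) (expR (c * t)) => X S E E'.
by rewrite !rmorphM/= !conjR; ring.
Qed.

Notation sd := (@setT_dil d).

Section form_dilation.

Lemma wdist_n2 v G g v' G' g' (a : R) : wdist v G g v' G' g' <= a ->
  n2O (fun x => v x - v' x) <= a /\
  forall j, n2O (fun x => sqr_r x * G j x - sqr_r x * G' j x) <= a.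
Proof.
rewrite /wdist => H.
have s1 : 0 <= \sum_(j < n) n2O (fun x => G j x - G' j x) by apply: sumr_ge0 => j _; exact: n2_ge0.
have s2 : 0 <= \sum_(j < n) n2O (fun x => sqr_r x * G j x - sqr_r x * G' j x).
  by apply: sumr_ge0 => j _; exact: n2_ge0.
have s3 := n2_ge0 mu Om (fun x => v x - v' x).
have s4 := n2_ge0 nu setT (fun x => g x - g' x).
split; first by move: H s1 s2 s3 s4; clear; lra.
move=> j; apply: le_trans H.
have s5 : n2O (fun x => sqr_r x * G j x - sqr_r x * G' j x) <=
    \sum_(j < n) n2O (fun x => sqr_r x * G j x - sqr_r x * G' j x).
  by rewrite (bigD1 j)//= lerDl; apply: sumr_ge0 => i _; exact: n2_ge0.
by move: s1 s3 s4 s5; clear; lra.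
Qed.

Variable c : R.

Lemma gn_dil t G : 2 * (c + 1) = n%:R -> (forall j, L2O (G j)) ->
  gn (fun j => dil (c + 1) t (G j)) = gn G.
Proof.
have inj (a b : R) : 0 <= a -> 0 <= b -> a ^+ 2 = b ^+ 2 -> a = b.
  by move=> a0 b0 /eqP; rewrite eqrXn2// => /eqP.
move=> cn lG; apply: inj; [exact: gn_ge0|exact: gn_ge0|].
have lG' j : L2O (dil (c + 1) t (G j)) by exact: (L2_dilc mOm hd).
apply: (etrans (sqr_gn lG')); apply: (etrans _ (esym (sqr_gn lG))).
by apply: eq_bigr => j _; rewrite (n2_dil_eq mOm hd _ cn (lG j)).
Qed.

Lemma cvg_gn (G_ : nat -> 'I_n -> V -> R[i]) G : (forall k j, L2O (G_ k j)) ->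
  (forall j, L2O (G j)) -> (forall j, cvg2O (fun k => G_ k j) (G j)) ->
  (fun k => gn (G_ k) ^+ 2) @ \oo --> gn G ^+ 2.
Proof.
move=> lG_ lG cG; have -> : (fun k => gn (G_ k) ^+ 2) = (fun k => \sum_(j < n) n2O (G_ k j) ^+ 2).
  by apply/funext => k; exact: (sqr_gn (lG_ k)).
rewrite [X in _ --> X](sqr_gn lG).
have h j : (fun k => n2O (G_ k j) ^+ 2) @ \oo --> n2O (G j) ^+ 2.
  have h0 := cvg2_n2 mOm (lG_^~ j) (lG j) (cG j).
  by rewrite expr2; under eq_fun do rewrite expr2; exact: (cvgM h0 h0).
elim: (index_enum 'I_n) => [|j s ih].
  by rewrite big_nil; under eq_fun do rewrite big_nil; exact: cvg_cst.
rewrite big_cons (_ : (fun k => _) = (fun k => n2O (G_ k j) ^+ 2 + \sum_(i <- s) n2O (G_ k i) ^+ 2)).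
  exact: (cvgD (h j) ih).
by apply/funext => k; rewrite big_cons.
Qed.

Lemma sqr_hseq_cvg0 (u : R^nat) (C : R) : (forall k, 0 <= u k <= hseq R k * C) -> u @ \oo --> (0 : R).
Proof.
move=> h; apply: (cvg0_le h); rewrite -[X in _ --> X](mul0r C).
by apply: cvgM; [exact: hseq_cvg|exact: cvg_cst].
Qed.

(** The conclusion of [boundary_gradient], abstracted so that what follows depends on the constant
    [K] alone. *)
Definition boundary_bound (al : W -> R[i]) (K : R) := forall Phi1 Phi2 : V -> R[i], tf Phi1 -> tf Phi2 ->
  \sum_j nc (cintegral nu setT (fun x => x_alpha al j x * Phi1 (rV_rcons x 0) *
     (partial j (fun x => Phi2 (rV_rcons x 0)) x)^*)) <=
  K * gn (fun j => partial j Phi1) * gn (fun j => partial j Phi2).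

Section boundary_form.
Variables (al : W -> R[i]) (A K : R).
Hypothesis mal : cmeasurable setT al.
Hypothesis alA : forall x, nc (al x) <= A.
Hypothesis cn : 2 * (c + 1) = n%:R.
Hypothesis HK : boundary_bound al K.

Lemma L2_al g : L2 nu setT g -> L2 nu setT (fun x => al x * g x).
Proof. by apply: (@L2_bnd _ _ _ nu setT mT A). Qed.

Let A0 : 0 <= A. Proof. by rewrite (le_trans (nc_ge0 (al 0))). Qed.

(** The mean value theorem gives the real part of the pairing of [al phi] with
    [U_s (x.grad + c) phi]. As [U_s] commutes with [x.grad], the tangential derivatives of the trace
    of [U_s Phi] appear, and [U_s Phi] has the same Dirichlet norm as [Phi]. *)
Lemma boundary_test Phi t : tf Phi -> 0 < t -> let phi := fun x : W => Phi (rV_rcons x 0) in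
  exists2 s, `|s| <= t &
  - (K * gn (fun j => partial j Phi) ^+ 2) + c * Re (ip nu setT (fun x => al x * phi x) (dil c s phi)) <=
  Re (ip nu setT (fun x => al x * phi x) (Dt c t phi)).
Proof.
move=> tP t0 phi; have tp : tf phi by exact: tf_rcons.
have lq : L2 nu setT (fun x => al x * phi x) by apply: L2_al; exact: tf_L2.
have [s st E] := mvt_Dt mT sd c tp lq t0; exists s => //; rewrite E {E}.
pose Phi2 := dil c s Phi; have tP2 : tf Phi2 by exact: tf_dil.
have e2 x : Phi2 (rV_rcons x 0) = dil c s phi x by rewrite /Phi2 /dil /phi rcons0Z.
have t2 : tf (fun x : W => Phi2 (rV_rcons x 0)) by exact: tf_rcons.
have := HK tP tP2; rewrite (_ : gn (fun j => partial j Phi2) = gn (fun j => partial j Phi)); last first.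
  rewrite -[RHS](gn_dil s cn); last by move=> j; apply: tf_L2Om; exact: tf_partial.
  by congr gn; apply/funext => j; apply/funext => x; rewrite /Phi2 (partial_dil _ _ _ _ (tf_smooth tP)).
rewrite -mulrA -expr2 => H.
have EE : ip nu setT (fun x => al x * phi x) (dil c s (gen c phi)) =
  \sum_j cintegral nu setT (fun x => x_alpha al j x * Phi (rV_rcons x 0) *
     (partial j (fun x => Phi2 (rV_rcons x 0)) x)^*) +
  c%:C * ip nu setT (fun x => al x * phi x) (dil c s phi).
  have tj j : tf (fun x : W => (x ord0 j)%:C * partial j (fun x => Phi2 (rV_rcons x 0)) x).
    by apply: tfM; [exact: csmooth_coord|exact: tf_partial].
  have lj j := ip_cint mT lq (tf_L2 (tj j)).
  have ls : L2 nu setT (dil c s phi) by apply: tf_L2; exact: tf_dil.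
  rewrite (eq_bigr (fun j => cintegral nu setT (fun x => al x * phi x *
      ((x ord0 j)%:C * partial j (fun x => Phi2 (rV_rcons x 0)) x)^*))); last first.
    move=> j _; apply: eq_cintegral => x _; rewrite /x_alpha [in RHS]rmorphM/= conjR /phi; ring.
  rewrite -(cintegral_sum mT _ lj) /ip -(cintegralZ mT _ (ip_cint mT lq ls)).
  rewrite -(cintegralD mT); [|exact: (cint_sum mT)|by apply: (cintZ mT); exact: (ip_cint mT)].
  apply: eq_cintegral => x _; rewrite -mulr_sumr mulrCA -mulrDr; congr (_ * _).
  rewrite -rmorph_sum -[X in X * _]conjR -rmorphM -rmorphD; congr (_^*).
  rewrite {1}/dil /gen /euler mulrDr mulr_sumr; congr (_ + _); last by rewrite /dil; ring.
  apply: eq_bigr => j _; rewrite (_ : (fun x0 : W => Phi2 _) = dil c s phi); last first.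
    by apply/funext => y; exact: e2.
  rewrite partial_dil; last exact: tf_smooth.
  rewrite /dil mxE mulrDl mul1r expRD !(rmorphM (real_complex R)); ring.
rewrite EE ReD.
rewrite ReRM lerD2r lerNl; apply: le_trans H.
apply: (@le_trans _ _ (nc (\sum_j cintegral nu setT (fun x => x_alpha al j x * Phi (rV_rcons x 0) *
     (partial j (fun x => Phi2 (rV_rcons x 0)) x)^*)))); last exact: nc_sum.
by rewrite (le_trans _ (nc_Re _))// -normrN ler_norm.
Qed.

(** With approximants whose error is the square of the step, the quotient costs only one power of
    it, so [boundary_test] survives the passage to the form domain up to a null sequence. *)
Lemma boundary_dilation v G g : XS v G g -> exists2 e : R^nat, e @ \oo --> (0 : R) &
  forall k, - (K * gn G ^+ 2) + c * Re (ip nu setT (fun x => al x * g x) g) - e k <=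
    Re (ip nu setT (fun x => al x * g x) (Dt c (hseq R k) g)).
Proof.
move=> X; have [lv lG lg ap] := X; have dg := XS_dcont_trace X.
have h0 k := hseq_gt0 R k; have h01 k := hseq_itv R k.
have /choice[Phi P] : forall k, exists Phi, tf Phi /\ near_test Phi v G g (hseq R k ^+ 2).
  by move=> k; have [Phi ? ?] := ap _ (exprn_gt0 2 (h0 k)); exists Phi.
have tP k : tf (Phi k) by have [] := P k.
pose phi k (x : W) := Phi k (rV_rcons x 0).
have tp k : tf (phi k) by exact: tf_rcons.
have lp k := tf_L2 (tp k).
have n1 k : n2 nu setT (fun x => g x - phi k x) <= hseq R k ^+ 2 by have [_ [_ _ /ltW]] := P k.
have h2 k : hseq R k ^+ 2 <= hseq R k by rewrite expr2 ler_piMr ?(ltW (h0 k))// hseq_le1.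
have cp : cvg2 nu setT phi g.
  by apply: cvg0_le (@hseq_cvg R) => k; rewrite n2_ge0/= n2BC (le_trans (n1 k)).
have lPj k j := tf_L2Om (tf_partial j (tP k)).
have cG j : cvg2O (fun k => partial j (Phi k)) (G j).
  apply: cvg0_le (@hseq_cvg R) => k; rewrite n2_ge0/= n2BC.
  by have [_ [_ /(_ j)/ltW h _]] := P k; exact: (le_trans h).
pose I k := Re (ip nu setT (fun x => al x * phi k x) (Dt c (hseq R k) (phi k))).
have /choice[s sP] : forall k, exists s, `|s| <= hseq R k /\
    - (K * gn (fun j => partial j (Phi k)) ^+ 2) +
      c * Re (ip nu setT (fun x => al x * phi k x) (dil c s (phi k))) <= I k.
  by move=> k; have [z z1 z2] := boundary_test (tP k) (h0 k); exists z.
pose J k := Re (ip nu setT (fun x => al x * phi k x) (dil c (s k) (phi k))).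
have H k : - (K * gn (fun j => partial j (Phi k)) ^+ 2) + c * J k <= I k by have [] := sP k.
have ss k : `|s k| <= hseq R k by have [] := sP k.
have [s0 s1] := le_hseq_cvg0 ss.
pose Ig k := Re (ip nu setT (fun x => al x * g x) (Dt c (hseq R k) g)).
pose T := Re (ip nu setT (fun x => al x * g x) g).
have cJ : J @ \oo --> T.
  have ca : cvg2 nu setT (fun k x => al x * phi k x) (fun x => al x * g x).
    by apply: (cvg2_bnd (C := A) mT).
  have := cvg2_ip mT (fun k => L2_al (lp k)) (L2_al lg) (fun k => L2_dilc mT sd c (s k) (lp k)) lg ca
    (dcont_dil mT sd c dg lp cp s0 s1).
  by move=> /ccvgP[].
have cI : (fun k => `|Ig k - I k|) @ \oo --> (0 : R).
  have [M MP] := cvg2_bounded mT lp lg cp.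
  apply: (@sqr_hseq_cvg0 _ (expR (`|c| + d%:R) * (A * n2 nu setT g + A * M))) => k.
  rewrite normr_ge0/= /Ig /I -raddfB (le_trans (nc_Re _))//.
  apply: (le_trans (Dt_ip_le mT sd c (h01 k) (L2_al lg) (L2_al (lp k)) lg (lp k))).
  have e1 : n2 nu setT (fun x => al x * g x - al x * phi k x) <= A * hseq R k ^+ 2.
    rewrite (@eq_n2 _ _ _ nu setT _ (fun x => al x * (g x - phi k x))); last by move=> x _; ring.
    by apply: (le_trans (@n2_bnd _ _ _ nu setT mT A _ _ A0 mal (fun x _ => alA x) (L2B mT lg (lp k)))); rewrite ler_wpM2l.
  have e2 : n2 nu setT (fun x => al x * phi k x) <= A * M.
    by apply: (le_trans (@n2_bnd _ _ _ nu setT mT A _ _ A0 mal (fun x _ => alA x) (lp k))); rewrite ler_wpM2l.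
  rewrite (_ : hseq R k * _ = expR (`|c| + d%:R) / hseq R k * (A * hseq R k ^+ 2 * n2 nu setT g + A * M * hseq R k ^+ 2)); last first.
    by field; rewrite gt_eqF.
  rewrite ler_wpM2l ?divr_ge0 ?expR_ge0 ?(ltW (h0 k))//.
  by apply: lerD; [rewrite ler_wpM2r ?n2_ge0|apply: ler_pM; rewrite ?n2_ge0].
exists (fun k => (- (K * gn G ^+ 2) + c * T - (- (K * gn (fun j => partial j (Phi k)) ^+ 2) + c * J k)) + `|Ig k - I k|).
  have c1 := cvg_gn lPj lG cG.
  have c2 : (fun k => - (K * gn (fun j => partial j (Phi k)) ^+ 2) + c * J k) @ \oo --> - (K * gn G ^+ 2) + c * T.
    by apply: cvgD; [apply: cvgN; apply: cvgM => //; exact: cvg_cst|apply: cvgM => //; exact: cvg_cst].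
  have c3 : (fun=> - (K * gn G ^+ 2) + c * T) @ \oo --> (- (K * gn G ^+ 2) + c * T : R) by exact: cvg_cst.
  have := cvgD (cvgB c3 c2) cI.
  by rewrite subrr addr0; exact.
have key (e x y a b : R) : b <= y -> - (x - y) <= e -> a - (a - b + e) <= x by lra.
by move=> k; apply: (key _ _ _ _ _ (H k)); rewrite -normrN ler_norm.
Qed.

End boundary_form.

(** The limit is [int v conj(|x| d_r v)], given a meaning by the two square integrable weighted
    factors. The constant [c] of the generator contributes the real number [c ||v||^2] and drops out
    of the imaginary part. *)
Lemma radial_limit v G g : XS v G g -> (forall j, L2O (fun x => sqr_r x * G j x)) ->
  L2O (fun x => sqr_r x * v x) ->
  (fun k => Im (ipO v (Dt c (hseq R k) v))) @ \oo -->
  Im (\sum_j ipO (fun x => sqr_r x * v x) (fun x => (xh j x)%:C * (sqr_r x * G j x))).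
Proof.
move=> X lrG lrv; have [lv lG lg _] := X; have dv := XS_dcont X.
have h0 k := hseq_gt0 R k; have h01 k := hseq_itv R k.
have /choice[Phi P] : forall k, exists Phi, tf Phi /\
    wdist v G g Phi (fun j => partial j Phi) (fun x => Phi (rV_rcons x 0)) < hseq R k ^+ 2.
  by move=> k; have [Phi ? ?] := weighted_density X lrG (exprn_gt0 2 (h0 k)); exists Phi.
have tP k : tf (Phi k) by have [] := P k.
have lP k := tf_L2Om (tP k).
have lrP k j := tf_weighted j (tP k).
have h2 k : hseq R k ^+ 2 <= hseq R k by rewrite expr2 ler_piMr ?(ltW (h0 k))// hseq_le1.
have wd k : n2O (fun x => v x - Phi k x) <= hseq R k ^+ 2 /\
    forall j, n2O (fun x => sqr_r x * G j x - sqr_r x * partial j (Phi k) x) <= hseq R k ^+ 2.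
  exact: (wdist_n2 (ltW (P k).2)).
have cP : cvg2O Phi v.
  by apply: cvg0_le (@hseq_cvg R) => k; rewrite n2_ge0/= n2BC (le_trans (wd k).1).
pose Z j x := (xh j x)%:C * (sqr_r x * G j x).
pose z k j x := (xh j x)%:C * (sqr_r x * partial j (Phi k) x).
have lz k j : L2O (z k j) by apply: L2_xh; exact: lrP.
have lZ j : L2O (Z j) by apply: L2_xh; exact: lrG.
have nz k j : n2O (fun x => Z j x - z k j x) <= hseq R k ^+ 2.
  rewrite (@eq_n2 _ _ _ mu Om _ (fun x => (xh j x)%:C * (sqr_r x * G j x - sqr_r x * partial j (Phi k) x))).
    by rewrite (le_trans (n2_xh _ (L2B mOm (lrG j) (lrP k j))))// (wd k).2.
  by move=> x _; rewrite /Z /z; ring.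
have cz j : cvg2O (fun k => z k j) (Z j).
  by apply: cvg0_le (@hseq_cvg R) => k; rewrite n2_ge0/= n2BC (le_trans (nz k j)).
have dZ j : dcont Om (Z j).
  apply: (dcont_closed mOm hd (lZ j)) => e e0.
  have [k hk] : exists k, hseq R k < e := cvg0_ex (@hseq_cvg R) e0.
  exists (z k j); first exact: (radial_tf_dcont j (tP k)).
  by rewrite (le_lt_trans (nz k j))// (le_lt_trans (h2 k)).
(* Multiplication by [-i] turns the imaginary part into a real part, to which the mean value theorem
   applies. *)
have lw : L2O (fun x => - 'i * v x) by exact: (L2Z mOm).
have iE (y : V -> R[i]) : L2O y -> Re (ipO (fun x => - 'i * v x) y) = Im (ipO v y).
  move=> ly; rewrite (ipZl mOm _ lv ly); case: (ipO v y) => a b /=; ring.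
have /choice[s sP] : forall k, exists s, `|s| <= hseq R k /\
  Im (ipO v (Dt c (hseq R k) (Phi k))) = Im (ipO v (dil c s (gen c (Phi k)))).
  move=> k; have [s s1 s2] := mvt_Dt mOm hd c (tP k) lw (h0 k); exists s; split => //.
  have l1 := L2_Dt mOm hd c (hseq R k) (lP k).
  have l2 := L2_dilc mOm hd c s (tf_L2Om (tf_gen c (tP k))).
  by rewrite (iE _ l1) (iE _ l2) in s2.
have ss k : `|s k| <= hseq R k by have [] := sP k.
have [s0 s1] := le_hseq_cvg0 ss.
have E k : ipO v (dil c (s k) (gen c (Phi k))) =
  \sum_j ipO (fun x => sqr_r x * v x) (dil (c + 2^-1) (s k) (z k j)) +
  c%:C * ipO v (dil c (s k) (Phi k)).
  rewrite -(euler_dil c (s k) (tP k) lv lrv) -[c%:C]conjR.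
  have le := L2_dilc mOm hd c (s k) (tf_L2Om (tf_euler (tP k))).
  have lp := L2_dilc mOm hd c (s k) (lP k).
  rewrite -(ipZr mOm _ lv lp) -(ipDr mOm le (L2Z mOm _ lp) lv).
  by apply: eq_ip => // x _; rewrite /dil /gen; ring.
have L1 : ccvg (fun k => \sum_j ipO (fun x => sqr_r x * v x) (dil (c + 2^-1) (s k) (z k j)) +
  c%:C * ipO v (dil c (s k) (Phi k))) (\sum_j ipO (fun x => sqr_r x * v x) (Z j) + c%:C * ipO v v).
  apply: ccvgD.
    apply: ccvg_sum => j; apply: (cvg2_ipr mOm) => //; first by move=> k; exact: (L2_dilc mOm hd).
    exact: (dcont_dil mOm hd _ (dZ j) (lz^~ j)).
  apply: ccvgM; first exact: ccvg_cst.
  apply: (cvg2_ipr mOm) => //; first by move=> k; exact: (L2_dilc mOm hd).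
  exact: (dcont_dil mOm hd _ dv lP).
have [_ L2'] := (ccvgP _ _).1 L1.
have im0 : Im (c%:C * ipO v v) = 0.
  by rewrite ip_self; [rewrite -rmorphM|exact: mOm].
rewrite ImD im0 addr0 in L2'.
have L3 : (fun k => `|Im (ipO v (Dt c (hseq R k) v)) - Im (ipO v (Dt c (hseq R k) (Phi k)))|) @ \oo --> (0 : R).
  apply: (@sqr_hseq_cvg0 _ (expR (`|c| + n%:R) * n2O v)) => k.
  rewrite normr_ge0 andTb.
  rewrite -ImB; apply: (le_trans (nc_Im _)).
  apply: (le_trans (Dt_ip_le mOm hd c (h01 k) lv lv lv (lP k))).
  rewrite (_ : n2O (fun x => v x - v x) = 0); last first.
    by rewrite -[RHS](n2_0 mu mOm); apply: eq_n2 => x _; rewrite subrr.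
  rewrite mul0r add0r (_ : hseq R k * _ = expR (`|c| + n%:R) / hseq R k * (n2O v * hseq R k ^+ 2)); last first.
    by field; rewrite gt_eqF.
  rewrite ler_wpM2l ?divr_ge0 ?expR_ge0 ?(ltW (h0 k))// ler_wpM2l ?n2_ge0//.
  exact: (wd k).1.
have L4 : (fun k => `|Im (ipO v (Dt c (hseq R k) (Phi k))) -
    Im (\sum_j ipO (fun x => sqr_r x * v x) (Z j))|) @ \oo --> (0 : R).
  have Ef : (fun k => Im (ipO v (Dt c (hseq R k) (Phi k)))) = (fun k => Im
      (\sum_j ipO (fun x => sqr_r x * v x) (dil (c + 2^-1) (s k) (z k j)) +
       c%:C * ipO v (dil c (s k) (Phi k)))).
    by apply/funext => k; rewrite (sP k).2 E.
  rewrite -Ef in L2'; move/subr_cvg0: L2' => L2'.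
  by have := @cvg_norm _ R^o _ _ _ _ _ L2'; rewrite normr0; exact.
have L5 := cvgD L3 L4; rewrite addr0 in L5.
have L6 : (fun k => Im (ipO v (Dt c (hseq R k) v)) -
    Im (\sum_j ipO (fun x => sqr_r x * v x) (Z j))) @ \oo --> (0 : R).
  apply: cvg0_abs; refine (@cvg0_le _ _ _ _ (L5 _)) => k.
  by rewrite normr_ge0 andTb; exact: ler_distD.
by apply/subr_cvg0; exact: L6.
Qed.

End form_dilation.

Definition rad G (x : V) : R[i] := \sum_j (xh j x)%:C * G j x.

Definition gsize G (x : V) : R := Num.sqrt (\sum_(j < n) nc (G j x) ^+ 2).

Lemma nc_dot_le (a : V) (z : 'I_n -> R[i]) :
  nc (\sum_j (a ord0 j)%:C * z j) <= enorm a * Num.sqrt (\sum_(j < n) nc (z j) ^+ 2).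
Proof.
apply: (le_trans (nc_sum _ _ _)); under eq_bigr do rewrite ncM nc_real.
have s0 : 0 <= \sum_(j < n) nc (z j) ^+ 2 by apply: sumr_ge0 => j _; exact: sqr_ge0.
have t0 : 0 <= \sum_j `|a ord0 j| * nc (z j) by apply: sumr_ge0 => j _; rewrite mulr_ge0 ?nc_ge0.
rewrite -(@ler_pXn2r _ 2) ?nnegrE ?mulr_ge0 ?enorm_ge0 ?sqrtr_ge0// exprMn sqr_enorm sqr_sqrtr//.
apply: (le_trans (sum_CS _ _)); rewrite ler_wpM2r// le_eqVlt; apply/orP; left; apply/eqP.
by apply: eq_bigr => j _; rewrite -normrX ger0_norm ?sqr_ge0// expr2.
Qed.

Lemma nc_euler phi x : nc (euler phi x) <= enorm x * gsize (fun j => partial j phi) x.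
Proof. exact: nc_dot_le. Qed.

Lemma nc_rad G x : nc (rad G x) <= gsize G x.
Proof.
pose a : V := \row_j xh j x.
rewrite /rad (eq_bigr (fun j => (a ord0 j)%:C * G j x)); last by move=> j _; rewrite mxE.
apply: (le_trans (nc_dot_le _ _)); rewrite ler_piMl ?sqrtr_ge0//.
rewrite -[leRHS]sqrtr1 ler_wsqrtr// /dot.
under eq_bigr do rewrite !mxE /xh mulrACA -expr2 -expr2.
rewrite -mulr_suml (_ : \sum_j _ = enorm x ^+ 2); last first.
  by rewrite sqr_enorm; apply: eq_bigr => j _; rewrite expr2.
rewrite -exprMn; have [->|x0] := eqVneq (enorm x) 0; first by rewrite mul0r expr0n.
by rewrite divff// expr1n.
Qed.

Lemma L2_rad G : (forall j, L2O (G j)) -> L2O (rad G).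
Proof. by move=> lG; apply: (L2_sum mOm) => j; exact: L2_xh. Qed.

Lemma n2_rad G : (forall j, L2O (G j)) -> n2O (rad G) <= gn G.
Proof.
move=> lG; apply: (n2_le mOm (L2_grad lG)); first exact: L2_meas (L2_rad lG).
by move=> x _; rewrite nc_real ger0_norm ?sqrtr_ge0// nc_rad.
Qed.

Lemma cvg_gn1 (G_ : nat -> 'I_n -> V -> R[i]) G : (forall k j, L2O (G_ k j)) ->
  (forall j, L2O (G j)) -> (forall j, cvg2O (fun k => G_ k j) (G j)) ->
  (fun k => gn (G_ k)) @ \oo --> gn G.
Proof.
move=> lG_ lG cG; have h := cvg_gn lG_ lG cG.
have E G' : gn G' = Num.sqrt (gn G' ^+ 2) by rewrite sqrtr_sqr ger0_norm ?gn_ge0.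
rewrite E (_ : (fun k => gn (G_ k)) = (fun k => Num.sqrt (gn (G_ k) ^+ 2))); last first.
  by apply/funext => k; exact: E.
apply: (@continuous_cvg _ R^o R^o _ _ (fun k => gn (G_ k) ^+ 2) (@Num.sqrt R) _ _ h).
exact: sqrt_continuous.
Qed.

(** Density: the right side converges along approximants in the form norm, and the left side only
    has to be continuous for the [L^2] convergence of the functions. *)
Lemma XS_bound v G g (K : R) (T : (V -> R[i]) -> R) : XS v G g ->
  (forall phi, tf phi -> T phi <= K * gn (fun j => partial j phi)) ->
  (forall phi : nat -> V -> R[i], (forall k, tf (phi k)) -> cvg2O phi v ->
     (fun k => T (phi k)) @ \oo --> T v) -> T v <= K * gn G.
Proof.
move=> X HT cT; have [lv lG _ _] := X; have [phi [tp c1 c2 _]] := XS_seq X.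
have c3 := cvg_gn1 (fun k j => tf_L2Om (tf_partial j (tp k))) lG c2.
have c4 : (fun k => T (phi k) - K * gn (fun j => partial j (phi k))) @ \oo --> T v - K * gn G.
  apply: cvgB; [exact: cT|apply: cvgM => //; exact: cvg_cst].
by rewrite -subr_le0; apply: (cvg_le_cst c4) => k; rewrite subr_le0 HT.
Qed.

Lemma rdel_dil (e s : R) (x : V) : expR (- `|s|) * rdel e x <= rdel e (expR (- s) *: x).
Proof.
rewrite -(@ler_pXn2r _ 2) ?nnegrE ?mulr_ge0 ?sqrtr_ge0 ?expR_ge0//.
rewrite exprMn !sqr_sqrtr ?addr_ge0 ?dot_ge0 ?sqr_ge0// dotZ mulrDr.
have h1 : expR (- `|s|) ^+ 2 <= expR (- s) ^+ 2.
  by rewrite lerXn2r ?nnegrE ?expR_ge0// ler_expR lerN2 ler_norm.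
have h2 : expR (- `|s|) ^+ 2 <= 1 by rewrite expr_le1 ?expR_ge0// -expR0 ler_expR oppr_le0.
by apply: lerD; [rewrite ler_wpM2r ?dot_ge0|rewrite ler_piMl ?sqr_ge0].
Qed.

(** Returns from a smoothed weight [p] to the true weight [q]; the price [e ||F||] disappears with
    the smoothing parameter. *)
Lemma weight_perturb (p q : V -> R) (e : R) F : 0 <= e -> measurable_fun setT p ->
  (forall x, 0 <= p x <= q x + e) -> (forall x, 0 <= q x) ->
  L2O F -> L2O (fun x => (q x)%:C * F x) ->
  L2O (fun x => (p x)%:C * F x) /\
  n2O (fun x => (p x)%:C * F x) <= n2O (fun x => (q x)%:C * F x) + e * n2O F.
Proof.
move=> e1 mp pq q0 lF lrF.
pose b (x : V) : R[i] := (nc ((q x)%:C * F x))%:C + (e * nc (F x))%:C.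
have lnc f : L2O f -> L2O (fun x => (nc (f x))%:C).
  move=> [mf fi]; split; first by apply: cmeas_real; exact: meas_nc.
  rewrite (_ : (fun x => _) = (fun x => (nc (f x) ^+ 2)%:E))//.
  by apply/funext => x; rewrite nc_real ger0_norm ?nc_ge0.
have l1 := lnc _ lrF.
have l2 : L2O (fun x => (e * nc (F x))%:C).
  have := L2Z mOm e%:C (lnc _ lF); apply: (eq_L2 mOm) => x _; by rewrite -rmorphM.
have lb : L2O b := L2D mOm l1 l2.
have mf : cmeasurable Om (fun x => (p x)%:C * F x).
  by apply: cmeasM; [apply: cmeas_real; exact: measurable_funTS|exact: L2_meas lF].
have le x : Om x -> nc ((p x)%:C * F x) <= nc (b x).
  have /andP[p0 pl] := pq x; move=> _; rewrite /b -rmorphD nc_real ger0_norm; last first.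
    by rewrite addr_ge0 ?nc_ge0// mulr_ge0 ?nc_ge0.
  rewrite !ncM !nc_real !ger0_norm// -mulrDl.
  by rewrite ler_wpM2r ?nc_ge0.
split.
  apply: (@L2_le _ _ _ mu Om mOm _ (fun x => nc (b x) ^+ 2)) => //; last by case: lb.
  by move=> x Ox; rewrite lerXn2r ?nnegrE ?nc_ge0// le.
apply: (le_trans (n2_le mOm lb mf le)); apply: (le_trans (n2D mOm l1 l2)); apply: lerD.
  by rewrite (n2_le mOm lrF)//; [exact: L2_meas l1|move=> x _; rewrite nc_real ger0_norm ?nc_ge0].
rewrite (@eq_n2 _ _ _ mu Om _ (fun x => e%:C * (nc (F x))%:C)); last by move=> x _; rewrite -rmorphM.
rewrite (n2Z mOm _ (lnc _ lF)) nc_real ger0_norm// ler_wpM2l//.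
by rewrite (n2_le mOm lF)//; [exact: L2_meas (lnc _ lF)|move=> x _; rewrite nc_real ger0_norm ?nc_ge0].
Qed.

Lemma measurable_rdel (e : R) : 0 < e -> measurable_fun setT (@rdel R n e).
Proof. by move=> e0; apply: continuous_rV_measurable; have [] := Ck_rdel n 0 e0. Qed.

(** * Hardy inequalities with the weights [|x|^{-1}] and [|x|^{-1/2}] *)

Section inverse_weight.
Variables (e : R).
Hypothesis e0 : 0 < e.
Hypothesis n3 : (3 <= n)%N.

Let w (x : V) : R := (rdel e x)^-1.
Let w0 x : 0 < w x. Proof. by rewrite invr_gt0 rdel_gt0. Qed.
Let wC x : w x <= e^-1.
Proof. by rewrite lef_pV2 ?posrE ?rdel_gt0// e_rdel// ltW. Qed.
Let mw : measurable_fun setT w.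
Proof.
apply: continuous_rV_measurable => x; have [c0 _] := Ck_rdel n 0 e0.
apply: (@continuousV R V (@rdel R n e) x _ (c0 x)).
by have := rdel_gt0 x e0; rewrite lt_neqAle eq_sym => /andP[].
Qed.
Let wg s x : w (expR (- s) *: x) <= expR (1 * `|s|) * w x.
Proof.
rewrite mul1r /w -[expR `|s|]invrK -expRN -invfM lef_pV2 ?posrE ?mulr_gt0 ?expR_gt0 ?rdel_gt0//.
exact: rdel_dil.
Qed.
Let gn2 : 2 * 1 < n%:R :> R. Proof. by rewrite mulr1 ltr_nat. Qed.

Let wn_euler phi : tf phi -> wn w (euler phi) <= gn (fun j => partial j phi).
Proof.
move=> tp; apply: (n2_le mOm).
- by apply: L2_grad => j; apply: tf_L2Om; exact: tf_partial.
- have := wL2 w0 wC mw (tf_L2Om (tf_euler tp)); exact: L2_meas.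
- move=> x _; rewrite ncM !nc_real gtr0_norm ?w0// ger0_norm ?sqrtr_ge0//.
  rewrite mulrC ler_pdivrMr ?rdel_gt0// (le_trans (nc_euler _ _))// mulrC.
  by rewrite ler_wpM2l ?sqrtr_ge0// enorm_rdel.
Qed.

Let nF F : L2O F -> L2O (fun x => (enorm x)%:C * F x) ->
  L2O (fun x => ((w x)^-1)%:C * F x) /\
  n2O (fun x => ((w x)^-1)%:C * F x) <= n2O (fun x => (enorm x)%:C * F x) + e * n2O F.
Proof.
move=> lF lrF; apply: weight_perturb => //; first exact: ltW.
- by rewrite /w; under eq_fun do rewrite invrK; exact: measurable_rdel.
- by move=> x; rewrite /w invrK sqrtr_ge0 rdel_enorm// ltW.
- by move=> x; exact: enorm_ge0.
Qed.

(** The weight [1 / rdel] has [g = 1], so the constant of [hardy] is [2 / (n - 2)]; multiplied by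
    this weight, the Euler operator is bounded by the gradient because [|x| <= rdel]. *)
Lemma hardy_ip_test F phi : L2O F -> L2O (fun x => (enorm x)%:C * F x) -> tf phi ->
  nc (ipO F phi) <= (n2O (fun x => (enorm x)%:C * F x) + e * n2O F) *
    (2 / (n%:R - 2) * gn (fun j => partial j phi)).
Proof.
move=> lF lrF tp; have [l1 l2] := nF lF lrF; have lp := wL2 w0 wC mw (tf_L2Om tp).
have -> : ipO F phi = ipO (fun x => ((w x)^-1)%:C * F x) (fun x => (w x)%:C * phi x).
  apply: eq_cintegral => x _; rewrite [in RHS]rmorphM/= conjR mulrACA -rmorphM/= mulVf ?mul1r//.
  by rewrite gt_eqF.
apply: (le_trans (CS mOm l1 lp)); apply: ler_pM; rewrite ?n2_ge0//.
apply: (le_trans (hardy w0 wC mw gn2 wg tp)); rewrite mulr1 ler_wpM2l ?wn_euler//.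
by rewrite divr_ge0// subr_ge0 ler_nat ltnW.
Qed.

Lemma dual_dilation_test F c t phi : tf phi -> 0 <= c -> 0 < t <= 1 -> L2O F ->
  L2O (fun x => (enorm x)%:C * F x) ->
  `|Re (ipO F (Dt c t phi))| <= (n2O (fun x => (enorm x)%:C * F x) + e * n2O F) *
    (Kd d 1 c * gn (fun j => partial j phi)).
Proof.
move=> tp c0 t01 lF lrF; have [l1 l2] := nF lF lrF; have /andP[t0 _] := t01.
have := dual_dilation w0 wC mw ler01 gn2 wg tp c0 t01 lF l1.
rewrite (ip_Dt mOm hd _ _ lF (tf_L2Om tp)).
rewrite ReRM ReB normrM gtr0_norm ?invr_gt0 ?mulr_gt0// => H.
rewrite mulrC ler_pdivrMr ?mulr_gt0//; apply: (le_trans H).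
rewrite mulrC ler_wpM2r ?mulr_ge0 ?(ltW t0)//.
apply: ler_pM; rewrite ?n2_ge0//; first by rewrite mulr_ge0 ?n2_ge0// Kd_ge0.
by rewrite ler_wpM2l ?wn_euler// Kd_ge0.
Qed.

End inverse_weight.

Section sqrt_weight.
Variables (e : R).
Hypothesis e0 : 0 < e.
Hypothesis n3 : (3 <= n)%N.

Let sr0 (x : V) : 0 < Num.sqrt (rdel e x) :> R. Proof. by rewrite sqrtr_gt0 rdel_gt0. Qed.
Let ms : measurable_fun setT (fun x : V => Num.sqrt (rdel e x)).
Proof.
apply: continuous_rV_measurable => x; have [c0 _] := Ck_rdel n 0 e0.
by apply: (continuous_comp (c0 x)); exact: sqrt_continuous.
Qed.

Let w (x : V) : R := (Num.sqrt (rdel e x))^-1.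
Let w0 x : 0 < w x. Proof. by rewrite invr_gt0. Qed.
Let wC x : w x <= (Num.sqrt e)^-1.
Proof.
have h : Num.sqrt e <= Num.sqrt (rdel e x) by apply: ler_wsqrtr; rewrite e_rdel// ltW.
by rewrite /w lef_pV2 ?posrE ?sr0 ?sqrtr_gt0.
Qed.
Let mw : measurable_fun setT w.
Proof.
apply: continuous_rV_measurable => x; have [c0 _] := Ck_rdel n 0 e0.
apply: (@continuousV R V (fun x : V => Num.sqrt (rdel e x)) x).
  by have := sr0 x; rewrite lt_neqAle eq_sym => /andP[].
by apply: (continuous_comp (c0 x)); exact: sqrt_continuous.
Qed.
Let wg s x : w (expR (- s) *: x) <= expR (2^-1 * `|s|) * w x.
Proof.
rewrite /w -[expR (2^-1 * _)]invrK -expRN -invfM lef_pV2 ?posrE ?mulr_gt0 ?expR_gt0//.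
apply: le_trans (ler_wsqrtr (rdel_dil e s x)).
rewrite sqrtrM ?expR_ge0// ler_wpM2r ?sqrtr_ge0//.
rewrite -[leLHS]ger0_norm ?expR_ge0// -sqrtr_sqr ler_wsqrtr// -expRM_natl.
by rewrite mulrN mulrA mulfV// mul1r.
Qed.
Let n31 : 2 <= n%:R - 1 :> R.
Proof. by have := n3; rewrite -(ler_nat R); move: (n%:R : R) => m; lra. Qed.

Let gn2 : 2 * 2^-1 < n%:R :> R. Proof. by rewrite mulfV// ltr1n ltnW. Qed.

Let wn_euler phi : tf phi -> wn w (euler phi) <= gn (fun j x => sqr_r x * partial j phi x).
Proof.
move=> tp; apply: (n2_le mOm).
- by apply: L2_grad => j; exact: tf_weighted.
- have := wL2 w0 wC mw (tf_L2Om (tf_euler tp)); exact: L2_meas.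
- move=> x _; rewrite ncM !nc_real gtr0_norm ?w0// ger0_norm ?sqrtr_ge0//.
  rewrite mulrC ler_pdivrMr//; apply: (le_trans (nc_euler _ _)).
  have -> : Num.sqrt (\sum_(j < n) nc (sqr_r x * partial j phi x) ^+ 2) =
      Num.sqrt (enorm x) * gsize (fun j => partial j phi) x.
    rewrite /gsize -sqrtrM ?enorm_ge0//; congr Num.sqrt; rewrite mulr_sumr; apply: eq_bigr => j _.
    by rewrite ncM nc_real exprMn ger0_norm ?sqrtr_ge0// sqr_sqrtr ?enorm_ge0.
  rewrite mulrAC ler_wpM2r ?sqrtr_ge0// -[leLHS]sqr_sqrtr ?enorm_ge0// expr2.
  by rewrite ler_wpM2l ?sqrtr_ge0// ler_wsqrtr// enorm_rdel.
Qed.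

(** For the weight [rdel^{-1/2}] one has [g = 1/2], and the constant [2 / (n - 1)] of [hardy] is at
    most 1 since [n >= 3]. The factors [rdel^{1/2}] and [rdel^{-1/2}] go to the radial derivative
    and to [v]. *)
Lemma hardy_sqrt v G g : XS v G g -> (forall j, L2O (fun x => sqr_r x * G j x)) ->
  nc (ipO (rad G) v) <=
  (gn (fun j x => sqr_r x * G j x) + Num.sqrt e * gn G) * gn (fun j x => sqr_r x * G j x).
Proof.
move=> X lrG; have [lv lG lg _] := X; have lR := L2_rad lG.
have E x : sqr_r x * rad G x = rad (fun j x => sqr_r x * G j x) x.
  by rewrite /rad mulr_sumr; apply: eq_bigr => j _; ring.
have lsR : L2O (fun x => sqr_r x * rad G x).
  by have := L2_rad lrG; apply: (eq_L2 mOm) => x _; rewrite E.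
have [l1 l2] : L2O (fun x => (Num.sqrt (rdel e x))%:C * rad G x) /\
    n2O (fun x => (Num.sqrt (rdel e x))%:C * rad G x) <=
    n2O (fun x => sqr_r x * rad G x) + Num.sqrt e * n2O (rad G).
  apply: weight_perturb => //.
  move=> x; rewrite sqrtr_ge0/= -(@ler_pXn2r _ 2) ?nnegrE ?addr_ge0 ?sqrtr_ge0//.
  have s1 : 0 <= Num.sqrt (enorm x) * Num.sqrt e by rewrite mulr_ge0 ?sqrtr_ge0.
  rewrite sqrrD !sqr_sqrtr ?enorm_ge0 ?sqrtr_ge0 ?(ltW e0)//.
  by rewrite (le_trans (rdel_enorm x (ltW e0)))// mulr2n lerD2r lerDl addr_ge0.
have lw := wL2 w0 wC mw lv.
have nw : n2O (fun x => (w x)%:C * v x) <= gn (fun j x => sqr_r x * G j x).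
  have /choice[phi P] : forall k, exists phi, tf phi /\
      wdist v G g phi (fun j => partial j phi) (fun x => phi (rV_rcons x 0)) < hseq R k.
    by move=> k; have [phi ? ?] := weighted_density X lrG (hseq_gt0 R k); exists phi.
  have tp k : tf (phi k) by have [] := P k.
  have [c1 c2] : cvg2O phi v /\ forall j,
      cvg2O (fun k x => sqr_r x * partial j (phi k) x) (fun x => sqr_r x * G j x).
    have H k : n2O (fun x => v x - phi k x) <= hseq R k /\
        forall j, n2O (fun x => sqr_r x * G j x - sqr_r x * partial j (phi k) x) <= hseq R k.
      exact: (wdist_n2 (ltW (P k).2)).
    split=> [|j]; apply: cvg0_le (@hseq_cvg R) => k; rewrite n2_ge0/= n2BC; first exact: (H k).1.
    exact: (H k).2.
  have c3 := cvg_gn1 (fun k j => tf_weighted j (tp k)) lrG c2.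
  have mw' : cmeasurable Om (fun x => (w x)%:C) by apply: cmeas_real; exact: measurable_funTS.
  have wb x : Om x -> nc (w x)%:C <= (Num.sqrt e)^-1 by move=> _; rewrite nc_real gtr0_norm// wC.
  have c4 := cvg2_n2 mOm (fun k => wL2 w0 wC mw (tf_L2Om (tp k))) lw
    (cvg2_bnd mOm mw' wb (fun k => tf_L2Om (tp k)) lv c1).
  rewrite -subr_le0; apply: (cvg_le_cst (cvgB c4 c3)) => k; rewrite subr_le0.
  apply: (le_trans (hardy w0 wC mw gn2 wg (tp k))).
  apply: (@le_trans _ _ (1 * wn w (euler (phi k)))); last by rewrite mul1r wn_euler.
  rewrite ler_wpM2r ?n2_ge0// mulfV// ler_pdivrMr ?mul1r; last by rewrite subr_gt0 ltr1n ltnW.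
  exact: n31.
have -> : ipO (rad G) v = ipO (fun x => (Num.sqrt (rdel e x))%:C * rad G x) (fun x => (w x)%:C * v x).
  apply: eq_cintegral => x _; rewrite [in RHS]rmorphM/= conjR mulrACA -rmorphM/= mulfV ?mul1r//.
  by rewrite gt_eqF.
apply: (le_trans (CS mOm l1 lw)); apply: ler_pM; rewrite ?n2_ge0//.
refine (le_trans l2 (lerD _ (ler_wpM2l (sqrtr_ge0 _) (n2_rad lG)))).
rewrite (@eq_n2 _ _ _ mu Om _ (rad (fun j x => sqr_r x * G j x))); last by move=> x _; exact: E.
exact: n2_rad.
Qed.

End sqrt_weight.

(** [hardy_sqrt] with the smoothing parameter tending to 0. Hence [int |x| |grad v|^2 + Re int
    conj(v) d_r v >= 0], the positivity behind the third identity. *)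
Lemma radial_hardy v G g : (3 <= n)%N -> XS v G g -> (forall j, L2O (fun x => sqr_r x * G j x)) ->
  nc (ipO (rad G) v) <= gn (fun j x => sqr_r x * G j x) ^+ 2.
Proof.
move=> n3 X lrG; apply: (@ler_addeps _ _ _ (gn G * gn (fun j x => sqr_r x * G j x))) => e e0.
have := hardy_sqrt (exprn_gt0 2 e0) n3 X lrG.
have -> : Num.sqrt (e ^+ 2) = e by rewrite sqrtr_sqr gtr0_norm.
by move: (gn _) (gn G) => Y a; rewrite mulrDl -expr2 mulrA.
Qed.

Let dist_eq (N e f k a : R) : k * N * a + e * (f * (k * a)) = (N + e * f) * (k * a).
Proof. by ring. Qed.

Lemma hardy_ip v G g F : (3 <= n)%N -> XS v G g -> L2O F -> L2O (fun x => (enorm x)%:C * F x) ->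
  nc (ipO F v) <= 2 / (n%:R - 2) * n2O (fun x => (enorm x)%:C * F x) * gn G.
Proof.
move=> n3 X lF lrF; have [lv _ _ _] := X.
apply: (XS_bound (T := fun h => nc (ipO F h)) X).
  move=> phi tp; apply: (@ler_addeps _ _ _ (n2O F * (2 / (n%:R - 2) * gn (fun j => partial j phi)))) => e e0.
  by apply: (le_trans (hardy_ip_test e0 n3 lF lrF tp)); rewrite dist_eq.
move=> phi tp cp; apply: ccvg_nc; apply: (cvg2_ipr mOm) => // k; exact: tf_L2Om.
Qed.

(** The bound is independent of [t]: the right-hand side of the second identity is estimated before
    the limit is taken. *)
Lemma dual_dilation_XS v G g F c t : (3 <= n)%N -> XS v G g -> 0 <= c -> 0 < t <= 1 -> L2O F ->
  L2O (fun x => (enorm x)%:C * F x) ->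
  `|Re (ipO F (Dt c t v))| <= Kd d 1 c * n2O (fun x => (enorm x)%:C * F x) * gn G.
Proof.
move=> n3 X c0 t01 lF lrF; have [lv _ _ _] := X.
apply: (XS_bound (T := fun h => `|Re (ipO F (Dt c t h))|) X).
  move=> phi tp; apply: (@ler_addeps _ _ _ (n2O F * (Kd d 1 c * gn (fun j => partial j phi)))) => e e0.
  by apply: (le_trans (dual_dilation_test e0 n3 tp c0 t01 lF lrF)); rewrite dist_eq.
move=> phi tp cp; apply: (@cvg_norm _ R^o).
have /ccvgP[+ _] : ccvg (fun k => ipO F (Dt c t (phi k))) (ipO F (Dt c t v)) => //.
have lp k := tf_L2Om (tp k).
have nt : `|t| <= 1 by have /andP[t0 t1] := t01; rewrite gtr0_norm.
apply: (@ccvg_squeeze _ _ _ (fun k => expR (`|c| + n%:R) / t * (n2O F * n2O (fun x => phi k x - v x)))).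
  move=> k; have := Dt_ip_le mOm hd c t01 lF lF (lp k) lv.
  rewrite (_ : n2O (fun x => F x - F x) = 0); last first.
    by rewrite -[RHS](n2_0 mu mOm); apply: eq_n2 => x _; rewrite subrr.
  by rewrite mul0r add0r.
have l1 : (fun k => n2O F * n2O (fun x => phi k x - v x)) @ \oo --> (n2O F * 0 : R).
  by apply: cvgM => //; exact: cvg_cst.
have c1 : (fun=> expR (`|c| + n%:R) / t) @ \oo --> (expR (`|c| + n%:R) / t : R) by exact: cvg_cst.
by have := cvgM c1 l1; rewrite !mulr0; exact.
Qed.

Lemma XS_Dt c t (v : V -> R[i]) G (g : W -> R[i]) : XS v G g ->
  XS (Dt c t v) (fun j => Dt (c + 1) t (G j)) (Dt c t g).
Proof.
move=> X; have := XS_Z ((2 * t)^-1)%:C (XS_D (XS_dil c t X) (XS_Z (-1) (XS_dil c (- t) X))).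
have E k (b : R) (f : 'rV[R]_k -> R[i]) :
    (fun x => ((2 * t)^-1)%:C * (dil b t f x + -1 * dil b (- t) f x)) = Dt b t f.
  by apply/funext => x; rewrite mulN1r.
rewrite !E (_ : (fun j x => _) = (fun j => Dt (c + 1) t (G j)))//.
by apply/funext => j; rewrite -E.
Qed.

Lemma rad_Dt c t (G : 'I_n -> V -> R[i]) x : rad (fun j => Dt c t (G j)) x = Dt c t (rad G) x.
Proof.
rewrite /rad /Dt /dil !mulr_sumr -sumrB mulr_sumr; apply: eq_bigr => j _.
by rewrite !xh_dil ?expR_gt0//; ring.
Qed.

Lemma L2_fatou (f_ : nat -> V -> R[i]) f (C : R) : (forall k, L2O (f_ k)) -> cmeasurable Om f ->
  (forall x, Om x -> (fun k => nc (f_ k x) ^+ 2) @ \oo --> nc (f x) ^+ 2) ->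
  (forall k, n2O (f_ k) ^+ 2 <= C) -> L2O f.
Proof.
move=> lf mf ff fC; split => //.
have [] // := @fatou_le _ _ _ mu Om mOm (fun k x => nc (f_ k x) ^+ 2) (fun x => nc (f x) ^+ 2) C.
- by move=> k x _; exact: sqr_ge0.
- by move=> k; apply: meas_nc2; exact: L2_meas (lf k).
- move=> k; have [_ fi] := lf k.
  by rewrite -(fineK (integrable_fin_num mOm fi)) lee_fin; have := fC k; rewrite sqr_n2.
Qed.

Section boundary_sign.
Variables (al : W -> R[i]) (A b : R).
Hypothesis mal : cmeasurable setT al.
Hypothesis alA : forall x, nc (al x) <= A.
Hypothesis alR : forall x, `|Im (al x)| <= Re (al x).
Hypothesis alx : forall x, enorm x * nc (al x) <= b.

(** The sum is the real part of [(1 - i s)] times the pairing, and [Re ((1 - i s) al) >= 0]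
    pointwise because [|Im al| <= Re al] and [|s| <= 1]. *)
Lemma boundary_sign (g : W -> R[i]) (p : W -> R) (s : R) : `|s| <= 1 -> (forall x, 0 <= p x) ->
  L2 nu setT g -> L2 nu setT (fun x => (p x)%:C * g x) ->
  0 <= Re (ip nu setT (fun x => al x * g x) (fun x => (p x)%:C * g x)) +
    s * Im (ip nu setT (fun x => al x * g x) (fun x => (p x)%:C * g x)).
Proof.
move=> s1 p0 lg lpg; have lag := L2_al mal alA lg; set B := ip _ _ _ _.
have -> : Re B + s * Im B = Re ((1 +i* - s) * B).
  by rewrite [RHS]ReM /= mul1r mulNr opprK.
rewrite /B -(ipZl mT _ lag lpg) /ip /cintegral/=; apply: Rintegral_ge0 => x _.
have -> : (1 +i* - s) * (al x * g x) * ((p x)%:C * g x)^* =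
    (p x * nc (g x) ^+ 2)%:C * ((1 +i* - s) * al x).
  have e : (p x * nc (g x) ^+ 2)%:C = (p x)%:C * (g x * (g x)^*).
    by rewrite mulconj; exact: (rmorphM (real_complex R)).
  by rewrite e [in LHS]rmorphM/= conjR; ring.
rewrite ReRM; apply: mulr_ge0; first by rewrite mulr_ge0 ?sqr_ge0.
rewrite ReM /= mul1r mulNr opprK.
have h := alR x; have : `|s * Im (al x)| <= Re (al x).
  by rewrite normrM (le_trans _ h)// ler_piMl.
by rewrite ler_norml => /andP[h1 _]; rewrite -lerBlDl sub0r.
Qed.

Lemma boundary_weight (g : W -> R[i]) (p : W -> R) : measurable_fun setT p ->
  (forall x, 0 <= p x <= enorm x) ->
  L2 nu setT g -> L2 nu setT (fun x => (p x)%:C * g x) ->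
  nc (ip nu setT (fun x => al x * g x) (fun x => (p x)%:C * g x)) <= b * n2 nu setT g ^+ 2.
Proof.
move=> mp pr lg lpg; have b0 : 0 <= b by rewrite (le_trans _ (alx 0))// mulr_ge0 ?enorm_ge0 ?nc_ge0.
have mq : cmeasurable setT (fun x => (p x)%:C * al x) by apply: cmeasM => //; exact: cmeas_real.
have qb x : setT x -> nc ((p x)%:C * al x) <= b.
  move=> _; have /andP[p0 p1] := pr x; rewrite ncM nc_real ger0_norm//.
  by rewrite (le_trans _ (alx x))// ler_wpM2r ?nc_ge0.
have -> : ip nu setT (fun x => al x * g x) (fun x => (p x)%:C * g x) =
    ip nu setT (fun x => (p x)%:C * al x * g x) g.
  by apply: eq_cintegral => x _; rewrite [in LHS]rmorphM/= conjR; ring.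
apply: (le_trans (CS mT (L2_bnd mT mq qb lg) lg)).
by rewrite expr2 mulrA ler_wpM2r ?n2_ge0// n2_bnd.
Qed.

End boundary_sign.

(** A square root of the bounded weight, so that [ip_rho] can share the weight between the two
    factors. *)
Definition qw (eta : R) (x : V) : R[i] := (Num.sqrt (rho eta (enorm x)))%:C.

Lemma measurable_rho k (eta : R) : measurable_fun setT (fun x : 'rV[R]_k => rho eta (enorm x)).
Proof.
apply: measurable_funM; first exact: measurable_enorm.
apply: (measurableT_comp (measurable_expR (R := R))).
by apply: measurable_funM => //; exact: measurable_enorm.
Qed.

Lemma measurable_rho' k (eta : R) : measurable_fun setT (fun x : 'rV[R]_k => rho' eta (enorm x)).
Proof.
apply: measurable_funM.
  by apply: measurable_funB => //; apply: measurable_funM => //; exact: measurable_enorm.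
apply: (measurableT_comp (measurable_expR (R := R))).
by apply: measurable_funM => //; exact: measurable_enorm.
Qed.

Lemma meas_qw eta : cmeasurable setT (qw eta).
Proof.
apply: cmeas_real; apply: (measurableT_comp (continuous_measurable_fun (@sqrt_continuous R))).
exact: measurable_rho.
Qed.

Lemma nc_qw eta x : 0 <= eta -> nc (qw eta x) <= nc (sqr_r x).
Proof.
move=> e0; rewrite !nc_real !ger0_norm ?sqrtr_ge0// ler_wsqrtr// rho_le//.
exact: enorm_ge0.
Qed.

Lemma L2_qw eta h : 0 < eta -> L2O h -> L2O (fun x => qw eta x * h x).
Proof.
move=> e0; apply: (@L2_bnd _ _ _ mu Om mOm (Num.sqrt eta^-1)); first by apply: cmeas_sub; exact: meas_qw.
move=> x _; rewrite nc_real ger0_norm ?sqrtr_ge0// ler_wsqrtr// rho_bnd//.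
exact: enorm_ge0.
Qed.

Lemma qw_mul eta x : qw eta x * qw eta x = (rho eta (enorm x))%:C.
Proof.
by rewrite /qw -(rmorphM (real_complex R)) -expr2 sqr_sqrtr// rho_ge0// enorm_ge0.
Qed.

Lemma conj_qw eta x : (qw eta x)^* = qw eta x. Proof. exact: conjR. Qed.

Lemma ip_rho eta f h : ipO f (fun x => (rho eta (enorm x))%:C * h x) =
  ipO (fun x => qw eta x * f x) (fun x => qw eta x * h x).
Proof.
apply: eq_cintegral => x _; rewrite -qw_mul -mulrA !(rmorphM Num.conj) /=.
by rewrite [_^*]conj_qw; ring.
Qed.

Lemma L2_rho' eta h : 0 < eta -> L2O h -> L2O (fun x => (rho' eta (enorm x))%:C * h x).
Proof.
move=> e0; apply: (@L2_bnd _ _ _ mu Om mOm 1).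
  by apply: cmeas_real; apply: measurable_funTS; exact: measurable_rho'.
by move=> x _; rewrite nc_real rho'_bnd ?enorm_ge0// ltW.
Qed.

Lemma n2_rho' eta h : 0 < eta -> L2O h -> n2O (fun x => (rho' eta (enorm x))%:C * h x) <= n2O h.
Proof.
move=> e0 lh; rewrite -[leRHS]mul1r; apply: (n2_bnd mOm) => //.
  by apply: cmeas_real; apply: measurable_funTS; exact: measurable_rho'.
by move=> x _; rewrite nc_real rho'_bnd ?enorm_ge0// ltW.
Qed.

Lemma eta_cvg (s : R) : (fun k => expR (- hseq R k * s)) @ \oo --> (1 : R).
Proof.
have h : (fun k => - hseq R k * s) @ \oo --> (0 : R).
  rewrite -[X in _ --> X](mul0r s) -[X in X * _]oppr0; apply: cvgM; last exact: cvg_cst.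
  by apply: cvgN; exact: hseq_cvg.
rewrite -expR0; apply: (@continuous_cvg _ R^o R^o _ _ (fun k => - hseq R k * s) expR 0 _ h).
exact: continuous_expR.
Qed.

Lemma rho_cvg (s : R) : (fun k => rho (hseq R k) s) @ \oo --> s.
Proof.
by rewrite -[X in _ --> X]mulr1; apply: cvgM; [exact: cvg_cst|exact: eta_cvg].
Qed.

Lemma rho'_cvg (s : R) : (fun k => rho' (hseq R k) s) @ \oo --> (1 : R).
Proof.
have h : (fun k => 1 - hseq R k * s) @ \oo --> (1 - 0 * s : R).
  apply: cvgB; first exact: cvg_cst.
  by apply: cvgM; [exact: hseq_cvg|exact: cvg_cst].
by have := cvgM h (eta_cvg s); rewrite mul0r subr0 mulr1; exact.
Qed.

Lemma qw_cvg x : ccvg (fun k => qw (hseq R k) x) (sqr_r x).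
Proof.
have h : (fun k => Num.sqrt (rho (hseq R k) (enorm x))) @ \oo --> Num.sqrt (enorm x).
  apply: (@cvg_comp _ _ _ (fun k => rho (hseq R k) (enorm x)) (@Num.sqrt R)); first exact: rho_cvg.
  exact: sqrt_continuous.
exact: ccvg_real h.
Qed.

Lemma qw_cvg2 h : L2O h -> L2O (fun x => sqr_r x * h x) ->
  cvg2O (fun k x => qw (hseq R k) x * h x) (fun x => sqr_r x * h x).
Proof.
move=> lh lrh; apply: (@cvg2_dominated _ _ _ mu Om mOm _ _ (fun x => nc (sqr_r x * h x))).
- by move=> k; exact: L2_meas (L2_qw (hseq_gt0 R k) lh).
- exact: L2_meas lrh.
- by move=> x _; apply: ccvgM; [exact: qw_cvg|exact: ccvg_cst].
- by case: lrh.
- by move=> k x _; rewrite !ncM ler_wpM2r ?nc_ge0// nc_qw// ltW// hseq_gt0.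
Qed.

Lemma rho'_cvg2 h : L2O h ->
  cvg2O (fun k x => (rho' (hseq R k) (enorm x))%:C * h x) h.
Proof.
move=> lh; apply: (@cvg2_dominated _ _ _ mu Om mOm _ _ (fun x => nc (h x))).
- by move=> k; exact: L2_meas (L2_rho' (hseq_gt0 R k) lh).
- exact: L2_meas lh.
- move=> x _; rewrite -[X in ccvg _ X]mul1r; apply: ccvgM; last exact: ccvg_cst.
  by apply: ccvg_real; exact: rho'_cvg.
- by case: lh.
- move=> k x _; rewrite ncM nc_real ler_piMl ?nc_ge0//.
  by rewrite rho'_bnd ?enorm_ge0// ltW// hseq_gt0.
Qed.

Lemma sum_sqr_xh (x : V) : Om x -> \sum_j xh j x ^+ 2 = 1.
Proof.
move=> Ox; have r0 := half_space_enorm Ox; rewrite /xh.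
under eq_bigr do rewrite exprMn; rewrite -mulr_suml (_ : \sum_j _ = enorm x ^+ 2).
  by rewrite -exprMn divff ?expr1n// gt_eqF.
by rewrite sqr_enorm; apply: eq_bigr => j _; rewrite expr2.
Qed.

(** Here [a = ||grad v||], [N = ||r F||], [w = ||v||], [l = |Im lambda|], [k = sqrt(Re lambda)].
    With [y = l w / k] the mixed term is [N y / 2 <= N^2/4 + y^2/4], and [y^2 <= l w^2] since
    [l <= k^2]. The last hypothesis bounds this by [P + CH N a], a quarter of which is absorbed by
    [P / 2]. *)
Lemma estimate_arith (a N P w l k del C CH : R) : 0 <= a -> 0 <= N -> 0 <= P -> 0 <= l -> 0 < k ->
  0 < del -> 0 <= C -> 0 <= CH -> l <= k ^+ 2 ->
  del * a ^+ 2 + P / 2 <= C * N * a + l / (2 * k) * (N * w) -> l * w ^+ 2 <= P + CH * N * a ->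
  a <= ((C + CH / 4 + 1) / del + 1) * N.
Proof.
move=> a0 N0 P0 l0 k0 d0 C0 CH0 lk H1 H2.
pose y := l * w / k.
have y1 : y ^+ 2 <= l * w ^+ 2.
  rewrite /y exprMn exprVn ler_pdivrMr ?exprn_gt0// exprMn expr2 [leRHS]mulrAC.
  by rewrite ler_wpM2r ?sqr_ge0// ler_wpM2l.
have e : l / (2 * k) * (N * w) = N * y / 2 by rewrite /y; field; rewrite gt_eqF.
rewrite e in H1; clearbody y; clear e lk k0.
have y2 : N * y / 2 <= N ^+ 2 / 4 + y ^+ 2 / 4 by have := sqr_ge0 (N - y); nra.
set C' := C + CH / 4 + 1.
have H3 : del * a ^+ 2 <= (C' - 1) * (N * a) + N ^+ 2 / 4 by rewrite /C'; lra.
have C'1 : 1 <= C' by rewrite /C'; lra.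
(* If [a] exceeded the bound, then [N <= a], hence [N^2 <= N a], and the quadratic inequality [H3]
   would fail. *)
rewrite leNgt; apply/negP => h.
have h1 : (C' + del) * N < del * a.
  rewrite -ltr_pdivrMl// (_ : del^-1 * ((C' + del) * N) = (C' / del + 1) * N)//.
  by field; rewrite gt_eqF.
have a1 : 0 < a by apply: le_lt_trans h; rewrite mulr_ge0// addr_ge0// divr_ge0// ltW// (lt_le_trans ltr01).
have Na : N <= a.
  rewrite (le_trans _ (ltW h))// ler_peMl// lerDr divr_ge0// ltW// (lt_le_trans ltr01)//.
have h2 : (C' + del) * N * a < del * a ^+ 2 by rewrite expr2 mulrA ltr_pM2r.
have h3 : 0 <= N * a by rewrite mulr_ge0.
have h4 : N ^+ 2 <= N * a by rewrite expr2 ler_wpM2l.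
have h5 : 0 <= del * (N * a) by rewrite mulr_ge0// ltW.
by move: h2; rewrite -mulrA mulrDl; lra.
Qed.

(** Half of the energy identity is added to the virial inequality: the terms [k * s] cancel and [rw]
    survives with the favourable coefficient 1/2. *)
Lemma arith_key (a2 N a p CH Kc k s q f cp K rw i : R) :
  - (K * a2) + cp - k * s + rw + i <= Kc * N * a -> a2 + 2 * k * s + p - rw = f ->
  f <= CH * N * a -> 0 <= cp -> 0 <= rw -> - q <= i ->
  (2^-1 - K) * a2 + p / 2 <= (2^-1 * CH + Kc) * N * a + q.
Proof.
rewrite -!mulrA; move: (N * a) (k * s) => x y h1 h2 h3 h4 h5 h6.
rewrite !mulrDl -mulrA mulNr; move: (K * a2) (Kc * x) (CH * x) h1 h2 h3 => u1 u2 u3 h1 h2 h3.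
lra.
Qed.

(** * The three multiplier identities and the estimate of the twisted solution *)

Section twisted.
Variables (al : W -> R[i]) (A K kap b c : R) (m : R[i]).
Hypothesis n3 : (3 <= n)%N.
Hypothesis mal : cmeasurable setT al.
Hypothesis alA : forall x, nc (al x) <= A.
Hypothesis alR : forall x, `|Im (al x)| <= Re (al x).
Hypothesis alx : forall x, enorm x * nc (al x) <= b.
Hypothesis K2 : K < 2^-1.
Hypothesis cn : 2 * (c + 1) = n%:R.
Hypothesis HK : boundary_bound al K.
Variables (v F : V -> R[i]) (G : 'I_n -> V -> R[i]) (g : W -> R[i]).
Hypothesis X : XS v G g.
Hypothesis lF : L2O F.
Hypothesis lrF : L2O (fun x => (enorm x)%:C * F x).
Hypothesis E : forall psi Gpsi gpsi, XS psi Gpsi gpsi ->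
  \sum_j ipO (G j) (Gpsi j) +
  (0 +i* kap) * (ipO v (rad Gpsi) - ipO (rad G) psi) +
  ip nu setT (fun x => al x * g x) gpsi - m * ipO v psi = ipO F psi.

Let lv : L2O v. Proof. by case: X. Qed.
Let lG j : L2O (G j). Proof. by case: X. Qed.
Let lg : L2 nu setT g. Proof. by case: X. Qed.
Let lR : L2O (rad G). Proof. exact: L2_rad. Qed.
Let lag : L2 nu setT (fun x => al x * g x). Proof. exact: (L2_al mal alA). Qed.

Let S := ipO (rad G) v.
Let P := ip nu setT (fun x => al x * g x) g.
Let N := n2O (fun x => (enorm x)%:C * F x).

(** The equation tested with [v]. The first order terms combine to [conj(S) - S = -2 i Im S], which
    becomes real after multiplication by [i kap], so that [kap] is absent from the imaginary
    part. *)
Lemma energy_identity :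
  gn G ^+ 2 + 2 * kap * Im S + Re P - Re m * n2O v ^+ 2 =
    Re (ipO F v) /\
  Im P - Im m * n2O v ^+ 2 = Im (ipO F v).
Proof.
have := E X; rewrite (ipC mOm lv lR) -/S -/P ip_self; last exact: mOm.
rewrite (eq_bigr (fun j => (n2O (G j) ^+ 2)%:C)); last by move=> j _; rewrite ip_self//; exact: mOm.
rewrite -(rmorph_sum (real_complex R)) -(sqr_gn lG).
move: (S) (P) (n2O v ^+ 2) (gn G ^+ 2) (ipO F v) => z p y a f <-; split.
- rewrite ReB !ReD ReIM ImB Im_conj ReM (_ : Im y%:C = 0)// (_ : Re y%:C = y)//.
  by rewrite (_ : Re a%:C = a)//; ring.
- rewrite ImB !ImD ImIM ReB Re_conj ImM (_ : Im y%:C = 0)// (_ : Re y%:C = y)//.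
  by rewrite (_ : Im a%:C = 0)//; ring.
Qed.

(** The equation tested with [Dt c (hseq R k) v]: the first order term tends to [-kap Im S], the
    [Re m] term to [Re m ||v||^2]. The limit [L] of the [Im m] term is a parameter, as it exists for
    different reasons in the two cases of [twisted_estimate]. *)
Lemma virial (L : R) :
  (fun k => Im m * Im (ipO v (Dt c (hseq R k) v))) @ \oo --> L ->
  - (K * gn G ^+ 2) + c * Re P - kap * Im S + Re m * n2O v ^+ 2 + L <=
  Kd d 1 c * N * gn G.
Proof.
move=> HL; have c0 : 0 <= c.
  have : (3 : R) <= n%:R by rewrite ler_nat.
  by rewrite -cn; lra.
have [e e0 He] := boundary_dilation mal alA cn HK X.
have dv := XS_dcont X.
pose s t := ipO (rad G) (dil c t v); pose q t := ipO v (dil c t v).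
have h0 k := hseq_gt0 R k; have h01 k := hseq_itv R k.
have hc := @hseq_cvg R; have h1 k : `|hseq R k| <= 1 by rewrite gtr0_norm// hseq_le1.
have nhc : (fun k => - hseq R k) @ \oo --> (0 : R) by rewrite -[X in _ --> X]oppr0; exact: cvgN.
have nh1 k : `|- hseq R k| <= 1 by rewrite normrN.
have [_ cs] := (ccvgP _ _).1 (dcont_ip mOm hd c dv lR hc h1).
have [_ cs'] := (ccvgP _ _).1 (dcont_ip mOm hd c dv lR nhc nh1).
have [cq _] := (ccvgP _ _).1 (dcont_ip mOm hd c dv lv hc h1).
(* Since [2 (c + 1) = n], the dilations are unitary on gradients, and the pairings of [G j] with its
   dilates by [t] and [-t] are conjugate. *)
have T1 t : Re (\sum_j ipO (G j) (Dt (c + 1) t (G j))) = 0.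
  elim/big_ind : _ => [//|x y hx hy|j _]; first by rewrite ReD hx hy addr0.
  rewrite (ip_Dt mOm hd _ _ (lG j) (lG j)) ReRM ReB (dil_opp mOm hd _ (c + 1) _ (lG j) (lG j)).
  have -> : n%:R - (c + 1) - (c + 1) = 0 by rewrite -cn; ring.
  rewrite mul0r expR0 mul1r (ipC mOm (L2_dilc mOm hd _ _ (lG j)) (lG j)) Re_conj.
  by rewrite subrr mulr0.
have T2 t : 0 < t -> Re ((0 +i* kap) * (ipO v (rad (fun j => Dt (c + 1) t (G j))) -
    ipO (rad G) (Dt c t v))) =
    - kap * ((expR (1 * t) - 1) / (2 * t) * Im (s t) - (expR (-1 * t) - 1) / (2 * t) * Im (s (- t))).
  move=> t0; rewrite (@eq_ip _ _ _ mu Om v (rad (fun j => Dt (c + 1) t (G j))) v (Dt (c + 1) t (rad G)))//; last first.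
    by move=> x _; exact: rad_Dt.
  have e1 : ipO v (dil (c + 1) (- t) (rad G)) = (expR t)%:C * (s t)^*.
    rewrite (dil_opp mOm hd _ c _ lv lR) (ipC mOm (L2_dilc mOm hd _ _ lv) lR).
    by congr ((expR _)%:C * _); rewrite -cn; ring.
  have e2 : ipO v (dil (c + 1) t (rad G)) = (expR (- t))%:C * (s (- t))^*.
    rewrite -[t in LHS]opprK (dil_opp mOm hd _ c _ lv lR) (ipC mOm (L2_dilc mOm hd _ _ lv) lR).
    by congr ((expR _)%:C * _); rewrite -cn; ring.
  rewrite (ip_Dt mOm hd _ _ lv lR) (ip_Dt mOm hd _ _ lR lv) e1 e2.
  exact: Re_antisymmetric.
(* On functions the transfer to the other factor costs [e^{2 t}]; the quotient tends to 1, which is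
   the source of [Re m ||v||^2]. *)
have T4 t : 0 < t -> Re (ipO v (Dt c t v)) = - ((expR (2 * t) - 1) / (2 * t)) * Re (q t).
  move=> t0; rewrite (ip_Dt mOm hd _ _ lv lv) ReRM ReB (dil_opp mOm hd _ c _ lv lv) ReRM.
  rewrite (ipC mOm (L2_dilc mOm hd _ _ lv) lv) Re_conj -/(q t).
  have -> : (n%:R - c - c) * t = 2 * t by rewrite -cn; ring.
  by field; rewrite gt_eqF.
pose Z k := - (K * gn G ^+ 2) + c * Re P - e k +
  - kap * ((expR (1 * hseq R k) - 1) / (2 * hseq R k) * Im (s (hseq R k)) -
           (expR (-1 * hseq R k) - 1) / (2 * hseq R k) * Im (s (- hseq R k))) +
  Re m * ((expR (2 * hseq R k) - 1) / (2 * hseq R k) * Re (q (hseq R k))) +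
  Im m * Im (ipO v (Dt c (hseq R k) v)).
have cZ : Z @ \oo --> - (K * gn G ^+ 2) + c * Re P - 0 +
  - kap * (1 / 2 * Im S - -1 / 2 * Im S) +
  Re m * (2 / 2 * Re (ipO v v)) + L.
  have cst (r : R) : (fun=> r) @ \oo --> r by exact: cvg_cst.
  apply: cvgD HL; apply: cvgD; last first.
    by apply: (cvgM (cst _)); apply: cvgM cq; exact: expR_quotient.
  apply: cvgD; first by apply: (cvgB (cst _)).
  apply: (cvgM (cst _)); apply: cvgB.
  - by apply: cvgM cs; exact: expR_quotient.
  - by apply: cvgM cs'; exact: expR_quotient.
have HZ k : Z k <= Kd d 1 c * N * gn G.
  have := E (XS_Dt c (hseq R k) X); have D := dual_dilation_XS n3 X c0 (h01 k) lF lrF.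
  move: D; rewrite -/N => /(le_trans (ler_norm _)) D e3; apply: le_trans D; rewrite -e3.
  rewrite ReB !ReD T1 (T2 _ (h0 k)) add0r [Re (m * _)]ReM (T4 _ (h0 k)).
  have key (a y kb rm Q p i : R) : a <= y -> a + kb + rm * (Q * p) + i <= kb + y - (rm * (- Q * p) - i).
    by move=> h; rewrite (_ : rm * (- Q * p) = - (rm * (Q * p))); [lra|ring].
  exact: key (He k).
have := cvg_le_cst cZ HZ.
rewrite ip_self; last exact: mOm.
rewrite (_ : Re (n2O v ^+ 2)%:C = n2O v ^+ 2)//.
have key (a' b' k z rm y l : R) : a' + b' - 0 + - k * (1 / 2 * z - -1 / 2 * z) + rm * (2 / 2 * y) + l =
  a' + b' - k * z + rm * y + l by field.
by rewrite key.
Qed.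

Section weighted_identity.

Let B eta := ip nu setT (fun x => al x * g x) (fun x => (rho eta (enorm x))%:C * g x).
Let z eta := ipO (fun x => qw eta x * rad G x) (fun x => qw eta x * v x).
Let r eta := ipO (rad G) (fun x => (rho' eta (enorm x))%:C * v x).
Let t eta := ipO v (fun x => (rho' eta (enorm x))%:C * v x).
Let f eta := ipO F (fun x => (rho eta (enorm x))%:C * v x).

(** The equation tested with [rho(|x|) v]. Differentiating the cut-off yields the terms [r] and [t],
    the latter because the [xh j] form a unit vector. *)
Lemma weighted_identity eta : 0 < eta ->
  gn (fun j x => qw eta x * G j x) ^+ 2 + Re (r eta) + 2 * kap * Im (z eta) +
    Re (B eta) - Re m * n2O (fun x => qw eta x * v x) ^+ 2 = Re (f eta) /\
  Im (r eta) + kap * Re (t eta) + Im (B eta) -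
    Im m * n2O (fun x => qw eta x * v x) ^+ 2 = Im (f eta).
Proof.
move=> e0; have := E (XS_mult (mult_rho e0) X); rewrite -/(B eta) -/(f eta).
have lqv := L2_qw e0 lv; have lqG j := L2_qw e0 (lG j); have lqR := L2_qw e0 lR.
have lrv := L2_rho' e0 lv.
have e1 : \sum_j ipO (G j) (fun x => (rho eta (enorm x))%:C * G j x +
    (rho' eta (enorm x))%:C * (xh j x)%:C * v x) =
    (gn (fun j x => qw eta x * G j x) ^+ 2)%:C + r eta.
  rewrite (sqr_gn lqG) (rmorph_sum (real_complex R)) /r /rad (ip_suml mOm); [|by move=> j; exact: L2_xh|exact: lrv].
  rewrite -big_split; apply: eq_bigr => j _ /=.
  have es : (n2O (fun x => qw eta x * G j x) ^+ 2)%:C =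
      ipO (fun x => qw eta x * G j x) (fun x => qw eta x * G j x) by rewrite ip_self//; exact: mOm.
  rewrite es /ip -(cintegralD mOm (ip_cint mOm (lqG j) (lqG j)) (ip_cint mOm (L2_xh j (lG j)) lrv)).
  apply: eq_cintegral => x _; rewrite -qw_mul; have := conj_qw eta x.
  by move: (qw eta x) => Q cQ; rewrite !(rmorphD, rmorphM)/= !cQ !conjR; ring.
have e2 : ipO v (rad (fun j x => (rho eta (enorm x))%:C * G j x +
    (rho' eta (enorm x))%:C * (xh j x)%:C * v x)) = (z eta)^* + t eta.
  rewrite /z -(ipC mOm lqv lqR) -ip_rho /t.
  rewrite /ip -(cintegralD mOm); last 2 first.
  - have := ip_cint mOm lqv lqR; apply: (eq_cint mOm) => x _.
    by rewrite -qw_mul -mulrA !(rmorphM Num.conj) /= [_^*]conj_qw; ring.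
  - exact: (ip_cint mOm).
  apply: eq_cintegral => x Ox; rewrite -mulrDr -rmorphD; congr (_ * _^*).
  rewrite /rad mulr_sumr -[X in _ = _ + X]mulr1 -(rmorph1 (real_complex R)) -(sum_sqr_xh Ox).
  rewrite (rmorph_sum (real_complex R)) mulr_sumr -big_split; apply: eq_bigr => j _ /=.
  by rewrite (rmorphXn (real_complex R)) /=; ring.
rewrite e1 e2 !ip_rho -/(z eta) ip_self; last exact: mOm.
have it : Im (t eta) = 0.
  rewrite (_ : t eta = (\int[mu]_(x in Om) (rho' eta (enorm x) * nc (v x) ^+ 2))%:C)//.
  rewrite -(cintegral_real _ mOm); apply: eq_cintegral => x _.
  rewrite [in LHS]rmorphM/= conjR mulrCA mulconj; exact: (esym (rmorphM (real_complex R) _ _)).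
move: it; move: (z eta) (t eta) (r eta) (B eta) (f eta) (n2O _ ^+ 2) (gn _ ^+ 2).
move=> z' t' r' B' f' y a it <-; split.
- rewrite ReB !ReD ReIM ImB ImD it Im_conj ReM (_ : Im y%:C = 0)// (_ : Re y%:C = y)//.
  by rewrite (_ : Re a%:C = a)//; ring.
- rewrite ImB !ImD ImIM ReB ReD Re_conj ImM (_ : Im y%:C = 0)// (_ : Re y%:C = y)//.
  by rewrite (_ : Im a%:C = 0)//; ring.
Qed.

End weighted_identity.

Let w := n2O v.
Let a := gn G.

Let qrad eta x : qw eta x * rad G x = rad (fun j x => qw eta x * G j x) x.
Proof. by rewrite /rad mulr_sumr; apply: eq_bigr => j _; ring. Qed.

Let bndB eta : 0 < eta ->
  0 <= Re (ip nu setT (fun x => al x * g x) (fun x => (rho eta (enorm x))%:C * g x)) /\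
  nc (ip nu setT (fun x => al x * g x) (fun x => (rho eta (enorm x))%:C * g x)) <= b * n2 nu setT g ^+ 2.
Proof.
move=> e0; have r0 (x : W) : 0 <= rho eta (enorm x) by apply: rho_ge0; exact: enorm_ge0.
have lrg : L2 nu setT (fun x => (rho eta (enorm x))%:C * g x).
  exact: (L2_mult (mult_rho e0) mT lg).
split.
  have s0 : `|0 : R| <= 1 by rewrite normr0.
  by have := boundary_sign mal alA alR s0 r0 lg lrg; rewrite mul0r addr0.
apply: (boundary_weight mal alx) => //; first exact: measurable_rho.
by move=> x; rewrite r0 rho_le ?enorm_ge0// ltW.
Qed.

Let bndf eta : 0 < eta -> nc (ipO F (fun x => (rho eta (enorm x))%:C * v x)) <= N * w.
Proof.
move=> e0; have r0 (x : V) : 0 <= rho eta (enorm x) by apply: rho_ge0; exact: enorm_ge0.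
have mr : cmeasurable Om (fun x => (rho eta (enorm x))%:C * F x).
  apply: cmeasM; last exact: L2_meas lF.
  by apply: cmeas_real; apply: measurable_funTS; exact: measurable_rho.
have le x : Om x -> nc ((rho eta (enorm x))%:C * F x) <= nc ((enorm x)%:C * F x).
  move=> _; rewrite !ncM !nc_real !ger0_norm ?enorm_ge0// ler_wpM2r ?nc_ge0//.
  by rewrite rho_le ?enorm_ge0// ltW.
have lm : L2O (fun x => (rho eta (enorm x))%:C * F x) := L2_mult (mult_rho e0) mOm lF.
have -> : ipO F (fun x => (rho eta (enorm x))%:C * v x) = ipO (fun x => (rho eta (enorm x))%:C * F x) v.
  by apply: eq_cintegral => x _; rewrite [in LHS]rmorphM/= conjR; ring.
apply: (le_trans (CS mOm lm lv)); rewrite ler_wpM2r ?n2_ge0//.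
exact: (n2_le mOm lrF mr le).
Qed.

Let bndz eta : 0 < eta -> nc (ipO (fun x => qw eta x * rad G x) (fun x => qw eta x * v x)) <=
  gn (fun j x => qw eta x * G j x) * n2O (fun x => qw eta x * v x).
Proof.
move=> e0; apply: (le_trans (CS mOm (L2_qw e0 lR) (L2_qw e0 lv))); rewrite ler_wpM2r ?n2_ge0//.
rewrite (@eq_n2 _ _ _ mu Om _ (rad (fun j x => qw eta x * G j x))); last by move=> x _; exact: qrad.
by apply: n2_rad => j; exact: L2_qw.
Qed.

Let bndr eta : 0 < eta -> nc (ipO (rad G) (fun x => (rho' eta (enorm x))%:C * v x)) <= a * w.
Proof.
move=> e0; apply: (le_trans (CS mOm lR (L2_rho' e0 lv))).
by apply: ler_pM; rewrite ?n2_ge0//; [exact: n2_rad|exact: n2_rho'].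
Qed.

Let bndt eta : 0 < eta -> nc (ipO v (fun x => (rho' eta (enorm x))%:C * v x)) <= w ^+ 2.
Proof.
move=> e0; apply: (le_trans (CS mOm lv (L2_rho' e0 lv))).
by rewrite expr2; apply: ler_wpM2l; [exact: n2_ge0|exact: n2_rho'].
Qed.

(** The imaginary part of the weighted identity bounds [|Im m| ||qw v||^2] uniformly in [eta], the
    real part then bounds the weighted gradient, and Fatou's lemma lets [eta -> 0]. These bounds
    depend on [v] and serve finiteness only. *)
Lemma weighted_finite : Re m = 0 -> Im m != 0 ->
  (forall j, L2O (fun x => sqr_r x * G j x)) /\ L2O (fun x => sqr_r x * v x).
Proof.
move=> rm im; have l0 : 0 < `|Im m| by rewrite normr_gt0.
pose M1 := (N * w + a * w + `|kap| * w ^+ 2 + b * n2 nu setT g ^+ 2) / `|Im m|.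
have H eta : 0 < eta -> n2O (fun x => qw eta x * v x) ^+ 2 <= M1 /\
    gn (fun j x => qw eta x * G j x) ^+ 2 <= 2 * (a * w + N * w) + 4 * kap ^+ 2 * M1.
  move=> e0; have [e1 e2] := weighted_identity e0.
  have [B0 B1] := bndB e0; have f1 := bndf e0; have z1 := bndz e0; have r1 := bndr e0; have t1 := bndt e0.
  move: e1 e2 B0 B1 f1 z1 r1 t1; rewrite rm mul0r subr0.
  move: (ip nu _ _ _) (ipO F _) (ipO (fun _ => _ * rad G _) _) (ipO (rad G) _) (ipO v _).
  move=> B f z r t.
  have Y0 := gn_ge0 (fun j x => qw eta x * G j x).
  have x0 := n2_ge0 mu Om (fun x => qw eta x * v x).
  move: (gn _) (n2O (fun x => qw eta x * v x)) Y0 x0 => Y x Y0 x0 e1 e2 B0 B1 f1 z1 r1 t1.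
  have X1 : x ^+ 2 <= M1.
    rewrite /M1 ler_pdivlMr// mulrC -[x ^+ 2]ger0_norm ?sqr_ge0// -normrM.
    rewrite (_ : Im m * x ^+ 2 = Im r + kap * Re t + Im B - Im f); last by lra.
    rewrite (le_trans (ler_normB _ _))// [leRHS](_ : _ = a * w + `|kap| * w ^+ 2 + b * n2 nu setT g ^+ 2 + N * w); last by ring.
    apply: lerD; last exact: (le_trans (nc_Im _)).
    rewrite (le_trans (ler_normD _ _))//; apply: lerD; last exact: (le_trans (nc_Im _)).
    rewrite (le_trans (ler_normD _ _))//; apply: lerD; first exact: (le_trans (nc_Im _)).
    by rewrite normrM ler_wpM2l// (le_trans (nc_Re _)).
  split => //.
  (* Young's inequality with the coefficient 1/2 on [Y^2], so that this term is absorbed by the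
     weighted gradient. *)
  have q1 : - (2 * kap * Im z) <= Y ^+ 2 / 2 + 2 * kap ^+ 2 * x ^+ 2.
    apply: (@le_trans _ _ (2 * `|kap| * (Y * x))).
      rewrite (le_trans (ler_norm _))// normrN !normrM [`|2|]ger0_norm//.
      by rewrite ler_wpM2l ?mulr_ge0// (le_trans (nc_Im _)).
    rewrite -[kap ^+ 2]real_normK ?num_real//; have := sqr_ge0 (Y - 2 * `|kap| * x).
    by move: (`|kap|) => k'; nra.
  have q2 : - Re r <= a * w by rewrite (le_trans _ r1)// (le_trans _ (nc_Re _))// -normrN ler_norm.
  have q3 : Re f <= N * w by rewrite (le_trans _ f1)// (le_trans _ (nc_Re _))// ler_norm.
  have q4 : kap ^+ 2 * x ^+ 2 <= kap ^+ 2 * M1 by rewrite ler_wpM2l ?sqr_ge0.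
  have key (y s u B' f' p q x' k' : R) : y + s + u + B' = f' -> - u <= y / 2 + 2 * x' -> - s <= p ->
    f' <= q -> x' <= k' -> 0 <= B' -> y <= 2 * (p + q) + 4 * k' by lra.
  by rewrite -[4 * _ * _]mulrA; apply: (key _ _ _ _ _ _ _ _ _ e1 _ q2 q3 q4 B0); rewrite mulrA.
have lqG k j := L2_qw (hseq_gt0 R k) (lG j); have lqv k := L2_qw (hseq_gt0 R k) lv.
have cq (h : V -> R[i]) x : (fun k => nc (qw (hseq R k) x * h x) ^+ 2) @ \oo --> nc (sqr_r x * h x) ^+ 2.
  have h0 : ccvg (fun k => qw (hseq R k) x * h x) (sqr_r x * h x) := ccvgM (qw_cvg x) (ccvg_cst _).
  have h1 := ccvg_nc h0; rewrite expr2.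
  rewrite (_ : (fun k => _) = (fun k => nc (qw (hseq R k) x * h x) * nc (qw (hseq R k) x * h x))).
    exact: (cvgM h1 h1).
  by apply/funext => k; rewrite expr2.
have ms h : L2O h -> cmeasurable Om (fun x => sqr_r x * h x).
  by move=> lh; apply: cmeasM; [exact: meas_sqr_r|exact: L2_meas lh].
split=> [j|].
- apply: (L2_fatou (f_ := fun k x => qw (hseq R k) x * G j x) (C := 2 * (a * w + N * w) + 4 * kap ^+ 2 * M1)).
  + by move=> k; exact: lqG.
  + exact: ms.
  + by move=> x _; exact: cq.
  + move=> k; have [_ h] := H _ (hseq_gt0 R k); apply: le_trans h.
    by rewrite lerXn2r ?nnegrE ?n2_ge0 ?gn_ge0//; exact: (n2_gn j (lqG k)).
- apply: (L2_fatou (f_ := fun k x => qw (hseq R k) x * v x) (C := M1)).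
  + exact: lqv.
  + exact: ms.
  + by move=> x _; exact: cq.
  + by move=> k; have [] := H _ (hseq_gt0 R k).
Qed.

(** The real part of the weighted identity as [eta -> 0]. The boundary term is nonnegative, and so
    is the weighted Dirichlet integral plus [Re <d_r v, v>] by [radial_hardy]; the [kap] term is
    left below [N w]. *)
Lemma weighted_bound : Re m = 0 ->
  (forall j, L2O (fun x => sqr_r x * G j x)) -> L2O (fun x => sqr_r x * v x) ->
  2 * kap * Im (ipO (fun x => sqr_r x * rad G x) (fun x => sqr_r x * v x)) <= N * w.
Proof.
move=> rm lrG lrv; have h0 k := hseq_gt0 R k.
have lrR : L2O (fun x => sqr_r x * rad G x).
  have := L2_rad lrG; apply: (eq_L2 mOm) => x _.
  by rewrite /rad mulr_sumr; apply: eq_bigr => j _; ring.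
have c1 := cvg_gn (fun k j => L2_qw (h0 k) (lG j)) lrG (fun j => qw_cvg2 (lG j) (lrG j)).
have [c2 _] := (ccvgP _ _).1 (cvg2_ipr mOm (fun k => L2_rho' (h0 k) lv) lv lR (rho'_cvg2 lv)).
have [_ c3] := (ccvgP _ _).1 (cvg2_ip mOm (fun k => L2_qw (h0 k) lR) lrR (fun k => L2_qw (h0 k) lv) lrv
  (qw_cvg2 lR lrR) (qw_cvg2 lv lrv)).
have c4 : (fun=> 2 * kap) @ \oo --> (2 * kap : R) by exact: cvg_cst.
have c5 := cvgD (cvgD c1 c2) (cvgM c4 c3).
have {}c5 : (fun k => gn (fun j x => qw (hseq R k) x * G j x) ^+ 2 +
    Re (ipO (rad G) (fun x => (rho' (hseq R k) (enorm x))%:C * v x)) +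
    2 * kap * Im (ipO (fun x => qw (hseq R k) x * rad G x) (fun x => qw (hseq R k) x * v x))) @ \oo -->
    gn (fun j x => sqr_r x * G j x) ^+ 2 + Re (ipO (rad G) v) +
    2 * kap * Im (ipO (fun x => sqr_r x * rad G x) (fun x => sqr_r x * v x)) by exact: c5.
have H := cvg_le_cst (M := N * w) c5.
have rh := radial_hardy n3 X lrG.
have Hk k : gn (fun j x => qw (hseq R k) x * G j x) ^+ 2 +
    Re (ipO (rad G) (fun x => (rho' (hseq R k) (enorm x))%:C * v x)) +
    2 * kap * Im (ipO (fun x => qw (hseq R k) x * rad G x) (fun x => qw (hseq R k) x * v x)) <= N * w.
  have [e1 _] := weighted_identity (h0 k); have [B0 _] := bndB (h0 k).
  have f1 := le_trans (nc_Re _) (bndf (h0 k)); have f2 := le_trans (ler_norm _) f1.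
  apply: le_trans f2; rewrite -e1 rm mul0r subr0.
  by rewrite lerDl.
have {}H := H Hk; have S1 := le_trans (nc_Re _) rh.
have S2 := le_trans (ler_norm _) S1; move: S1; rewrite ler_norml => /andP[S3 _].
have key (y s u q : R) : y + s + u <= q -> - y <= s -> u <= q by lra.
exact: key H S3.
Qed.

(** The constant of [estimate_arith] with [del = 1/2 - K], [CH = 2 / (n - 2)] and
    [C = CH / 2 + Kd d 1 c]. *)
Definition twisted_cst : R := ((2^-1 * (2 / (n%:R - 2)) + Kd d 1 c + 2 / (n%:R - 2) / 4 + 1) / (2^-1 - K) + 1).

Let c0 : 0 <= c.
Proof. by have : (3 : R) <= n%:R; [rewrite ler_nat|rewrite -cn; lra]. Qed.

Let CH0 : 0 <= 2 / (n%:R - 2) :> R.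
Proof. by rewrite divr_ge0// subr_ge0 ler_nat ltnW. Qed.

Let Kd0 : 0 <= Kd d 1 c.
Proof. by apply: Kd_ge0 => //; rewrite mulr1 ltr_nat. Qed.

Let P_sign (s : R) : `|s| <= 1 -> 0 <= Re P + s * Im P.
Proof.
move=> s1; have l1 : L2 nu setT (fun x => (1 : R)%:C * g x) by exact: (L2Z mT).
have := boundary_sign mal alA alR s1 (fun=> ler01) lg l1.
by rewrite (@eq_ip _ _ _ nu setT _ (fun x => (1 : R)%:C * g x) (fun x => al x * g x) g)// => x _; rewrite mul1r.
Qed.

(** In the first case [energy_identity] and [virial] suffice, with [L = 0]. In the second, [L] is
    [-Im m] times the weighted radial pairing, whose bad part [weighted_bound] controls by a
    multiple of [N w]; the imaginary energy identity then disposes of [w]. *)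
Lemma twisted_estimate :
  (Im m = 0 /\ 0 <= Re m) \/
  (Re m = 0 /\ Im m != 0 /\ exists2 k, 0 < k &
     `|Im m| <= k ^+ 2 /\ kap = k * Num.sg (Im m)) ->
  a <= twisted_cst * N.
Proof.
have [e1 e2] := energy_identity.
have HF := hardy_ip n3 X lF lrF; rewrite -/N -/a in HF.
have f1 := le_trans (ler_norm _) (le_trans (nc_Re _) HF).
have P0 : 0 <= Re P by have := P_sign (_ : `|0 : R| <= 1); rewrite normr0 mul0r addr0; apply.
have a0 : 0 <= a by exact: gn_ge0.
have N0 : 0 <= N by exact: n2_ge0.
have d0 : 0 < 2^-1 - K by rewrite subr_gt0.
have cP0 : 0 <= c * Re P by rewrite mulr_ge0.
have C0 : 0 <= 2^-1 * (2 / (n%:R - 2)) + Kd d 1 c by rewrite addr_ge0// mulr_ge0.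
case=> [[im rm]|[rm [im [k k0 [lk kapE]]]]].
- have z0 : (fun j => Im m * Im (ipO v (Dt c (hseq R j) v))) @ \oo --> (0 : R).
    by rewrite im (_ : (fun j => _) = fun=> 0); [exact: cvg_cst|apply/funext => j; rewrite mul0r].
  have V1 := virial z0; rewrite -/N -/a -/P addr0 in V1.
  apply: (@estimate_arith a N (Re P) 0 0 1) => //.
    have rw : 0 <= Re m * w ^+ 2 by rewrite mulr_ge0 ?sqr_ge0.
    rewrite mul0r mul0r; apply: (arith_key (i := 0) _ e1 f1 cP0 rw); rewrite ?oppr0//.
    by rewrite addr0.
  by rewrite mul0r addr_ge0// mulr_ge0// mulr_ge0.
- have [lrG lrv] := weighted_finite rm im.
  have WB := weighted_bound rm lrG lrv.
  have lrR : L2O (fun x => sqr_r x * rad G x).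
    have := L2_rad lrG; apply: (eq_L2 mOm) => x _.
    by rewrite /rad mulr_sumr; apply: eq_bigr => j _; ring.
  pose z0 := Im (ipO (fun x => sqr_r x * rad G x) (fun x => sqr_r x * v x)).
  (* The pairing in the virial limit is the conjugate of the one in the third identity; this sign is
     what makes the two cancel. *)
  have JE : Im (\sum_j ipO (fun x => sqr_r x * v x) (fun x => (xh j x)%:C * (sqr_r x * G j x))) = - z0.
    rewrite /z0 (ipC mOm lrR lrv) Im_conj opprK; congr Im.
    rewrite /ip -(cintegral_sum mOm); last by move=> j; apply: (ip_cint mOm) => //; exact: L2_xh.
    apply: eq_cintegral => x _; rewrite -mulr_sumr -rmorph_sum; congr (_ * _^*).
    by rewrite /rad mulr_sumr; apply: eq_bigr => j _; ring.
  have RL := radial_limit c X lrG lrv; rewrite JE in RL.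
  have ci : (fun=> Im m) @ \oo --> (Im m : R) by exact: cvg_cst.
  have V1 := virial (cvgM ci RL); rewrite -/N -/a -/P rm mul0r in V1.
  rewrite -/z0 kapE in WB; rewrite -/P -/w -/a rm mul0r in e1.
  rewrite -/P -/w in e2.
  have sE : Im m = Num.sg (Im m) * `|Im m| by rewrite -numEsg.
  have s2 : Num.sg (Im m) ^+ 2 = 1 by rewrite sqr_sg im.
  have s1 : `|- Num.sg (Im m)| <= 1 by rewrite normrN normr_sg im.
  have Ps := P_sign (_ : `|Num.sg (Im m)| <= 1); rewrite -normrN in Ps.
  have {}Ps := P_sign s1.
  have fi : Num.sg (Im m) * - Im (ipO F v) <= 2 / (n%:R - 2) * N * a.
    rewrite (le_trans (ler_norm _))// normrM normr_sg im mul1r normrN.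
    exact: (le_trans (nc_Im _)).
  have P1 : Num.sg (Im m) * Im P <= Re P by move: Ps; rewrite mulNr; lra.
  apply: (@estimate_arith a N (Re P) w `|Im m| k) => //.
    (* [weighted_bound] multiplied by [|Im m| / (2 k)], where [kap = k sgn(Im m)] turns the left
       side into [Im m z0]. *)
    have zz : - (`|Im m| / (2 * k) * (N * w)) <= Im m * - z0.
      rewrite mulrN lerN2; apply: (@le_trans _ _ (`|Im m| / (2 * k) * (2 * (k * Num.sg (Im m)) * z0))).
        by rewrite [in leLHS]sE le_eqVlt; apply/orP; left; apply/eqP; field; rewrite gt_eqF.
      by rewrite ler_wpM2l// divr_ge0// mulr_ge0// ltW.
    exact: (arith_key (V1 _) e1 f1 cP0 (lexx 0) zz).
  (* The imaginary energy identity expresses [|Im m| ||v||^2] through the boundary term and the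
     source; the former is at most [Re P] by [P_sign]. *)
  apply: (@le_trans _ _ (Num.sg (Im m) * (Im m * w ^+ 2))).
    by rewrite {3}sE !mulrA -expr2 s2 mul1r.
  rewrite (_ : Im m * w ^+ 2 = Im P - Im (ipO F v)); last by rewrite -e2; ring.
  by rewrite mulrDr; apply: lerD.
Qed.

End twisted.

(** * From the Robin equation to the twisted equation, and the estimate for
    [|Im lambda| > Re lambda] *)

Section robin.

Lemma ae_L2 (D : set V) (f h : V -> R[i]) : measurable D -> cmeasurable D f -> L2 mu D h ->
  {ae mu, forall x, D x -> h x = f x} -> L2 mu D f.
Proof.
move=> mD mf [mh hi] hf; split => //; apply/integrableP; split.
  exact/measurable_EFinP/meas_nc2.
have /integrableP[_] := hi; apply: le_lt_trans; rewrite le_eqVlt; apply/orP; left; apply/eqP.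
apply: ae_eq_integral => //.
- by apply: measurableT_comp => //; exact/measurable_EFinP/meas_nc2.
- by apply: measurableT_comp => //; exact/measurable_EFinP/meas_nc2.
- by apply: filterS hf => x hx Dx; rewrite hx.
Qed.

Lemma eq_nc_n2 (D : set V) (f h : V -> R[i]) : (forall x, nc (f x) = nc (h x)) -> n2 mu D f = n2 mu D h.
Proof. by move=> fh; congr Num.sqrt; apply: eq_Rintegral => x _; rewrite fh. Qed.

Variables (al : W -> R[i]) (A : R).
Hypothesis mal : cmeasurable setT al.
Hypothesis alA : forall x, nc (al x) <= A.

Section equation.
Variables (lam : R[i]) (u f : V -> R[i]) (G : 'I_n -> V -> R[i]) (g : W -> R[i]).
Hypothesis X : XS u G g.
Hypothesis lf : L2O f.
Hypothesis H : forall psi Gpsi gpsi, XS psi Gpsi gpsi ->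
  \sum_j ipO (G j) (Gpsi j) + ip nu setT (fun x => al x * g x) gpsi - lam * ipO u psi =
  ipO f psi.

(* [u = e^{i kap |x|} v] is tested against [e^{i kap |x|} psi] *)
Lemma twisted_equation (kap : R) :
  let e := fun k (x : 'rV[R]_k) => expi (- kap * enorm x) in
  let Gv := fun j x => e n x * G j x + (0 +i* - kap) * e n x * (xh j x)%:C * u x in
  XS (fun x => e n x * u x) Gv (fun x => e d x * g x) /\
  forall psi Gpsi gpsi, XS psi Gpsi gpsi ->
  \sum_j ipO (Gv j) (Gpsi j) +
  (0 +i* kap) * (ipO (fun x => e n x * u x) (rad Gpsi) - ipO (rad Gv) psi) +
  ip nu setT (fun x => al x * (e d x * g x)) gpsi -
  (lam - (kap ^+ 2)%:C) * ipO (fun x => e n x * u x) psi = ipO (fun x => e n x * f x) psi.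
Proof.
move=> e Gv; have X1 := XS_mult (mult_expi (- kap)) X; split; first exact: X1.
move=> psi Gpsi gpsi Xp; have Xp' := XS_mult (mult_expi kap) Xp.
have [lv lGv lgv _] := X1; have [lu lG lg _] := X; have [lp lGp lgp _] := Xp; have [lp' lGp' lgp' _] := Xp'.
have ce k (x : 'rV[R]_k) : (expi (kap * enorm x))^* = e k x.
  by rewrite conj_expi /e mulNr.
have := H Xp'; have lR := L2_rad lGp; have lRv := L2_rad lGv.
have i1 : (0 +i* - kap : R[i]) = - (0 +i* kap) by rewrite /GRing.opp/= oppr0.
have i2 : (0 +i* kap) * (0 +i* kap) = - (kap ^+ 2)%:C :> R[i].
  by apply/eqP; rewrite eq_complex /= expr2; apply/andP; split; apply/eqP; ring.
have i3 : (0 +i* kap)^* = - (0 +i* kap) :> R[i] by rewrite -i1.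
have -> : ipO u (fun x => expi (kap * enorm x) * psi x) = ipO (fun x => e n x * u x) psi.
  by apply: eq_cintegral => x _; rewrite [in LHS]rmorphM/= [_^* in LHS]ce; ring.
have -> : ipO f (fun x => expi (kap * enorm x) * psi x) = ipO (fun x => e n x * f x) psi.
  by apply: eq_cintegral => x _; rewrite [in LHS]rmorphM/= [_^* in LHS]ce; ring.
have -> : ip nu setT (fun x => al x * g x) (fun x => expi (kap * enorm x) * gpsi x) =
    ip nu setT (fun x => al x * (e d x * g x)) gpsi.
  by apply: eq_cintegral => x _; rewrite [in LHS]rmorphM/= [_^* in LHS]ce; ring.
move=> <-.
have -> : \sum_j ipO (G j) (fun x => expi (kap * enorm x) * Gpsi j x +
      (0 +i* kap) * expi (kap * enorm x) * (xh j x)%:C * psi x) =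
    \sum_j ipO (Gv j) (Gpsi j) +
    (0 +i* kap) * (ipO (fun x => e n x * u x) (rad Gpsi) - ipO (rad Gv) psi) +
    (kap ^+ 2)%:C * ipO (fun x => e n x * u x) psi; last by ring.
rewrite /ip -(cintegral_sum mOm); last by move=> j; exact: (ip_cint mOm (lG j) (lGp' j)).
have c1 := ip_cint mOm lv lR; have c2 := ip_cint mOm lRv lp; have c3 := ip_cint mOm lv lp.
have c4 j := ip_cint mOm (lGv j) (lGp j).
rewrite -(cintegralB mOm c1 c2) -(cintegral_sum mOm _ c4).
have c5 := cintB mOm c1 c2; have c6 := cint_sum mOm (index_enum 'I_n) c4.
rewrite -(cintegralZ mOm _ c5) -(cintegralZ mOm _ c3) -(cintegralD mOm c6 (cintZ mOm _ c5)).
rewrite -(cintegralD mOm (cintD mOm c6 (cintZ mOm _ c5)) (cintZ mOm _ c3)).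
apply: eq_cintegral => x Ox; have sx := sum_sqr_xh Ox.
have r1 : rad Gv x = e n x * rad G x - (0 +i* kap) * e n x * u x.
  rewrite /rad /Gv i1 -[_ * u x]mulr1 -(rmorph1 (real_complex R)) -sx (rmorph_sum (real_complex R)).
  rewrite !mulr_sumr -sumrB; apply: eq_bigr => j _.
  by rewrite (rmorphXn (real_complex R)) /=; ring.
have l1 : \sum_j G j x * (expi (kap * enorm x) * Gpsi j x +
      (0 +i* kap) * expi (kap * enorm x) * (xh j x)%:C * psi x)^* =
    e n x * (\sum_j G j x * (Gpsi j x)^*) - (0 +i* kap) * e n x * rad G x * (psi x)^*.
  rewrite /rad !mulr_sumr mulr_suml -sumrB; apply: eq_bigr => j _.
  have := ce n x; move: (expi _) (e n x) => E E' cE.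
  by rewrite !(rmorphD, rmorphM)/= !cE !conjR i3; ring.
have l2 : \sum_j Gv j x * (Gpsi j x)^* =
    e n x * (\sum_j G j x * (Gpsi j x)^*) - (0 +i* kap) * e n x * u x * (rad Gpsi x)^*.
  rewrite /rad rmorph_sum/= !mulr_sumr -sumrB; apply: eq_bigr => j _.
  by rewrite /Gv i1 [in RHS]rmorphM/= conjR; ring.
rewrite l1 l2 r1 -/(e n x); move: i2; move: (0 +i* kap) (e n x) (kap ^+ 2)%:C => I E k2 i2.
have -> : k2 = - (I * I) by rewrite i2 opprK.
by ring.
Qed.

(** From the real part of the equation tested with [u], [sgn(Im lambda)] times the imaginary part is
    subtracted: the [||u||^2] terms collect to [(|Im lambda| - Re lambda) ||u||^2 >= 0], and the
    boundary terms are nonnegative by [boundary_sign]. Hardy's inequality is used for both parts,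
    hence 4 in place of 2. *)
Lemma outer_estimate : (3 <= n)%N -> (forall x, `|Im (al x)| <= Re (al x)) ->
  L2O (fun x => (enorm x)%:C * f x) -> Re lam < `|Im lam| ->
  gn G <= 4 / (n%:R - 2) * n2O (fun x => (enorm x)%:C * f x).
Proof.
move=> n3 alR lrf ll; have [lu lG lg _] := X.
(* The shape of the twisted equation with [kap = 0], so that [energy_identity] can be reused. *)
have E psi Gpsi gpsi : XS psi Gpsi gpsi -> \sum_j ipO (G j) (Gpsi j) +
  (0 +i* 0) * (ipO u (rad Gpsi) - ipO (rad G) psi) +
  ip nu setT (fun x => al x * g x) gpsi - lam * ipO u psi = ipO f psi.
  by move=> Xp; rewrite -(H Xp) (_ : (0 +i* 0) = 0 :> R[i])// mul0r addr0.
have [e1 e2] := energy_identity X E.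
have HF := hardy_ip n3 X lf lrf.
set s := Num.sg (Im lam).
have sE : s * Im lam = `|Im lam| by rewrite normrEsg.
have s1 : `|- s| <= 1 by rewrite normrN normr_sg; case: (_ != 0).
have l1 : L2 nu setT (fun x => (1 : R)%:C * g x) by exact: (L2Z mT).
have PS := boundary_sign mal alA alR s1 (fun=> ler01) lg l1.
rewrite (@eq_ip _ _ _ nu setT _ (fun x => (1 : R)%:C * g x) (fun x => al x * g x) g)// in PS; last first.
  by move=> x _; rewrite mul1r.
have f1 := le_trans (ler_norm _) (le_trans (nc_Re _) HF).
have f2 : - s * Im (ipO f u) <= 2 / (n%:R - 2) * n2O (fun x => (enorm x)%:C * f x) * gn G.
  apply: (le_trans (ler_norm _)); rewrite normrM; apply: le_trans (le_trans (nc_Im _) HF).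
  by rewrite ler_piMl.
have w0 : 0 <= (`|Im lam| - Re lam) * n2O u ^+ 2.
  by rewrite mulr_ge0 ?sqr_ge0// subr_ge0 ltW.
have CH0 : 0 <= 2 / (n%:R - 2) :> R by rewrite divr_ge0// subr_ge0 ler_nat ltnW.
have N0 := n2_ge0 mu Om (fun x => (enorm x)%:C * f x).
rewrite mulr0 mul0r addr0 in e1; rewrite -e1 in f1; rewrite -e2 in f2.
have e3 (p w : R) : - s * (p - Im lam * w) = - s * p + `|Im lam| * w by rewrite -sE; ring.
rewrite e3 in f2.
rewrite mulrBl in w0.
have a0 := gn_ge0 G.
have -> : 4 / (n%:R - 2) = 2 * (2 / (n%:R - 2)) :> R by ring.
move: (gn G) (n2O (fun x => (enorm x)%:C * f x)) (ip nu _ _ _) (n2O u ^+ 2) (2 / (n%:R - 2)) a0 N0 PS f1 f2 w0 CH0.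
move=> a N P w CH a0 N0 PS f1 f2 w0 CH0.
have h : a * a <= (2 * CH * N) * a by rewrite -expr2; lra.
have [->|an0] := eqVneq a 0; first by rewrite mulr_ge0// mulr_ge0.
by rewrite -(ler_pM2r (_ : 0 < a))// lt_neqAle eq_sym an0.
Qed.

End equation.

End robin.

Lemma sum_cLnorm_fin (p : \bar R) (f_ : 'I_d -> W -> R[i]) (b : R) :
  (\sum_(j < d) cLnorm nu setT p (f_ j) <= b%:E)%E ->
  exists B : 'I_d -> R, [/\ forall j, 0 <= B j, forall j, cLnorm nu setT p (f_ j) = (B j)%:E & \sum_j B j <= b].
Proof.
move=> h; have fin j : cLnorm nu setT p (f_ j) \is a fin_num.
  rewrite ge0_fin_numE ?cLnorm_ge0//; apply: (@le_lt_trans _ _ b%:E); last exact: ltry.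
  by apply: le_trans h; rewrite (bigD1 j)//= leeDl// sume_ge0// => i _; exact: cLnorm_ge0.
exists (fun j => fine (cLnorm nu setT p (f_ j))); split => [j|j|].
- by rewrite fine_ge0// cLnorm_ge0.
- by rewrite fineK.
- by rewrite -lee_fin -sumEFin; under eq_bigr do rewrite fineK//.
Qed.

(** Reads the definition of the operator on [XS], replacing [alpha] by [al] and [w - lam u] by [f],
    which are equal almost everywhere. Square integrability of [f] comes from the equation
    itself. *)
Lemma robin_form (alpha al : W -> R[i]) (A : R) (lam : R[i]) (u f : V -> R[i]) :
  cmeasurable setT alpha -> cmeasurable setT al -> (forall x, nc (al x) <= A) ->
  {ae nu, forall x, alpha x = al x} ->
  cmeasurable Om f -> robin_equation alpha lam u f ->
  L2O f /\ exists G g, XS u G g /\ forall psi Gpsi gpsi, XS psi Gpsi gpsi ->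
    \sum_j ipO (G j) (Gpsi j) + ip nu setT (fun x => al x * g x) gpsi - lam * ipO u psi =
    ipO f psi.
Proof.
move=> ma mal alA aal mf [w [[/(L2P mu mOm) lw [G [g [[/(L2P mu mOm) lu lG' _] tr eq]]]] wf]].
have lG j : L2O (G j) by apply/(L2P mu mOm).
have X := trace_XS lu lG tr; have lh := L2B mOm lw (L2Z mOm lam lu).
have lf := ae_L2 mOm mf lh wf; split => //; exists G, g; split => // psi Gpsi gpsi Xp.
have [lp lGp lgp _] := Xp; have [_ _ lg _] := X; have [H1p trp] := XS_H1 Xp.
have := eq _ _ _ H1p trp; rewrite (cintegral_sum mOm); last by move=> j; exact: (ip_cint mOm).
rewrite (@ae_cintegral _ _ _ nu setT _ (fun x => al x * g x * (gpsi x)^*) mT); first last.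
- by apply: filterS aal => x -> _.
- by apply: cmeasM; [apply: cmeasM => //; exact: L2_meas lg|apply: cmeas_conj; exact: L2_meas lgp].
- by apply: cmeasM; [apply: cmeasM => //; exact: L2_meas lg|apply: cmeas_conj; exact: L2_meas lgp].
rewrite -/(ip nu setT (fun x => al x * g x) gpsi) -/(ipO w psi) => ->.
rewrite -(ipZl mOm _ lu lp) -(ipBl mOm lw (L2Z mOm lam lu) lp).
apply: (ae_cintegral mOm).
- by apply: cmeasM; [exact: L2_meas lh|apply: cmeas_conj; exact: L2_meas lp].
- by apply: cmeasM; [exact: mf|apply: cmeas_conj; exact: L2_meas lp].
- by apply: filterS wf => x h Ox; rewrite h.
Qed.

(** When [r f] is not square integrable the right-hand side is infinite, so the estimate [H] is
    invoked in the finite case only. *)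
Lemma weighted_gradient_bound v Gv gv (f : V -> R[i]) (c : R) : XS v Gv gv -> cmeasurable Om f -> 0 < c ->
  (L2O (fun x => (enorm x)%:C * f x) -> gn Gv <= c * n2O (fun x => (enorm x)%:C * f x)) ->
  exists G0, weak_gradient Om v G0 /\ (vL2norm Om G0 <= c%:E * r_norm f)%E.
Proof.
move=> Y mf c0 H; have [_ lGv _ _] := Y; exists Gv; split; first by have [[_ _]] := XS_H1 Y.
have mrf : cmeasurable Om (fun x => (enorm x)%:C * f x).
  by apply: cmeasM => //; apply: cmeas_real; apply: measurable_funTS; exact: measurable_enorm.
rewrite (vL2norm_gn lGv); have [fin|inf] := boolP (r_norm f < +oo)%E; last first.
  by move: inf; rewrite -leNgt leye_eq => /eqP ->; rewrite gt0_muley ?lte_fin// leey.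
have lrf : L2O (fun x => (enorm x)%:C * f x) by apply/(L2P _ mOm); split.
by rewrite /r_norm (L2_cLnorm mOm lrf) -EFinM lee_fin H.
Qed.

(** If [Im lam <> 0], then [kap^2 = Re lam] and [m = lam - kap^2] is purely imaginary; if
    [Im lam = 0], the sign function gives [kap = 0], and [m = lam] is real and nonnegative. These
    are the two cases of [twisted_estimate]. *)
Lemma inner_estimate (al : W -> R[i]) (A K b c : R) (lam : R[i]) (u f : V -> R[i]) G g : (3 <= n)%N ->
  cmeasurable setT al -> (forall x, nc (al x) <= A) ->
  (forall x, `|Im (al x)| <= Re (al x)) -> (forall x, enorm x * nc (al x) <= b) ->
  K < 2^-1 -> 2 * (c + 1) = n%:R -> boundary_bound al K -> XS u G g -> L2O f ->
  (forall psi Gpsi gpsi, XS psi Gpsi gpsi ->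
    \sum_j ipO (G j) (Gpsi j) + ip nu setT (fun x => al x * g x) gpsi - lam * ipO u psi =
    ipO f psi) ->
  `|Im lam| <= Re lam ->
  exists Gv gv, XS (u_minus lam u) Gv gv /\ (L2O (fun x => (enorm x)%:C * f x) ->
    gn Gv <= twisted_cst K c * n2O (fun x => (enorm x)%:C * f x)).
Proof.
move=> n3 mal alA alR alx K2 cn HK X lf H hl.
pose kap : R := Num.sqrt (Re lam) * Num.sg (Im lam).
have [Xv E] := twisted_equation X H kap.
have -> : u_minus lam u = (fun x => expi (- kap * enorm x) * u x).
  by apply/funext => x; rewrite /u_minus -/kap mulNr.
eexists; eexists; split; first exact: Xv.
move=> lrf; have ncE (x : V) : nc ((enorm x)%:C * (expi (- kap * enorm x) * f x)) = nc ((enorm x)%:C * f x).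
  by rewrite !ncM nc_expi mul1r.
have me : cmeasurable Om (fun x => expi (- kap * enorm x)).
  by have [+ _] := mult_meas (mult_expi (- kap)) (measurable_enorm (R := R) (n := n)); exact: cmeas_sub.
have L2e h : L2O h -> L2O (fun x => expi (- kap * enorm x) * h x).
  by apply: (@L2_bnd _ _ _ _ _ mOm 1) => // x _; rewrite nc_expi.
have lrF : L2O (fun x => (enorm x)%:C * (expi (- kap * enorm x) * f x)).
  by have := L2e _ lrf; apply: (eq_L2 mOm) => x _; ring.
rewrite -(eq_nc_n2 _ ncE).
apply: (twisted_estimate n3 mal alA alR alx K2 cn HK Xv (L2e _ lf) lrF E).
have rl0 : 0 <= Re lam by rewrite (le_trans _ hl).
rewrite ReB ImB /= subr0; have [i0|i0] := eqVneq (Im lam) 0.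
  by left; rewrite /kap i0 sgr0 mulr0 expr0n/= subr0.
right; rewrite /kap exprMn sqr_sqrtr// sqr_sg i0 mulr1 subrr; split => //; split => //.
exists (Num.sqrt (Re lam)); last by rewrite sqr_sqrtr.
by rewrite sqrtr_gt0 (lt_le_trans _ hl)// normr_gt0.
Qed.

End half_space_forms.

Theorem theorem1p5 (R : realType) (d : nat) (hn : (3 <= d.+1)%N)
  (Cstar : R) (hC : is_smallest (leibniz_constant d) Cstar)
  (Sstar : R) (hS : is_smallest (sobolev_constant d) Sstar)
  (alpha : 'rV[R]_d -> R[i])
  (halpha : cLp (lebesgue_rV R d) setT +oo%E alpha)
  (hRe : {ae lebesgue_rV R d,
           forall x, `|complex.Im (alpha x)| <= complex.Re (alpha x)})
  (b1 b2 : R) (hb1 : 0 <= b1) (hb2 : 0 <= b2)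
  (hb : 2 * Cstar * (b1 + Sstar * b2) < 1)
  (hxa : (\sum_(j < d)
            cLnorm (lebesgue_rV R d) setT +oo (x_alpha alpha j) <= b1%:E)%E)
  (hDxa : exists Dxa : 'I_d -> 'rV[R]_d -> R[i],
     (forall j, is_frac_lap (x_alpha alpha j) (Dxa j)) /\
     (\sum_(j < d)
        cLnorm (lebesgue_rV R d) setT (2 * d%:R)%:E (Dxa j) <= b2%:E)%E) :
  exists c : R, 0 < c /\
    forall (lambda : R[i]) (f : 'rV[R]_d.+1 -> R[i]), weighted_L2 f ->
    forall u : 'rV[R]_d.+1 -> R[i], robin_equation alpha lambda u f ->
      (`|complex.Im lambda| <= complex.Re lambda ->
       exists G, weak_gradient (@half_space R d) (u_minus lambda u) G /\
         (vL2norm (@half_space R d) G <= c%:E * r_norm f)%E) /\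
      (complex.Re lambda < `|complex.Im lambda| ->
       exists G, weak_gradient (@half_space R d) u G /\
         (vL2norm (@half_space R d) G <= c%:E * r_norm f)%E).
Proof.
have mOm := @measurable_half_space R d.
have [hC1 _] := hC; have [hS1 _] := hS; have [ma halpha1] := halpha.
have [B [B0 BE Bb1]] := sum_cLnorm_fin hxa.
have [Dxa [Hfl /sum_cLnorm_fin[be [be0 beE beb2]]]] := hDxa.
have [A A0 aeA] : exists2 A : R, 0 <= A & {ae lebesgue_rV R d, forall x, nc (alpha x) <= A}.
  have fin : cLnorm (lebesgue_rV R d) setT +oo alpha \is a fin_num by rewrite ge0_fin_numE ?cLnorm_ge0.
  exists (fine (cLnorm (lebesgue_rV R d) setT +oo alpha)); first by rewrite fine_ge0// cLnorm_ge0.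
  by apply: cLnorm_oo_ae; rewrite fineK.
have aeB j : {ae lebesgue_rV R d, forall x, nc (x_alpha alpha j x) <= B j}.
  by apply: cLnorm_oo_ae; rewrite BE.
have [al [mal alA alR alB aal]] := regular_coefficient ma A0 B0 aeA hRe aeB.
have HK := boundary_gradient hn hC1 hS1 hb2 ma mal aal BE alB Bb1 Hfl beE beb2.
(* The boundary constant of [boundary_gradient]; the smallness assumption says precisely that it is
   below 1/2. *)
pose K := Num.max 0 (Cstar * (b1 + Sstar * b2)).
have K2 : K < 2^-1.
  rewrite /K gt_max invr_gt0 ltr0n andTb; move: hb; rewrite -mulrA.
  by move: (Cstar * _) => y; lra.
have alx (x : 'rV[R]_d) : enorm x * nc (al x) <= b1.
  apply: le_trans Bb1; apply: (@le_trans _ _ (\sum_j nc (x_alpha al j x))); last by apply: ler_sum => j _; exact: alB.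
  apply: (le_trans (ler_wpM2r (nc_ge0 _) (enorm_le_sum x))); rewrite mulr_suml; apply: ler_sum => j _.
  by rewrite /x_alpha ncM nc_real.
(* The exponent for which the dilations preserve the Dirichlet integral. *)
pose c0 : R := (d.+1%:R - 2) / 2.
have cn : 2 * (c0 + 1) = d.+1%:R by rewrite /c0; field.
have n30 : (3 : R) <= d.+1%:R by rewrite ler_nat.
(* The larger of the constants for the two regions of [lambda]; the second one guarantees
   positivity. *)
pose c := Num.max (twisted_cst d K c0) (4 / (d.+1%:R - 2)).
have c1 : 0 < c by rewrite /c lt_max; apply/orP; right; rewrite divr_gt0//; lra.
exists c; split => // lambda f [mf _] u req.
have [lf [G [g [X H]]]] := robin_form ma mal alA aal mf req.
split=> hl; last first.
  apply: (weighted_gradient_bound X mf c1) => lrf.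
  apply: (le_trans (outer_estimate mal alA X lf H hn alR lrf hl)).
  by rewrite ler_wpM2r ?n2_ge0// /c le_max lexx orbT.
have [Gv [gv [Xv HG]]] := inner_estimate hn mal alA alR alx K2 cn HK X lf H hl.
apply: (weighted_gradient_bound Xv mf c1) => lrf; apply: (le_trans (HG lrf)).
by rewrite ler_wpM2r ?n2_ge0// /c le_max lexx.
Qed.
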